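(* Let $X, Y, Z$ be dual operator spaces such that $Z\subset_\Delta Y$ and $Y\subset_\Delta X$. Then: (i) There exist a $w^*$-continuous complete isometry $\chi: X\to \chi (X)$ and projections $p, q$ such that $p\chi (X)\subseteq \chi (X)$, $\chi (X)q\subseteq \chi (X)$ and $Z\subset_\Delta p\chi (X)q$. (ii) $Z\subset_{cb\Delta}X$.
   Context: A dual operator space is an operator space completely isometrically isomorphic to the operator space dual of some operator space. $[S]^{-w^*}$ is the $w^*$-closure of the linear span of $S$. A TRO is a subspace $M\subseteq B(H,K)$ ($H,K$ Hilbert spaces) with $m_1m_2^*m_3\in M$ for all $m_i\in M$. For $w^*$-closed spaces $X\subseteq B(H_1,H_2)$, $Y\subseteq B(K_1,K_2)$, $Y\subset_{TRO}X$ means that there exist TROs $M_1\subseteq B(H_1,K_1)$, $M_2\subseteq B(H_2,K_2)$ such that $Y=[M_2XM_1^*]^{-w^*}$, $M_2^*YM_1\subseteq X$, $M_2^*M_2X\subseteq X$ and $XM_1^*M_1\subseteq X$. For dual operator spaces, $Y\subset_\Delta X$ means that there exist $w^*$-continuous completely isometric maps $\phi:X\to\phi(X)$, $\psi:Y\to\psi(Y)$ onto $w^*$-closed spaces of Hilbert space operators with $\psi(Y)\subset_{TRO}\phi(X)$. A $w^*$-c.b. isomorphism is a bijective, $w^*$-continuous, completely bounded linear map with completely bounded inverse; $Y\subset_{cb\Delta}X$ means that there exist $w^*$-c.b. isomorphisms $\phi:X\to\phi(X)$, $\psi:Y\to\psi(Y)$ onto $w^*$-closed spaces of Hilbert space operators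 with $\psi(Y)\subset_{TRO}\phi(X)$. If $X\subseteq B(H_1,H_2)$ is $w^*$-closed and $q\in B(H_1)$, $p\in B(H_2)$ are projections with $pX\subseteq X$, $Xq\subseteq X$, then $pXq=\{pxq:x\in X\}$, a $w^*$-closed space. *)

(* Defs.v *)
From HB Require Import structures.
From mathcomp Require Import all_boot all_order all_algebra.
From mathcomp Require Import complex.
From mathcomp Require Import all_classical all_reals all_analysis.

Set Implicit Arguments.
Unset Strict Implicit.
Unset Printing Implicit Defensive.

Import Order.TTheory GRing.Theory Num.Theory.
Import numFieldNormedType.Exports.

Local Open Scope classical_set_scope.
Local Open Scope ring_scope.
Local Open Scope complex_scope.

(** Norms of normed modules over [R[i]] take (real) values in [R[i]];
    [rnorm] is the same number as an element of [R]. *)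
Definition rnorm (R : realType) (V : normedModType R[i]) (x : V) : R :=
  complex.Re `|x|.

Lemma rnormE (R : realType) (V : normedModType R[i]) (x : V) :
  (rnorm x)%:C = `|x|.
Proof. by rewrite /rnorm RRe_real // normr_real. Qed.

(** Complex Hilbert spaces; the inner product is linear on the left. *)
HB.mixin Record isHilbert (R : realType) H of CompleteNormedModule R[i] H := {
  ip : H -> H -> R[i];
  ip_linearl : forall (a : R[i]) (x y z : H),
    ip (a *: x + y) z = a * ip x z + ip y z;
  ip_conj : forall x y : H, ip y x = (ip x y)^*;
  ip_norm : forall x : H, ip x x = `|x| ^+ 2
}.

#[short(type="hilbertType")]
HB.structure Definition Hilbert (R : realType) :=
  {H of isHilbert R H & CompleteNormedModule R[i] H}.

(** A complex vector space with a function on each matrix space [M_n(X)];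
    operator spaces are singled out by [operator_space] below. *)
HB.mixin Record hasMatrixNorm (R : realType) X of GRing.Lmodule R[i] X := {
  mxnorm : forall n : nat, 'M[X]_n -> R
}.

#[short(type="mxNormedType")]
HB.structure Definition MxNormed (R : realType) :=
  {X of hasMatrixNorm R X & GRing.Lmodule R[i] X}.

Arguments mxnorm {R s} [n] A.

(** The topology is meant to be the w*-topology; in general it is not the one
    given by the norm. *)
#[short(type="wMxNormedType")]
HB.structure Definition WMxNormed (R : realType) :=
  {X of MxNormed R X & Topological X}.

(** The norm of the operator matrix [a] from [l2(I, U)] to [l2(I, W)]. *)
Definition l2opnorm (R : realType) (U W : normedModType R[i]) (I : finType)
    (a : I -> I -> U -> W) : R :=
  sup [set Num.sqrt (\sum_i rnorm (\sum_j a i j (xi j)) ^+ 2) |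
       xi in [set xi : I -> U | \sum_j rnorm (xi j) ^+ 2 <= 1]].

Section BoundedOperators.
Variables (R : realType) (H K : hilbertType R).

Definition bop_pred : {pred H -> K} :=
  fun f => `[< linear f /\ continuous f >].

Record bop := Bop { bop_fun :> H -> K; bop_funP : bop_fun \in bop_pred }.

HB.instance Definition _ := [isSub for bop_fun].
HB.instance Definition _ := [Choice of bop by <:].

Fact bop_submod_closed : submod_closed bop_pred.
Proof.
split.
  apply/asboolP; split=> [a x y|]; first by rewrite scaler0 addr0.
  exact: cst_continuous.
move=> a f g /asboolP[lf cf] /asboolP[lg cg]; apply/asboolP; split.
  move=> b x y.
  rewrite !(fctE, scalrfctE) /= lf lg !scalerDr !scalerA addrACA.
  by rewrite [a * b]mulrC.
move=> x; apply: (@cvgD _ _ _ (nbhs x)); last exact: cg.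
by apply: cvgZl_tmp; exact: cf.
Qed.
HB.instance Definition _ :=
  GRing.isSubmodClosed.Build R[i] (H -> K) bop_pred bop_submod_closed.
HB.instance Definition _ := [SubChoice_isSubLmodule of bop by <:].


(** The w*-topology of [B(H, K)] as the dual of the trace class operators is
    the initial topology of the functionals
    [T |-> sum_n <T (xi n), eta n>] with [xi], [eta] square summable. *)
Definition sqsummable (L : hilbertType R) (xi : nat -> L) : Prop :=
  cvgn (series (fun n => rnorm (xi n) ^+ 2)).

Definition normal_index :=
  {p : (nat -> H) * (nat -> K) | sqsummable p.1 /\ sqsummable p.2}.

Definition normal_functional (T : bop)
    : prod_topology (fun _ : normal_index => R[i]^o) := fun s =>
  limn (series (fun n => ip (T ((sval s).1 n)) ((sval s).2 n)) : nat -> R[i]^o).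

HB.instance Definition _ :=
  Topological.copy bop (initial_topology normal_functional).

HB.instance Definition _ := hasMatrixNorm.Build R bop
  (fun n (A : 'M[bop]_n) => l2opnorm (fun i j : 'I_n => A i j : H -> K)).

End BoundedOperators.

Section Composition.
Variables (R : realType) (H K L : hilbertType R).

Fact bop_comp_subproof (S : bop K L) (T : bop H K) : S \o T \in @bop_pred R H L.
Proof.
have /asboolP[lS cS] := bop_funP S; have /asboolP[lT cT] := bop_funP T.
apply/asboolP; split=> [a x y|x] /=; first by rewrite lT lS.
by apply: continuous_comp; [exact: cT | exact: cS].
Qed.

Definition bop_comp (S : bop K L) (T : bop H K) : bop H L :=
  Bop (bop_comp_subproof S T).

Definition bop_setmul (A : set (bop K L)) (B : set (bop H K)) : set (bop H L) :=
  [set bop_comp S T | S in A & T in B].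

(** A relation, so that the Riesz theorem is not needed here; every bounded
    operator has exactly one adjoint. *)
Definition adjoint_of (T : bop H K) (T' : bop K H) : Prop :=
  forall x y, ip (T x) y = ip x (T' y).

Definition bop_setadj (A : set (bop H K)) : set (bop K H) :=
  [set T' | exists2 T, A T & adjoint_of T T'].

End Composition.

Infix "`o`" := bop_setmul (at level 40, left associativity).
Notation "A ^`*" := (bop_setadj A) (at level 2, format "A ^`*").

Definition projection (R : realType) (H : hilbertType R) (p : bop H H) : Prop :=
  bop_comp p p = p /\ adjoint_of p p.

Definition lspan (R : realType) (V : lmodType R[i]) (S : set V) : set V :=
  [set v | exists n (a : 'I_n -> R[i]) (u : 'I_n -> V),
     (forall i, S (u i)) /\ v = \sum_i a i *: u i].

(** Linear subspaces of [B(H, K)], with the matrix norms and the w*-topology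
    they inherit. *)
Section OperatorSubspaces.
Variables (R : realType) (H K : hilbertType R).

Record opSubspace := OpSubspace {
  opset :> set (bop H K);
  opset_submod : submod_closed [in opset]
}.

Variable S : opSubspace.

Definition opsub_pred : {pred bop H K} := [in opset S].

Fact opsub_submod_closed : submod_closed opsub_pred.
Proof. exact: opset_submod. Qed.
HB.instance Definition _ :=
  GRing.isSubmodClosed.Build R[i] (bop H K) opsub_pred opsub_submod_closed.

Record opsub := Opsub { opsub_val :> bop H K; opsubP : opsub_val \in opsub_pred }.

HB.instance Definition _ := [isSub for opsub_val].
HB.instance Definition _ := [Choice of opsub by <:].
HB.instance Definition _ := [SubChoice_isSubLmodule of opsub by <:].
HB.instance Definition _ :=
  Topological.copy opsub (initial_topology opsub_val).
HB.instance Definition _ := hasMatrixNorm.Build R opsub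
  (fun n (A : 'M[opsub]_n) => mxnorm (map_mx opsub_val A)).

End OperatorSubspaces.

Section Compression.
Variables (R : realType) (H K : hilbertType R).

Fact compression_subproof (p : bop K K) (X : opSubspace H K) (q : bop H H) :
  submod_closed [in [set p] `o` X `o` [set q]].
Proof.
have [X0 Xlin] := opset_submod X.
split.
  rewrite inE; exists (bop_comp p 0).
    by exists p => //; exists 0 => //; move: X0; rewrite inE.
  exists q => //; apply/val_inj/funext => x /=.
  have /asboolP[lp _] := bop_funP p.
  by have := lp (-1) 0 0; rewrite scaler0 add0r scaleN1r addNr.
move=> a _ _ /set_mem[_ [_ -> [x Xx <-]] [_ -> <-]]
  /set_mem[_ [_ -> [y Xy <-]] [_ -> <-]].
rewrite inE; exists (bop_comp p (a *: x + y)).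
  exists p => //; exists (a *: x + y) => //.
  by apply: set_mem; apply: Xlin; exact: mem_set.
exists q => //; apply/val_inj/funext => z /=.
by have /asboolP[lp _] := bop_funP p; rewrite lp.
Qed.

Definition compression (p : bop K K) (X : opSubspace H K) (q : bop H H) :
  opSubspace H K := OpSubspace (compression_subproof p X q).

End Compression.

Section Maps.
Variable R : realType.

Definition complete_isometry (X Y : mxNormedType R) (phi : X -> Y) : Prop :=
  linear phi /\
  forall n (A : 'M[X]_n), mxnorm (map_mx phi A) = mxnorm A.

Definition completely_bounded (X Y : mxNormedType R) (phi : X -> Y) : Prop :=
  exists c : R, forall n (A : 'M[X]_n), mxnorm (map_mx phi A) <= c * mxnorm A.

Definition wcomplete_isometry_onto (X Y : wMxNormedType R) (phi : X -> Y) :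
    Prop :=
  [/\ complete_isometry phi, continuous phi & range phi = setT].

Definition wcb_isomorphism (X Y : wMxNormedType R) (phi : X -> Y) : Prop :=
  [/\ linear phi, continuous phi, completely_bounded phi &
   exists psi : Y -> X,
     [/\ cancel phi psi, cancel psi phi & completely_bounded psi]].

End Maps.

(** The norm dual of [V], with [M_n(V^* )] normed as [CB(V, M_n)] and the
    w*-topology (pointwise convergence on [V]). *)
Section Dual.
Variables (R : realType) (V : mxNormedType R).

Definition mxnorm1 (v : V) : R := mxnorm (const_mx v : 'M[V]_1).

Definition dual_pred : {pred V -> R[i]^o} :=
  fun f => `[< linear f /\
               exists c : R, forall v, rnorm (f v) <= c * mxnorm1 v >].

Record dual := Dual { dual_fun :> V -> R[i]^o; dual_funP : dual_fun \in dual_pred }.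

HB.instance Definition _ := [isSub for dual_fun].
HB.instance Definition _ := [Choice of dual by <:].


Fact dual_submod_closed : submod_closed dual_pred.
Proof.
split.
  apply/asboolP; split=> [a x y|]; first by rewrite scaler0 addr0.
  by exists 0 => v; rewrite mul0r /rnorm normr0.
move=> a f g /asboolP[lf [c fc]] /asboolP[lg [d gd]]; apply/asboolP; split.
  move=> b x y.
  rewrite !(fctE, scalrfctE) /= lf lg !scalerDr !scalerA addrACA.
  by rewrite [a * b]mulrC.
exists (rnorm (a : R[i]^o) * c + d) => v.
rewrite -lecR rnormE; apply: le_trans (ler_normD _ _) _.
rewrite normrZ mulrDl -mulrA rmorphD rmorphM /=; apply: lerD.
  rewrite -(rnormE (a : R[i]^o)) -(rnormE (f v)); apply: ler_wpM2l.
    by rewrite rnormE.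
  by rewrite lecR.
by rewrite -(rnormE (g v)) lecR.
Qed.
HB.instance Definition _ :=
  GRing.isSubmodClosed.Build R[i] (V -> R[i]^o) dual_pred dual_submod_closed.
HB.instance Definition _ := [SubChoice_isSubLmodule of dual by <:].

Definition dual_eval (f : dual) : prod_topology (fun _ : V => R[i]^o) :=
  fun v => f v.
HB.instance Definition _ := Topological.copy dual (initial_topology dual_eval).

(** [||F||] is the supremum over [A] in the unit ball of [M_m(V)] of the norm
    of the [nm x nm] matrix [F i j (A k l)]. *)
Definition dual_mxnorm n (F : 'M[dual]_n) : R :=
  sup [set r | exists m (A : 'M[V]_m), mxnorm A <= 1 /\
    r = l2opnorm (fun (s t : 'I_n * 'I_m) (z : R[i]^o) =>
                    F s.1 t.1 (A s.2 t.2) * z : R[i]^o)].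

HB.instance Definition _ := hasMatrixNorm.Build R dual dual_mxnorm.

End Dual.

Section OperatorSpaces.
Variable R : realType.

Definition mxnorm_complete (X : mxNormedType R) : Prop :=
  forall u : nat -> X,
    (forall e, 0 < e -> exists N, forall m n, (N <= m)%N -> (N <= n)%N ->
       mxnorm1 (u m - u n) < e) ->
    exists x, (fun n => mxnorm1 (u n - x)) @ \oo --> (0 : R).

(** Operator spaces are taken complete: the norm-closed subspaces of some
    [B(H)], up to complete isometry. The w*-topology of [dual V] is the usual
    one only for complete [V]. *)
Definition operator_space (X : mxNormedType R) : Prop :=
  mxnorm_complete X /\
  exists (H : hilbertType R) (u : X -> bop H H), complete_isometry u.

(** The predual [V] is the one that gives the topology of [X]. *)
Definition dual_operator_space (X : wMxNormedType R) : Prop :=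
  operator_space X /\
  exists (V : mxNormedType R) (J : X -> dual V) (J' : dual V -> X),
    [/\ operator_space V, complete_isometry J, cancel J J', cancel J' J &
        continuous J /\ continuous J'].

Definition is_TRO (H K : hilbertType R) (M : set (bop H K)) : Prop :=
  submod_closed [in M] /\ M `o` M^`* `o` M `<=` M.

Definition TRO_sub (K1 K2 H1 H2 : hilbertType R)
    (Y : set (bop K1 K2)) (X : set (bop H1 H2)) : Prop :=
  exists (M1 : set (bop H1 K1)) (M2 : set (bop H2 K2)),
    [/\ is_TRO M1, is_TRO M2, Y = closure (lspan (M2 `o` X `o` M1^`*)) &
    [/\ M2^`* `o` Y `o` M1 `<=` X,
        M2^`* `o` M2 `o` X `<=` X & X `o` M1^`* `o` M1 `<=` X]].

Definition delta_sub (Y X : wMxNormedType R) : Prop :=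
  exists (K1 K2 H1 H2 : hilbertType R)
    (Y' : opSubspace K1 K2) (X' : opSubspace H1 H2)
    (psi : Y -> opsub Y') (phi : X -> opsub X'),
    [/\ closed Y', closed X', wcomplete_isometry_onto psi,
        wcomplete_isometry_onto phi & TRO_sub Y' X'].

Definition cb_delta_sub (Y X : wMxNormedType R) : Prop :=
  exists (K1 K2 H1 H2 : hilbertType R)
    (Y' : opSubspace K1 K2) (X' : opSubspace H1 H2)
    (psi : Y -> opsub Y') (phi : X -> opsub X'),
    [/\ closed Y', closed X', wcb_isomorphism psi,
        wcb_isomorphism phi & TRO_sub Y' X'].

End OperatorSpaces.

(* Main.v *)
(** The TROs [M1, M2] of [Y < X] and [N1, N2] of [Z < Y] act on two unrelated
    representations of [Y], so they cannot be multiplied directly. Both pairs,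
    however, act on the abstract space [Y]. Left and right actions commute,
    although they come from different representations: conjugating by Cayley
    transforms of self-adjoint elements gives complete isometries of the first
    row (or column) of [M_2(Y)], and their commutator is a translation whose
    iterates stay bounded. A Hahn-Banach argument in the style of Arveson, which
    alternates between the two representations and passes to the limit, followed
    by a GNS construction, then yields one normal completely isometric
    representation [tau] of [Y] on which [M_i M_i^*] and [N_i^* N_i] act by
    operators. Inducing [tau] along the [M_i] represents the corner [p X q],
    where [p] and [q] are the projections on the closed spans of [M2^* L2] and
    [M1^* L1]; inducing along the [N_i] represents [Z]; and between the induced
    spaces the TROs compose, which is (i). For (ii), [x] is sent to the direct
    sum of [x - p x q] and the new representation of [p x q]. *)

From HB Require Import structures.
Require Import Defs.
From mathcomp Require Import all_boot all_order all_algebra.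
From mathcomp Require Import complex.
From mathcomp Require Import all_classical all_reals all_analysis.
From mathcomp Require Import ring lra.

Set Implicit Arguments.
Unset Strict Implicit.
Unset Printing Implicit Defensive.

Import Order.TTheory GRing.Theory Num.Theory.
Import numFieldNormedType.Exports.

Local Open Scope classical_set_scope.
Local Open Scope ring_scope.
Local Open Scope complex_scope.

(** Nothing in a Hahn-Banach and GNS argument makes the resulting representation w*-continuous, and
    a space on which left multipliers act may not admit the right ones. The construction therefore
    runs twice, once for the target space of a given representation of [Y] and once, through
    adjoints, for its domain. After each run the new space is cut down to the vectors whose
    functionals have the properties to be kept: w*-continuity and, in the second run, compatibility
    with the left action already obtained. Commutation of left and right multipliers makes this cut
    invariant under the right ones; no norm is lost, because the original functionals pass the cut.

    The facts on w*-continuous functionals that are used are collected in [dualized]. Hilbert spaces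
    are realised as functions on a set with a positive kernel, normed as functionals, so that
    completeness is a matter of pointwise limits.

    Of X only the corner p X q receives a new isometric representation. In (ii) it is glued to x - p
    x q, and the triangle inequality costs a factor 2 in both directions; hence cb instead of
    isometric. *)

Section Scalars.
Variable R : realType.
Implicit Types z w : R[i].

Definition cmod z : R := rnorm (z : R[i]^o).

Lemma Re_conjc z : complex.Re (conjc z) = complex.Re z.
Proof. by case: z. Qed.
Lemma conjcM z w : conjc (z * w) = conjc z * conjc w.
Proof. by rewrite rmorphM. Qed.
Lemma conjcD z w : conjc (z + w) = conjc z + conjc w.
Proof. by rewrite rmorphD. Qed.
Lemma conjcN z : conjc (- z) = - conjc z.
Proof. by rewrite rmorphN. Qed.
Lemma ReD z w : complex.Re (z + w) = complex.Re z + complex.Re w.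
Proof. by case: z w => a b [c d]. Qed.
Lemma ReN z : complex.Re (- z) = - complex.Re z.
Proof. by case: z. Qed.
Lemma ReM (t : R) z : complex.Re (t%:C * z) = t * complex.Re z.
Proof. by case: z => a b /=; rewrite mul0r subr0. Qed.
Lemma Re_sum I (r : seq I) (P : pred I) (F : I -> R[i]) :
  complex.Re (\sum_(i <- r | P i) F i) = \sum_(i <- r | P i) complex.Re (F i).
Proof. exact: (big_morph _ ReD). Qed.
Lemma ReiC z : complex.Re ((- 'i) * z) = complex.Im z.
Proof. by case: z => a b /=; rewrite oppr0 mul0r sub0r mulN1r opprK. Qed.
Lemma Im_miC z : complex.Im ((- 'i) * z) = - complex.Re z.
Proof. by case: z => a b /=; ring. Qed.
Lemma complex_mulD z (p q r s : R) : z * (p +i* q) + (r +i* s) =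
  (complex.Re z * p - complex.Im z * q + r) +i* (complex.Re z * q + complex.Im z * p + s).
Proof. by case: z. Qed.
Lemma cmodE z : (cmod z)%:C = `|z|.
Proof. exact: rnormE. Qed.
Lemma cmod_ge0 z : 0 <= cmod z.
Proof. by rewrite -lecR cmodE normr_ge0. Qed.
Lemma cmodM z w : cmod (z * w) = cmod z * cmod w.
Proof. by apply: complexI; rewrite rmorphM /= !cmodE normrM. Qed.
Lemma cmodD z w : cmod (z + w) <= cmod z + cmod w.
Proof. by rewrite -lecR rmorphD /= !cmodE ler_normD. Qed.
Lemma cmodN z : cmod (- z) = cmod z.
Proof. by apply: complexI; rewrite !cmodE normrN. Qed.
Lemma cmodJ z : cmod (conjc z) = cmod z.
Proof. by apply: complexI; rewrite !cmodE normcJ. Qed.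
Lemma cmodR (t : R) : cmod t%:C = `|t|.
Proof. by apply: complexI; rewrite cmodE normc_def /= expr0n /= addr0 sqrtr_sqr. Qed.
Lemma cmod0 : cmod 0 = 0.
Proof. by rewrite (cmodR 0) normr0. Qed.
Lemma cmod0_eq0 z : cmod z = 0 -> z = 0.
Proof. by move=> h; apply/eqP; rewrite -normr_eq0 -cmodE h. Qed.
Lemma ler_Re z : `|complex.Re z| <= cmod z.
Proof. by rewrite -lecR cmodE normc_ge_Re. Qed.
Lemma Re_cmod z : complex.Re z <= cmod z.
Proof. exact: le_trans (ler_norm _) (ler_Re z). Qed.
Lemma cmod_sum I (r : seq I) (P : pred I) (F : I -> R[i]) :
  cmod (\sum_(i <- r | P i) F i) <= \sum_(i <- r | P i) cmod (F i).
Proof.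
elim/big_rec2: _ => [|i x y _ h]; first by rewrite cmod0.
by apply: le_trans (cmodD _ _) _; rewrite lerD2l.
Qed.
Lemma cmod_sqr z : (cmod z ^+ 2)%:C = z * conjc z.
Proof. by rewrite rmorphXn /= cmodE sqr_normc. Qed.
Lemma Re_mulJ z : complex.Re (z * conjc z) = cmod z ^+ 2.
Proof. by rewrite -cmod_sqr. Qed.

Lemma phase z : exists w, cmod w = 1 /\ w * z = (cmod z)%:C.
Proof.
have [->|z0] := eqVneq z 0.
  by exists 1; rewrite mulr0 cmod0 (cmodR 1) normr1.
exists ((cmod z)%:C^-1 * conjc z).
have c0 : cmod z != 0 by apply: contra_neq z0; exact: cmod0_eq0.
have c0' : (cmod z)%:C != 0 :> R[i] by rewrite (inj_eq (@complexI _)).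
split; last by rewrite -mulrA [conjc z * z]mulrC -cmod_sqr rmorphXn /= expr2 mulKf.
by rewrite -fmorphV /= cmodM cmodR cmodJ ger0_norm ?mulVf // invr_ge0 cmod_ge0.
Qed.

End Scalars.

(** * Elementary Hilbert space geometry *)

Section HilbertBasics.
Variables (R : realType) (H : hilbertType R).
Implicit Types x y z : H.

(** The real part is enough for norm estimates; [phase] and [ip_rip] lead back to the complex
    product. *)
Definition rip x y : R := complex.Re (ip x y).

Lemma ipDl x y z : ip (x + y) z = ip x z + ip y z.
Proof. by have := ip_linearl 1 x y z; rewrite scale1r mul1r. Qed.
Lemma ip0l z : ip 0 z = 0 :> R[i].
Proof. by apply: (@addrI _ (ip 0 z)); rewrite -ipDl !addr0. Qed.
Lemma ipZl a x z : ip (a *: x) z = a * ip x z.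
Proof. by have := ip_linearl a x 0 z; rewrite !addr0 ip0l addr0. Qed.
Lemma ipDr x y z : ip z (x + y) = ip z x + ip z y.
Proof. by rewrite ip_conj ipDl rmorphD /= -!ip_conj. Qed.
Lemma ipZr a x z : ip z (a *: x) = conjc a * ip z x.
Proof. by rewrite ip_conj ipZl rmorphM /= -!ip_conj. Qed.
Lemma ip0r z : ip z 0 = 0 :> R[i].
Proof. by rewrite ip_conj ip0l conjc0. Qed.
Lemma ipNl x z : ip (- x) z = - ip x z.
Proof. by rewrite -scaleN1r ipZl mulN1r. Qed.
Lemma ipNr x z : ip z (- x) = - ip z x.
Proof. by rewrite ip_conj ipNl rmorphN /= -ip_conj. Qed.
Lemma ipBl x y z : ip (x - y) z = ip x z - ip y z.
Proof. by rewrite ipDl ipNl. Qed.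
Lemma ipBr x y z : ip z (x - y) = ip z x - ip z y.
Proof. by rewrite ipDr ipNr. Qed.
Lemma ip_suml I (r : seq I) (P : pred I) (F : I -> H) z :
  ip (\sum_(i <- r | P i) F i) z = \sum_(i <- r | P i) ip (F i) z.
Proof. by apply: (big_morph (fun x => ip x z)) => [x y|]; rewrite ?ipDl ?ip0l. Qed.
Lemma ip_sumr I (r : seq I) (P : pred I) (F : I -> H) z :
  ip z (\sum_(i <- r | P i) F i) = \sum_(i <- r | P i) ip z (F i).
Proof. by apply: (big_morph (ip z)) => [x y|]; rewrite ?ipDr ?ip0r. Qed.

Lemma rnorm_ge0 x : 0 <= rnorm x.
Proof. by rewrite -lecR rnormE normr_ge0. Qed.
Lemma rnormD x y : rnorm (x + y) <= rnorm x + rnorm y.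
Proof. by rewrite -lecR rmorphD /= !rnormE ler_normD. Qed.
Lemma rnormN x : rnorm (- x) = rnorm x.
Proof. by apply: complexI; rewrite !rnormE normrN. Qed.
Lemma rnormB x y : rnorm (x - y) <= rnorm x + rnorm y.
Proof. by rewrite -[rnorm y]rnormN rnormD. Qed.
Lemma rnormBC x y : rnorm (x - y) = rnorm (y - x).
Proof. by rewrite -opprB rnormN. Qed.
Lemma rnormZ a x : rnorm (a *: x) = cmod a * rnorm x.
Proof. by apply: complexI; rewrite rmorphM /= cmodE !rnormE normrZ. Qed.
Lemma rnorm0 : rnorm (0 : H) = 0.
Proof. by apply: complexI; rewrite rnormE normr0. Qed.
Lemma rnorm0_eq0 x : rnorm x = 0 -> x = 0.
Proof. by move=> h; apply/eqP; rewrite -normr_eq0 -rnormE h. Qed.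
Lemma rnorm_sum I (r : seq I) (P : pred I) (F : I -> H) :
  rnorm (\sum_(i <- r | P i) F i) <= \sum_(i <- r | P i) rnorm (F i).
Proof.
elim/big_rec2: _ => [|i x y _ h]; first by rewrite rnorm0.
by apply: le_trans (rnormD _ _) _; rewrite lerD2l.
Qed.

Lemma ripDl x y z : rip (x + y) z = rip x z + rip y z.
Proof. by rewrite /rip ipDl ReD. Qed.
Lemma ripDr x y z : rip z (x + y) = rip z x + rip z y.
Proof. by rewrite /rip ipDr ReD. Qed.
Lemma ripNl x z : rip (- x) z = - rip x z.
Proof. by rewrite /rip ipNl ReN. Qed.
Lemma ripNr x z : rip z (- x) = - rip z x.
Proof. by rewrite /rip ipNr ReN. Qed.
Lemma ripBl x y z : rip (x - y) z = rip x z - rip y z.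
Proof. by rewrite ripDl ripNl. Qed.
Lemma ripBr x y z : rip z (x - y) = rip z x - rip z y.
Proof. by rewrite ripDr ripNr. Qed.
Lemma ripZl (t : R) x z : rip (t%:C *: x) z = t * rip x z.
Proof. by rewrite /rip ipZl ReM. Qed.
Lemma rip_sym x y : rip x y = rip y x.
Proof. by rewrite /rip ip_conj Re_conjc. Qed.
Lemma ripZr (t : R) x z : rip z (t%:C *: x) = t * rip z x.
Proof. by rewrite rip_sym ripZl rip_sym. Qed.
Lemma rip0l z : rip 0 z = 0.
Proof. by rewrite /rip ip0l. Qed.
Lemma rip0r z : rip z 0 = 0.
Proof. by rewrite /rip ip0r. Qed.
Lemma rip_suml I (r : seq I) (P : pred I) (F : I -> H) z :
  rip (\sum_(i <- r | P i) F i) z = \sum_(i <- r | P i) rip (F i) z.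
Proof. by rewrite /rip ip_suml Re_sum. Qed.
Lemma rip_sumr I (r : seq I) (P : pred I) (F : I -> H) z :
  rip z (\sum_(i <- r | P i) F i) = \sum_(i <- r | P i) rip z (F i).
Proof. by rewrite /rip ip_sumr Re_sum. Qed.
Lemma rip_norm x : rip x x = rnorm x ^+ 2.
Proof. by rewrite /rip ip_norm -rnormE -rmorphXn. Qed.
Lemma ip_normC x : ip x x = (rnorm x ^+ 2)%:C.
Proof. by rewrite ip_norm -rnormE rmorphXn. Qed.
Lemma ip_rip x y : ip x y = rip x y +i* rip x ('i *: y).
Proof.
rewrite /rip ipZr; case: (ip x y) => a b /=.
by congr (_ +i* _); ring.
Qed.

Lemma rnormD_sqr x y :
  rnorm (x + y) ^+ 2 = rnorm x ^+ 2 + 2 * rip x y + rnorm y ^+ 2.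
Proof. rewrite -!rip_norm ripDl !ripDr (rip_sym y x); ring. Qed.
Lemma rnormB_sqr x y :
  rnorm (x - y) ^+ 2 = rnorm x ^+ 2 - 2 * rip x y + rnorm y ^+ 2.
Proof. rewrite rnormD_sqr ripNr rnormN; ring. Qed.
Lemma parallelogram x y :
  rnorm (x + y) ^+ 2 + rnorm (x - y) ^+ 2 = 2 * (rnorm x ^+ 2 + rnorm y ^+ 2).
Proof. rewrite rnormD_sqr rnormB_sqr; ring. Qed.

Lemma rip_CS x y : rip x y <= rnorm x * rnorm y.
Proof.
have [->|y0] := eqVneq y 0; first by rewrite rip0r rnorm0 mulr0.
have n0 : 0 < rnorm y.
  rewrite lt_neqAle rnorm_ge0 andbT eq_sym.
  by apply: contra_neq y0; exact: rnorm0_eq0.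
(* Expanded, this square is the inequality multiplied by [2 * (rnorm x * rnorm y)]. *)
have := sqr_ge0 (rnorm ((rnorm y)%:C *: x - (rnorm x)%:C *: y)).
rewrite rnormB_sqr !rnormZ !cmodR !ger0_norm ?rnorm_ge0 // ripZl ripZr => h.
have [->|x0] := eqVneq x 0; first by rewrite rip0l rnorm0 mul0r.
have m0 : 0 < rnorm x.
  rewrite lt_neqAle rnorm_ge0 andbT eq_sym.
  by apply: contra_neq x0; exact: rnorm0_eq0.
have h2 : (2 * (rnorm x * rnorm y)) * rip x y <=
    (2 * (rnorm x * rnorm y)) * (rnorm x * rnorm y) by nra.
by rewrite ler_pM2l // in h2; rewrite !mulr_gt0.
Qed.

Lemma ip_CS x y : cmod (ip x y) <= rnorm x * rnorm y.
Proof.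
have [w [w1 wz]] := phase (ip x y).
have -> : cmod (ip x y) = rip (w *: x) y by rewrite /rip ipZl wz.
by apply: le_trans (rip_CS _ _) _; rewrite rnormZ w1 mul1r.
Qed.

Lemma ip_eq0 x : (forall y, ip x y = 0) -> x = 0.
Proof.
move=> h; apply: rnorm0_eq0; apply/eqP; rewrite -sqrf_eq0 -rip_norm.
by rewrite /rip h.
Qed.
Lemma ip_inj x y : (forall z, ip x z = ip y z) -> x = y.
Proof.
by move=> h; apply/subr0_eq/ip_eq0 => z; rewrite ipBl h subrr.
Qed.
Lemma ip_injr x y : (forall z, ip z x = ip z y) -> x = y.
Proof. by move=> h; apply: ip_inj => z; rewrite ip_conj h -ip_conj. Qed.

Lemma hilbert_complete (u : nat -> H) :
  (forall e : R, 0 < e -> exists N, forall m n, (N <= m)%N -> (N <= n)%N ->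
     rnorm (u m - u n) < e) ->
  exists l, forall e : R, 0 < e ->
    exists N, forall n, (N <= n)%N -> rnorm (u n - l) < e.
Proof.
move=> hu.
have cu : cauchy (u @ \oo).
  apply/cauchy_ballP => e e0.
  have e0' : 0 < complex.Re e by move: e0; rewrite ltcE => /andP[].
  have eE : (complex.Re e)%:C = e.
    by apply: RRe_real; rewrite realE ltW.
  have [N hN] := hu _ e0'.
  exists (u @` [set n | (N <= n)%N], u @` [set n | (N <= n)%N]).
    by split; exists N => // n /= Nn; exists n.
  move=> [_ _] /= [[m Nm <-] [n Nn <-]].
  rewrite -ball_normE /= -rnormE -eE ltcR; exact: hN.
have [l hl] := proj1 (cvg_ex _) (cauchy_cvg _ cu).
exists l => e e0.
have e0' : 0 < e%:C by rewrite ltcR.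
have [N _ hN] := proj1 (cvgrPdist_lt _ _) hl _ e0'.
by exists N => n /hN; rewrite /= -rnormE ltcR rnormBC.
Qed.

End HilbertBasics.

Lemma sqrt_le_sqr (R : realType) (x y : R) : 0 <= y -> x ^+ 2 <= y ^+ 2 -> x <= y.
Proof.
move=> y0 h; rewrite real_leNgt ?num_real //; apply/negP => yx.
have : y ^+ 2 < x ^+ 2 by rewrite ltr_pXn2r // nnegrE // ltW // (le_lt_trans y0).
by rewrite ltNge h.
Qed.
(** Stands in for passages to the limit: an error linear in an arbitrary [e] may be dropped,
    whatever its coefficient. *)
Lemma le_eps (R : realType) (x y c : R) : 0 <= c ->
  (forall e, 0 < e -> x <= y + e * c) -> x <= y.
Proof.
move=> c0 h; apply/ler_addgt0Pr => e e0.
have c1 : 0 < c + 1 by lra.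
apply: le_trans (h (e / (c + 1)) _) _; first by rewrite divr_gt0.
have h1 : c / (c + 1) <= 1 by rewrite ler_pdivrMr // mul1r; lra.
by rewrite lerD2l mulrAC -mulrA ler_piMr // ltW.
Qed.
Lemma inv_small (R : realType) (e : R) : 0 < e ->
  exists N, forall n, (N <= n)%N -> n.+1%:R^-1 < e.
Proof.
move=> e0; exists (Num.bound e^-1) => n Nn.
have h : e^-1 < n.+1%:R.
  apply: lt_le_trans (archi_boundP _) _; first by rewrite invr_ge0 ltW.
  by rewrite ler_nat (leq_trans Nn).
by rewrite invf_plt ?posrE.
Qed.

(** * Bounded operators, adjoints and orthogonal projections *)

Section BopBasics.
Variable R : realType.
Implicit Types H K L : hilbertType R.

Lemma bop_predI H K (f : H -> K) (c : R) : linear f ->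
  (forall x, rnorm (f x) <= c * rnorm x) -> f \in @bop_pred R H K.
Proof.
move=> lf hf; apply/asboolP; split=> // x.
apply/(@cvgrPdist_lt _ _ _ (nbhs x)) => e e0.
have e0' : 0 < complex.Re e by move: e0; rewrite ltcE => /andP[].
have eE : (complex.Re e)%:C = e by apply: RRe_real; rewrite realE ltW.
have c1 : 0 < `|c| + 1 by rewrite ltr_pwDr.
apply/nbhs_ballP; exists (complex.Re e / (`|c| + 1))%:C.
  by rewrite /= ltcR divr_gt0.
move=> z; rewrite -ball_normE /= -!rnormE ltcR => hz.
rewrite -eE ltcR.
have -> : f x - f z = f (x - z).
  by have := lf (-1) z x; rewrite !scaleN1r addrC => <-; rewrite addrC.
apply: le_lt_trans (hf _) _.
apply: (@le_lt_trans _ _ ((`|c| + 1) * rnorm (x - z))).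
  by rewrite ler_wpM2r ?rnorm_ge0 // (le_trans (ler_norm c)) // lerDl.
by rewrite mulrC -ltr_pdivlMr.
Qed.

Definition mkbop H K (f : H -> K) (c : R) (lf : linear f)
  (hf : forall x, rnorm (f x) <= c * rnorm x) : bop H K := Bop (bop_predI lf hf).

Lemma bop_linear H K (T : bop H K) : linear T.
Proof. by have /asboolP[] := bop_funP T. Qed.
Lemma bop0 H K (T : bop H K) : T 0 = 0.
Proof. by have := bop_linear T (-1) 0 0; rewrite scaler0 addr0 scaleN1r addNr. Qed.
Lemma bopD H K (T : bop H K) x y : T (x + y) = T x + T y.
Proof. by have := bop_linear T 1 x y; rewrite !scale1r. Qed.
Lemma bopZ H K (T : bop H K) a x : T (a *: x) = a *: T x.
Proof. by have := bop_linear T a x 0; rewrite !addr0 bop0 addr0. Qed.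
Lemma bopN H K (T : bop H K) x : T (- x) = - T x.
Proof. by rewrite -scaleN1r bopZ scaleN1r. Qed.
Lemma bopB H K (T : bop H K) x y : T (x - y) = T x - T y.
Proof. by rewrite bopD bopN. Qed.
Lemma bop_sum H K (T : bop H K) I (r : seq I) (P : pred I) (F : I -> H) :
  T (\sum_(i <- r | P i) F i) = \sum_(i <- r | P i) T (F i).
Proof. by apply: (big_morph T) => [x y|]; rewrite ?bopD ?bop0. Qed.

Lemma bop_bound H K (T : bop H K) :
  exists2 c : R, 0 <= c & forall x, rnorm (T x) <= c * rnorm x.
Proof.
have /asboolP[_ cT] := bop_funP T.
have /cvgrPdist_lt/(_ 1 ltr01) := cT 0.
move=> /nbhs_ballP[e /= e0 he].
have e0' : 0 < complex.Re e by move: e0; rewrite ltcE => /andP[].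
have eE : (complex.Re e)%:C = e by apply: RRe_real; rewrite realE ltW.
set d := complex.Re e in e0' eE.
exists (2 / d) => [|x]; first by rewrite divr_ge0 // ltW.
have [->|x0] := eqVneq x 0; first by rewrite bop0 !rnorm0 mulr0.
have n0 : 0 < rnorm x.
  by rewrite lt_neqAle rnorm_ge0 andbT eq_sym; apply: contra_neq x0; exact: rnorm0_eq0.
set t := d / 2 / rnorm x.
have t0 : 0 < t by rewrite !divr_gt0.
have htx : rnorm (t%:C *: x) = d / 2.
  by rewrite rnormZ cmodR (ger0_norm (ltW t0)) /t divfK ?gt_eqF.
have hd : d / 2 < d by lra.
have := he (t%:C *: x); rewrite -ball_normE /= sub0r normrN -rnormE -eE ltcR htx.
move=> /(_ hd); rewrite bop0 sub0r normrN -rnormE ltcR bopZ rnormZ cmodR.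
rewrite (ger0_norm (ltW t0)) -ltr_pdivlMl // mulr1 => /ltW /le_trans; apply.
by rewrite /t !invf_div mulrC mulrAC mulrC mulrA [d^-1 * _]mulrC.
Qed.

Lemma bop_eq H K (S T : bop H K) : (forall x, S x = T x) -> S = T.
Proof. by move=> h; apply/val_inj/funext. Qed.
Lemma bop_addE H K (S T : bop H K) x : (S + T) x = S x + T x. Proof. by []. Qed.
Lemma bop_oppE H K (T : bop H K) x : (- T) x = - T x. Proof. by []. Qed.
Lemma bop_subE H K (S T : bop H K) x : (S - T) x = S x - T x. Proof. by []. Qed.
Lemma bop_scaleE H K a (T : bop H K) x : (a *: T) x = a *: T x. Proof. by []. Qed.
Lemma bop_zeroE H K x : (0 : bop H K) x = 0. Proof. by []. Qed.
Lemma bop_sumE H K I (r : seq I) (P : pred I) (F : I -> bop H K) x :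
  (\sum_(i <- r | P i) F i) x = \sum_(i <- r | P i) F i x.
Proof. by apply: (big_morph (fun T : bop H K => T x)). Qed.
Lemma bop_compE H K L (S : bop K L) (T : bop H K) x : bop_comp S T x = S (T x).
Proof. by []. Qed.

Fact bop_id_subproof H x : rnorm (idfun x : H) <= 1 * rnorm x.
Proof. by rewrite mul1r. Qed.
Definition bop_id H : bop H H :=
  mkbop (fun (a : R[i]) (x y : H) => erefl (a *: x + y)) (@bop_id_subproof H).
Lemma bop_idE H x : bop_id H x = x. Proof. by []. Qed.

Definition closed_subspace H (S : set H) : Prop :=
  [/\ S 0, forall a x y, S x -> S y -> S (a *: x + y) &
   forall x, (forall e : R, 0 < e -> exists2 y, S y & rnorm (x - y) < e) -> S x].

Lemma closed_subspaceT H : closed_subspace (@setT H).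
Proof. by []. Qed.

(* Maximise [2 Re f(y) - |y|^2] over [S]; maximising sequences are Cauchy. *)
Lemma riesz_closed H (S : set H) (f : H -> R[i]) (c : R) : closed_subspace S ->
  (forall a x y, f (a *: x + y) = a * f x + f y) ->
  (forall x, cmod (f x) <= c * rnorm x) ->
  exists2 x, S x & forall y, S y -> f y = ip y x.
Proof.
move=> [S0 Sl Sc] fl fb.
have f0 : f 0 = 0 by apply: cmod0_eq0; apply/eqP; rewrite eq_le cmod_ge0 (le_trans (fb _)) // rnorm0 mulr0.
have fD x y : f (x + y) = f x + f y by have := fl 1 x y; rewrite scale1r mul1r.
have fZ a x : f (a *: x) = a * f x by have := fl a x 0; rewrite !addr0 f0 addr0.
have SD x y : S x -> S y -> S (x + y) by move=> ? ?; rewrite -[x]scale1r; apply: Sl.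
have SZ a x : S x -> S (a *: x) by move=> ?; rewrite -[_ *: x]addr0; apply: Sl.
pose J y : R := 2 * complex.Re (f y) - rnorm y ^+ 2.
have Jb y : J y <= c ^+ 2.
  have := le_trans (Re_cmod _) (fb y); have := sqr_ge0 (rnorm y - c); rewrite /J; nra.
pose E := [set J y | y in S].
have hE : has_sup E.
  by split; [exists (J 0); exists 0 | exists (c ^+ 2) => _ [y _ <-]].
pose M := sup E.
have JM y : S y -> J y <= M by move=> Sy; apply: ub_le_sup; [case: hE | exists y].
have exu n : {y | S y /\ M - n.+1%:R^-1 <= J y}.
  apply: cid; have [|_ [y Sy <-] hy] := @sup_adherent _ E n.+1%:R^-1 _ hE.
    by rewrite invr_gt0.
  by exists y; split=> //; exact: ltW.
pose u n := sval (exu n).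
have uS n : S (u n) by have [] := svalP (exu n).
have uJ n : M - n.+1%:R^-1 <= J (u n) by have [] := svalP (exu n).
have mid y z : J y + J z = 2 * J ((2^-1)%:C *: (y + z)) - rnorm (y - z) ^+ 2 / 2.
  rewrite /J fZ ReM fD ReD rnormZ cmodR ger0_norm ?invr_ge0 // exprMn.
  have := parallelogram y z; rewrite -[rnorm (y - z) ^+ 2]opprK; lra.
have cau m n : rnorm (u m - u n) ^+ 2 <= 2 * (m.+1%:R^-1 + n.+1%:R^-1).
  have := mid (u m) (u n); have := uJ m; have := uJ n.
  have /JM : S ((2^-1)%:C *: (u m + u n)) by apply: SZ; apply: SD.
  move: (m.+1%:R^-1) (n.+1%:R^-1) => a b; lra.
have [|x hx] := @hilbert_complete _ _ u.
  move=> e e0; have [N hN] := @inv_small R (e ^+ 2 / 4) ltac:(by rewrite divr_gt0 ?exprn_gt0).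
  exists N => m n /hN hm /hN hn.
  rewrite -(@ltr_pXn2r _ 2) ?nnegrE ?rnorm_ge0 ?(ltW e0) //.
  have := cau m n; move: (m.+1%:R^-1) (n.+1%:R^-1) hm hn => a b; lra.
have Sx : S x.
  by apply: Sc => e /hx[N /(_ N (leqnn N))]; exists (u N); rewrite // rnormBC.
exists x => //.
have key w : S w -> complex.Re (f w) = rip w x.
  move=> Sw; set D := complex.Re (f w) - rip w x.
  (* [J] is nearly maximal at [u n], so a move by [t w] gains at most [1 / (n + 1)]. In the limit
     the first and second order terms in [t] remain, and [t = D / (rnorm w ^+ 2 + 1)] forces
     [D = 0]. *)
  have hD (t : R) : 2 * t * D <= t ^+ 2 * rnorm w ^+ 2.
    apply: (@le_eps _ _ _ (1 + 2 * `|t| * rnorm w)).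
      by rewrite addr_ge0 // !mulr_ge0 // rnorm_ge0.
    move=> e e0; have [N1 h1] := @inv_small R _ e0; have [N2 h2] := hx _ e0.
    pose n := maxn N1 N2.
    have {}h1 := h1 n (leq_maxl _ _); have {}h2 := h2 n (leq_maxr _ _).
    have /JM : S (u n + t%:C *: w) by apply: SD => //; apply: SZ.
    have := uJ n; rewrite /J fD fZ ReD ReM rnormD_sqr rnormZ ripZr cmodR.
    rewrite exprMn real_normK ?num_real //.
    have h3 : rip (u n) w <= rip w x + e * rnorm w.
      rewrite (rip_sym w) -lerBlDl -ripBl.
      by apply: le_trans (rip_CS _ _) _; rewrite ler_wpM2r ?rnorm_ge0 // ltW.
    have h4 : rip w x - e * rnorm w <= rip (u n) w.
      rewrite (rip_sym w) lerBlDl -lerBlDr -ripBl rnormBC in h2 *.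
      by apply: le_trans (rip_CS _ _) _; rewrite ler_wpM2r ?rnorm_ge0 // ltW.
    have h5 : t * (rip (u n) w - rip w x) <= `|t| * (e * rnorm w).
      apply: le_trans (ler_norm _) _; rewrite normrM ler_wpM2l //.
      by rewrite ler_norml; lra.
    rewrite /D; move: (n.+1%:R^-1) h1 => a; lra.
  have W0 : 0 <= rnorm w ^+ 2 by exact: sqr_ge0.
  move: hD W0; move: (rnorm w ^+ 2) => W hD W0.
  have W1 : W + 1 != 0 by rewrite gt_eqF // ltr_wpDl.
  apply/eqP; rewrite -subr_eq0 -/D -[D](divfK W1) mulf_eq0 (negPf W1) orbF.
  have := hD (D / (W + 1)); rewrite -{2}[D](divfK W1); move: (D / _) => s h.
  by rewrite -sqrf_eq0; apply/eqP/le_anti; rewrite sqr_ge0 andbT; nra.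
move=> y Sy; have h1 := key _ Sy; have h2 := key _ (SZ (- 'i) _ Sy).
rewrite fZ ReiC in h2; rewrite /rip ipZl ReiC in h2; rewrite /rip in h1.
by case: (f y) (ip y x) h1 h2 => a b [a' b'] /= -> ->.
Qed.

Lemma riesz H (f : H -> R[i]) (c : R) :
  (forall a x y, f (a *: x + y) = a * f x + f y) ->
  (forall x, cmod (f x) <= c * rnorm x) -> exists x, forall y, f y = ip y x.
Proof.
move=> fl fb; have [x _ hx] := riesz_closed (closed_subspaceT H) fl fb.
by exists x => y; apply: hx.
Qed.

Lemma adj_exists H K (T : bop H K) :
  exists T' : bop K H, forall x y, ip (T x) y = ip x (T' y).
Proof.
have [c c0 hc] := bop_bound T.
have ex y : {z | forall x, ip (T x) y = ip x z}.
  apply: cid; apply: (@riesz _ _ (c * rnorm y)) => [a x z|x].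
    by rewrite bopD bopZ ipDl ipZl.
  apply: le_trans (ip_CS _ _) _; rewrite mulrAC ler_wpM2r ?rnorm_ge0 //.
pose g y := sval (ex y).
have gE x y : ip (T x) y = ip x (g y) by exact: (svalP (ex y)).
have lg : linear g.
  move=> a x y; apply: ip_injr => z.
  by rewrite -gE ipDr ipZr ipDr ipZr -!gE.
have bg y : rnorm (g y) <= c * rnorm y.
  have [->|g0] := eqVneq (g y) 0; first by rewrite rnorm0 mulr_ge0 // rnorm_ge0.
  have n0 : 0 < rnorm (g y).
    by rewrite lt_neqAle rnorm_ge0 andbT eq_sym; apply: contra_neq g0; exact: rnorm0_eq0.
  rewrite -(ler_pM2l n0) -expr2 -rip_norm /rip -gE.
  apply: le_trans (rip_CS _ _) _.
  by rewrite mulrA [_ * c]mulrC ler_wpM2r ?rnorm_ge0.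
by exists (mkbop lg bg).
Qed.

(** A choice that turns the relation [adjoint_of] into a function; [adjoint_ofE] translates back. *)
Definition adj H K (T : bop H K) : bop K H := sval (cid (adj_exists T)).
Lemma adjP H K (T : bop H K) x y : ip (T x) y = ip x (adj T y).
Proof. exact: (svalP (cid (adj_exists T))). Qed.
Lemma adjPr H K (T : bop H K) x y : ip (adj T x) y = ip x (T y).
Proof. by rewrite ip_conj -adjP -ip_conj. Qed.
Lemma adj_uniq H K (T : bop H K) (T' : bop K H) :
  (forall x y, ip (T x) y = ip x (T' y)) -> T' = adj T.
Proof. by move=> h; apply: bop_eq => y; apply: ip_injr => x; rewrite -h adjP. Qed.
Lemma adjoint_ofE H K (T : bop H K) (T' : bop K H) : adjoint_of T T' <-> T' = adj T.
Proof. by split=> [|->]; [exact: adj_uniq | exact: adjP]. Qed.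
Lemma adjK H K (T : bop H K) : adj (adj T) = T.
Proof. by apply/esym/adj_uniq => x y; rewrite adjPr. Qed.
Lemma adj_comp H K L (S : bop K L) (T : bop H K) :
  adj (bop_comp S T) = bop_comp (adj T) (adj S).
Proof. by apply/esym/adj_uniq => x y /=; rewrite !adjP. Qed.
Lemma adjD H K (S T : bop H K) : adj (S + T) = adj S + adj T.
Proof. by apply/esym/adj_uniq => x y; rewrite !bop_addE ipDl ipDr !adjP. Qed.
Lemma adjZ H K a (T : bop H K) : adj (a *: T) = conjc a *: adj T.
Proof. by apply/esym/adj_uniq => x y; rewrite !bop_scaleE ipZl ipZr conjcK adjP. Qed.
Lemma adj0 H K : adj (0 : bop H K) = 0.
Proof. by apply/esym/adj_uniq => x y; rewrite !bop_zeroE ip0l ip0r. Qed.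
Lemma adj_id H : adj (bop_id H) = bop_id H.
Proof. by apply/esym/adj_uniq. Qed.
Lemma adj_sum H K I (r : seq I) (P : pred I) (F : I -> bop H K) :
  adj (\sum_(i <- r | P i) F i) = \sum_(i <- r | P i) adj (F i).
Proof. by apply: (big_morph (@adj H K)) => [x y|]; rewrite ?adjD ?adj0. Qed.

Lemma adj_bound H K (T : bop H K) c : 0 <= c ->
  (forall x, rnorm (T x) <= c * rnorm x) -> forall y, rnorm (adj T y) <= c * rnorm y.
Proof.
move=> c0 hT y; have := rip_CS (T (adj T y)) y.
have -> : rip (T (adj T y)) y = rnorm (adj T y) ^+ 2 by rewrite /rip adjP -rip_norm.
move=> h; have [->|n0] := eqVneq (rnorm (adj T y)) 0.
  by rewrite mulr_ge0 // rnorm_ge0.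
have n1 : 0 < rnorm (adj T y) by rewrite lt_neqAle rnorm_ge0 andbT eq_sym.
rewrite -(ler_pM2l n1) -expr2; apply: le_trans h _.
by rewrite mulrA [_ * c]mulrC ler_wpM2r ?rnorm_ge0.
Qed.

(** The projection of [x] is the Riesz vector, inside [S], of the functional [y |-> ip y x]. *)
Lemma projection_exists H (S : set H) : closed_subspace S ->
  exists P : bop H H, [/\ forall x, S (P x), forall x, S x -> P x = x,
    adj P = P & forall x, rnorm (P x) <= rnorm x].
Proof.
move=> cS; have [S0 Sl Sc] := cS.
have ex x : {z | S z /\ forall y, S y -> ip y x = ip y z}.
  apply: cid; have [|y|z Sz hz] := @riesz_closed _ S (fun y => ip y x) (rnorm x) cS.
  - by move=> a u v; rewrite ipDl ipZl.
  - by rewrite mulrC ip_CS.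
  - by exists z.
pose g x := sval (ex x).
have gS x : S (g x) by have [] := svalP (ex x).
have gE x y : S y -> ip y x = ip y (g x) by have [_] := svalP (ex x); apply.
have SB x y : S x -> S y -> S (x - y).
  by move=> Sx Sy; rewrite addrC -scaleN1r; apply: Sl.
have uniq x z : S z -> (forall y, S y -> ip y x = ip y z) -> g x = z.
  move=> Sz hz; apply/subr0_eq/rnorm0_eq0/eqP; rewrite -sqrf_eq0 -rip_norm /rip.
  by rewrite ipBr -gE ?hz ?subrr //; apply: SB.
have lg : linear g.
  move=> a x y; apply: uniq; first exact: Sl.
  by move=> z Sz; rewrite !ipDr !ipZr -!gE.
have bg x : rnorm (g x) <= 1 * rnorm x.
  rewrite mul1r; have := rip_CS (g x) x; rewrite /rip gE // -/(rip _ _) rip_norm => h.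
  have [->|n0] := eqVneq (rnorm (g x)) 0; first exact: rnorm_ge0.
  have n1 : 0 < rnorm (g x) by rewrite lt_neqAle rnorm_ge0 andbT eq_sym.
  by rewrite -(ler_pM2l n1) -expr2.
exists (mkbop lg bg); split=> //= [x Sx||x]; first exact: uniq.
  apply/esym/adj_uniq => x y /=.
  by rewrite (gE _ _ (gS x)) [in RHS]ip_conj (gE x _ (gS y)) -ip_conj.
by have := bg x; rewrite mul1r.
Qed.

End BopBasics.

(** * Inner products from the parallelogram law *)

Section JordanVonNeumann.
Variables (R : realType) (V : normedModType R[i]).
Hypothesis paral : forall x y : V,
  rnorm (x + y) ^+ 2 + rnorm (x - y) ^+ 2 = 2 * (rnorm x ^+ 2 + rnorm y ^+ 2).
Implicit Types x y z : V.

Let nN x : rnorm (- x) = rnorm x.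
Proof. by apply: complexI; rewrite !rnormE normrN. Qed.
Let nZ a x : rnorm (a *: x) = cmod a * rnorm x.
Proof. by apply: complexI; rewrite rmorphM /= cmodE !rnormE normrZ. Qed.
Let nD x y : rnorm (x + y) <= rnorm x + rnorm y.
Proof. by rewrite -lecR rmorphD /= !rnormE ler_normD. Qed.
Let n0 : rnorm (0 : V) = 0.
Proof. by apply: complexI; rewrite rnormE normr0. Qed.
Let ng0 x : 0 <= rnorm x.
Proof. by rewrite -lecR rnormE normr_ge0. Qed.

Definition jvn x y : R := (rnorm (x + y) ^+ 2 - rnorm (x - y) ^+ 2) / 4.

Lemma jvn_sym x y : jvn x y = jvn y x.
Proof. by rewrite /jvn (addrC x) -(opprB y) nN. Qed.
Lemma jvnxx x : jvn x x = rnorm x ^+ 2.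
Proof.
have := paral x x; rewrite /jvn subrr n0 => h; lra.
Qed.
Lemma jvn0 y : jvn 0 y = 0.
Proof. by rewrite /jvn add0r sub0r nN subrr mul0r. Qed.
Lemma jvnN x y : jvn (- x) y = - jvn x y.
Proof.
rewrite /jvn -[- x - y]opprD nN.
have -> : - x + y = - (x - y) by rewrite opprB addrC.
rewrite nN; lra.
Qed.
Lemma jvn_mid x y z : jvn (x + z) y + jvn (x - z) y = 2 * jvn x y.
Proof.
have h1 := paral (x + y) z; have h2 := paral (x - y) z.
have e1 : x + y + z = x + z + y by rewrite addrAC.
have e2 : x + y - z = x - z + y by rewrite addrAC.
have e3 : x - y + z = x + z - y by rewrite addrAC.
have e4 : x - y - z = x - z - y by rewrite addrAC.
rewrite e1 e2 in h1; rewrite e3 e4 in h2; rewrite /jvn; lra.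
Qed.
Lemma jvnD x z y : jvn (x + z) y = jvn x y + jvn z y.
Proof.
have dbl u : jvn (u + u) y = 2 * jvn u y.
  by rewrite -(jvn_mid u y u) subrr jvn0 addr0.
pose h : R[i] := 2^-1; pose u := h *: (x + z); pose v := h *: (x - z).
have half w : h *: w + h *: w = w.
  by rewrite -scalerDl -mulr2n -mulr_natr mulVf ?scale1r // pnatr_eq0.
have -> : x + z = u + u by rewrite half.
rewrite dbl -(jvn_mid u y v); congr (jvn _ y + jvn _ y).
  by rewrite /u /v -scalerDr addrACA subrr addr0 scalerDr half.
by rewrite /u /v -scalerBr opprB [z - x]addrC addrACA subrr add0r scalerDr half.
Qed.
Lemma jvn_bound x y : `|jvn x y| <= rnorm x * rnorm y.
Proof.
have b u w : jvn u w <= rnorm u * rnorm w.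
  have h1 : rnorm (u + w) ^+ 2 <= (rnorm u + rnorm w) ^+ 2.
    by rewrite ler_pXn2r ?nnegrE ?addr_ge0 ?ng0 // nD.
  have h2 : (rnorm u - rnorm w) ^+ 2 <= rnorm (u - w) ^+ 2.
    rewrite -[X in X <= _]real_normK ?num_real // ler_pXn2r ?nnegrE ?ng0 //.
    have k1 := nD (u - w) w; have k2 := nD (w - u) u; rewrite !subrK in k1 k2.
    by rewrite -[w - u]opprB nN in k2; rewrite ler_norml; lra.
  rewrite /jvn; nra.
by rewrite ler_norml b andbT -lerNl -jvnN; apply: le_trans (b _ _) _; rewrite nN.
Qed.
Lemma jvnMn n x y : jvn (x *+ n) y = n%:R * jvn x y.
Proof.
elim: n => [|n IH]; first by rewrite mulr0n jvn0 mul0r.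
by rewrite mulrS jvnD IH -natr1 mulrDl mul1r addrC.
Qed.
(** Additivity settles integer multiples. Comparing [n t] with its integer part leaves an error
    bounded independently of [n]; so every multiple of the defect at [t] obeys one bound, and the
    defect vanishes. *)
Lemma jvnZ (t : R) x y : jvn (t%:C *: x) y = t * jvn x y.
Proof.
wlog t0 : t / 0 <= t.
  move=> h; have [/h//|/ltW tn] := leP 0 t.
  have := h (- t); rewrite oppr_ge0 => /(_ tn).
  rewrite rmorphN /= scaleNr jvnN mulNr => /eqP; rewrite eqr_opp => /eqP //.
pose c := rnorm x * rnorm y + `|jvn x y|.
have key n : n%:R * `|jvn (t%:C *: x) y - t * jvn x y| <= c.
  pose m := Num.truncn (n%:R * t).
  have /andP[m1 m2] : m%:R <= n%:R * t < m.+1%:R.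
    by apply: truncn_itv; rewrite mulr_ge0.
  have e1 : n%:R * (jvn (t%:C *: x) y - t * jvn x y) =
      jvn ((n%:R * t - m%:R)%:C *: x) y - (n%:R * t - m%:R) * jvn x y.
    rewrite mulrBr -jvnMn rmorphB scalerBl jvnD jvnN /= !rmorphM !rmorph_nat.
    rewrite -scalerA !scaler_nat (jvnMn m); ring.
  have -> : n%:R * `|jvn (t%:C *: x) y - t * jvn x y| =
     `|n%:R * (jvn (t%:C *: x) y - t * jvn x y)|.
    by rewrite normrM ger0_norm.
  have d1 : `|n%:R * t - m%:R| <= 1.
    rewrite -natr1 in m2; rewrite ger0_norm ?subr_ge0 //; move: m1 m2; move: (m%:R) => w; lra.
  rewrite e1; apply: le_trans (ler_normB _ _) _; apply: lerD.
    apply: le_trans (jvn_bound _ _) _; rewrite nZ cmodR.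
    by rewrite ler_wpM2r ?ng0 // ler_piMl ?ng0.
  by rewrite normrM ler_piMl.
apply/eqP; rewrite -subr_eq0 -normr_eq0; apply: contraT => ne.
have p : 0 < `|jvn (t%:C *: x) y - t * jvn x y| by rewrite normr_gt0 -normr_eq0.
have c0 : 0 <= c by rewrite addr_ge0 // mulr_ge0 // ng0.
have := key (Num.bound (c / `|jvn (t%:C *: x) y - t * jvn x y|)).
rewrite -ler_pdivlMr // leNgt archi_boundP //.
by rewrite divr_ge0 // ltW.
Qed.
Lemma jvni x y : jvn ('i *: x) ('i *: y) = jvn x y.
Proof.
have ci : cmod ('i : R[i]) = 1.
  by apply: complexI; rewrite cmodE normc_def /= expr0n expr1n add0r sqrtr1.
by rewrite /jvn -scalerDr -scalerBr !nZ ci !mul1r.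
Qed.
Lemma jvniC x y : jvn ('i *: x) y = - jvn x ('i *: y).
Proof. by rewrite -jvni scalerA -expr2 sqr_i scaleN1r jvnN. Qed.

(** A product that is conjugate linear on the right satisfies [Im <x, y> = Re <x, i y>]. *)
Definition jip x y : R[i] := jvn x y +i* jvn x ('i *: y).

Lemma jip_linearl (a : R[i]) x y z : jip (a *: x + y) z = a * jip x z + jip y z.
Proof.
have D u v : jip (u + v) z = jip u z + jip v z by rewrite /jip !jvnD.
rewrite D; congr (_ + _); case: a => a b.
have -> : a +i* b = a%:C + b%:C * 'i by rewrite [LHS]complexE /= mulrC.
rewrite scalerDl D -scalerA.
have rZ (t : R) u : jip (t%:C *: u) z = t%:C * jip u z.
  by rewrite /jip !jvnZ /= /GRing.mul /= !mul0r subr0 addr0.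
rewrite !rZ mulrDl -mulrA; congr (_ + _ * _).
rewrite /jip jvniC jvni /GRing.mul /=; congr (_ +i* _); ring.
Qed.
Lemma jip_conj x y : jip y x = conjc (jip x y).
Proof. by rewrite /jip /= (jvn_sym y x) (jvn_sym y) jvniC. Qed.
Lemma jip_norm x : jip x x = `|x| ^+ 2.
Proof.
rewrite /jip jvnxx; have -> : jvn x ('i *: x) = 0.
  by have := jvniC x x; rewrite jvn_sym; lra.
by rewrite -rnormE -rmorphXn.
Qed.

End JordanVonNeumann.

(** * Hilbert spaces from positive kernels *)

Section RKHS.
Variables (R : realType) (G : Type).

Definition lin_comb := seq (R[i] * G).
Implicit Types s t : lin_comb.

(** With conjugated coefficients this becomes the inner product of [f] with the combination of
    kernel functions that has the coefficients [p.1]. *)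
Definition lc_ev (f : G -> R[i]) s : R[i] := \sum_(p <- s) conjc p.1 * f p.2.
Definition lc_scale (a : R[i]) s : lin_comb := [seq (a * p.1, p.2) | p <- s].
Definition lc_form (k : G -> G -> R[i]) s t : R[i] :=
  \sum_(p <- s) \sum_(q <- t) p.1 * conjc q.1 * k p.2 q.2.

Definition psd_kernel (k : G -> G -> R[i]) : Prop :=
  (forall x y, k y x = conjc (k x y)) /\
  forall s, 0 <= complex.Re (lc_form k s s).

Record psdKernel := PsdKernel { kernel_fun :> G -> G -> R[i];
  kernel_psd : psd_kernel kernel_fun }.

Variable k : psdKernel.

Definition lc_q s : R := complex.Re (lc_form k s s).

Lemma lc_evD f g s : lc_ev (fun x => f x + g x) s = lc_ev f s + lc_ev g s.
Proof. by rewrite -big_split; apply: eq_bigr => p _; rewrite mulrDr. Qed.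
Lemma lc_evZ a f s : lc_ev (fun x => a * f x) s = a * lc_ev f s.
Proof. by rewrite mulr_sumr; apply: eq_bigr => p _; rewrite mulrCA. Qed.
Lemma lc_ev_cat f s t : lc_ev f (s ++ t) = lc_ev f s + lc_ev f t.
Proof. by rewrite /lc_ev big_cat. Qed.
Lemma lc_ev_scale f a s : lc_ev f (lc_scale a s) = conjc a * lc_ev f s.
Proof.
by rewrite /lc_ev big_map mulr_sumr; apply: eq_bigr => p _; rewrite rmorphM mulrA.
Qed.
Lemma lc_form_cat s t : lc_form k (s ++ t) (s ++ t) =
  lc_form k s s + lc_form k s t + lc_form k t s + lc_form k t t.
Proof.
rewrite /lc_form big_cat /= -!addrA; do 2!rewrite addrA; rewrite -addrA; congr (_ + _).
  by rewrite -big_split; apply: eq_bigr => p _; rewrite big_cat.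
by rewrite -big_split; apply: eq_bigr => p _; rewrite big_cat.
Qed.
Lemma lc_form_scale a b s t :
  lc_form k (lc_scale a s) (lc_scale b t) = a * conjc b * lc_form k s t.
Proof.
rewrite /lc_form big_map mulr_sumr; apply: eq_bigr => p _.
rewrite big_map mulr_sumr; apply: eq_bigr => q _; rewrite rmorphM /=.
by ring.
Qed.
Lemma lc_form_conj s t : lc_form k t s = conjc (lc_form k s t).
Proof.
rewrite /lc_form rmorph_sum /= exchange_big; apply: eq_bigr => p _ /=.
rewrite rmorph_sum; apply: eq_bigr => q _; rewrite !rmorphM /= conjcK.
by rewrite (kernel_psd k).1 [conjc p.1 * _]mulrC.
Qed.
Lemma lc_q_ge0 s : 0 <= lc_q s.
Proof. exact: (kernel_psd k).2. Qed.
Lemma lc_q_scale a s : lc_q (lc_scale a s) = cmod a ^+ 2 * lc_q s.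
Proof. by rewrite /lc_q lc_form_scale -cmod_sqr ReM. Qed.
Lemma lc_q_cat s t :
  lc_q (s ++ t) = lc_q s + 2 * complex.Re (lc_form k s t) + lc_q t.
Proof. rewrite /lc_q lc_form_cat !ReD (lc_form_conj s t) Re_conjc; ring. Qed.
Lemma lc_q_paral s t :
  lc_q (s ++ t) + lc_q (s ++ lc_scale (-1) t) = 2 * (lc_q s + lc_q t).
Proof.
have h : cmod (-1 : R[i]) = 1 by rewrite cmodN (cmodR 1) normr1.
rewrite !lc_q_cat lc_q_scale h expr1n mul1r.
have -> : lc_form k s (lc_scale (-1) t) = - lc_form k s t.
  rewrite /lc_form -sumrN; apply: eq_bigr => p _; rewrite big_map -sumrN.
  by apply: eq_bigr => q _ /=; rewrite mulN1r rmorphN /=; ring.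
rewrite ReN; ring.
Qed.

(** The space consists of the bounded functionals on formal combinations, with their norm. This dual
    description replaces a quotient followed by a completion. *)
Definition rk_bound (f : G -> R[i]) (c : R) : Prop :=
  0 <= c /\ forall s, cmod (lc_ev f s) <= c * Num.sqrt (lc_q s).
Definition rk_pred : {pred G -> R[i]^o} := fun f => `[< exists c, rk_bound f c >].
Record rkhs := Rkhs { rk_fun :> G -> R[i]^o; rk_funP : rk_fun \in rk_pred }.
HB.instance Definition _ := [isSub for rk_fun].
HB.instance Definition _ := [Choice of rkhs by <:].

Lemma rk_boundD f g c d : rk_bound f c -> rk_bound g d ->
  rk_bound (fun x => f x + g x) (c + d).
Proof.
move=> [c0 hc] [d0 hd]; split=> [|s]; first exact: addr_ge0.
by rewrite lc_evD mulrDl; apply: le_trans (cmodD _ _) _; apply: lerD.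
Qed.
Lemma rk_boundZ a f c : rk_bound f c -> rk_bound (fun x => a * f x) (cmod a * c).
Proof.
move=> [c0 hc]; split=> [|s]; first by rewrite mulr_ge0 // cmod_ge0.
by rewrite lc_evZ cmodM -mulrA ler_wpM2l // cmod_ge0.
Qed.

Fact rk_submod_closed : submod_closed rk_pred.
Proof.
split.
  apply/asboolP; exists 0; split=> // s; rewrite mul0r /lc_ev big1 ?cmod0 // => p _.
  by rewrite mulr0.
move=> a f g /asboolP[c hc] /asboolP[d hd]; apply/asboolP; exists (cmod a * c + d).
by apply: rk_boundD; [apply: rk_boundZ | ].
Qed.
HB.instance Definition _ :=
  GRing.isSubmodClosed.Build R[i] (G -> R[i]^o) rk_pred rk_submod_closed.
HB.instance Definition _ := [SubChoice_isSubLmodule of rkhs by <:].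

Definition rk_norm (f : rkhs) : R := inf [set c | rk_bound f c].

Lemma rk_norm_le (f : rkhs) c : rk_bound f c -> rk_norm f <= c.
Proof. by move=> hc; apply: ge_inf => //; exists 0 => d []. Qed.
Lemma rk_normP (f : rkhs) : rk_bound f (rk_norm f).
Proof.
have /asboolP[c0 hc0] := rk_funP f.
have ne : [set c | rk_bound f c] !=set0 by exists c0.
split; first by apply: lb_le_inf => // d [].
move=> s; have [q0|q0] := eqVneq (Num.sqrt (lc_q s)) 0.
  by have := hc0.2 s; rewrite q0 !mulr0.
have qp : 0 < Num.sqrt (lc_q s) by rewrite lt_neqAle eq_sym q0 sqrtr_ge0.
rewrite -ler_pdivrMr //; apply: lb_le_inf => // d [_ hd].
by rewrite ler_pdivrMr.
Qed.
Lemma rk_norm_ge0 (f : rkhs) : 0 <= rk_norm f.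
Proof. by have [] := rk_normP f. Qed.
Lemma rk_norm_ev (f : rkhs) s : cmod (lc_ev f s) <= rk_norm f * Num.sqrt (lc_q s).
Proof. by have [] := rk_normP f. Qed.

Lemma rk_normD (f g : rkhs) : rk_norm (f + g) <= rk_norm f + rk_norm g.
Proof. by apply: rk_norm_le; apply: rk_boundD; exact: rk_normP. Qed.
Lemma rk_normZ_le a (f : rkhs) : rk_norm (a *: f) <= cmod a * rk_norm f.
Proof. by apply: rk_norm_le; apply: rk_boundZ; exact: rk_normP. Qed.
Lemma rk_norm0 : rk_norm 0 = 0.
Proof.
apply/eqP; rewrite eq_le rk_norm_ge0 andbT.
by have := rk_normZ_le 0 0; rewrite scale0r cmod0 mul0r.
Qed.
Lemma rk_normZ a (f : rkhs) : rk_norm (a *: f) = cmod a * rk_norm f.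
Proof.
have [->|a0] := eqVneq a 0; first by rewrite scale0r rk_norm0 cmod0 mul0r.
apply/eqP; rewrite eq_le rk_normZ_le /=.
have c0 : 0 < cmod a.
  by rewrite lt_neqAle cmod_ge0 andbT eq_sym; apply: contra_neq a0; exact: cmod0_eq0.
have := rk_normZ_le a^-1 (a *: f); rewrite scalerA mulVf // scale1r.
rewrite -(ler_pM2l c0) mulrA -cmodM mulfV // (cmodR 1) normr1 mul1r //.
Qed.
Lemma rk_norm0_eq0 (f : rkhs) : rk_norm f = 0 -> f = 0.
Proof.
move=> h; apply/val_inj/funext => x.
have := rk_norm_ev f [:: (1, x)]; rewrite h mul0r => h2.
have : cmod (lc_ev f [:: (1, x)]) = 0 by apply/le_anti; rewrite h2 cmod_ge0.
by move/cmod0_eq0; rewrite /lc_ev big_seq1 [X in X * _]conjc1 mul1r.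
Qed.

Fact rk_cnormD (f g : rkhs) : (rk_norm (f + g))%:C <= (rk_norm f)%:C + (rk_norm g)%:C.
Proof. by rewrite -rmorphD lecR rk_normD. Qed.
Fact rk_cnormZ (a : R[i]) (f : rkhs) : (rk_norm (a *: f))%:C = `|a| * (rk_norm f)%:C.
Proof. by rewrite -cmodE -rmorphM /= rk_normZ. Qed.
Fact rk_cnorm0_eq0 (f : rkhs) : (rk_norm f)%:C = 0 -> f = 0.
Proof. by move=> h; apply: rk_norm0_eq0; exact: complexI. Qed.
HB.instance Definition _ :=
  Lmodule_isNormed.Build R[i] rkhs rk_cnormD rk_cnormZ rk_cnorm0_eq0.

Lemma rk_rnorm (f : rkhs) : rnorm f = rk_norm f.
Proof. by []. Qed.

Lemma rk_ev_re (f : rkhs) s : complex.Re (lc_ev f s) <= rk_norm f * Num.sqrt (lc_q s).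
Proof. exact: le_trans (Re_cmod _) (rk_norm_ev f s). Qed.

(* Evaluating [f] at [s + t] and [g] at [s - t] turns the parallelogram law of the
   kernel into one inequality for the dual norm. *)
Lemma rk_paral_ev (f g : rkhs) s t (a b : R) : 0 <= a -> 0 <= b ->
  (a * cmod (lc_ev (f + g) s) + b * cmod (lc_ev (f - g) t)) ^+ 2 <=
  (rk_norm f ^+ 2 + rk_norm g ^+ 2) * (2 * (a ^+ 2 * lc_q s + b ^+ 2 * lc_q t)).
Proof.
move=> a0 b0; have [w [w1 hw]] := phase (lc_ev (f + g) s).
have [v [v1 hv]] := phase (lc_ev (f - g) t).
pose s' := lc_scale (a%:C * conjc w) s; pose t' := lc_scale (b%:C * conjc v) t.
have qs : lc_q s' = a ^+ 2 * lc_q s.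
  by rewrite lc_q_scale cmodM cmodJ w1 mulr1 cmodR real_normK // num_real.
have qt : lc_q t' = b ^+ 2 * lc_q t.
  by rewrite lc_q_scale cmodM cmodJ v1 mulr1 cmodR real_normK // num_real.
have e1 : a * cmod (lc_ev (f + g) s) = complex.Re (lc_ev (f + g) s').
  by rewrite lc_ev_scale conjcM conjcK conjc_real -mulrA hw -rmorphM.
have e2 : b * cmod (lc_ev (f - g) t) = complex.Re (lc_ev (f - g) t').
  by rewrite lc_ev_scale conjcM conjcK conjc_real -mulrA hv -rmorphM.
set A := rk_norm f; set B := rk_norm g.
have evB u : lc_ev (f - g) u = lc_ev f u - lc_ev g u.
  rewrite -[- lc_ev g u]mulN1r -lc_evZ -lc_evD; congr lc_ev; apply/funext => x /=.
  by rewrite mulN1r.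
have e3 : complex.Re (lc_ev (f + g) s') + complex.Re (lc_ev (f - g) t') =
  complex.Re (lc_ev f (s' ++ t')) + complex.Re (lc_ev g (s' ++ lc_scale (-1) t')).
  rewrite (_ : lc_ev (f + g) s' = lc_ev f s' + lc_ev g s'); last exact: lc_evD.
  rewrite evB !lc_ev_cat lc_ev_scale conjcN conjc1 mulN1r !ReD ReN; ring.
have pos : 0 <= a * cmod (lc_ev (f + g) s) + b * cmod (lc_ev (f - g) t).
  by rewrite addr_ge0 // mulr_ge0 // cmod_ge0.
move: pos; rewrite e1 e2 e3 => pos.
have pr := lc_q_paral s' t'; rewrite qs qt in pr; rewrite -pr.
have p0 := lc_q_ge0 (s' ++ t'); have r0 := lc_q_ge0 (s' ++ lc_scale (-1) t').
have hx := rk_ev_re f (s' ++ t'); have hy := rk_ev_re g (s' ++ lc_scale (-1) t').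
rewrite -(sqr_sqrtr p0) -(sqr_sqrtr r0).
have P0 := sqrtr_ge0 (lc_q (s' ++ t')).
have Q0 := sqrtr_ge0 (lc_q (s' ++ lc_scale (-1) t')).
have A0 : 0 <= A := rk_norm_ge0 f; have B0 : 0 <= B := rk_norm_ge0 g.
rewrite -/A in hx; rewrite -/B in hy.
move: (complex.Re (lc_ev f _)) (complex.Re (lc_ev g _)) pos hx hy => x y pos hx hy.
move: (Num.sqrt _) (Num.sqrt _) P0 Q0 hx hy => Q P P0 Q0 hx hy.
apply: (@le_trans _ _ ((A * P + B * Q) ^+ 2)).
  have h := lerD hx hy; have h0 := le_trans pos h.
  by rewrite ler_pXn2r.
have := sqr_ge0 (A * Q - B * P); lra.
Qed.

Lemma rk_paral_le (f g : rkhs) :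
  rk_norm (f + g) ^+ 2 + rk_norm (f - g) ^+ 2 <= 2 * (rk_norm f ^+ 2 + rk_norm g ^+ 2).
Proof.
set P := 2 * _.
have P0 : 0 <= P by rewrite mulr_ge0 // addr_ge0 // sqr_ge0.
have zero (h : rkhs) s : lc_q s = 0 -> cmod (lc_ev h s) ^+ 2 = 0.
  move=> q0; have := rk_norm_ev h s; rewrite q0 sqrtr0 mulr0 => h0.
  by rewrite (_ : cmod _ = 0) ?expr0n //; apply/le_anti; rewrite h0 cmod_ge0.
have bound (h : rkhs) (c : R) : 0 <= c ->
    (forall s, cmod (lc_ev h s) ^+ 2 <= c * lc_q s) -> rk_norm h ^+ 2 <= c.
  move=> c0 hc; rewrite -(sqr_sqrtr c0) ler_pXn2r ?nnegrE ?rk_norm_ge0 ?sqrtr_ge0 //.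
  apply: rk_norm_le; split=> [|s]; first exact: sqrtr_ge0.
  rewrite -sqrtrM // -[X in X <= _]ger0_norm ?cmod_ge0 // -sqrtr_sqr.
  by rewrite ler_psqrt ?nnegrE ?sqr_ge0 ?mulr_ge0 ?lc_q_ge0.
have key s t : 0 < lc_q s -> 0 < lc_q t ->
    cmod (lc_ev (f + g) s) ^+ 2 / lc_q s + cmod (lc_ev (f - g) t) ^+ 2 / lc_q t <= P.
  move=> s0 t0; set u := cmod _; set v := cmod _.
  (* These weights make both sides multiples of the same quantity [X], so that one factor [X]
     cancels. *)
  have := @rk_paral_ev f g s t (u / lc_q s) (v / lc_q t)
    (divr_ge0 (cmod_ge0 _) (ltW s0)) (divr_ge0 (cmod_ge0 _) (ltW t0)).
  rewrite -/u -/v; set X := u ^+ 2 / lc_q s + v ^+ 2 / lc_q t.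
  have -> : u / lc_q s * u + v / lc_q t * v = X by rewrite /X !expr2; ring.
  have -> : (u / lc_q s) ^+ 2 * lc_q s + (v / lc_q t) ^+ 2 * lc_q t = X.
    by rewrite /X; field; rewrite !gt_eqF.
  rewrite [_ * (2 * X)](_ : _ = P * X); last by rewrite /P; ring.
  have X0 : 0 <= X by rewrite addr_ge0 // divr_ge0 ?sqr_ge0 // ltW.
  by move=> h; nra.
have tb t : 0 < lc_q t -> cmod (lc_ev (f - g) t) ^+ 2 / lc_q t <= P ->
    rk_norm (f + g) ^+ 2 <= P - cmod (lc_ev (f - g) t) ^+ 2 / lc_q t.
  move=> t0 ht; apply: bound => [|s]; first by rewrite subr_ge0.
  have [q0|q0] := eqVneq (lc_q s) 0; first by rewrite zero // q0 mulr0.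
  have sp : 0 < lc_q s by rewrite lt_neqAle eq_sym q0 lc_q_ge0.
  by rewrite -ler_pdivrMr // lerBrDr key.
(* Ensures a nonnegative constant for the supremum over [t] below. If no [t] is admissible, then no
   [s] has positive [lc_q], since [key s s] would make [s] itself admissible. *)
have fgP : rk_norm (f + g) ^+ 2 <= P.
  have [[t [t0 ht]]|no] := pselect (exists t, 0 < lc_q t /\ cmod (lc_ev (f - g) t) ^+ 2 / lc_q t <= P).
    apply: le_trans (tb t t0 ht) _.
    by rewrite lerBlDr lerDl divr_ge0 ?sqr_ge0 // ltW.
  apply: bound => // s.
  have [q0|q0] := eqVneq (lc_q s) 0; first by rewrite zero // q0 mulr0.
  have sp : 0 < lc_q s by rewrite lt_neqAle eq_sym q0 lc_q_ge0.
  case: no; exists s; split=> //; apply: le_trans (key s s sp sp).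
  by rewrite lerDr divr_ge0 ?sqr_ge0 // ltW.
rewrite -lerBrDl; apply: bound => [|t]; first by rewrite subr_ge0.
have [q0|q0] := eqVneq (lc_q t) 0; first by rewrite zero // q0 mulr0.
have tp : 0 < lc_q t by rewrite lt_neqAle eq_sym q0 lc_q_ge0.
rewrite -ler_pdivrMr // lerBrDr -lerBrDl; apply: tb => //.
apply: le_trans (key t t tp tp); by rewrite lerDr divr_ge0 ?sqr_ge0 // ltW.
Qed.

(** The reverse inequality is [rk_paral_le] for [f + g] and [f - g], whose sum and difference are
    [2 f] and [2 g]. *)
Lemma rk_paral (f g : rkhs) :
  rnorm (f + g) ^+ 2 + rnorm (f - g) ^+ 2 = 2 * (rnorm f ^+ 2 + rnorm g ^+ 2).
Proof.
rewrite !rk_rnorm; apply/le_anti; rewrite rk_paral_le /=.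
have := rk_paral_le (f + g) (f - g).
have dbl (x : rkhs) : rk_norm (x + x) = 2 * rk_norm x.
  rewrite -mulr2n -scaler_nat rk_normZ -(rmorph_nat (real_complex R)) cmodR.
  by rewrite ger0_norm.
have -> : f + g + (f - g) = f + f by rewrite addrACA subrr addr0.
have -> : f + g - (f - g) = g + g by rewrite opprB [g - f]addrC addrACA subrr add0r.
by rewrite !dbl !exprMn; lra.
Qed.

Lemma real_complete (u : nat -> R) :
  (forall e : R, 0 < e -> exists N, forall m n, (N <= m)%N -> (N <= n)%N ->
     `|u m - u n| < e) ->
  exists l, forall e : R, 0 < e ->
    exists N, forall n, (N <= n)%N -> `|u n - l| < e.
Proof.
move=> hu.
have cu : cauchy (u @ \oo : set_system R^o).
  apply/cauchy_ballP => e e0; have [N hN] := hu _ e0.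
  exists (u @` [set n | (N <= n)%N], u @` [set n | (N <= n)%N]).
    by split; exists N => // n /= Nn; exists n.
  by move=> [_ _] /= [[m Nm <-] [n Nn <-]]; exact: hN.
have [l hl] := proj1 (cvg_ex _) (cauchy_cvg _ cu).
exists l => e e0.
have [N _ hN] := proj1 (cvgrPdist_lt _ _) hl _ e0.
by exists N => n /hN; rewrite /= distrC.
Qed.

Lemma complex_complete (u : nat -> R[i]) :
  (forall e : R, 0 < e -> exists N, forall m n, (N <= m)%N -> (N <= n)%N ->
     cmod (u m - u n) < e) ->
  exists l, forall e : R, 0 < e ->
    exists N, forall n, (N <= n)%N -> cmod (u n - l) < e.
Proof.
move=> hu.
have ReB z w : complex.Re (z - w) = complex.Re z - complex.Re w :> R.
  by rewrite ReD ReN.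
have [a ha] : exists l, forall e : R, 0 < e ->
    exists N, forall n, (N <= n)%N -> `|complex.Re (u n) - l| < e.
  apply: real_complete => e /hu[N hN]; exists N => m n hm hn.
  by rewrite -ReB; apply: le_lt_trans (ler_Re _) (hN _ _ hm hn).
have [b hb] : exists l, forall e : R, 0 < e ->
    exists N, forall n, (N <= n)%N -> `|complex.Re (- 'i * u n) - l| < e.
  apply: real_complete => e /hu[N hN]; exists N => m n hm hn.
  rewrite -ReB -mulrBr; apply: le_lt_trans (ler_Re _) _.
  rewrite cmodM (_ : cmod (- 'i) = 1) ?mul1r; first exact: hN.
  by apply: complexI; rewrite cmodE normc_def /= !oppr0 expr0n sqrrN expr1n add0r sqrtr1.
exists (a +i* b) => e e0.
have [N1 h1] := ha (e / 2) ltac:(by rewrite divr_gt0).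
have [N2 h2] := hb (e / 2) ltac:(by rewrite divr_gt0).
exists (maxn N1 N2) => n; rewrite geq_max => /andP[/h1 {}h1 /h2 {}h2].
rewrite ReiC in h2; case: (u n) h1 h2 => x y /= h1 h2.
have -> : x +i* y - (a +i* b) = (x - a)%:C + 'i * (y - b)%:C.
  by rewrite [LHS]complexE.
apply: le_lt_trans (cmodD _ _) _; rewrite cmodM !cmodR.
rewrite (_ : cmod 'i = 1); first lra.
by apply: complexI; rewrite cmodE normc_def /= expr0n expr1n add0r sqrtr1.
Qed.
End RKHS.

(** * Completeness and the reproducing property *)

Section RKHSComplete.
Variables (R : realType) (G : Type) (k : psdKernel R G).
Local Notation H := (rkhs k).
Implicit Types (f g : rkhs k) (s t : lin_comb R G).

Lemma lc_ev1 (f : G -> R[i]) x : lc_ev f [:: (1, x)] = f x.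
Proof. by rewrite /lc_ev big_seq1 [X in X * _]conjc1 mul1r. Qed.

Lemma lc_evB (f g : G -> R[i]) s : lc_ev (fun x => f x - g x) s = lc_ev f s - lc_ev g s.
Proof.
rewrite -[- lc_ev g s]mulN1r -lc_evZ -lc_evD; congr lc_ev; apply/funext => x /=.
by rewrite mulN1r.
Qed.

Lemma rk_complete (F : set_system H) : ProperFilter F -> cauchy F -> cvg F.
Proof.
move=> FF /cauchyP cF.
(* Centres of balls of radius [1 / (n + 1)] belonging to the filter form a Cauchy sequence; its
   pointwise limit is the limit of the filter. *)
have exf n : {x : H | F (ball x (n.+1%:R^-1)%:C)}.
  by apply/cid/cF; rewrite ltcR invr_gt0.
pose f n := sval (exf n).
have fF n : F (ball (f n) (n.+1%:R^-1)%:C) by exact: svalP (exf n).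
have fB (x y : H) (e : R) : ball x e%:C y = (rk_norm (x - y) < e) :> Prop.
  by rewrite -ball_normE /= -rnormE ltcR rk_rnorm.
have cau m n : rk_norm (f m - f n) <= m.+1%:R^-1 + n.+1%:R^-1.
  have [h [h1 h2]] := filter_ex (filterI (fF m) (fF n)).
  rewrite fB in h1; rewrite fB in h2.
  have -> : f m - f n = (f m - h) + - 1 *: (f n - h).
    by rewrite scaleN1r opprB addrA subrK.
  apply: le_trans (rk_normD _ _) _; rewrite rk_normZ cmodN (cmodR 1) normr1 mul1r.
  by rewrite lerD // ltW.
have evB m n s : cmod (lc_ev (f m) s - lc_ev (f n) s) <=
    (m.+1%:R^-1 + n.+1%:R^-1) * Num.sqrt (lc_q k s).
  rewrite -lc_evB; apply: le_trans (rk_norm_ev (f m - f n) s) _.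
  by rewrite ler_wpM2r // sqrtr_ge0.
have [l hl] : {l : G -> R[i] | forall x (e : R), 0 < e ->
    exists N, forall n, (N <= n)%N -> cmod (f n x - l x) < e}.
  suff h x : {z | forall e : R, 0 < e ->
      exists N, forall n, (N <= n)%N -> cmod (f n x - z) < e}.
    by exists (fun x => sval (h x)) => x; exact: (svalP (h x)).
  apply/cid/complex_complete => e e0.
  set q := Num.sqrt (lc_q k [:: (1, x)]); have q0 : 0 <= q := sqrtr_ge0 _.
  have [N hN] := @inv_small R (e / (2 * (q + 1))) ltac:(by rewrite divr_gt0 // mulr_gt0 // ltr_wpDl).
  exists N => m n /hN hm /hN hn; rewrite -!lc_ev1.
  apply: le_lt_trans (evB _ _ _) _; rewrite -/q.
  have q1 : 0 < 2 * (q + 1) by lra.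
  rewrite ltr_pdivlMr // in hm; rewrite ltr_pdivlMr // in hn.
  have := @invr_ge0 R m.+1%:R; have := @invr_ge0 R n.+1%:R; rewrite !ler0n.
  move: (m.+1%:R^-1) (n.+1%:R^-1) hm hn => a b hm hn b0 a0; nra.
have evl s (e : R) : 0 < e ->
    exists N, forall n, (N <= n)%N -> cmod (lc_ev (f n) s - lc_ev l s) < e.
  elim: s e => [|[a x] s IH] e e0.
    by exists 0%N => n _; rewrite /lc_ev !big_nil subrr cmod0.
  have a1 : 0 < cmod a + 1 by rewrite ltr_wpDl // cmod_ge0.
  have [N1 h1] := IH (e / 2) ltac:(by rewrite divr_gt0).
  have [N2 h2] := hl x (e / 2 / (cmod a + 1)) ltac:(by rewrite !divr_gt0).
  exists (maxn N1 N2) => n; rewrite geq_max => /andP[/h1 {}h1 /h2 {}h2].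
  rewrite -[(a, x) :: s]/([:: (a, x)] ++ s) !lc_ev_cat opprD addrACA.
  apply: le_lt_trans (cmodD _ _) _.
  rewrite [X in cmod X + _](_ : _ = conjc a * (f n x - l x)); last first.
    by rewrite /lc_ev !big_seq1 /= mulrBr.
  rewrite cmodM cmodJ ltr_pdivlMr // in h2 *.
  have := cmod_ge0 (f n x - l x); lra.
have lb n s : cmod (lc_ev (f n) s - lc_ev l s) <= 2 * n.+1%:R^-1 * Num.sqrt (lc_q k s).
  apply: (@le_eps _ _ _ 1) => // e e0; have [N hN] := evl s _ e0.
  pose m := maxn N n; have := evB n m s; have := hN m (leq_maxl _ _).
  have -> : lc_ev (f n) s - lc_ev l s =
     (lc_ev (f n) s - lc_ev (f m) s) + (lc_ev (f m) s - lc_ev l s).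
    by rewrite addrA subrK.
  move=> h1 h2; apply: le_trans (cmodD _ _) _; rewrite mulr1.
  apply: lerD (ltW h1); apply: le_trans h2 _; rewrite ler_wpM2r ?sqrtr_ge0 //.
  have : m.+1%:R^-1 <= n.+1%:R^-1 :> R.
    by rewrite lef_pV2 ?posrE // ler_nat ltnS leq_maxr.
  by move: (m.+1%:R^-1) (n.+1%:R^-1) => x y; lra.
have lbd : (l : G -> R[i]^o) \in rk_pred k.
  apply/asboolP; exists (2 * 1%:R^-1 + rk_norm (f 0%N)); split=> [|s].
    by rewrite addr_ge0 ?rk_norm_ge0 // mulr_ge0 // invr_ge0.
  have -> : lc_ev l s = - (lc_ev (f 0%N) s - lc_ev l s) + lc_ev (f 0%N) s.
    by rewrite opprB subrK.
  apply: le_trans (cmodD _ _) _; rewrite cmodN mulrDl; apply: lerD => //.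
  exact: rk_norm_ev.
apply/cvg_ex; exists (Rkhs lbd); apply/cvgrPdist_lt => e e0.
have e0' : 0 < complex.Re e by move: e0; rewrite ltcE => /andP[].
have eE : (complex.Re e)%:C = e by apply: RRe_real; rewrite realE ltW.
have [N hN] := @inv_small R (complex.Re e / 3) ltac:(by rewrite divr_gt0).
apply: filterS (fF N) => h; rewrite fB => hh.
rewrite -rnormE -eE ltcR rk_rnorm.
have -> : Rkhs lbd - h = - 1 *: (f N - Rkhs lbd) + (f N - h).
  by rewrite scaleN1r opprB addrA subrK.
apply: le_lt_trans (rk_normD _ _) _; rewrite rk_normZ cmodN (cmodR 1) normr1 mul1r.
have h2 : rk_norm (f N - Rkhs lbd) <= 2 * N.+1%:R^-1.
  apply: rk_norm_le; split=> [|s]; first by rewrite mulr_ge0 // invr_ge0.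
  by rewrite [lc_ev _ _]lc_evB; exact: lb.
have := hN N (leqnn N); move: (N.+1%:R^-1) h2 hh => a h2 hh; lra.
Qed.

HB.instance Definition _ := Uniform_isComplete.Build (rkhs k) rk_complete.
HB.instance Definition _ := isHilbert.Build R (rkhs k)
  (fun a x y z => jip_linearl (@rk_paral R G k) a x y z)
  (fun x y => jip_conj x y) (fun x => jip_norm (@rk_paral R G k) x).

(** Together with [rk_var_le] this is the variational formula: the squared norm is the supremum of
    [2 Re f(s) - q(s)]. *)
Lemma rk_var_ge f s : 2 * complex.Re (lc_ev f s) - lc_q k s <= rk_norm f ^+ 2.
Proof.
have := rk_ev_re f s; rewrite -{2}(sqr_sqrtr (lc_q_ge0 k s)).
have := sqr_ge0 (rk_norm f - Num.sqrt (lc_q k s)).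
move: (complex.Re _) (Num.sqrt _) => x y; lra.
Qed.

Lemma rk_var_le f (c : R) :
  (forall s, 2 * complex.Re (lc_ev f s) - lc_q k s <= c) -> rk_norm f ^+ 2 <= c.
Proof.
move=> hc.
have c0 : 0 <= c.
  by have := hc [::]; rewrite /lc_q /lc_form /lc_ev !big_nil mulr0 subr0.
rewrite -(sqr_sqrtr c0) ler_pXn2r ?nnegrE ?rk_norm_ge0 ?sqrtr_ge0 //.
apply: rk_norm_le; split=> [|s]; first exact: sqrtr_ge0.
have [q0|q0] := eqVneq (lc_q k s) 0.
  by have := rk_norm_ev f s; rewrite q0 sqrtr0 !mulr0.
have qp : 0 < lc_q k s by rewrite lt_neqAle eq_sym q0 lc_q_ge0.
rewrite -sqrtrM // -[X in X <= _]ger0_norm ?cmod_ge0 // -sqrtr_sqr.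
rewrite ler_psqrt ?nnegrE ?sqr_ge0 ?mulr_ge0 ?lc_q_ge0 //.
have [w [w1 hw]] := phase (lc_ev f s).
set u := cmod _ in hw *.
have := hc (lc_scale ((u / lc_q k s)%:C * conjc w) s).
rewrite lc_q_scale lc_ev_scale conjcM conjcK conjc_real -mulrA hw -rmorphM /=.
rewrite cmodM cmodJ w1 mulr1 cmodR real_normK ?num_real //.
have -> : 2 * (u / lc_q k s * u) - (u / lc_q k s) ^+ 2 * lc_q k s = u ^+ 2 / lc_q k s.
  by field; rewrite gt_eqF.
by rewrite ler_pdivrMr.
Qed.

Lemma lc_form_CS s t :
  cmod (lc_form k s t) <= Num.sqrt (lc_q k s) * Num.sqrt (lc_q k t).
Proof.
have [w [w1 hw]] := phase (lc_form k s t).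
set u := cmod _ in hw *; have u0 : 0 <= u := cmod_ge0 _.
have key (a : R) : 0 <= lc_q k s - 2 * a * u + a ^+ 2 * lc_q k t.
  have := lc_q_ge0 k (lc_scale w s ++ lc_scale (- a%:C) t).
  rewrite lc_q_cat !lc_q_scale lc_form_scale w1 cmodN cmodR real_normK ?num_real //.
  rewrite expr1n mul1r conjcN conjc_real mulrN mulNr mulrAC hw -rmorphM ReN /=.
  by move=> h; lra.
have q0 := lc_q_ge0 k s; have r0 := lc_q_ge0 k t.
rewrite -sqrtrM // -[u]ger0_norm // -sqrtr_sqr ler_psqrt ?nnegrE ?sqr_ge0 ?mulr_ge0 //.
have [t0|t0] := eqVneq (lc_q k t) 0.
  have [->|un] := eqVneq u 0; first by rewrite expr0n mulr_ge0.
  have up : 0 < u by rewrite lt_neqAle eq_sym un.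
  have := key ((lc_q k s + 1) / u); rewrite t0 mulr0 addr0 -mulrA divfK //; lra.
have tp : 0 < lc_q k t by rewrite lt_neqAle eq_sym t0.
have := key (u / lc_q k t).
have -> : lc_q k s - 2 * (u / lc_q k t) * u + (u / lc_q k t) ^+ 2 * lc_q k t =
  lc_q k s - u ^+ 2 / lc_q k t by field; rewrite gt_eqF.
by rewrite subr_ge0 ler_pdivrMr.
Qed.

Definition rk_comb_fun s : G -> R[i]^o := fun x => lc_form k s [:: (1, x)].
Lemma rk_comb_funE s x : rk_comb_fun s x = \sum_(p <- s) p.1 * k p.2 x.
Proof.
rewrite /rk_comb_fun /lc_form; apply: eq_bigr => p _.
by rewrite big_seq1 [conjc (1, _).1]conjc1 mulr1.
Qed.
Lemma rk_comb_ev s t : lc_ev (rk_comb_fun s) t = lc_form k s t.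
Proof.
rewrite /lc_ev /lc_form exchange_big; apply: eq_bigr => p _ /=.
rewrite rk_comb_funE mulr_sumr; apply: eq_bigr => q _; ring.
Qed.
Fact rk_comb_subproof s : rk_comb_fun s \in rk_pred k.
Proof.
apply/asboolP; exists (Num.sqrt (lc_q k s)); split=> [|t]; first exact: sqrtr_ge0.
by rewrite rk_comb_ev lc_form_CS.
Qed.
Definition rk_comb s : rkhs k := Rkhs (rk_comb_subproof s).

(** Shifting the combination by [s] in the variational formula completes the square and gives one
    inequality. The other is the same inequality for [f + rk_comb s] and the combination [- s]. *)
Lemma rk_norm_add f s :
  rk_norm (f + rk_comb s) ^+ 2 = rk_norm f ^+ 2 + 2 * complex.Re (lc_ev f s) + lc_q k s.
Proof.
have le g u : rk_norm (g + rk_comb u) ^+ 2 <=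
    rk_norm g ^+ 2 + 2 * complex.Re (lc_ev g u) + lc_q k u.
  apply: rk_var_le => t; rewrite [lc_ev _ _]lc_evD rk_comb_ev ReD.
  have := rk_var_ge g (t ++ lc_scale (-1) u).
  rewrite lc_ev_cat lc_ev_scale lc_q_cat lc_q_scale cmodN (cmodR 1) normr1 expr1n.
  have -> : lc_form k t (lc_scale (-1) u) = - lc_form k t u.
    rewrite /lc_form -sumrN; apply: eq_bigr => p _; rewrite big_map -sumrN.
    by apply: eq_bigr => q _ /=; rewrite mulN1r conjcN; ring.
  by rewrite conjcN conjc1 mulN1r ReD !ReN (lc_form_conj k u t) Re_conjc; lra.
apply/le_anti; rewrite le /=.
have := le (f + rk_comb s) (lc_scale (-1) s).
have -> : f + rk_comb s + rk_comb (lc_scale (-1) s) = f.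
  rewrite -addrA [X in f + X](_ : _ = 0) ?addr0 //; apply/val_inj/funext => x.
  rewrite -[RHS](subrr (rk_comb_fun s x)) {2}rk_comb_funE -sumrN.
  congr (_ + _); rewrite [LHS]rk_comb_funE big_map; apply: eq_bigr => p _ /=.
  by rewrite mulN1r mulNr.
rewrite lc_ev_scale [lc_ev (f + rk_comb s) s]lc_evD rk_comb_ev conjcN conjc1 mulN1r ReN ReD.
rewrite lc_q_scale cmodN (cmodR 1) normr1 expr1n -/(lc_q k s); lra.
Qed.

Lemma rk_jvn f s : jvn f (rk_comb s) = complex.Re (lc_ev f s).
Proof.
rewrite /jvn !rk_rnorm rk_norm_add.
have -> : f - rk_comb s = f + rk_comb (lc_scale (-1) s).
  congr (_ + _); apply/val_inj/funext => x.
  rewrite -[LHS]/(- rk_comb_fun s x) -[RHS]/(rk_comb_fun _ x) !rk_comb_funE big_map -sumrN.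
  by apply: eq_bigr => p _ /=; rewrite mulN1r mulNr.
rewrite rk_norm_add lc_ev_scale lc_q_scale cmodN (cmodR 1) normr1 conjcN conjc1 mulN1r ReN.
by rewrite expr1n; lra.
Qed.

Lemma rk_reproducing f x : ip f (rk_comb [:: (1, x)]) = f x.
Proof.
rewrite /ip /= /jip rk_jvn.
have -> : 'i *: rk_comb [:: (1, x)] = rk_comb [:: ('i, x)].
  apply/val_inj/funext => y.
  by rewrite -[LHS]/('i * rk_comb_fun _ y) -[RHS]/(rk_comb_fun _ y) !rk_comb_funE !big_seq1 mul1r.
rewrite rk_jvn lc_ev1 /lc_ev big_seq1.
have -> : conjc 'i = - 'i :> R[i] by apply/eqP; rewrite eq_complex /= oppr0 !eqxx.
by rewrite ReiC; case: (f x).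
Qed.

End RKHSComplete.

Definition total (R : realType) (G : Type) (H : hilbertType R) (e : G -> H) : Prop :=
  forall h : H, (forall x, ip h (e x) = 0) -> h = 0.

(** The source of all Hilbert spaces constructed below: GNS spaces, closed ranges, induced spaces
    and direct sums each reduce to a positive kernel. *)
Theorem kolmogorov (R : realType) (G : Type) (k : G -> G -> R[i]) : psd_kernel k ->
  exists (H : hilbertType R) (e : G -> H), (forall x y, ip (e x) (e y) = k x y) /\ total e.
Proof.
move=> kP; pose K := PsdKernel kP.
exists (rkhs K : hilbertType R), (fun x => rk_comb K [:: (1, x)]); split=> [x y|h hh].
  by rewrite rk_reproducing -[LHS]/(rk_comb_fun K _ y) rk_comb_funE big_seq1 mul1r.
apply/val_inj/funext => x.
by have := hh x; rewrite rk_reproducing.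
Qed.

(** * Total families and the operators they determine *)

Section TotalFamilies.
Variable R : realType.
Implicit Types H K : hilbertType R.

Definition lc_val (G : Type) (H : hilbertType R) (e : G -> H) (s : seq (R[i] * G)) : H :=
  \sum_(p <- s) p.1 *: e p.2.

Lemma lc_val_cat G H (e : G -> H) s t : lc_val e (s ++ t) = lc_val e s + lc_val e t.
Proof. by rewrite /lc_val big_cat. Qed.
Lemma lc_val_scale G H (e : G -> H) a s : lc_val e (lc_scale a s) = a *: lc_val e s.
Proof.
by rewrite /lc_val big_map scaler_sumr; apply: eq_bigr => p _; rewrite scalerA.
Qed.
Lemma lc_val1 G H (e : G -> H) x : lc_val e [:: (1, x)] = e x.
Proof. by rewrite /lc_val big_seq1 scale1r. Qed.
Definition closed_span G H (e : G -> H) : set H :=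
  [set x | forall d : R, 0 < d -> exists s, rnorm (x - lc_val e s) < d].

Lemma closed_spanP G H (e : G -> H) : closed_subspace (closed_span e).
Proof.
split=> [d d0|a x y hx hy d d0|x hx d d0].
- by exists [::]; rewrite /lc_val big_nil subr0 rnorm0.
- have a1 : 0 < cmod a + 1 by rewrite ltr_wpDl // cmod_ge0.
  have [s hs] := hx (d / 2 / (cmod a + 1)) ltac:(by rewrite !divr_gt0).
  have [t ht] := hy (d / 2) ltac:(by rewrite divr_gt0).
  exists (lc_scale a s ++ t); rewrite lc_val_cat lc_val_scale opprD addrACA -scalerBr.
  apply: le_lt_trans (rnormD _ _) _; rewrite rnormZ ltr_pdivlMr // in hs *.
  have := rnorm_ge0 (x - lc_val e s); lra.
- have [y hy h] := hx (d / 2) ltac:(by rewrite divr_gt0).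
  have [s hs] := hy (d / 2) ltac:(by rewrite divr_gt0).
  exists s; rewrite -(subrK y x) -addrA; apply: le_lt_trans (rnormD _ _) _; lra.
Qed.
Lemma closed_span_mem G H (e : G -> H) x : closed_span e (e x).
Proof. by move=> d d0; exists [:: (1, x)]; rewrite lc_val1 subrr rnorm0. Qed.
Lemma closed_span_min G H (e : G -> H) (S : set H) : closed_subspace S ->
  (forall x, S (e x)) -> closed_span e `<=` S.
Proof.
move=> [S0 Sl Sc] Se x hx; apply: Sc => d /hx[s hs]; exists (lc_val e s) => //.
rewrite /lc_val; elim/big_rec: _ => // p y _ Sy; exact: Sl.
Qed.
Lemma total_dense G H (e : G -> H) : total e -> forall x, closed_span e x.
Proof.
move=> te x; have cS := closed_spanP e; have [P [PS PI PA _]] := projection_exists cS.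
suff -> : x = P x by [].
apply/subr0_eq/te => g; rewrite ipBl -PA adjPr PI ?subrr //; exact: closed_span_mem.
Qed.

(* Images of approximating combinations form a Cauchy sequence. *)
Lemma total_ext G H K (e : G -> H) (F : G -> K) (c : R) : total e -> 0 <= c ->
  (forall s, rnorm (lc_val F s) <= c * rnorm (lc_val e s)) ->
  exists T : bop H K, (forall x, T (e x) = F x) /\ forall h, rnorm (T h) <= c * rnorm h.
Proof.
move=> te c0 hb; have de := total_dense te.
have c1 : 0 < c + 1 by lra.
pose Gr (x : H) (z : K) := forall d : R, 0 < d ->
  exists s, rnorm (x - lc_val e s) < d /\ rnorm (z - lc_val F s) < d.
have GrB x z : Gr x z -> rnorm z <= c * rnorm x.
  move=> h; apply: (@le_eps _ _ _ (1 + c)) => [|d d0]; first lra.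
  have [s [h1 h2]] := h _ d0.
  have e1 : rnorm z <= d + rnorm (lc_val F s).
    by rewrite -{1}(subrK (lc_val F s) z); apply: le_trans (rnormD _ _) _; lra.
  have e2 : rnorm (lc_val e s) <= d + rnorm x.
    rewrite -{1}(subrK x (lc_val e s)); apply: le_trans (rnormD _ _) _.
    by rewrite rnormBC; lra.
  have := hb s; have := ler_wpM2l c0 e2; lra.
have GrL a x z x' z' : Gr x z -> Gr x' z' -> Gr (a *: x + x') (a *: z + z').
  move=> h h' d d0; have a1 : 0 < cmod a + 1 by rewrite ltr_wpDl // cmod_ge0.
  have [s [h1 h2]] := h (d / 2 / (cmod a + 1)) ltac:(by rewrite !divr_gt0).
  have [t [h3 h4]] := h' (d / 2) ltac:(by rewrite divr_gt0).
  rewrite ltr_pdivlMr // in h1; rewrite ltr_pdivlMr // in h2.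
  have p1 := rnorm_ge0 (x - lc_val e s); have p2 := rnorm_ge0 (z - lc_val F s).
  exists (lc_scale a s ++ t); split.
    rewrite lc_val_cat lc_val_scale opprD addrACA -scalerBr.
    by apply: le_lt_trans (rnormD _ _) _; rewrite rnormZ; lra.
  rewrite lc_val_cat lc_val_scale opprD addrACA -scalerBr.
  by apply: le_lt_trans (rnormD _ _) _; rewrite rnormZ; lra.
have Gr1 x : Gr (e x) (F x).
  by move=> d d0; exists [:: (1, x)]; rewrite !lc_val1 !subrr !rnorm0.
have ex x : {z | Gr x z}.
  apply: cid.
  have exs n : {s | rnorm (x - lc_val e s) < n.+1%:R^-1}.
    by apply/cid/de; rewrite invr_gt0.
  pose s n := sval (exs n).
  have hs n : rnorm (x - lc_val e (s n)) < n.+1%:R^-1 by exact: (svalP (exs n)).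
  have [d d0|z hz] := @hilbert_complete _ K (fun n => lc_val F (s n)).
    have [N hN] := @inv_small R (d / 2 / (c + 1)) ltac:(by rewrite !divr_gt0).
    exists N => m n Nm Nn.
    have -> : lc_val F (s m) - lc_val F (s n) = lc_val F (s m ++ lc_scale (-1) (s n)).
      by rewrite lc_val_cat lc_val_scale scaleN1r.
    apply: le_lt_trans (hb _) _.
    rewrite lc_val_cat lc_val_scale scaleN1r.
    have -> : lc_val e (s m) - lc_val e (s n) =
       (x - lc_val e (s n)) - (x - lc_val e (s m)).
      by rewrite opprB [RHS]addrC addrA subrK.
    have h1 := lt_trans (hs m) (hN _ Nm); have h2 := lt_trans (hs n) (hN _ Nn).
    apply: le_lt_trans (ler_wpM2l c0 (rnormB _ _)) _.
    rewrite ltr_pdivlMr // in h1; rewrite ltr_pdivlMr // in h2.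
    move: h1 h2 (rnorm_ge0 (x - lc_val e (s m))) (rnorm_ge0 (x - lc_val e (s n))).
    move: (rnorm _) (rnorm _) => a b *; lra.
  exists z => d d0; have [N1 h1] := hz _ d0; have [N2 h2] := inv_small d0.
  exists (s (maxn N1 N2)); split; last by rewrite rnormBC h1 // leq_maxl.
  by apply: lt_trans (hs _) _; apply: h2; rewrite leq_maxr.
pose f x := sval (ex x); have fG x : Gr x (f x) by exact: (svalP (ex x)).
have uniq x z z' : Gr x z -> Gr x z' -> z = z'.
  move=> h h'; apply/subr0_eq/rnorm0_eq0/le_anti; rewrite rnorm_ge0 andbT.
  have := GrB _ _ (GrL (-1) _ _ _ _ h' h); rewrite !scaleN1r addNr rnorm0 mulr0.
  by rewrite addrC.
have lf : linear f by move=> a x y; apply: uniq (fG _) _; exact: GrL.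
have bf x : rnorm (f x) <= c * rnorm x by exact: GrB.
exists (mkbop lf bf); split=> // x /=; exact: uniq (fG _) (Gr1 _).
Qed.

Lemma bop_eq_total G H K (e : G -> H) (S T : bop H K) : total e ->
  (forall x, S (e x) = T (e x)) -> S = T.
Proof.
move=> te h; apply: bop_eq => x; apply: ip_inj => y; rewrite !adjP.
apply/eqP; rewrite -subr_eq0 -ipBr ip_conj; apply/eqP.
have -> : adj S y - adj T y = 0; last by rewrite ip0l conjc0.
by apply: te => g; rewrite ipBl !adjPr h subrr.
Qed.

(** The constant kernel on a point yields the scalars as a Hilbert space, so that [total_riesz] can
    read a functional as an operator and take the adjoint. *)
Lemma line_exists : exists (H : hilbertType R) (u : H), rnorm u = 1.
Proof.
have [|H [e [he _]]] := @kolmogorov R unit (fun _ _ => 1).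
  split=> [x y|s]; first by rewrite conjc1.
  rewrite /lc_form; have -> : \sum_(p <- s) \sum_(q <- s) p.1 * conjc q.1 * 1 =
      (\sum_(p <- s) p.1) * conjc (\sum_(p <- s) p.1).
    rewrite mulr_suml; apply: eq_bigr => p _; rewrite rmorph_sum mulr_sumr.
    by apply: eq_bigr => q _; rewrite mulr1.
  by rewrite Re_mulJ sqr_ge0.
exists H, (e tt); apply/eqP; rewrite -(@eqrXn2 _ 2) ?rnorm_ge0 // expr1n.
by rewrite -rip_norm /rip he.
Qed.

Lemma total_riesz G H (e : G -> H) (f : G -> R[i]) (c : R) : total e -> 0 <= c ->
  (forall s, cmod (lc_ev f s) <= c * rnorm (lc_val e s)) ->
  exists v, rnorm v <= c /\ forall x, ip v (e x) = f x.
Proof.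
move=> te c0 hb; have [L [u u1]] := line_exists.
have [s|T [hT bT]] := @total_ext G H L e (fun x => conjc (f x) *: u) c te c0.
  rewrite (_ : lc_val _ s = conjc (lc_ev f s) *: u) ?rnormZ ?u1 ?mulr1 ?cmodJ //.
  rewrite /lc_ev rmorph_sum scaler_suml; apply: eq_bigr => p _.
  by rewrite rmorphM /= conjcK scalerA.
exists (adj T u); split; first by rewrite -[c]mulr1 -u1; apply: adj_bound.
by move=> x; rewrite adjPr hT ipZr conjcK ip_normC u1 expr1n mulr1.
Qed.

Lemma total_norm_le G H (e : G -> H) v (c : R) : total e ->
  0 <= c -> (forall s, rip v (lc_val e s) <= c * rnorm (lc_val e s)) -> rnorm v <= c.
Proof.
move=> te c0 hv.
have h : rnorm v ^+ 2 <= c * rnorm v.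
  apply: (@le_eps _ _ _ (rnorm v + c)) => [|d d0]; first by rewrite addr_ge0 // rnorm_ge0.
  have [s hs] := total_dense te v d0.
  rewrite -rip_norm -{2}(subrK (lc_val e s) v) ripDr.
  have h1 : rip v (v - lc_val e s) <= d * rnorm v.
    apply: le_trans (rip_CS _ _) _; rewrite mulrC ler_wpM2r ?rnorm_ge0 //; exact: ltW.
  have h2 : rnorm (lc_val e s) <= d + rnorm v.
    rewrite -{1}(subrK v (lc_val e s)); apply: le_trans (rnormD _ _) _.
    by rewrite rnormBC lerD2r ltW.
  have := hv s; have := ler_wpM2l c0 h2; lra.
have [->//|n0] := eqVneq (rnorm v) 0.
have n1 : 0 < rnorm v by rewrite lt_neqAle rnorm_ge0 andbT eq_sym.
by rewrite -(ler_pM2r n1) -expr2.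
Qed.

(** Riesz in the second variable produces the images of the [e x]; the bound on finite sums then
    permits extension in the first variable. *)
Lemma total_form G G' H H' (e : G -> H) (e' : G' -> H') (B : G -> G' -> R[i]) (c : R) :
  total e -> total e' -> 0 <= c ->
  (forall s t, cmod (\sum_(p <- s) p.1 * lc_ev (B p.2) t) <=
      c * rnorm (lc_val e s) * rnorm (lc_val e' t)) ->
  exists T : bop H H', (forall x y, ip (T (e x)) (e' y) = B x y) /\
    forall h, rnorm (T h) <= c * rnorm h.
Proof.
move=> te te' c0 hB.
have ex x : {v | forall y, ip v (e' y) = B x y}.
  apply: cid; have [||v [_ hv]] := @total_riesz G' H' e' (B x) (c * rnorm (e x)) te'.
  - by rewrite mulr_ge0 // rnorm_ge0.
  - by move=> t; have := hB [:: (1, x)] t; rewrite big_seq1 mul1r lc_val1.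
  - by exists v.
pose F x := sval (ex x); have FE x y : ip (F x) (e' y) = B x y by exact: (svalP (ex x)).
have [s|T [hT bT]] := @total_ext G H H' e F c te c0.
  apply: (total_norm_le te') => [|t]; first by rewrite mulr_ge0 // rnorm_ge0.
  apply: le_trans (hB s t); apply: le_trans (Re_cmod _) _.
  rewrite /lc_val ip_suml le_eqVlt; apply/orP; left; apply/eqP; congr cmod.
  apply: eq_bigr => p _; rewrite ipZl ip_sumr; congr (_ * _).
  by apply: eq_bigr => q _; rewrite ipZr FE.
by exists T; split=> // x y; rewrite hT FE.
Qed.

End TotalFamilies.

(** * Hahn-Banach for a sublinear functional controlled on a subspace *)

Section HahnBanach.
Variables (R : realType) (V : lmodType R) (D : set V).
Hypothesis D0 : D 0.
Hypothesis Dl : forall (a : R) x y, D x -> D y -> D (a *: x + y).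
Implicit Types (p q : V -> R) (x y z : V).

Definition sublinear_on p : Prop :=
  (forall x y, D x -> D y -> p (x + y) <= p x + p y) /\
  (forall (t : R) x, 0 < t -> D x -> p (t *: x) = t * p x).

Let DD x y : D x -> D y -> D (x + y).
Proof. by move=> Dx Dy; rewrite -[x]scale1r; apply: Dl. Qed.
Let DZ t x : D x -> D (t *: x).
Proof. by move=> Dx; rewrite -[_ *: x]addr0; apply: Dl. Qed.
Let DN x : D x -> D (- x).
Proof. by rewrite -scaleN1r; apply: DZ. Qed.

Lemma sublinear0 p : sublinear_on p -> p 0 = 0.
Proof.
move=> [_ hZ]; have h2 : (0 : R) < 2 by [].
by have := hZ 2 0 h2 D0; rewrite scaler0; lra.
Qed.

Lemma sublinear_opp p x : sublinear_on p -> D x -> - p (- x) <= p x.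
Proof.
move=> sp Dx; have := sp.1 _ _ Dx (DN Dx); rewrite subrr sublinear0 //; lra.
Qed.

(** Lowers [p] so that it becomes linear along [y]: the choice [t = 1] bounds the value at [- y] by
    [- p y], and sublinearity survives. *)
Definition tilt p y : V -> R :=
  fun x => inf [set u | exists2 t : R, 0 <= t & u = p (x + t *: y) - t * p y].

Lemma tilt_lb p x y : sublinear_on p -> D x -> D y ->
  lbound [set u | exists2 t : R, 0 <= t & u = p (x + t *: y) - t * p y] (- p (- x)).
Proof.
move=> sp Dx Dy _ [t t0 ->].
have [->|tn] := eqVneq t 0.
  by rewrite scale0r addr0 mul0r subr0 sublinear_opp.
have tp : 0 < t by rewrite lt_neqAle eq_sym tn.
have := sp.1 (x + t *: y) (- x) (DD Dx (DZ t Dy)) (DN Dx).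
by rewrite addrAC subrr add0r sp.2 //; lra.
Qed.

Lemma tilt_le p x y (t : R) : sublinear_on p -> D x -> D y -> 0 <= t ->
  tilt p y x <= p (x + t *: y) - t * p y.
Proof.
by move=> sp Dx Dy t0; apply: ge_inf; [exists (- p (- x)); exact: tilt_lb | exists t].
Qed.

Lemma tilt_ge p x y c : sublinear_on p -> D x -> D y ->
  (forall t : R, 0 <= t -> c <= p (x + t *: y) - t * p y) -> c <= tilt p y x.
Proof.
move=> sp Dx Dy h; apply: lb_le_inf; last by move=> _ [t t0 ->]; apply: h.
by exists (p (x + 0 *: y) - 0 * p y); exists 0.
Qed.

Lemma tilt_sublinear p y : sublinear_on p -> D y -> sublinear_on (tilt p y).
Proof.
move=> sp Dy; split=> [x z Dx Dz|t x t0 Dx].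
  suff h (s t : R) : 0 <= s -> 0 <= t -> tilt p y (x + z) <=
      (p (x + s *: y) - s * p y) + (p (z + t *: y) - t * p y).
    rewrite -lerBlDr; apply: tilt_ge => // s s0; rewrite lerBlDr -lerBlDl.
    by apply: tilt_ge => // t t0; rewrite lerBlDl; apply: h.
  move=> s0 t0; apply: le_trans (tilt_le sp (DD Dx Dz) Dy (addr_ge0 s0 t0)) _.
  have := sp.1 (x + s *: y) (z + t *: y) (DD Dx (DZ s Dy)) (DD Dz (DZ t Dy)).
  by rewrite addrACA -scalerDl; lra.
have half (u : R) w : 0 < u -> D w -> tilt p y (u *: w) <= u * tilt p y w.
  move=> u0 Dw; rewrite mulrC -ler_pdivrMr //; apply: tilt_ge => // s s0.
  rewrite ler_pdivrMr //.
  have us : 0 <= u * s by rewrite mulr_ge0 // ltW.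
  apply: le_trans (tilt_le sp (DZ u Dw) Dy us) _.
  rewrite -scalerA -scalerDr sp.2 //; last by apply: DD => //; apply: DZ.
  by lra.
apply/le_anti; rewrite half //=.
have := half t^-1 (t *: x) ltac:(by rewrite invr_gt0) (DZ t Dx).
by rewrite scalerA mulVf ?gt_eqF // scale1r mulrC ler_pdivlMr // mulrC.
Qed.

(* A minimal sublinear functional is linear: it coincides with all its tilts. *)
Theorem hahn_banach p x0 : sublinear_on p -> D x0 ->
  exists f : V -> R, [/\ forall a x y, D x -> D y -> f (a *: x + y) = a * f x + f y,
    forall x, D x -> f x <= p x & f x0 = p x0].
Proof.
move=> sp Dx0.
(* Zorn's lemma is run below [tilt p x0] instead of [p]; this is what yields [f x0 = p x0] at the
   end. *)
pose PT (q : V -> R) := sublinear_on q /\ forall x, D x -> q x <= tilt p x0 x.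
pose T := {q : V -> R | PT q}.
have tP := tilt_sublinear sp Dx0.
pose t0 : T := exist PT (tilt p x0) (conj tP (fun x _ => lexx _)).
pose Rel (q r : T) := `[< forall x, D x -> sval r x <= sval q x >].
have [||A totA|q qmax] := @ZL_preorder T t0 Rel.
- by move=> q; apply/asboolP.
- move=> r q s /asboolP h1 /asboolP h2; apply/asboolP => x Dx.
  exact: le_trans (h2 x Dx) (h1 x Dx).
- have [[a0 Aa0]|noA] := pselect (exists a, A a); last first.
    by exists t0 => s As; case: noA; exists s.
  pose E x := [set sval q x | q in A].
  have lbE x : D x -> lbound (E x) (- tilt p x0 (- x)).
    move=> Dx _ [q Aq <-]; have [sq hq] := svalP q.
    by apply: le_trans (sublinear_opp sq Dx); rewrite lerN2 hq //; exact: DN.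
  have infE x (q : T) : D x -> A q -> inf (E x) <= sval q x.
    by move=> Dx Aq; apply: ge_inf; [exists (- tilt p x0 (- x)); exact: lbE | exists q].
  have geE x c : (forall q : T, A q -> c <= sval q x) -> c <= inf (E x).
    by move=> h; apply: lb_le_inf; [exists (sval a0 x); exists a0 | move=> _ [q Aq <-]; exact: h].
  have sI : sublinear_on (fun x => inf (E x)).
    split=> [x y Dx Dy|t x tp Dx].
      suff h (q r : T) : A q -> A r -> inf (E (x + y)) <= sval q x + sval r y.
        rewrite -lerBlDr; apply: (geE x) => q Aq; rewrite lerBlDr -lerBlDl.
        by apply: (geE y) => r Ar; rewrite lerBlDl; apply: h.
      move=> Aq Ar; have [sq _] := svalP q; have [sr _] := svalP r.
      have [/asboolP h|/asboolP h] := totA _ _ Aq Ar.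
        apply: le_trans (infE _ _ (DD Dx Dy) Ar) _.
        by apply: le_trans (sr.1 _ _ Dx Dy) _; rewrite lerD2r h.
      apply: le_trans (infE _ _ (DD Dx Dy) Aq) _.
      by apply: le_trans (sq.1 _ _ Dx Dy) _; rewrite lerD2l h.
    have half (u : R) w : 0 < u -> D w -> inf (E (u *: w)) <= u * inf (E w).
      move=> u0 Dw; rewrite mulrC -ler_pdivrMr //; apply: geE => q Aq.
      have [sq _] := svalP q; rewrite ler_pdivrMr // mulrC -sq.2 //.
      by apply: infE => //; exact: DZ.
    apply/le_anti; rewrite half //=.
    have := half t^-1 (t *: x) ltac:(by rewrite invr_gt0) (DZ t Dx).
    by rewrite scalerA mulVf ?gt_eqF // scale1r mulrC ler_pdivlMr // mulrC.
  have hI x : D x -> inf (E x) <= tilt p x0 x.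
    move=> Dx; have [_ h] := svalP a0; exact: le_trans (infE _ _ Dx Aa0) (h x Dx).
  exists (exist PT _ (conj sI hI)) => q Aq; apply/asboolP => x Dx /=; exact: infE.
have [sq hq] := svalP q; set f := sval q in sq hq.
have key y x : D y -> D x -> f x + f y <= f (x + y).
  move=> Dy Dx; have sT := tilt_sublinear sq Dy.
  have hT z : D z -> tilt f y z <= f z.
    by move=> Dz; have := tilt_le sq Dz Dy (lexx 0); rewrite scale0r addr0 mul0r subr0.
  have hT' z : D z -> tilt f y z <= tilt p x0 z.
    by move=> Dz; apply: le_trans (hT z Dz) (hq z Dz).
  pose r : T := exist PT _ (conj sT hT').
  have /asboolP h := qmax r (asboolT hT).
  have := tilt_le sq Dx Dy ler01; have := h x Dx; rewrite /= -/f scale1r; lra.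
have fD x y : D x -> D y -> f (x + y) = f x + f y.
  by move=> Dx Dy; apply/le_anti; rewrite key // sq.1.
have fN x : D x -> f (- x) = - f x.
  by move=> Dx; have := fD _ _ Dx (DN Dx); rewrite subrr sublinear0 //; lra.
have fZ (a : R) x : D x -> f (a *: x) = a * f x.
  move=> Dx; case: (ltrgtP a 0) => [an|ap|->].
  - rewrite -[a]opprK scaleNr fN; last exact: DZ.
    by rewrite sq.2 ?oppr_gt0 // !mulNr.
  - exact: sq.2.
  - by rewrite scale0r mul0r sublinear0.
have le x : D x -> f x <= p x.
  move=> Dx; apply: le_trans (hq x Dx) _.
  by have := tilt_le sp Dx Dx0 (lexx 0); rewrite scale0r addr0 mul0r subr0.
exists f; split=> // [a x y Dx Dy|]; first by rewrite fD ?fZ //; exact: DZ.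
apply/le_anti; rewrite le //= -lerN2 -fN //.
apply: le_trans (hq _ (DN Dx0)) _.
have := tilt_le sp (DN Dx0) Dx0 ler01; rewrite scale1r addNr sublinear0 //; lra.
Qed.
End HahnBanach.

(** * Neighbourhoods in an initial topology of complex functionals *)

Section ComplexInitialTopology.
Variables (R : realType) (S : choiceType) (I : Type).
Variable ev : S -> prod_topology (fun _ : I => R[i]^o).
Local Notation T := (initial_topology ev).

Lemma cvg_initial (F : set_system S) {FF : Filter F} (t : S) :
  (forall i (e : R), 0 < e -> F [set x | cmod (ev x i - ev t i) < e]) ->
  F --> (t : T).
Proof.
move=> hF.
have hev : ev @ F --> ev t.
  apply/cvg_sup => i A /= [_ [[B Bo <-] Bt sB]].
  have /nbhs_ballP[e /= e0 he] : nbhs (ev t i : R[i]^o) B by exact: open_nbhs_nbhs.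
  have e0' : 0 < complex.Re e by move: e0; rewrite ltcE => /andP[].
  have eE : (complex.Re e)%:C = e by apply: RRe_real; rewrite realE ltW.
  change (F (ev @^-1` A)); apply: filterS (hF i _ e0') => x /= hx; apply: sB; apply: he.
  by rewrite -ball_normE /= -cmodE -eE ltcR -cmodN opprB.
move=> A /= [_ [[B Bo <-] Bt sB]]; apply: filterS sB _.
by apply: hev; exact: open_nbhs_nbhs.
Qed.

Definition basic_nbhs (t : S) (l : seq I) (e : R) : set S :=
  [set x | forall i, List.In i l -> cmod (ev x i - ev t i) < e].

(** The sets containing a basic neighbourhood form a filter, and [cvg_initial] shows that it
    converges to [t]; unfolded, this is the claim. *)
Lemma nbhs_initial (t : S) (B : set S) : nbhs (t : T) B ->
  exists (l : seq I) (e : R), 0 < e /\ basic_nbhs t l e `<=` B.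
Proof.
pose F : set_system S := [set B | exists l e, 0 < e /\ basic_nbhs t l e `<=` B].
have FF : Filter F.
  split=> [|P Q [l [e [e0 h]]] [m [d [d0 h']]]|P Q PQ [l [e [e0 h]]]].
  - by exists [::], 1; split=> // x _.
  - exists (l ++ m), (Num.min e d); split; first by rewrite lt_min e0 d0.
    move=> x hx; split.
      apply: h => i il; have := hx i (List.in_or_app _ _ _ (or_introl il)).
      by rewrite lt_min => /andP[].
    apply: h' => i il; have := hx i (List.in_or_app _ _ _ (or_intror il)).
    by rewrite lt_min => /andP[].
  - by exists l, e; split=> // x /h /PQ.
have h : F --> (t : T).
  apply: cvg_initial => i e e0; exists [:: i], e; split=> // x hx.
  by apply: hx; left.
by move=> /h.
Qed.

Lemma closure_initial (A : set S) (t : S) :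
  (forall (l : seq I) (e : R), 0 < e -> exists2 x, A x & basic_nbhs t l e x) ->
  closure (A : set T) (t : T).
Proof.
by move=> h B /nbhs_initial[l [e [e0 hB]]]; have [x Ax /hB] := h l e e0; exists x.
Qed.

Lemma initial_ev_continuous i : continuous (fun x : T => ev x i : R[i]^o).
Proof.
move=> x; have h : {for x, continuous (ev : T -> _)} by exact: initial_continuous.
have h' := proj1 (@cvg_sup _ _ _ _ _ _) h i.
move=> A hA; apply: (h' _ [set f : forall _ : I, R[i]^o | A (f i)]); first by apply: (@fmap_filter _ _ ev (nbhs (x : T)) (nbhs_filter (x : T))).
have [B [Bo Bx] BA] : exists2 B, open_nbhs (ev x i) B & B `<=` A.
  by have := hA; rewrite (@nbhsE (R[i]^o : topologicalType)).
rewrite nbhsE; exists [set f : forall _ : I, R[i]^o | B (f i)]; last by move=> f /BA.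
by split=> //; exists B.
Qed.

End ComplexInitialTopology.

Section ContinuityHelpers.
Variables (R : realType) (X : topologicalType).

Lemma continuous_cmod (f : X -> R[i]^o) : continuous f ->
  forall x (e : R), 0 < e -> nbhs x [set y | cmod (f y - f x) < e].
Proof.
move=> cf x e e0; have e0' : 0 < e%:C by rewrite ltcR.
have /cvgrPdist_lt/(_ _ e0') := cf x.
by apply: filterS => y /=; rewrite -cmodE ltcR -cmodN opprB.
Qed.

Lemma cmod_continuous (f : X -> R[i]^o) :
  (forall x (e : R), 0 < e -> nbhs x [set y | cmod (f y - f x) < e]) -> continuous f.
Proof.
move=> h x; apply/(@cvgrPdist_lt _ _ _ (nbhs x)) => e e0.
have e0' : 0 < complex.Re e by move: e0; rewrite ltcE => /andP[].
have eE : (complex.Re e)%:C = e by apply: RRe_real; rewrite realE ltW.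
by apply: filterS (h x _ e0') => y /=; rewrite -cmodE -eE ltcR -cmodN opprB.
Qed.

Lemma continuousZD (a : R[i]) (f g : X -> R[i]) :
  continuous (f : X -> R[i]^o) -> continuous (g : X -> R[i]^o) ->
  continuous ((fun x => a * f x + g x) : X -> R[i]^o).
Proof.
move=> cf cg; apply: cmod_continuous => x e e0.
have a1 : 0 < cmod a + 1 by rewrite ltr_wpDl // cmod_ge0.
have h1 := continuous_cmod cf x (e := e / 2 / (cmod a + 1)) ltac:(by rewrite !divr_gt0).
have h2 := continuous_cmod cg x (e := e / 2) ltac:(by rewrite divr_gt0).
apply: filterS (filterI h1 h2) => y /= [k1 k2].
rewrite opprD addrACA -mulrBr; apply: le_lt_trans (cmodD _ _) _; rewrite cmodM.
rewrite ltr_pdivlMr // in k1; have := cmod_ge0 (f y - f x); lra.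
Qed.
End ContinuityHelpers.

(** * Normal functionals and the w*-topology of operators *)

Section NormalFunctionals.
Variable R : realType.
Implicit Types H K L : hilbertType R.

(** Square summability with an explicit bound on the partial sums, so that constants can be
    followed; [sqsummableP] is the link. *)
Definition sq_bounded (H : hilbertType R) (xi : nat -> H) (M : R) : Prop :=
  forall n, \sum_(i < n) rnorm (xi i) ^+ 2 <= M.

Lemma sqsummableP H (xi : nat -> H) : sqsummable xi <-> exists M, sq_bounded xi M.
Proof.
have nd : nondecreasing_seq (series (fun n => rnorm (xi n) ^+ 2)).
  by apply/nondecreasing_seqP => n; rewrite /series /= big_nat_recr //= lerDl sqr_ge0.
split=> [cx|[M hM]].
  exists (limn (series (fun n => rnorm (xi n) ^+ 2))) => n.
  by have := nondecreasing_cvgn_le nd cx n; rewrite /series /= big_mkord.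
apply: nondecreasing_is_cvgn => //; exists M => _ [n _ <-].
by rewrite /series /= big_mkord.
Qed.

Lemma sq_tail H (xi : nat -> H) (M : R) : sq_bounded xi M -> forall e : R, 0 < e ->
  exists N, forall m n, (N <= m)%N -> \sum_(m <= i < n) rnorm (xi i) ^+ 2 < e.
Proof.
move=> hM e e0.
pose E := [set u | exists n, u = \sum_(i < n) rnorm (xi i) ^+ 2].
have hE : has_sup E.
  by split; [exists (\sum_(i < 0) rnorm (xi i) ^+ 2); exists 0%N | exists M => _ [n ->]].
have [_ [N ->] hN] := sup_adherent e0 hE.
exists N => m n Nm.
have [nm|mn] := leqP n m; first by rewrite big_geq.
have h : \sum_(i < n) rnorm (xi i) ^+ 2 <= sup E.
  by apply: ub_le_sup; [case: hE | exists n].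
move: h hN; rewrite -!(big_mkord xpredT (fun i => rnorm (xi i) ^+ 2)).
rewrite (big_cat_nat (leq0n m) (ltnW mn)) /=.
rewrite (big_cat_nat (leq0n N) Nm) /=.
have : 0 <= \sum_(N <= i < m) rnorm (xi i) ^+ 2 by apply: sumr_ge0 => i _; exact: sqr_ge0.
lra.
Qed.

Lemma ip_bop_le H K (T : bop H K) (c : R) : 0 <= c ->
  (forall x, rnorm (T x) <= c * rnorm x) -> forall x y,
  cmod (ip (T x) y) <= c / 2 * (rnorm x ^+ 2 + rnorm y ^+ 2).
Proof.
move=> c0 hT x y; apply: le_trans (ip_CS _ _) _.
apply: le_trans (ler_wpM2r (rnorm_ge0 _) (hT x)) _.
have := mulr_ge0 c0 (sqr_ge0 (rnorm x - rnorm y)); lra.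
Qed.

Definition nsum H K (xi : nat -> H) (eta : nat -> K) (T : bop H K) n : R[i] :=
  \sum_(i < n) ip (T (xi i)) (eta i).

Definition nlim H K (xi : nat -> H) (eta : nat -> K) (T : bop H K) : R[i] :=
  limn (series (fun n => ip (T (xi n)) (eta n)) : nat -> R[i]^o).

Lemma nsum_tail H K (xi : nat -> H) (eta : nat -> K) (T : bop H K) (c : R) m n : 0 <= c ->
  (forall x, rnorm (T x) <= c * rnorm x) -> (m <= n)%N ->
  cmod (nsum xi eta T n - nsum xi eta T m) <= c / 2 *
    (\sum_(m <= i < n) rnorm (xi i) ^+ 2 + \sum_(m <= i < n) rnorm (eta i) ^+ 2).
Proof.
move=> c0 hT mn; rewrite /nsum -!(big_mkord xpredT (fun i => ip (T (xi i)) (eta i))).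
rewrite (big_cat_nat (leq0n m) mn) /= addrAC subrr add0r.
apply: le_trans (cmod_sum _ _ _) _; rewrite -big_split mulr_sumr.
by apply: ler_sum => i _; exact: ip_bop_le.
Qed.

Lemma nlim_lim H K (xi : nat -> H) (eta : nat -> K) (T : bop H K) (l : R[i]) :
  (forall e : R, 0 < e -> exists N, forall n, (N <= n)%N -> cmod (nsum xi eta T n - l) < e) ->
  nlim xi eta T = l.
Proof.
move=> h; apply: (@cvg_lim _ (@norm_hausdorff R[i] R[i]^o)).
apply/cvgrPdist_lt => e e0.
have e0' : 0 < complex.Re e by move: e0; rewrite ltcE => /andP[].
have eE : (complex.Re e)%:C = e by apply: RRe_real; rewrite realE ltW.
have [N hN] := h _ e0'; exists N => // n /hN; rewrite /= -cmodE -eE ltcR -cmodN opprB.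
by rewrite /nsum /series /= big_mkord.
Qed.

Lemma nlim_cvg H K (xi : nat -> H) (eta : nat -> K) (T : bop H K) (M M' : R) :
  sq_bounded xi M -> sq_bounded eta M' ->
  forall e : R, 0 < e -> exists N, forall n, (N <= n)%N ->
    cmod (nsum xi eta T n - nlim xi eta T) < e.
Proof.
move=> hM hM'; have [c c0 hT] := bop_bound T.
suff [l hl] : exists l, forall e : R, 0 < e -> exists N, forall n, (N <= n)%N ->
    cmod (nsum xi eta T n - l) < e by rewrite (nlim_lim hl).
apply: complex_complete => e e0.
have c1 : 0 < c + 1 by lra.
have d0 : 0 < e / (c + 1) by rewrite divr_gt0.
have [N1 h1] := sq_tail hM d0; have [N2 h2] := sq_tail hM' d0.
have key m n : (maxn N1 N2 <= m)%N -> (m <= n)%N ->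
    cmod (nsum xi eta T n - nsum xi eta T m) < e.
  rewrite geq_max => /andP[m1 m2] mn.
  have k1 := h1 m n m1; have k2 := h2 m n m2.
  rewrite ltr_pdivlMr // in k1; rewrite ltr_pdivlMr // in k2.
  apply: le_lt_trans (nsum_tail _ _ c0 hT mn) _.
  have : 0 <= \sum_(m <= i < n) rnorm (xi i) ^+ 2 by apply: sumr_ge0 => i _; exact: sqr_ge0.
  have : 0 <= \sum_(m <= i < n) rnorm (eta i) ^+ 2 by apply: sumr_ge0 => i _; exact: sqr_ge0.
  move: k1 k2; move: (\sum_(m <= i < n) _) (\sum_(m <= i < n) _) => a b; nra.
exists (maxn N1 N2) => m n hm hn.
have [mn|/ltnW nm] := leqP m n; last exact: key.
by rewrite -cmodN opprB; exact: key.
Qed.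

Lemma nlim_bound H K (xi : nat -> H) (eta : nat -> K) (T : bop H K) (c M M' : R) :
  sq_bounded xi M -> sq_bounded eta M' -> 0 <= c ->
  (forall x, rnorm (T x) <= c * rnorm x) -> cmod (nlim xi eta T) <= c / 2 * (M + M').
Proof.
move=> hM hM' c0 hT; apply: (@le_eps _ _ _ 1) => // e e0.
have [N hN] := nlim_cvg T hM hM' e0; have {}hN := hN N (leqnn N).
have -> : nlim xi eta T = - (nsum xi eta T N - nlim xi eta T) + nsum xi eta T N.
  by rewrite opprB subrK.
apply: le_trans (cmodD _ _) _; rewrite cmodN mulr1 addrC; apply: lerD (ltW hN).
apply: le_trans (cmod_sum _ _ _) _; apply: le_trans (ler_sum _ (fun i _ => ip_bop_le c0 hT _ _)) _.
rewrite -mulr_sumr big_split /= ler_wpM2l ?divr_ge0 // lerD //; [exact: hM | exact: hM'].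
Qed.

Lemma nlimP H K (xi : nat -> H) (eta : nat -> K) (M M' : R) (a : R[i]) (S T : bop H K) :
  sq_bounded xi M -> sq_bounded eta M' ->
  nlim xi eta (a *: S + T) = a * nlim xi eta S + nlim xi eta T.
Proof.
move=> hM hM'; apply: nlim_lim => e e0.
have a1 : 0 < cmod a + 1 by rewrite ltr_wpDl // cmod_ge0.
have [N1 h1] := nlim_cvg S hM hM' (e := e / 2 / (cmod a + 1)) ltac:(by rewrite !divr_gt0).
have [N2 h2] := nlim_cvg T hM hM' (e := e / 2) ltac:(by rewrite divr_gt0).
exists (maxn N1 N2) => n; rewrite geq_max => /andP[/h1 {}h1 /h2 {}h2].
have -> : nsum xi eta (a *: S + T) n = a * nsum xi eta S n + nsum xi eta T n.
  rewrite /nsum mulr_sumr -big_split; apply: eq_bigr => i _.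
  by rewrite bop_addE bop_scaleE ipDl ipZl.
rewrite opprD addrACA -mulrBr; apply: le_lt_trans (cmodD _ _) _; rewrite cmodM.
rewrite ltr_pdivlMr // in h1; have := cmod_ge0 (nsum xi eta S n - nlim xi eta S); lra.
Qed.

Definition nidx H K (xi : nat -> H) (eta : nat -> K) (M M' : R)
    (hM : sq_bounded xi M) (hM' : sq_bounded eta M') : normal_index H K :=
  exist (fun p : (nat -> H) * (nat -> K) => sqsummable p.1 /\ sqsummable p.2) (xi, eta)
    (conj (proj2 (sqsummableP xi) (ex_intro _ M hM))
          (proj2 (sqsummableP eta) (ex_intro _ M' hM'))).

Lemma nidxE H K (s : normal_index H K) : exists M M',
  sq_bounded (sval s).1 M /\ sq_bounded (sval s).2 M'.
Proof.
have [/sqsummableP[M hM] /sqsummableP[M' hM']] := svalP s; by exists M, M'.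
Qed.

Lemma nlim_continuous H K (xi : nat -> H) (eta : nat -> K) (M M' : R) :
  sq_bounded xi M -> sq_bounded eta M' ->
  continuous (fun T : bop H K => nlim xi eta T : R[i]^o).
Proof.
move=> hM hM'.
have h := @initial_ev_continuous R (bop H K) _ (@normal_functional R H K) (nidx hM hM').
move=> x; exact: (h x).
Qed.

Lemma continuous_bop (X : topologicalType) H K (f : X -> bop H K) :
  (forall xi eta (M M' : R), sq_bounded xi M -> sq_bounded eta M' ->
    continuous (fun x => nlim xi eta (f x) : R[i]^o)) -> continuous f.
Proof.
move=> h x; apply: (cvg_initial (ev := @normal_functional R H K)) => s e e0.
have [M [M' [hM hM']]] := nidxE s.
exact: (continuous_cmod (h _ _ _ _ hM hM') x e0).
Qed.

(** A single vector seen as a square summable sequence makes every vector functional a normal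
    one. *)
Definition seq1 H (x : H) (n : nat) : H := if n is 0%N then x else 0.
Lemma seq1_bounded H (x : H) : sq_bounded (seq1 x) (rnorm x ^+ 2).
Proof.
case=> [|n]; first by rewrite big_ord0 sqr_ge0.
by rewrite big_ord_recl big1 ?addr0 //= => i _; rewrite rnorm0 expr0n.
Qed.
Lemma nlim_seq1 H K (x : H) (y : K) (T : bop H K) : nlim (seq1 x) (seq1 y) T = ip (T x) y.
Proof.
apply: nlim_lim => e e0; exists 1%N => -[//|n] _.
rewrite /nsum big_ord_recl big1 ?addr0 ?subrr ?cmod0 //= => i _.
by rewrite bop0 ip0l.
Qed.
Lemma ip_continuous H K (x : H) (y : K) :
  continuous (fun T : bop H K => ip (T x) y : R[i]^o).
Proof.
have h := nlim_continuous (seq1_bounded x) (seq1_bounded y).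
by move: h; under eq_fun do rewrite nlim_seq1.
Qed.

Lemma sq_bounded_bop H K (A : bop H K) xi (M : R) : sq_bounded xi M ->
  exists M', sq_bounded (fun n => A (xi n)) M'.
Proof.
move=> hM; have [c c0 hA] := bop_bound A; exists (c ^+ 2 * M) => n.
apply: le_trans (ler_wpM2l (sqr_ge0 c) (hM n)); rewrite mulr_sumr; apply: ler_sum => i _.
by rewrite -exprMn ler_pXn2r ?nnegrE ?mulr_ge0 ?rnorm_ge0.
Qed.

Lemma nlim_comp H K H' K' (A : bop K K') (B : bop H' H) xi eta (T : bop H K) :
  nlim xi eta (bop_comp A (bop_comp T B)) =
  nlim (fun n => B (xi n)) (fun n => adj A (eta n)) T.
Proof.
rewrite /nlim; have -> // : (fun n => ip (bop_comp A (bop_comp T B) (xi n)) (eta n)) =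
  (fun n => ip (T (B (xi n))) (adj A (eta n))).
by apply/funext => n; rewrite /= adjP.
Qed.

Lemma continuous_comp2 (X : topologicalType) H K H' K' (A : bop K K') (B : bop H' H)
  (f : X -> bop H K) : continuous f ->
  continuous (fun x => bop_comp A (bop_comp (f x) B) : bop H' K').
Proof.
move=> cf; apply: continuous_bop => xi eta M M' hM hM'.
have [M1 h1] := sq_bounded_bop B hM; have [M2 h2] := sq_bounded_bop (adj A) hM'.
under eq_fun do rewrite nlim_comp.
by move=> x; apply: continuous_comp (cf x) _; exact: nlim_continuous h1 h2 _.
Qed.

Lemma continuous_bopD (X : topologicalType) H K (f g : X -> bop H K) (a : R[i]) :
  continuous f -> continuous g -> continuous (fun x => a *: f x + g x : bop H K).
Proof.
move=> cf cg; apply: continuous_bop => xi eta M M' hM hM'.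
under eq_fun do rewrite (nlimP _ _ _ hM hM').
apply: continuousZD => x.
  by apply: continuous_comp (cf x) _; exact: nlim_continuous hM hM' _.
by apply: continuous_comp (cg x) _; exact: nlim_continuous hM hM' _.
Qed.

Lemma closed_eq_fun (X : topologicalType) (f g : X -> R[i]^o) (A : set X) :
  continuous f -> continuous g -> (forall x, A x -> f x = g x) ->
  forall x, closure A x -> f x = g x.
Proof.
move=> cf cg h x Ax; apply/eqP; rewrite -subr_eq0; apply/eqP/cmod0_eq0/le_anti.
rewrite cmod_ge0 andbT; apply: (@le_eps _ _ _ 2) => // e e0.
have [y [Ay [/= h1 h2]]] := Ax _ (filterI (continuous_cmod cf x e0) (continuous_cmod cg x e0)).
have -> : f x - g x = - (f y - f x) + (g y - g x) by rewrite (h y Ay) opprB addrA subrK.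
by apply: le_trans (cmodD _ _) _; rewrite cmodN; lra.
Qed.

(** On norm bounded sets the weak operator topology already gives the w*-topology: the tails of the
    series are small uniformly in the operator, so finitely many vector functionals decide. *)
Lemma wot_closure H K (S : set (bop H K)) (T : bop H K) (c : R) : 0 <= c ->
  (forall x, rnorm (T x) <= c * rnorm x) ->
  (forall (l : seq (H * K)) (e : R), 0 < e -> exists2 T', S T' &
    (forall x, rnorm (T' x) <= c * rnorm x) /\
    forall p, List.In p l -> cmod (ip (T' p.1) p.2 - ip (T p.1) p.2) < e) ->
  closure S T.
Proof.
move=> c0 hT h; apply: (closure_initial (ev := @normal_functional R H K)) => l e e0.
pose d := e / 8 / (c + 1).
have c1 : 0 < c + 1 by lra.
have d0 : 0 < d by rewrite !divr_gt0.
(* One cut for all functionals in [l]. Tails below [d] contribute at most [e / 8] for every operator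
   bounded by [c]. *)
have [N hN] : exists N, forall s, List.In s l -> forall n, (N <= n)%N ->
   \sum_(N <= i < n) rnorm ((sval s).1 i) ^+ 2 < d /\
   \sum_(N <= i < n) rnorm ((sval s).2 i) ^+ 2 < d.
  elim: l => [|s l [N IH]]; first by exists 0%N.
  have [M [M' [hM hM']]] := nidxE s.
  have [N1 h1] := sq_tail hM d0; have [N2 h2] := sq_tail hM' d0.
  exists (maxn N (maxn N1 N2)) => t [<-|tl] n hn.
    split; [apply: h1 | apply: h2]; by rewrite !leq_max leqnn !orbT.
  have cut (L : hilbertType R) (u : nat -> L) : \sum_(N <= i < n) rnorm (u i) ^+ 2 < d ->
      \sum_(maxn N (maxn N1 N2) <= i < n) rnorm (u i) ^+ 2 < d.
    apply: le_lt_trans; rewrite (big_cat_nat (leq_maxl N (maxn N1 N2)) hn) /=.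
    by rewrite lerDr; apply: sumr_ge0 => i _; exact: sqr_ge0.
  have [|k1 k2] := IH _ tl n; first by rewrite (leq_trans _ hn) // leq_maxl.
  by split; exact: cut.
pose pts := flatten [seq [seq ((sval s).1 i, (sval s).2 i) | i <- iota 0 N] | s <- l].
have [T' ST' [bT' hT']] := h pts (e / 4 / N.+1%:R) ltac:(by rewrite !divr_gt0 ?ltr0n).
exists T' => // s sl; have [M [M' [hM hM']]] := nidxE s.
set xi := (sval s).1 in hM *; set eta := (sval s).2 in hM' *.
have hin i : (i < N)%N -> List.In (xi i, eta i) pts.
  move=> iN; rewrite /pts; elim: (l) sl => //= s' l' IH [->|/IH hl'].
    apply/List.in_or_app; left; apply: List.in_map.
    have : i \in iota 0 N by rewrite mem_iota.
    by elim: (iota 0 N) => //= j r IHr; rewrite inE => /orP[/eqP ->|/IHr]; [left|right].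
  by apply/List.in_or_app; right.
have fin : cmod (nsum xi eta T' N - nsum xi eta T N) <= e / 4.
  rewrite /nsum -sumrB; apply: le_trans (cmod_sum _ _ _) _.
  apply: (@le_trans _ _ (\sum_(i < N) e / 4 / N.+1%:R)).
    by apply: ler_sum => i _; apply/ltW/(hT' (_, _))/hin.
  rewrite sumr_const card_ord -[_ *+ N]mulr_natr.
  have h4 : 0 <= e / 4 by rewrite divr_ge0 // ltW.
  have h5 : (N%:R : R) / N.+1%:R <= 1 by rewrite ler_pdivrMr ?ltr0n // mul1r ler_nat.
  by rewrite mulrAC -mulrA ler_piMr.
have tl (U : bop H K) : (forall x, rnorm (U x) <= c * rnorm x) ->
    cmod (nsum xi eta U N - nlim xi eta U) <= e / 4.
  move=> bU; have [N' hN'] := nlim_cvg U hM hM' (e := e / 8) ltac:(by rewrite divr_gt0).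
  pose n := maxn N N'; have h1 := hN' n (leq_maxr _ _).
  have h2 := nsum_tail xi eta c0 bU (leq_maxl N N').
  have [k1 k2] := hN _ sl n (leq_maxl _ _).
  have -> : nsum xi eta U N - nlim xi eta U =
    - (nsum xi eta U n - nsum xi eta U N) + (nsum xi eta U n - nlim xi eta U).
    by rewrite opprB addrA subrK.
  apply: le_trans (cmodD _ _) _; rewrite cmodN.
  apply: (@le_trans _ _ (e / 8 + e / 8)); last lra.
  apply: lerD (ltW h1); apply: le_trans h2 _.
  rewrite /d ltr_pdivlMr // in k1; rewrite /d ltr_pdivlMr // in k2.
  have : 0 <= \sum_(N <= i < n) rnorm (xi i) ^+ 2 by apply: sumr_ge0 => i _; exact: sqr_ge0.
  have : 0 <= \sum_(N <= i < n) rnorm (eta i) ^+ 2 by apply: sumr_ge0 => i _; exact: sqr_ge0.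
  move: k1 k2; rewrite -/xi -/eta -/n; move: (\sum_(N <= i < n) _) (\sum_(N <= i < n) _) => a b; nra.
rewrite -[normal_functional T' s]/(nlim xi eta T') -[normal_functional T s]/(nlim xi eta T).
have -> : nlim xi eta T' - nlim xi eta T = - (nsum xi eta T' N - nlim xi eta T') +
   ((nsum xi eta T' N - nsum xi eta T N) + (nsum xi eta T N - nlim xi eta T)).
  by rewrite opprB !addrA !subrK.
apply: le_lt_trans (cmodD _ _) _; rewrite cmodN.
have := cmodD (nsum xi eta T' N - nsum xi eta T N) (nsum xi eta T N - nlim xi eta T).
have := tl T hT; have := tl T' bT'; lra.
Qed.

End NormalFunctionals.

(** * Finite sums and norms of operator matrices *)

Section FiniteSums.
Variables (R : realType).

Lemma quad_disc (A B x : R) : 0 <= A -> 0 <= B ->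
  (forall t : R, 0 <= A - 2 * t * x + t ^+ 2 * B) -> x ^+ 2 <= A * B.
Proof.
move=> A0 B0 h; have [BE|Bn] := eqVneq B 0.
  have [->|xn] := eqVneq x 0; first by rewrite expr0n /= mulr_ge0.
  have := h ((A + 1) / (2 * x)); rewrite BE.
  have -> : A - 2 * ((A + 1) / (2 * x)) * x + ((A + 1) / (2 * x)) ^+ 2 * 0 = - 1.
    by field; rewrite xn.
  by rewrite oppr_ge0 ler10.
have Bp : 0 < B by rewrite lt_neqAle eq_sym Bn.
have := h (x / B).
have -> : A - 2 * (x / B) * x + (x / B) ^+ 2 * B = A - x ^+ 2 / B by field.
by rewrite subr_ge0 ler_pdivrMr.
Qed.

Variables (H : hilbertType R).

Lemma sum_rip_CS (I : Type) (r : seq I) (a b : I -> H) :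
  (\sum_(i <- r) rip (a i) (b i)) ^+ 2 <=
  (\sum_(i <- r) rnorm (a i) ^+ 2) * (\sum_(i <- r) rnorm (b i) ^+ 2).
Proof.
apply: quad_disc => [||t]; try by apply: sumr_ge0 => i _; exact: sqr_ge0.
have -> : \sum_(i <- r) rnorm (a i) ^+ 2 - 2 * t * (\sum_(i <- r) rip (a i) (b i)) +
   t ^+ 2 * (\sum_(i <- r) rnorm (b i) ^+ 2) =
   \sum_(i <- r) rnorm (a i - t%:C *: b i) ^+ 2.
  rewrite !mulr_sumr -sumrB -big_split; apply: eq_bigr => i _ /=.
  rewrite rnormB_sqr rnormZ cmodR exprMn real_normK ?num_real // ripZr; ring.
by apply: sumr_ge0 => i _; exact: sqr_ge0.
Qed.

Lemma rnorm_sum_sq n (v : 'I_n -> H) :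
  rnorm (\sum_i v i) ^+ 2 <= n%:R * \sum_i rnorm (v i) ^+ 2.
Proof.
rewrite -rip_norm rip_suml.
apply: (@le_trans _ _ (\sum_i \sum_j (rnorm (v i) ^+ 2 + rnorm (v j) ^+ 2) / 2)).
  apply: ler_sum => i _; rewrite rip_sumr; apply: ler_sum => j _.
  have := sqr_ge0 (rnorm (v i) - rnorm (v j)); have := rip_CS (v i) (v j); lra.
have -> : \sum_(i < n) \sum_(j < n) (rnorm (v i) ^+ 2 + rnorm (v j) ^+ 2) / 2 =
    n%:R * \sum_i rnorm (v i) ^+ 2; last by [].
set S := \sum_i rnorm (v i) ^+ 2.
transitivity (\sum_(i < n) (n%:R * rnorm (v i) ^+ 2 + S) / 2).
  apply: eq_bigr => i _; rewrite -mulr_suml big_split /= sumr_const card_ord.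
  by rewrite -[_ *+ n]mulr_natl.
rewrite -mulr_suml big_split /= sumr_const card_ord -mulr_sumr -/S -[_ *+ n]mulr_natl; lra.
Qed.
End FiniteSums.

Section L2OpNorm.
Variables (R : realType) (U W : normedModType R[i]) (I : finType) (a : I -> I -> U -> W).

Lemma l2op_le (c : R) : 0 <= c -> (forall xi : I -> U,
   \sum_i rnorm (\sum_j a i j (xi j)) ^+ 2 <= c ^+ 2 * \sum_j rnorm (xi j) ^+ 2) ->
  (forall i j, a i j 0 = 0) -> l2opnorm a <= c.
Proof.
move=> c0 h a0; apply: ge_sup.
  exists (Num.sqrt (\sum_i rnorm (\sum_j a i j 0) ^+ 2)); exists (fun _ => 0) => //=.
  by rewrite big1 // => i _; rewrite /rnorm normr0 expr0n.
move=> _ [xi /= hxi <-]; rewrite -[c]ger0_norm // -sqrtr_sqr.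
rewrite ler_psqrt ?nnegrE ?sqr_ge0 ?sumr_ge0 // => [|i _]; last exact: sqr_ge0.
by apply: le_trans (h xi) _; rewrite ler_piMr // sqr_ge0.
Qed.

(** Some bound [C] must be known beforehand, because [sup] of an unbounded set is a default value;
    the rest is homogeneity. *)
Lemma l2op_ub (C : R) : (forall i j (t : R) x, a i j (t%:C *: x) = t%:C *: a i j x) ->
  (forall xi : I -> U,
   \sum_i rnorm (\sum_j a i j (xi j)) ^+ 2 <= C * \sum_j rnorm (xi j) ^+ 2) ->
  forall xi : I -> U,
   \sum_i rnorm (\sum_j a i j (xi j)) ^+ 2 <= l2opnorm a ^+ 2 * \sum_j rnorm (xi j) ^+ 2.
Proof.
move=> hom hC xi.
have nZ (V : normedModType R[i]) (t : R) (x : V) : rnorm (t%:C *: x) ^+ 2 = t ^+ 2 * rnorm x ^+ 2.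
  rewrite /rnorm normrZ; have -> : `|t%:C| = (`|t|)%:C :> R[i].
    by rewrite -cmodE cmodR.
  by rewrite ReM exprMn real_normK // num_real.
set Xi := \sum_j rnorm (xi j) ^+ 2.
have Xi0 : 0 <= Xi by apply: sumr_ge0 => i _; exact: sqr_ge0.
have S0 : 0 <= \sum_i rnorm (\sum_j a i j (xi j)) ^+ 2.
  by apply: sumr_ge0 => i _; exact: sqr_ge0.
have [XE|Xn] := eqVneq Xi 0.
  by have := hC xi; rewrite -/Xi XE !mulr0.
have Xp : 0 < Xi by rewrite lt_neqAle eq_sym Xn.
pose t := (Num.sqrt Xi)^-1.
have t2 : t ^+ 2 = Xi^-1 by rewrite exprVn sqr_sqrtr.
have sc : \sum_i rnorm (\sum_j a i j (t%:C *: xi j)) ^+ 2 =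
    t ^+ 2 * \sum_i rnorm (\sum_j a i j (xi j)) ^+ 2.
  rewrite mulr_sumr; apply: eq_bigr => i _.
  by under eq_bigr do rewrite hom; rewrite -scaler_sumr nZ.
have ub : Num.sqrt (\sum_i rnorm (\sum_j a i j (t%:C *: xi j)) ^+ 2) <= l2opnorm a.
  apply: ub_le_sup; last first.
    exists (fun j => t%:C *: xi j) => //=.
    by under eq_bigr do rewrite nZ; rewrite -mulr_sumr t2 mulVf.
  exists (Num.sqrt `|C|) => _ [eta /= heta <-].
  rewrite ler_psqrt ?nnegrE ?sumr_ge0 // => [|i _]; last exact: sqr_ge0.
  apply: le_trans (hC eta) _; apply: le_trans (ler_norm _) _; rewrite normrM.
  rewrite ler_piMr // ger0_norm //; apply: sumr_ge0 => i _; exact: sqr_ge0.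
have l0 : 0 <= l2opnorm a by apply: le_trans ub; exact: sqrtr_ge0.
have ub2 : Xi^-1 * \sum_i rnorm (\sum_j a i j (xi j)) ^+ 2 <= l2opnorm a ^+ 2.
  rewrite -t2 -sc; have s0 := le_trans (sqrtr_ge0 _) ub.
  have p0 : 0 <= \sum_i rnorm (\sum_j a i j (t%:C *: xi j)) ^+ 2.
    by apply: sumr_ge0 => i _; exact: sqr_ge0.
  by rewrite -(sqr_sqrtr p0) ler_pXn2r ?nnegrE ?sqrtr_ge0.
by rewrite mulrC ler_pdivrMr // in ub2.
Qed.
End L2OpNorm.

Section OperatorMatrices.
Variable R : realType.
Implicit Types H K : hilbertType R.

(** The norm inequality in squared form. It covers rectangular matrices, while [mxnorm] exists for
    square ones. *)
Definition mat_le H K m n (c : R) (A : 'I_m -> 'I_n -> H -> K) : Prop :=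
  forall xi : 'I_n -> H,
    \sum_i rnorm (\sum_j A i j (xi j)) ^+ 2 <= c * \sum_j rnorm (xi j) ^+ 2.

Lemma bop_mat_bound H K m n (A : 'I_m -> 'I_n -> bop H K) :
  exists2 c : R, 0 <= c & mat_le c (fun i j => A i j : H -> K).
Proof.
have [c hc] : {c : 'I_m -> 'I_n -> R | forall i j, 0 <= c i j /\
    forall x, rnorm (A i j x) <= c i j * rnorm x}.
  suff h i j : {c : R | 0 <= c /\ forall x, rnorm (A i j x) <= c * rnorm x}.
    by exists (fun i j => sval (h i j)) => i j; exact: (svalP (h i j)).
  by apply: cid; have [c] := bop_bound (A i j); exists c.
pose d := \sum_i \sum_j c i j.
have d0 : 0 <= d by apply: sumr_ge0 => i _; apply: sumr_ge0 => j _; case: (hc i j).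
have cd i j : c i j <= d.
  rewrite /d (bigD1 i) //= (bigD1 j) //= -!addrA lerDl addr_ge0 //.
    by apply: sumr_ge0 => j' _; case: (hc i j').
  by apply: sumr_ge0 => i' _; apply: sumr_ge0 => j' _; case: (hc i' j').
exists (m%:R * (n%:R * d ^+ 2)) => [|xi]; first by rewrite !mulr_ge0 // sqr_ge0.
have -> : m%:R * (n%:R * d ^+ 2) * (\sum_j rnorm (xi j) ^+ 2) =
   \sum_(i < m) n%:R * (\sum_j (d * rnorm (xi j)) ^+ 2).
  have e : \sum_j (d * rnorm (xi j)) ^+ 2 = d ^+ 2 * \sum_j rnorm (xi j) ^+ 2.
    by rewrite mulr_sumr; apply: eq_bigr => j _; rewrite exprMn.
  by rewrite sumr_const card_ord e -[RHS]mulr_natl !mulrA.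
apply: ler_sum => i _; apply: le_trans (rnorm_sum_sq _) _.
rewrite ler_wpM2l //; apply: ler_sum => j _.
rewrite ler_pXn2r ?nnegrE ?mulr_ge0 ?rnorm_ge0 //.
by apply: le_trans ((hc i j).2 _) _; rewrite ler_wpM2r ?rnorm_ge0.
Qed.

Lemma mxnorm_bop_ge0 H K n (A : 'M[bop H K]_n) : 0 <= mxnorm A.
Proof.
have [c c0 hc] := bop_mat_bound A.
apply: le_trans (_ : Num.sqrt (\sum_i rnorm (\sum_j A i j 0) ^+ 2) <= _).
  exact: sqrtr_ge0.
apply: ub_le_sup; last by exists (fun _ => 0) => //=; rewrite big1 // => i _; rewrite rnorm0 expr0n.
exists (Num.sqrt c) => _ [eta /= heta <-].
rewrite ler_psqrt ?nnegrE ?sumr_ge0 // => [|i _]; last exact: sqr_ge0.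
by apply: le_trans (hc eta) _; rewrite ler_piMr.
Qed.

Lemma mxnorm_bop_ub H K n (A : 'M[bop H K]_n) :
  mat_le (mxnorm A ^+ 2) (fun i j => A i j : H -> K).
Proof.
have [c c0 hc] := bop_mat_bound A.
by apply: l2op_ub hc => i j t x; rewrite bopZ.
Qed.

Lemma mxnorm_bop_le H K n (A : 'M[bop H K]_n) (c : R) : 0 <= c ->
  mat_le (c ^+ 2) (fun i j => A i j : H -> K) -> mxnorm A <= c.
Proof. by move=> c0 h; apply: l2op_le => // i j; rewrite bop0. Qed.

Lemma mxnorm1_bop_ub H K (T : bop H K) x : rnorm (T x) <= mxnorm1 T * rnorm x.
Proof.
have := mxnorm_bop_ub (const_mx T : 'M[bop H K]_1) (fun _ => x).
rewrite !big_ord1 mxE -/(mxnorm1 T) -exprMn ler_pXn2r ?nnegrE ?mulr_ge0 ?rnorm_ge0 //.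
exact: mxnorm_bop_ge0.
Qed.
Lemma mxnorm1_bop_le H K (T : bop H K) (c : R) : 0 <= c ->
  (forall x, rnorm (T x) <= c * rnorm x) -> mxnorm1 T <= c.
Proof.
move=> c0 h; apply: mxnorm_bop_le => // xi; rewrite !big_ord1 mxE -exprMn.
by rewrite ler_pXn2r ?nnegrE ?mulr_ge0 ?rnorm_ge0.
Qed.
Lemma mxnorm1_bop_ge0 H K (T : bop H K) : 0 <= mxnorm1 T.
Proof. exact: mxnorm_bop_ge0. Qed.

Lemma isometry_mxnorm1 (X Y : mxNormedType R) (phi : X -> Y) x :
  complete_isometry phi -> mxnorm1 (phi x) = mxnorm1 x.
Proof. by move=> [_ h]; rewrite /mxnorm1 -h map_const_mx. Qed.

(* The adjoint matrix; one application of Cauchy-Schwarz. *)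
Lemma mat_le_adj H K m n (c : R) (A : 'I_m -> 'I_n -> bop H K) : 0 <= c ->
  mat_le c (fun i j => A i j : H -> K) ->
  mat_le c (fun j i => adj (A i j) : K -> H).
Proof.
move=> c0 h eta; set S := \sum_j _; set E := \sum_i _.
have S0 : 0 <= S by apply: sumr_ge0 => i _; exact: sqr_ge0.
have E0 : 0 <= E by apply: sumr_ge0 => i _; exact: sqr_ge0.
pose xi j := \sum_i adj (A i j) (eta i).
have SE : S = \sum_i rip (\sum_j A i j (xi j)) (eta i).
  under eq_bigr do rewrite rip_suml.
  rewrite exchange_big; apply: eq_bigr => j _ /=; rewrite -rip_norm {1}/rip.
  rewrite ip_sumr Re_sum; apply: eq_bigr => i _.
  by rewrite /rip adjP.
have := sum_rip_CS (index_enum 'I_m) (fun i => \sum_j A i j (xi j)) eta.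
rewrite -SE -/E => hS.
have h2 : S ^+ 2 <= c * S * E by apply: le_trans hS _; rewrite ler_wpM2r //; exact: h.
have [->|Sn] := eqVneq S 0; first exact: mulr_ge0.
have Sp : 0 < S by rewrite lt_neqAle eq_sym Sn.
by rewrite -(ler_pM2l Sp) -expr2; apply: le_trans h2 _; rewrite mulrAC mulrC.
Qed.

End OperatorMatrices.

(** * The norm of a dual operator space and its predual *)

Section DualNorm.
Variables (R : realType) (V : mxNormedType R) (H : hilbertType R) (u : V -> bop H H).
Hypothesis ci_u : complete_isometry u.

Let uL a x y : u (a *: x + y) = a *: u x + u y.
Proof. exact: ci_u.1. Qed.
Let u0 : u 0 = 0.
Proof. by have := uL (-1) 0 0; rewrite scaler0 addr0 scaleN1r addNr. Qed.
Let uD x y : u (x + y) = u x + u y.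
Proof. by have := uL 1 x y; rewrite !scale1r. Qed.
Let uZ a x : u (a *: x) = a *: u x.
Proof. by have := uL a x 0; rewrite !addr0 u0 addr0. Qed.
Let nE v : mxnorm1 v = mxnorm1 (u v).
Proof. by rewrite (isometry_mxnorm1 v ci_u). Qed.

Lemma dualP (F : dual V) : linear F /\ exists2 c : R, 0 <= c & forall v, cmod (F v) <= c * mxnorm1 v.
Proof.
have /asboolP[lF [c hc]] := dual_funP F; split=> //; exists `|c| => // v.
by apply: le_trans (hc v) _; rewrite ler_wpM2r ?ler_norm // nE mxnorm1_bop_ge0.
Qed.
Lemma dual0 (F : dual V) : F 0 = 0.
Proof. by have := (dualP F).1 (-1) 0 0; rewrite scaler0 addr0 scaleN1r addNr. Qed.
Lemma dualD (F : dual V) x y : F (x + y) = F x + F y.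
Proof. by have := (dualP F).1 1 x y; rewrite !scale1r. Qed.
Lemma dualZ (F : dual V) a x : F (a *: x) = a * F x.
Proof. by have := (dualP F).1 a x 0; rewrite !addr0 dual0 addr0. Qed.
Lemma dual_sum (F : dual V) I (r : seq I) (f : I -> V) :
  F (\sum_(i <- r) f i) = \sum_(i <- r) F (f i).
Proof. by apply: (big_morph F) => [x y|]; rewrite ?dualD ?dual0. Qed.
Let u_sum I (r : seq I) (f : I -> V) : u (\sum_(i <- r) f i) = \sum_(i <- r) u (f i).
Proof. by apply: (big_morph u) => [x y|]; rewrite ?uD ?u0. Qed.

Lemma mxnorm1Z (t : R) (v : V) : 0 <= t -> mxnorm1 (t%:C *: v) <= t * mxnorm1 v.
Proof.
move=> t0; rewrite !nE; apply: mxnorm1_bop_le => [|x].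
  by rewrite mulr_ge0 // mxnorm1_bop_ge0.
rewrite uZ bop_scaleE rnormZ cmodR ger0_norm // -mulrA ler_wpM2l //.
exact: mxnorm1_bop_ub.
Qed.

Lemma sum_pair1 m (f : 'I_1 * 'I_m -> R) : \sum_s f s = \sum_k f (ord0, k).
Proof.
transitivity (\sum_(i < 1) \sum_k f (i, k)); last by rewrite big_ord1.
by rewrite pair_bigA /=; apply: eq_bigr => -[].
Qed.
Lemma csum_pair1 m (f : 'I_1 * 'I_m -> R[i]) : \sum_s f s = \sum_k f (ord0, k).
Proof.
transitivity (\sum_(i < 1) \sum_k f (i, k)); last by rewrite big_ord1.
by rewrite pair_bigA /=; apply: eq_bigr => -[].
Qed.

(* For a scalar functional the norm and the completely bounded norm agree:
   [|w|^2 = F (w* A z)] with [w] the image vector. *)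
Lemma dual_cb (F : dual V) (c : R) m (A : 'M[V]_m) (z : 'I_m -> R[i]) : 0 <= c ->
  (forall v, cmod (F v) <= c * mxnorm1 v) -> mxnorm A <= 1 ->
  \sum_k cmod (\sum_l F (A k l) * z l) ^+ 2 <= c ^+ 2 * \sum_l cmod (z l) ^+ 2.
Proof.
move=> c0 hc hA; pose w k := \sum_l F (A k l) * z l.
set W := \sum_k _; set Z := \sum_l _.
have W0 : 0 <= W by apply: sumr_ge0 => k _; exact: sqr_ge0.
have Z0 : 0 <= Z by apply: sumr_ge0 => k _; exact: sqr_ge0.
pose v := \sum_k \sum_l (conjc (w k) * z l) *: A k l.
have Fv : F v = W%:C.
  rewrite /v dual_sum /W rmorph_sum; apply: eq_bigr => k _ /=.
  rewrite dual_sum cmod_sqr mulrC mulr_sumr; apply: eq_bigr => l _.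
  by rewrite dualZ mulrAC mulrA.
have nv : mxnorm1 v <= Num.sqrt W * Num.sqrt Z.
  rewrite nE; apply: mxnorm1_bop_le => [|x]; first by rewrite mulr_ge0 ?sqrtr_ge0.
  set y := u v x.
  have yE : rnorm y ^+ 2 = \sum_k rip (\sum_l u (A k l) (z l *: x)) (w k *: y).
    rewrite -rip_norm {1}/y /v u_sum bop_sumE rip_suml; apply: eq_bigr => k _.
    rewrite u_sum bop_sumE !rip_suml; apply: eq_bigr => l _.
    by rewrite uZ bop_scaleE bopZ /rip !ipZl ipZr; congr complex.Re; ring.
  have := sum_rip_CS (index_enum 'I_m) (fun k => \sum_l u (A k l) (z l *: x)) (fun k => w k *: y).
  rewrite -yE.
  have h1 : \sum_k rnorm (\sum_l u (A k l) (z l *: x)) ^+ 2 <= Z * rnorm x ^+ 2.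
    have := mxnorm_bop_ub (map_mx u A) (fun l => z l *: x); rewrite ci_u.2.
    under eq_bigr do under eq_bigr do rewrite mxE.
    move=> /le_trans; apply; rewrite -[X in _ <= X]mul1r /Z mulr_suml.
    under eq_bigr do rewrite rnormZ exprMn.
    apply: ler_wpM2r; first by apply: sumr_ge0 => l _; rewrite mulr_ge0 // sqr_ge0.
    have A0 : 0 <= mxnorm A by rewrite -ci_u.2 mxnorm_bop_ge0.
    by rewrite -[1](expr1n _ 2) ler_pXn2r ?nnegrE.
  have h2 : \sum_k rnorm (w k *: y) ^+ 2 = W * rnorm y ^+ 2.
    by rewrite /W mulr_suml; apply: eq_bigr => k _; rewrite rnormZ exprMn.
  rewrite h2 => h3.
  have h4 : (rnorm y ^+ 2) ^+ 2 <= Z * rnorm x ^+ 2 * (W * rnorm y ^+ 2).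
    by apply: le_trans h3 _; rewrite ler_wpM2r // mulr_ge0 // sqr_ge0.
  have [->|yn] := eqVneq (rnorm y) 0.
    by rewrite !mulr_ge0 ?sqrtr_ge0 ?rnorm_ge0.
  have yp : 0 < rnorm y ^+ 2 by rewrite exprn_gt0 // lt_neqAle eq_sym yn rnorm_ge0.
  apply: sqrt_le_sqr; first by rewrite !mulr_ge0 ?sqrtr_ge0 ?rnorm_ge0.
  rewrite !exprMn !sqr_sqrtr // -(ler_pM2r yp) -expr2; apply: le_trans h4 _.
  by rewrite le_eqVlt; apply/orP; left; apply/eqP; ring.
have h : W <= c * (Num.sqrt W * Num.sqrt Z).
  have := le_trans (hc v) (ler_wpM2l c0 nv); rewrite Fv cmodR ger0_norm //.
have [->|Wn] := eqVneq W 0; first by rewrite mulr_ge0 // sqr_ge0.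
have Wp : 0 < W by rewrite lt_neqAle eq_sym Wn.
have sW : 0 < Num.sqrt W by rewrite sqrtr_gt0.
have h2 : Num.sqrt W <= c * Num.sqrt Z.
  by rewrite -(ler_pM2l sW) -expr2 sqr_sqrtr // mulrCA.
rewrite -(sqr_sqrtr W0) -(sqr_sqrtr Z0) -exprMn ler_pXn2r ?nnegrE ?sqrtr_ge0 //.
by rewrite mulr_ge0 ?sqrtr_ge0.
Qed.

Let dset (F : dual V) : set R := [set r | exists m (A : 'M[V]_m), mxnorm A <= 1 /\
    r = l2opnorm (fun (s t : 'I_1 * 'I_m) (z : R[i]^o) =>
                    (const_mx F : 'M[dual V]_1) s.1 t.1 (A s.2 t.2) * z : R[i]^o)].

Let dset_le (F : dual V) (c : R) : 0 <= c ->
  (forall m (A : 'M[V]_m) (z : 'I_m -> R[i]), mxnorm A <= 1 ->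
    \sum_k cmod (\sum_l F (A k l) * z l) ^+ 2 <= c ^+ 2 * \sum_l cmod (z l) ^+ 2) ->
  ubound (dset F) c.
Proof.
move=> c0 h _ [m [A [hA ->]]]; apply: l2op_le => // [xi|i j]; last by rewrite mulr0.
rewrite !sum_pair1 /=; apply: le_trans (h m A (fun l => xi (ord0, l)) hA).
rewrite le_eqVlt; apply/orP; left; apply/eqP; apply: eq_bigr => k _.
congr (_ ^+ 2); rewrite -[LHS]/(cmod _); congr cmod; rewrite csum_pair1.
by apply: eq_bigr => l _; rewrite mxE.
Qed.

(** After normalising [v], read off the [1 x 1] matrix in the supremum; [dual_cb] provides the upper
    bound that makes the supremum meaningful. *)
Lemma dual_eval_le (F : dual V) v : cmod (F v) <= mxnorm1 F * mxnorm1 v.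
Proof.
have [_ [c c0 hc]] := dualP F.
have n0 : 0 <= mxnorm1 v by rewrite nE mxnorm1_bop_ge0.
have [nv|nv] := eqVneq (mxnorm1 v) 0.
  by apply: le_trans (hc v) _; rewrite nv !mulr0.
have np : 0 < mxnorm1 v by rewrite lt_neqAle eq_sym nv.
have ubd : ubound (dset F) c by apply: dset_le => // m A z; exact: dual_cb.
pose v' := (mxnorm1 v)^-1%:C *: v.
have nv' : mxnorm1 v' <= 1.
  by apply: le_trans (mxnorm1Z _ _) _; rewrite ?invr_ge0 // mulVf.
pose op := fun (s t : 'I_1 * 'I_1) (z : R[i]^o) =>
   (const_mx F : 'M[dual V]_1) s.1 t.1 ((const_mx v' : 'M[V]_1) s.2 t.2) * z : R[i]^o.
have h1 : l2opnorm op <= mxnorm1 F.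
  by apply: ub_le_sup; [exists c | exists 1%N, (const_mx v')].
have h2 : cmod (F v') ^+ 2 <= l2opnorm op ^+ 2.
  have := @l2op_ub R R[i]^o R[i]^o _ op (c ^+ 2) _ _ (fun _ => (1 : R[i]) : R[i]^o).
  have r1 : rnorm ((1 : R[i]) : R[i]^o) = 1 by rewrite -[LHS]/(cmod 1) (cmodR 1) normr1.
  rewrite !sum_pair1 !big_ord1 csum_pair1 big_ord1 /op !mxE mulr1 r1 expr1n mulr1; apply.
    by move=> i j t x; rewrite /op mulrCA.
  move=> xi; rewrite !sum_pair1 /=.
  have := @dual_cb F c 1 (const_mx v') (fun l => xi (ord0, l)) c0 hc nv'.
  by rewrite !big_ord1 csum_pair1 big_ord1 /op !mxE.
have h0 : 0 <= l2opnorm op.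
  apply: (@le_trans _ _ (Num.sqrt (\sum_i rnorm (\sum_j op i j 0) ^+ 2))).
    exact: sqrtr_ge0.
  apply: ub_le_sup; last first.
    exists (fun _ => 0) => //=; by rewrite big1 // => i _; rewrite -[rnorm 0]/(cmod 0) cmod0 expr0n.
  exists c => _ [xi /= hxi <-]; rewrite -[c]ger0_norm // -sqrtr_sqr.
  rewrite ler_psqrt ?nnegrE ?sqr_ge0 ?sumr_ge0 // => [|i _]; last exact: sqr_ge0.
  rewrite sum_pair1 big_ord1 csum_pair1 big_ord1 /op !mxE.
  have := @dual_cb F c 1 (const_mx v') (fun l => xi (ord0, l)) c0 hc nv'.
  rewrite !big_ord1 !mxE => /le_trans; apply; rewrite ler_piMr ?sqr_ge0 //.
  by rewrite sum_pair1 big_ord1 in hxi.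
have h3 : cmod (F v') <= mxnorm1 F.
  by apply: le_trans h1; rewrite -(@ler_pXn2r _ 2) ?nnegrE ?cmod_ge0.
move: h3; rewrite /v' dualZ cmodM cmodR ger0_norm ?invr_ge0 //.
by rewrite mulrC ler_pdivrMr.
Qed.

(** The vector functionals of the representation [u] norm [V], and on matrices too each is bounded
    by [rnorm x * rnorm y]. *)
Lemma dual_norming (v : V) (t : R) : 0 <= t ->
  (forall F : dual V, cmod (F v) <= t * mxnorm1 F) -> mxnorm1 v <= t.
Proof.
move=> t0 h; rewrite nE; apply: mxnorm1_bop_le => // x.
have key y : cmod (ip (u v x) y) <= t * (rnorm x * rnorm y).
  have fP : (fun v => ip (u v x) y : R[i]^o) \in @dual_pred R V.
    apply/asboolP; split=> [a v1 v2|]; first by rewrite uL bop_addE bop_scaleE ipDl ipZl.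
    exists (rnorm x * rnorm y) => w; rewrite -[rnorm _]/(cmod _).
    apply: le_trans (ip_CS _ _) _; rewrite mulrAC ler_wpM2r ?rnorm_ge0 // mulrC nE.
    exact: mxnorm1_bop_ub.
  apply: le_trans (h (Dual fP)) _; rewrite ler_wpM2l //.
  apply: ge_sup; first by
    exists (l2opnorm (fun (s t : 'I_1 * 'I_0) (z : R[i]^o) =>
      (const_mx (Dual fP) : 'M[dual V]_1) s.1 t.1 ((const_mx 0 : 'M[V]_0) s.2 t.2) * z : R[i]^o));
    exists 0%N, (const_mx 0); split=> //; rewrite -ci_u.2; apply: mxnorm_bop_le => // xi;
    rewrite !big_ord0 mulr0.
  apply: dset_le => [|m A z hA]; first by rewrite mulr_ge0 ?rnorm_ge0.
  have := mxnorm_bop_ub (map_mx u A) (fun l => z l *: x); rewrite ci_u.2.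
  under eq_bigr do under eq_bigr do rewrite mxE.
  under [X in _ <= _ * X]eq_bigr do rewrite rnormZ exprMn.
  rewrite -mulr_suml => h2.
  apply: (@le_trans _ _ (rnorm y ^+ 2 * \sum_k rnorm (\sum_l u (A k l) (z l *: x)) ^+ 2)).
    rewrite mulr_sumr; apply: ler_sum => k _; rewrite -exprMn.
    rewrite ler_pXn2r ?nnegrE ?cmod_ge0 ?mulr_ge0 ?rnorm_ge0 // mulrC.
    apply: le_trans (ip_CS _ _); rewrite ip_suml /= le_eqVlt; apply/orP; left; apply/eqP.
    by congr cmod; apply: eq_bigr => l _; rewrite bopZ ipZl mulrC.
  have -> : (rnorm x * rnorm y) ^+ 2 * \sum_l cmod (z l) ^+ 2 =
    rnorm y ^+ 2 * ((\sum_l cmod (z l) ^+ 2) * rnorm x ^+ 2) by ring.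
  rewrite ler_wpM2l ?sqr_ge0 //; apply: le_trans h2 _; rewrite ler_piMl //.
    by rewrite mulr_ge0 ?sqr_ge0 // sumr_ge0 // => l _; rewrite sqr_ge0.
  have A0 : 0 <= mxnorm A by rewrite -ci_u.2 mxnorm_bop_ge0.
  by rewrite -[1](expr1n _ 2) ler_pXn2r ?nnegrE.
have := key (u v x); rewrite ip_normC cmodR ger0_norm ?sqr_ge0 // mulrA => h2.
have [->|n0] := eqVneq (rnorm (u v x)) 0; first by rewrite mulr_ge0 // rnorm_ge0.
by rewrite -(@ler_pM2r _ (rnorm (u v x))) ?lt_neqAle ?rnorm_ge0 ?(eq_sym 0) ?n0 // -expr2.
Qed.
End DualNorm.

(** * w*-continuous functionals and the predual *)

Section WeakStarFunctionals.
Variable R : realType.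

Definition clinear (X : lmodType R[i]) (f : X -> R[i]) : Prop :=
  forall a x y, f (a *: x + y) = a * f x + f y.

Definition wfun (X : wMxNormedType R) (f : X -> R[i]) : Prop :=
  clinear f /\ continuous (f : X -> R[i]^o).

Definition fbounded (X : mxNormedType R) (f : X -> R[i]) (t : R) : Prop :=
  forall x, cmod (f x) <= t * mxnorm1 x.

(* [X] is the dual of the normed space of its w*-continuous functionals. *)
Definition dualized (X : wMxNormedType R) : Prop :=
  [/\ forall f : X -> R[i], wfun f -> exists2 t : R, 0 <= t & fbounded f t,
      forall f : X -> R[i], clinear f ->
        (forall e : R, 0 < e -> exists2 g, wfun g & fbounded (fun x => f x - g x) e) -> wfun f
    & forall (F : (X -> R[i]) -> R[i]) (c : R),
        (forall a f g, wfun f -> wfun g -> F (fun x => a * f x + g x) = a * F f + F g) ->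
        (forall f (t : R), wfun f -> 0 <= t -> fbounded f t -> cmod (F f) <= c * t) ->
        exists x, forall f, wfun f -> F f = f x].

Lemma clinear0 (X : lmodType R[i]) (f : X -> R[i]) : clinear f -> f 0 = 0.
Proof. by move=> h; have := h (-1) 0 0; rewrite scaler0 addr0 mulN1r addNr. Qed.
Lemma clinearZ (X : lmodType R[i]) (f : X -> R[i]) a x : clinear f -> f (a *: x) = a * f x.
Proof. by move=> h; have := h a x 0; rewrite !addr0 clinear0 // addr0. Qed.
Lemma clinearD (X : lmodType R[i]) (f : X -> R[i]) x y : clinear f -> f (x + y) = f x + f y.
Proof. by move=> h; have := h 1 x y; rewrite scale1r mul1r. Qed.
Lemma clinearB (X : lmodType R[i]) (f : X -> R[i]) x y : clinear f -> f (x - y) = f x - f y.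
Proof. by move=> h; rewrite clinearD // -scaleN1r clinearZ // mulN1r. Qed.

Lemma wfunZD (X : wMxNormedType R) (f g : X -> R[i]) a : wfun f -> wfun g ->
  wfun (fun x => a * f x + g x).
Proof.
move=> [lf cf] [lg cg]; split; last by (have h := @continuousZD R X a f g cf cg; exact h).
by move=> b x y; rewrite lf lg; ring.
Qed.
Lemma wfun0 (X : wMxNormedType R) : wfun (fun _ : X => 0).
Proof.
by split; [move=> a x y; rewrite mulr0 addr0 | move=> x; exact: cst_continuous].
Qed.

(** Continuity at 0 gives finitely many vectors such that [phi] vanishes on every functional killing
    them all, since such functionals can be rescaled freely. Induction on the list then turns [phi]
    into evaluation at a combination of these vectors. *)
Lemma dual_wcontinuous (V : mxNormedType R) (phi : dual V -> R[i]) : clinear phi ->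
  continuous (phi : dual V -> R[i]^o) -> exists v, forall F : dual V, phi F = F v.
Proof.
move=> lp cp.
have [l hl] : exists l : seq V, forall F : dual V,
    (forall v, List.In v l -> F v = 0) -> phi F = 0.
  have [l [e [e0 hl]]] :=
    nbhs_initial (ev := @dual_eval R V) (continuous_cmod cp 0 ltr01).
  exists l => F hF; apply: cmod0_eq0; apply/le_anti; rewrite cmod_ge0 andbT.
  apply: (@le_eps _ _ _ 1) => // d d0; rewrite add0r mulr1.
  have /hl /= : basic_nbhs (@dual_eval R V) (0 : dual V) l e ((d^-1)%:C *: F).
    move=> v vl; rewrite -[dual_eval _ _]/((d^-1)%:C * F v) hF // mulr0.
    by rewrite -[dual_eval _ _]/(0 : R[i]) subrr cmod0.
  rewrite clinear0 // subr0 clinearZ // cmodM cmodR ger0_norm ?invr_ge0 ?(ltW d0) //.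
  by rewrite mulrC ltr_pdivrMr // mul1r => /ltW.
elim: l phi lp {cp} hl => [|v l IH] phi lp hl.
  have /asboolP lV : (fun _ : V => 0 : R[i]^o) \in @dual_pred R V.
    apply/asboolP; split=> [a x y|]; first by rewrite scaler0 addr0.
    by exists 0 => w; rewrite mul0r /rnorm normr0.
  exists 0 => F; rewrite hl //.
  have /asboolP[lF _] := dual_funP F.
  by have := lF (-1) 0 0; rewrite scaler0 addr0 scaleN1r addNr.
have [[F0 [h0 h1]]|no] := pselect (exists F0 : dual V,
    (forall w, List.In w l -> F0 w = 0) /\ F0 v <> 0).
  have v0 : (F0 v : R[i]) != 0 by apply/eqP.
  pose c := phi F0 / F0 v.
  have [|F hF|w hw] := IH (fun F => phi F - c * F v).
  - by move=> a x y; rewrite lp -[(a *: x + y : dual V) v]/(a * x v + y v); ring.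
  - have e : phi (F - (F v / F0 v) *: F0) = 0.
      apply: hl => w [<-|wl].
        by rewrite -[(_ - _ : dual V) v]/(F v - F v / F0 v * F0 v) divfK // subrr.
      by rewrite -[(_ - _ : dual V) w]/(F w - F v / F0 v * F0 w) (hF _ wl) (h0 _ wl) mulr0 subrr.
    by move: e; rewrite clinearB // clinearZ // /c => e; rewrite -[RHS]e; ring.
  exists (c *: v + w) => F; have /asboolP[lF _] := dual_funP F.
  by rewrite lF -hw addrC -[c *: F v]/(c * F v) subrK.
apply: IH => // F hF; apply: hl => w [<-|/hF //].
by apply: contrapT => h; apply: no; exists F.
Qed.

(** The w*-continuous functionals are the evaluations at vectors of [V]. Completeness of [V] closes
    them under norm limits, and a bounded functional on them is an element of [dual V]. *)
Theorem dual_dualized (X : wMxNormedType R) : dual_operator_space X -> dualized X.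
Proof.
move=> [_ [V [J [J' [[cV [H [u ciu]]] ciJ JK J'K [cJ cJ']]]]]].
have lJ := ciJ.1.
have nJ x : mxnorm1 (J x) = mxnorm1 x by exact: isometry_mxnorm1.
have wev v : wfun (fun x => J x v).
  split=> [a x y|]; first by rewrite lJ.
  move=> x; apply: (@continuous_comp _ _ _ J (fun F : dual V => F v : R[i]^o)); first exact: cJ.
  exact: (initial_ev_continuous (ev := @dual_eval R V)).
have evw f : wfun f -> exists v, forall x, f x = J x v.
  move=> [lf cf].
  have lJ' a F G : J' (a *: F + G) = a *: J' F + J' G.
    by rewrite -{1}(J'K F) -{1}(J'K G) -lJ JK.
  have [||v hv] := @dual_wcontinuous V (f \o J').
  - by move=> a F G /=; rewrite lJ' lf.
  - by move=> F; apply: continuous_comp; [exact: cJ' | exact: cf].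
  - by exists v => x; rewrite -hv /= JK.
have le x v : cmod (J x v) <= mxnorm1 x * mxnorm1 v.
  by rewrite -nJ; exact: (dual_eval_le ciu).
have nrm v (t : R) : 0 <= t -> fbounded (fun x => J x v) t -> mxnorm1 v <= t.
  move=> t0 h; apply: (dual_norming ciu) => // F; have := h (J' F).
  by rewrite J'K -nJ J'K.
have n0 (v : V) : 0 <= mxnorm1 v by rewrite -(isometry_mxnorm1 v ciu) mxnorm1_bop_ge0.
split.
- move=> f /evw[v hv]; exists (mxnorm1 v) => // x; rewrite hv mulrC; exact: le.
- move=> f lf hf.
  have exv n : {v : V | fbounded (fun x => f x - J x v) n.+1%:R^-1}.
    apply: cid; have [|g /evw[v hv] hg] := hf n.+1%:R^-1; first by rewrite invr_gt0.
    by exists v => x; rewrite -hv.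
  pose v n := sval (exv n).
  have hv n : fbounded (fun x => f x - J x (v n)) n.+1%:R^-1 by exact: (svalP (exv n)).
  have nx (x : X) : 0 <= mxnorm1 x.
    have := le_trans (cmod_ge0 _) (hv 0%N x); rewrite pmulr_rge0 // invr_gt0 //.
  have vB (x : X) a b : J x (a - b) = J x a - J x b.
    by rewrite (dualD ciu) -scaleN1r (dualZ ciu) mulN1r.
  have cau m n : mxnorm1 (v m - v n) <= m.+1%:R^-1 + n.+1%:R^-1.
    apply: nrm => [|x]; first by rewrite addr_ge0 // invr_ge0.
    rewrite vB; have -> : J x (v m) - J x (v n) = - (f x - J x (v m)) + (f x - J x (v n)).
      by rewrite opprB addrA subrK.
    apply: le_trans (cmodD _ _) _; rewrite cmodN mulrDl.
    by apply: lerD; [exact: (hv m x) | exact: (hv n x)].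
  have [e e0|w hw] := cV v.
    have [N hN] := @inv_small R (e / 2) ltac:(by rewrite divr_gt0).
    exists N => m n /hN hm /hN hn; apply: le_lt_trans (cau m n) _.
    by move: hm hn; move: (m.+1%:R^-1) (n.+1%:R^-1) => a b; lra.
  suff fE : f = (fun x => J x w) by rewrite fE.
  apply/funext => x; apply/eqP; rewrite -subr_eq0; apply/eqP/cmod0_eq0/le_anti.
  rewrite cmod_ge0 andbT; apply: (@le_eps _ _ _ (2 * mxnorm1 x)) => [|e e0].
    by rewrite mulr_ge0.
  have [N1 _ h1] := proj1 (cvgrPdist_lt _ _) hw _ e0.
  have [N2 h2] := inv_small e0.
  pose n := maxn N1 N2; have := h1 n (leq_maxl _ _); have := h2 n (leq_maxr _ _).
  rewrite /= sub0r normrN ger0_norm // => k2 k1.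
  have -> : f x - J x w = (f x - J x (v n)) + J x (v n - w) by rewrite vB addrA subrK.
  apply: le_trans (cmodD _ _) _; rewrite add0r.
  have := hv n x; have := le x (v n - w).
  have := ler_wpM2r (nx x) (ltW k2); have := ler_wpM2r (nx x) (ltW k1).
  move: (n.+1%:R^-1) => a; lra.
- move=> F c lF hF.
  have fP : (fun v => F (fun x => J x v) : R[i]^o) \in @dual_pred R V.
    apply/asboolP; split=> [a v w|]; last first.
      by exists c => v; apply: hF => // x; rewrite mulrC.
    rewrite -[RHS]/(a * F (fun x => J x v) + F (fun x => J x w)) -lF //.
    by congr F; apply/funext => x; rewrite (dualD ciu) (dualZ ciu).
  exists (J' (Dual fP)) => f wf; have [v hv] := evw f wf.
  by rewrite hv J'K /=; congr F; apply/funext.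
Qed.

End WeakStarFunctionals.

(** * w*-continuous functionals as normal functionals *)

Section NormalRepresentation.
Variables (R : realType) (X : wMxNormedType R) (H K : hilbertType R) (chi : X -> bop H K).
Hypothesis dX : dualized X.
Hypothesis chiL : linear chi.
Hypothesis chiN : forall x, mxnorm1 (chi x) = mxnorm1 x.
Hypothesis chiC : continuous chi.

Definition fin_functional (l : seq (H * K)) (T : bop H K) : R[i] :=
  \sum_(p <- l) ip (T p.1) p.2.
Definition weights_le (t : R) (l : seq (H * K)) : Prop :=
  \sum_(p <- l) rnorm p.1 ^+ 2 <= t /\ \sum_(p <- l) rnorm p.2 ^+ 2 <= t.
Definition scale_pairs (s : R) (l : seq (H * K)) : seq (H * K) :=
  [seq (s%:C *: p.1, s%:C *: p.2) | p <- l].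

Lemma fin_functional_scale s l T :
  fin_functional (scale_pairs s l) T = (s ^+ 2)%:C * fin_functional l T.
Proof.
rewrite /fin_functional big_map mulr_sumr; apply: eq_bigr => p _ /=.
by rewrite bopZ ipZl ipZr conjc_real mulrA -rmorphM.
Qed.
Lemma weights_scale s t l : weights_le t l -> weights_le (s ^+ 2 * t) (scale_pairs s l).
Proof.
by move=> [h1 h2]; split; rewrite big_map; under eq_bigr do
  rewrite rnormZ cmodR exprMn real_normK ?num_real //;
  rewrite -mulr_sumr ler_wpM2l ?sqr_ge0.
Qed.

Let nx0 (x : X) : 0 <= mxnorm1 x. Proof. by rewrite -chiN mxnorm1_bop_ge0. Qed.
Let chiZ a x : chi (a *: x) = a *: chi x.
Proof.
have c0 : chi 0 = 0 by have := chiL (-1) 0 0; rewrite scaler0 addr0 scaleN1r addNr.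
by have := chiL a x 0; rewrite c0 !addr0.
Qed.
Let nxZ w (x : X) : cmod w = 1 -> mxnorm1 (w *: x) <= mxnorm1 x.
Proof.
move=> w1; rewrite -chiN; apply: mxnorm1_bop_le => // y.
by rewrite chiZ bop_scaleE rnormZ w1 mul1r -chiN mxnorm1_bop_ub.
Qed.

Lemma nlim_wfun (xi : nat -> H) (eta : nat -> K) (M M' : R) :
  sq_bounded xi M -> sq_bounded eta M' -> wfun (fun x => nlim xi eta (chi x)).
Proof.
move=> hM hM'; split=> [a x y|x]; first by rewrite chiL (nlimP _ _ _ hM hM').
have h := @continuous_comp _ _ _ chi (fun T => nlim xi eta T : R[i]^o) x (@chiC x)
  (@nlim_continuous R H K xi eta M M' hM hM' (chi x)).
exact h.
Qed.

Lemma ip_wfun (xi : H) (eta : K) : wfun (fun x => ip (chi x xi) eta).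
Proof.
have := nlim_wfun (seq1_bounded xi) (seq1_bounded eta).
by under eq_fun do rewrite nlim_seq1.
Qed.

Lemma fin_functional_wfun l : wfun (fun x => fin_functional l (chi x)).
Proof.
elim: l => [|p l IH].
  have -> : (fun x : X => fin_functional [::] (chi x)) = (fun _ => 0); last exact: wfun0.
  by apply/funext => x; rewrite /fin_functional big_nil.
have -> : (fun x : X => fin_functional (p :: l) (chi x)) =
    (fun x => 1 * ip (chi x p.1) p.2 + fin_functional l (chi x)).
  by apply/funext => x; rewrite /fin_functional big_cons mul1r.
have h := wfunZD 1 (ip_wfun p.1 p.2) IH; exact h.
Qed.

(* Hahn-Banach applied to the gauge of the functionals coming from finite-rank
   operators of trace norm at most 1, thickened by a small norm ball. *)
Lemma normal_approx (f : X -> R[i]) (C : R) : wfun f -> fbounded f 1 -> 0 < C ->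
  exists l, weights_le 2 l /\ fbounded (fun x => f x - fin_functional l (chi x)) (2 / C).
Proof.
move=> wf f1 C0.
pose V := X -> R^o.
pose D : set V := [set g | exists2 f, wfun f & forall x, g x = complex.Re (f x)].
(* The gauge charges [t] for a finite-rank functional of weight [t], and [C r] for a remainder of
   norm [r]. *)
pose E (g : V) : set R := [set u | exists l (t r : R), [/\ 0 <= t, 0 <= r, weights_le t l,
  u = t + C * r & forall x, `|g x - complex.Re (fin_functional l (chi x))| <= r * mxnorm1 x]].
pose p (g : V) : R := inf (E g).
have lb g : lbound (E g) 0.
  by move=> _ [l [t [r [t0 r0 _ -> _]]]]; rewrite addr_ge0 // mulr_ge0 // ltW.
have p_le g l t r : 0 <= t -> 0 <= r -> weights_le t l ->
    (forall x, `|g x - complex.Re (fin_functional l (chi x))| <= r * mxnorm1 x) ->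
    p g <= t + C * r.
  by move=> *; apply: ge_inf; [exists 0; exact: lb | exists l, t, r].
have nil_le g r : 0 <= r -> (forall x, `|g x| <= r * mxnorm1 x) -> p g <= C * r.
  move=> r0 h; rewrite -[C * r]add0r; apply: (p_le g [::]) => //.
    by split; rewrite big_nil.
  by move=> x; rewrite /fin_functional big_nil /= subr0.
have Ene g : D g -> E g !=set0.
  move=> [h wh hg]; have [t t0 ht] := (let: And3 d0 _ _ := dX in d0) h wh.
  exists (0 + C * t); exists [::], 0, t; split=> //; first by split; rewrite big_nil.
  by move=> x; rewrite /fin_functional big_nil /= subr0 hg; apply: le_trans (ler_Re _) (ht x).
have sub : sublinear_on D p.
  split=> [g h Dg Dh|s g s0 Dg].
    suff k u v : E g u -> E h v -> p (g + h) <= u + v.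
      rewrite -lerBlDr; apply: lb_le_inf; first exact: Ene.
      move=> u Eu; rewrite lerBlDr -lerBlDl; apply: lb_le_inf; first exact: Ene.
      by move=> v Ev; rewrite lerBlDl; exact: k.
    move=> [l [t [r [t0 r0 [w1 w2] -> hg]]]] [m [t' [r' [t0' r0' [w1' w2'] -> hh]]]].
    have -> : t + C * r + (t' + C * r') = (t + t') + C * (r + r') by ring.
    apply: (p_le _ (l ++ m)); rewrite ?addr_ge0 //; first by split; rewrite big_cat lerD.
    move=> x; rewrite /fin_functional big_cat /= ReD mulrDl.
    have -> : (g + h) x = g x + h x by [].
    rewrite opprD addrACA; apply: le_trans (ler_normD _ _) _.
    by apply: lerD; [exact: hg | exact: hh].
  have half (u : R) k : 0 < u -> D k -> p (u *: k) <= u * p k.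
    move=> u0 Dk; rewrite mulrC -ler_pdivrMr //; apply: lb_le_inf; first exact: Ene.
    move=> _ [l [t [r [t0 r0 w -> hk]]]]; rewrite ler_pdivrMr //.
    have -> : (t + C * r) * u = u * t + C * (u * r) by ring.
    have us : Num.sqrt u ^+ 2 = u by rewrite sqr_sqrtr // ltW.
    apply: (p_le _ (scale_pairs (Num.sqrt u) l)).
    - by rewrite mulr_ge0 // ltW.
    - by rewrite mulr_ge0 // ltW.
    - by rewrite -{1}us; exact: weights_scale.
    - move=> x; rewrite fin_functional_scale us ReM -[(u *: k) x]/(u * k x) -mulrBr normrM.
      by rewrite gtr0_norm // -mulrA ler_wpM2l // ltW.
  apply/le_anti; rewrite half //=.
  have Dsg : D (s *: g).
    have [h wh hg] := Dg; have wsh := wfunZD s%:C wh (wfun0 X).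
    by exists (fun x => s%:C * h x + 0) => // x; rewrite addr0 ReM -hg.
  have := half s^-1 (s *: g) ltac:(by rewrite invr_gt0) Dsg.
  by rewrite scalerA mulVf ?gt_eqF // scale1r mulrC ler_pdivlMr // mulrC.
pose re (h : X -> R[i]) : V := fun x => complex.Re (h x).
have Dre (h : X -> R[i]) : wfun h -> D (re h) by move=> wh; exists h.
have D0 : D 0 by exists (fun _ => 0); [exact: wfun0 | ].
have Dl (a : R) g h : D g -> D h -> D (a *: g + h).
  move=> [g' wg hg] [h' wh hh]; have wgh := wfunZD a%:C wg wh.
  by exists (fun x => a%:C * g' x + h' x) => // x; rewrite ReD ReM -hg -hh.
have [F [Fl Fp Fx]] := hahn_banach D0 Dl sub (Dre f wf).
have ReE (z w : R[i]) (a : R[i]) : complex.Re (a * z + w) =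
    complex.Re a * complex.Re z + (- complex.Im a) * complex.Re (- 'i * z) + complex.Re w.
  by rewrite ReiC; case: a z w => a b [c d] [e g] /=; ring.
have F0 : F 0 = 0 by have := Fl (-1) 0 0 D0 D0; rewrite scaler0 addr0; lra.
have FZ (a : R) g : D g -> F (a *: g) = a * F g.
  by move=> Dg; have := Fl a g 0 Dg D0; rewrite !addr0 F0 addr0.
have FD g h : D g -> D h -> F (g + h) = F g + F h.
  by move=> Dg Dh; have := Fl 1 g h Dg Dh; rewrite scale1r mul1r.
have DZ (a : R) g : D g -> D (a *: g) by move=> Dg; rewrite -[_ *: g]addr0; exact: Dl.
have DD g h : D g -> D h -> D (g + h) by move=> Dg Dh; rewrite -[g]scale1r; exact: Dl.
have wmi (h : X -> R[i]) : wfun h -> wfun (fun x => - 'i * h x).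
  move=> wh; have := wfunZD (- 'i) wh (wfun0 X).
  by congr wfun; apply/funext => x; rewrite addr0.
pose Phi (h : X -> R[i]) : R[i] := F (re h) +i* F (re (fun x => - 'i * h x)).
have Fcomb (a : R[i]) (g h : X -> R[i]) : wfun g -> wfun h -> F (re (fun x => a * g x + h x)) =
    complex.Re a * F (re g) + (- complex.Im a) * F (re (fun x => - 'i * g x)) + F (re h).
  move=> wg wh; have wig := wmi g wg.
  rewrite -FZ; last exact: Dre. rewrite -FZ; last exact: Dre.
  rewrite -!FD; try (by apply: DZ; exact: Dre); try exact: Dre.
    by congr F; apply/funext => x; rewrite /re ReE.
  by apply: DD; apply: DZ; exact: Dre.
(* The complexification of [F] is bounded by [2 C] on the predual, so duality returns a point [x0].
   Rank one functionals show that its norm is at most 1, which keeps the gauge of [f] below 2. *)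
have [x0 hx0] : exists x, forall h, wfun h -> Phi h = h x.
  have [_ _ d2] := dX; apply: (d2 Phi (2 * C)) => [a g h wg wh|h t wh t0 ht].
    have e : (fun x => - 'i * (a * g x + h x)) = (fun x => (- 'i * a) * g x + (- 'i * h x)).
      by apply/funext => x; ring.
    rewrite /Phi (Fcomb a g h wg wh) e (Fcomb (- 'i * a) g _ wg (wmi h wh)).
    by rewrite complex_mulD ReiC Im_miC; congr (_ +i* _); ring.
  have b (k : X -> R[i]) : wfun k -> fbounded k t -> `|F (re k)| <= C * t.
    move=> wk hk; have bd (s : R) : `|s| = 1 -> s * F (re k) <= C * t.
      move=> s1; rewrite -FZ; last exact: Dre.
      apply: le_trans (Fp _ (DZ _ _ (Dre _ wk))) _; apply: nil_le => // x.
      by rewrite -[(s *: re k) x]/(s * re k x) normrM s1 mul1r; apply: le_trans (ler_Re _) (hk x).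
    have := bd 1 (normr1 _); have := bd (-1) ltac:(by rewrite normrN normr1).
    by rewrite ler_norml; lra.
  have -> : Phi h = (F (re h))%:C + 'i * (F (re (fun x => - 'i * h x)))%:C.
    by rewrite [LHS]complexE.
  apply: le_trans (cmodD _ _) _; rewrite cmodM !cmodR.
  have -> : cmod ('i : R[i]) = 1.
    by apply: complexI; rewrite cmodE normc_def /= expr0n expr1n add0r sqrtr1.
  have ci : cmod (- 'i : R[i]) = 1.
    by apply: complexI; rewrite cmodE normc_def /= !oppr0 expr0n sqrrN expr1n add0r sqrtr1.
  have h1 := b h wh ht; have h2 := b _ (wmi h wh) (fun x => ltac:(rewrite cmodM ci mul1r; exact: ht)).
  lra.
have nx1 : mxnorm1 x0 <= 1.
  rewrite -chiN; apply: mxnorm1_bop_le => // y; rewrite mul1r.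
  have key (z : H) (w : K) : rnorm z <= 1 -> rnorm w <= 1 -> rip (chi x0 z) w <= 1.
    move=> z1 w1; have wk := ip_wfun z w.
    have -> : rip (chi x0 z) w = F (re (fun x => ip (chi x z) w)) by rewrite /rip -(hx0 _ wk).
    apply: le_trans (Fp _ (Dre _ wk)) _; rewrite -[X in _ <= X](addr0 1) -[X in 1 + X](mulr0 C).
    apply: (p_le _ [:: (z, w)]) => // [|x].
      by split; rewrite big_seq1 /= expr_le1 ?rnorm_ge0.
    by rewrite /fin_functional big_seq1 /= subrr normr0 mul0r.
  have [->|y0] := eqVneq (rnorm (chi x0 y)) 0; first exact: rnorm_ge0.
  have [yz|yn] := eqVneq (rnorm y) 0.
    by rewrite (rnorm0_eq0 yz) bop0 rnorm0 in y0; rewrite eqxx in y0.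
  have p1 : 0 < rnorm (chi x0 y) by rewrite lt_neqAle eq_sym y0 rnorm_ge0.
  have p2 : 0 < rnorm y by rewrite lt_neqAle eq_sym yn rnorm_ge0.
  have := key ((rnorm y)^-1%:C *: y) ((rnorm (chi x0 y))^-1%:C *: chi x0 y).
  rewrite !rnormZ !cmodR !ger0_norm ?invr_ge0 ?rnorm_ge0 // !mulVf // => /(_ (lexx _) (lexx _)).
  rewrite bopZ ripZl ripZr rip_norm expr2 mulKf // mulrC ler_pdivrMr // mul1r //.
have pf : p (re f) < 2.
  rewrite -Fx; have -> : F (re f) = complex.Re (f x0) by rewrite -(hx0 _ wf).
  apply: le_lt_trans (le_trans (Re_cmod _) (f1 x0)) _; rewrite mul1r.
  by apply: le_lt_trans nx1 _; rewrite ltr1n.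
have [_ [l [t [r [t0 r0 w -> hr]]]] hu] := inf_lt (Ene _ (Dre _ wf)) pf.
exists l; split.
  have t2 : t <= 2 by have := mulr_ge0 (ltW C0) r0; lra.
  by split; [apply: le_trans w.1 t2 | apply: le_trans w.2 t2].
have r2 : r <= 2 / C by rewrite ler_pdivlMr // mulrC; lra.
move=> x; apply: le_trans (_ : r * mxnorm1 x <= _); last by rewrite ler_wpM2r.
have lg : clinear (fun x => f x - fin_functional l (chi x)).
  move=> a y z; have [lf _] := wf; have [lb' _] := fin_functional_wfun l.
  by rewrite lf lb'; ring.
have [u [u1 hu1]] := phase (f x - fin_functional l (chi x)).
have -> : cmod (f x - fin_functional l (chi x)) =
   complex.Re (f (u *: x) - fin_functional l (chi (u *: x))).
  by have := clinearZ u x lg => /= ->; rewrite hu1.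
rewrite ReD ReN; apply: le_trans (ler_norm _) _; apply: le_trans (hr _) _.
by rewrite ler_wpM2l // nxZ.
Qed.
End NormalRepresentation.

Section CatUpto.
Variables (T : Type) (d : T) (l : nat -> seq T).
Hypothesis lne : forall n, (0 < size (l n))%N.

Fixpoint cat_upto n : seq T := if n is m.+1 then cat_upto m ++ l m else [::].
(** The infinite concatenation: as the blocks are nonempty, the first [i + 1] of them already
    contain position [i]. *)
Definition cat_seq (i : nat) : T := nth d (cat_upto i.+1) i.

Lemma size_cat_upto n : (n <= size (cat_upto n))%N.
Proof.
elim: n => //= n IH; rewrite size_cat -addn1; exact: leq_add.
Qed.
Lemma cat_upto_prefix m n i : (m <= n)%N -> (i < size (cat_upto m))%N ->
  nth d (cat_upto n) i = nth d (cat_upto m) i.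
Proof.
move=> /subnK <- im; elim: (n - m)%N => [|k IH]; first by rewrite add0n.
rewrite addSn /= nth_cat ifT //; apply: leq_trans im _.
by elim: k {IH} => [|k IH]; rewrite ?add0n // addSn /= size_cat (leq_trans IH) // leq_addr.
Qed.
Lemma cat_seqE n i : (i < size (cat_upto n))%N -> cat_seq i = nth d (cat_upto n) i.
Proof.
move=> iL; have iS : (i < size (cat_upto i.+1))%N by exact: size_cat_upto.
rewrite /cat_seq; have [h|h] := leqP n i.+1; first by rewrite (cat_upto_prefix h iL).
by rewrite (cat_upto_prefix (ltnW h) iS).
Qed.
Lemma cat_seq_sum (M : nmodType) (g : T -> M) n :
  \sum_(i < size (cat_upto n)) g (cat_seq i) = \sum_(p <- cat_upto n) g p.
Proof.
rewrite (big_nth d) big_mkord; apply: eq_bigr => i _; by rewrite (cat_seqE (ltn_ord i)).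
Qed.
End CatUpto.

Section NormalRepresentation2.
Variables (R : realType) (X : wMxNormedType R) (H K : hilbertType R) (chi : X -> bop H K).
Hypothesis dX : dualized X.
Hypothesis chiL : linear chi.
Hypothesis chiN : forall x, mxnorm1 (chi x) = mxnorm1 x.
Hypothesis chiC : continuous chi.

(** Successive approximation. [normal_approx] with [C = 8] leaves a remainder of norm at most
    [1 / 4], which is multiplied by 4 and treated again. The pairs of stage [k] are scaled by
    [2^(-k)], so the total weight is at most [2 + 2/4 + 2/16 + ... = 8/3], below 3. *)
Let normal_rep1 (f : X -> R[i]) : wfun f -> fbounded f 1 ->
  exists xi eta, [/\ sq_bounded xi (3 : R), sq_bounded eta (3 : R) &
    forall x, f x = nlim xi eta (chi x)].
Proof.
move=> wf f1.
pose P (g : X -> R[i]) := wfun g /\ fbounded g 1.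
have pick (g : {g | P g}) : {l | weights_le 2 l /\
    fbounded (fun x => sval g x - fin_functional l (chi x)) (2 / 8)}.
  by apply: cid; have [wg bg] := svalP g; apply: (normal_approx dX chiL chiN chiC wg bg).
have next (g : {g | P g}) : {h : {g | P g} | forall x,
    sval h x = (4 : R)%:C * (sval g x - fin_functional (sval (pick g)) (chi x))}.
  have [wg bg] := svalP g; have [_ bl] := svalP (pick g).
  have h0 := wfunZD (- 1) (fin_functional_wfun chiL chiC (sval (pick g))) wg.
  have h1 := wfunZD (4 : R)%:C h0 (wfun0 X).
  have e x : (4 : R)%:C * (- 1 * fin_functional (sval (pick g)) (chi x) + sval g x) + 0 =
     (4 : R)%:C * (sval g x - fin_functional (sval (pick g)) (chi x)).
    by rewrite addr0 mulN1r addrC.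
  unshelve eexists (exist P (fun x => (4 : R)%:C * (- 1 * fin_functional (sval (pick g)) (chi x) + sval g x) + 0) _).
    split; first exact: h1.
    move=> x; rewrite e cmodM cmodR ger0_norm //.
    by have := bl x; lra.
  by move=> x /=; rewrite e.
pose s n := iter n (fun g => sval (next g)) (exist P f (conj wf f1)).
(* The added pair of zero vectors keeps every block nonempty. *)
pose l k : seq (H * K) := scale_pairs (2^-1 ^+ k) ((0, 0) :: sval (pick (s k))).
have lne n : (0 < size (l n))%N by [].
have ff0 (m : seq (H * K)) T : fin_functional ((0, 0) :: m) T = fin_functional m T.
  by rewrite /fin_functional big_cons /= ip0r add0r.
have sq4 k : (2^-1 ^+ k) ^+ 2 = 4^-1 ^+ k :> R.
  by rewrite -exprM mulnC exprM; congr (_ ^+ k); field.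
have rem n x : f x - fin_functional (cat_upto l n) (chi x) = (4^-1 ^+ n)%:C * sval (s n) x.
  elim: n => [|n IH]; first by rewrite /fin_functional big_nil subr0 expr0 mul1r.
  rewrite /= {1}/fin_functional big_cat opprD addrA.
  rewrite -[\sum_(p <- cat_upto l n) _]/(fin_functional _ _) IH.
  rewrite -[\sum_(p <- l n) _]/(fin_functional _ _) fin_functional_scale ff0 sq4 -mulrBr.
  rewrite [sval (sval _) x](svalP (next (s n))) mulrA -rmorphM; congr (_%:C * _).
  by rewrite exprSr -mulrA mulVf ?mulr1.
have wt n : weights_le (8 / 3 - 8 / 3 * 4^-1 ^+ n : R) (cat_upto l n).
  elim: n => [|n [IH1 IH2]]; first by split; rewrite big_nil expr0 mulr1 subrr.
  have [w _] := svalP (pick (s n)).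
  have w' : weights_le 2 ((0, 0) :: sval (pick (s n))).
    by case: w => w1 w2; split; rewrite big_cons /= rnorm0 expr0n add0r.
  have [w1 w2] := weights_scale (2^-1 ^+ n) w'; rewrite sq4 in w1 w2.
  rewrite exprS; move: (4^-1 ^+ n) IH1 IH2 w1 w2 => a IH1 IH2 w1 w2.
  by split; rewrite /= big_cat; apply: le_trans (lerD _ _) _; [exact: IH1|exact: w1|lra|exact: IH2|exact: w2|lra].
have wt3 n : weights_le (3 : R) (cat_upto l n).
  have := wt n; have : 0 <= 4^-1 ^+ n :> R by rewrite exprn_ge0 // invr_ge0.
  move: (4^-1 ^+ n) => a a0 [w1 w2].
  by split; [apply: le_trans w1 _ | apply: le_trans w2 _]; lra.
pose xi i := (cat_seq (0, 0) l i).1; pose eta i := (cat_seq (0, 0) l i).2.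
have bnd (L : hilbertType R) (g : H * K -> L) :
    (forall n, \sum_(p <- cat_upto l n) rnorm (g p) ^+ 2 <= 3) ->
    sq_bounded (fun i => g (cat_seq (0, 0) l i)) (3 : R).
  move=> hg n; apply: le_trans (hg n).
  rewrite -(cat_seq_sum (0, 0) lne (fun p => rnorm (g p) ^+ 2)).
  rewrite -!(big_mkord xpredT (fun i => rnorm (g (cat_seq (0, 0) l i)) ^+ 2)).
  rewrite (big_cat_nat (leq0n n) (size_cat_upto lne n)) /= lerDl.
  by apply: sumr_ge0 => i _; exact: sqr_ge0.
have hxi : sq_bounded xi (3 : R) by apply: (bnd H fst) => n; case: (wt3 n).
have heta : sq_bounded eta (3 : R) by apply: (bnd K snd) => n; case: (wt3 n).
exists xi, eta; split=> // x; apply/esym/eqP; rewrite -subr_eq0; apply/eqP/cmod0_eq0/le_anti.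
rewrite cmod_ge0 andbT; apply: (@le_eps _ _ _ (1 + mxnorm1 x)) => [|e e0].
  by rewrite addr_ge0 // -chiN mxnorm1_bop_ge0.
have [N1 h1] := nlim_cvg (chi x) hxi heta e0.
have [N2 h2] := inv_small e0.
pose n := maxn N1 N2; pose m := size (cat_upto l n).
have nm : (n <= m)%N by exact: size_cat_upto.
have k1 := h1 m (leq_trans (leq_maxl _ _) nm).
have e1 : nsum xi eta (chi x) m = fin_functional (cat_upto l n) (chi x).
  exact: (cat_seq_sum (0, 0) lne (fun p => ip (chi x p.1) p.2)).
rewrite e1 in k1.
have -> : nlim xi eta (chi x) - f x =
   - (fin_functional (cat_upto l n) (chi x) - nlim xi eta (chi x)) -
   (f x - fin_functional (cat_upto l n) (chi x)) by ring.
apply: le_trans (cmodD _ _) _; rewrite !cmodN rem add0r mulrDr mulr1 (lerD (ltW k1)) //.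
have [_ bs] := svalP (s n); rewrite cmodM cmodR ger0_norm ?exprn_ge0 ?invr_ge0 //.
have x0 : 0 <= mxnorm1 x by rewrite -chiN mxnorm1_bop_ge0.
have hs := bs x; rewrite mul1r in hs.
apply: ler_pM; rewrite ?exprn_ge0 ?invr_ge0 ?cmod_ge0 //.
apply/ltW/(le_lt_trans _ (h2 n (leq_maxr _ _))).
rewrite exprVn lef_pV2 ?posrE ?exprn_gt0 // -natrX ler_nat.
exact: ltn_expl.
Qed.

Theorem normal_rep (f : X -> R[i]) (t : R) : wfun f -> 0 < t -> fbounded f t ->
  exists xi eta, [/\ sq_bounded xi (3 * t), sq_bounded eta (3 * t) &
    forall x, f x = nlim xi eta (chi x)].
Proof.
move=> wf t0 ft.
have [||xi [eta [h1 h2 hf]]] := @normal_rep1 (fun x => (t^-1)%:C * f x + 0).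
- by have h := wfunZD (t^-1)%:C wf (wfun0 X); exact: h.
- move=> x; rewrite addr0 cmodM cmodR gtr0_norm ?invr_gt0 // mul1r mulrC ler_pdivrMr //.
  by rewrite mulrC; exact: ft.
have st : Num.sqrt t ^+ 2 = t by rewrite sqr_sqrtr // ltW.
have sc (L : hilbertType R) (u : nat -> L) : sq_bounded u 3 ->
    sq_bounded (fun n => (Num.sqrt t)%:C *: u n) (3 * t).
  move=> hu n; under eq_bigr do rewrite rnormZ cmodR exprMn real_normK ?num_real // st.
  by rewrite -mulr_sumr mulrC ler_wpM2r ?hu // ltW.
exists (fun n => (Num.sqrt t)%:C *: xi n), (fun n => (Num.sqrt t)%:C *: eta n).
split; [exact: sc | exact: sc |] => x.
have -> : f x = t%:C * nlim xi eta (chi x).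
  by rewrite -hf addr0 mulrA -rmorphM mulfV ?gt_eqF // mul1r.
have <- : nlim xi eta (t%:C *: chi x + 0) = t%:C * nlim xi eta (chi x).
  rewrite (nlimP _ _ _ h1 h2) (_ : nlim xi eta 0 = 0) ?addr0 //.
  by apply: nlim_lim => e e0; exists 0%N => n _; rewrite /nsum big1 ?subrr ?cmod0 // => i _; rewrite bop_zeroE ip0l.
rewrite /nlim addr0; have -> // : (fun n => ip ((t%:C *: chi x) (xi n)) (eta n)) =
  (fun n => ip (chi x ((Num.sqrt t)%:C *: xi n)) ((Num.sqrt t)%:C *: eta n)).
apply/funext => n; rewrite bop_scaleE bopZ !ipZl ipZr conjc_real mulrA -rmorphM -expr2 st //.
Qed.

(* A special case of the Krein-Smulian theorem. *)
Theorem isometry_range_closed : closed (range chi).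
Proof.
move=> T hT.
(* A functional on [X] has many normal representations; their values at [T] agree since they agree
   on [range chi], whose closure contains [T]. So [F] below is well defined, and duality turns it
   into a point of [X]. *)
have nl_uniq xi eta xi' eta' (M1 M2 M3 M4 : R) : sq_bounded xi M1 -> sq_bounded eta M2 ->
    sq_bounded xi' M3 -> sq_bounded eta' M4 ->
    (forall x, nlim xi eta (chi x) = nlim xi' eta' (chi x)) ->
    nlim xi eta T = nlim xi' eta' T.
  move=> h1 h2 h3 h4 h.
  apply: (closed_eq_fun (nlim_continuous h1 h2) (nlim_continuous h3 h4) _ hT).
  by move=> _ [x _ <-]; exact: h.
pose P f z := forall xi eta (M M' : R), sq_bounded xi M -> sq_bounded eta M' ->
  (forall x, f x = nlim xi eta (chi x)) -> z = nlim xi eta T.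
have exF f : wfun f -> exists z, P f z.
  move=> wf; have [t t0 ft] := (let: And3 d0 _ _ := dX in d0) f wf.
  have [||xi [eta [h1 h2 hf]]] := @normal_rep f (t + 1) wf.
  - by rewrite ltr_wpDl.
  - move=> x; apply: le_trans (ft x) _; rewrite ler_wpM2r ?lerDl //.
    by rewrite -chiN mxnorm1_bop_ge0.
  exists (nlim xi eta T) => xi' eta' M M' h3 h4 hf'.
  by apply: (nl_uniq _ _ _ _ _ _ _ _ h1 h2 h3 h4) => x; rewrite -hf hf'.
pose F f := xget 0 (P f).
have FP f : wfun f -> P f (F f) by move=> /exF[z hz]; exact: (xgetI 0 hz).
have repr f : wfun f -> exists xi eta, exists M M', [/\ sq_bounded xi M, sq_bounded eta M',
    forall x, f x = nlim xi eta (chi x) & F f = nlim xi eta T].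
  move=> wf; have [t t0 ft] := (let: And3 d0 _ _ := dX in d0) f wf.
  have [||xi [eta [h1 h2 hf]]] := @normal_rep f (t + 1) wf.
  - by rewrite ltr_wpDl.
  - move=> x; apply: le_trans (ft x) _; rewrite ler_wpM2r ?lerDl //.
    by rewrite -chiN mxnorm1_bop_ge0.
  by exists xi, eta, (3 * (t + 1)), (3 * (t + 1)); split=> //; exact: (FP f wf _ _ _ _ h1 h2 hf).
have [c c0 hc] := bop_bound T.
have [x0 hx0] : exists x, forall f, wfun f -> F f = f x.
  have [_ _ d2] := dX; apply: (d2 F (c * 3)) => [a f g wf wg|f t wf t0 ft].
    have [xi [eta [M1 [M2 [h1 h2 hf ->]]]]] := repr f wf.
    have [xi' [eta' [M3 [M4 [h3 h4 hg ->]]]]] := repr g wg.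
    have wfg := wfunZD a wf wg.
    have [xi'' [eta'' [M5 [M6 [h5 h6 hfg ->]]]]] := repr _ wfg.
    have cc := @continuousZD R (bop H K) a (fun T => nlim xi eta T) (fun T => nlim xi' eta' T)
      (nlim_continuous h1 h2) (nlim_continuous h3 h4).
    apply: (closed_eq_fun (nlim_continuous h5 h6) cc _ hT) => _ [x _ <-].
    by rewrite -hfg -hf -hg.
  apply: (@le_eps _ _ _ (c * 3)) => [|e e0]; first by rewrite mulr_ge0.
  have [||xi [eta [h1 h2 hf]]] := @normal_rep f (t + e) wf.
  - by rewrite ltr_wpDl.
  - move=> x; apply: le_trans (ft x) _; rewrite ler_wpM2r ?lerDl ?(ltW e0) //.
    by rewrite -chiN mxnorm1_bop_ge0.
  rewrite (FP f wf _ _ _ _ h1 h2 hf); apply: le_trans (nlim_bound h1 h2 c0 hc) _; lra.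
exists x0 => //; apply: bop_eq => y; apply: ip_inj => z.
have wk := ip_wfun chiL chiC y z; rewrite -(hx0 _ wk) -nlim_seq1.
apply: (FP _ wk _ _ _ _ (seq1_bounded y) (seq1_bounded z)) => x.
by rewrite nlim_seq1.
Qed.

End NormalRepresentation2.

(** * Biorthogonal systems adapted to a quadratic form *)

Section DualSystems.
Variables (R : realType) (K : hilbertType R).
Implicit Types (k x : K).

Definition spans d (e phi : 'I_d -> K) k : Prop := k = \sum_l ip k (phi l) *: e l.

Lemma onb_span (ks : seq K) : exists d (f : 'I_d -> K),
  (forall l m, ip (f l) (f m) = (l == m)%:R) /\ forall k, k \in ks -> spans f f k.
Proof.
elim: ks => [|k ks [d [f [ortho sp]]]].
  by exists 0%N, (fun=> 0); split=> [[]|].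
pose k0 := k - \sum_l ip k (f l) *: f l.
have k0f l : ip k0 (f l) = 0.
  rewrite ipBl ip_suml (bigD1 l) //= big1 => [|m ml].
    by rewrite addr0 ipZl ortho eqxx mulr1 subrr.
  by rewrite ipZl ortho (negPf ml) mulr0.
have [k00|kn] := eqVneq k0 0.
  exists d, f; split=> // k'; rewrite inE => /predU1P[->|/sp//].
  by apply/eqP; rewrite -subr_eq0 -/k0 k00.
have nn : rnorm k0 != 0 by apply: contra_neq kn; exact: rnorm0_eq0.
pose u := (rnorm k0)^-1%:C *: k0.
have uf l : ip u (f l) = 0 by rewrite ipZl k0f mulr0.
have fu l : ip (f l) u = 0 by rewrite ip_conj uf conjc0.
have uu : ip u u = 1.
  by rewrite ip_normC rnormZ cmodR ger0_norm ?invr_ge0 ?rnorm_ge0 // mulVf // expr1n.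
pose g (i : 'I_d.+1) := oapp f u (unlift ord_max i).
have gl i : g (widen_ord (leqnSn d) i) = f i.
  have -> : widen_ord (leqnSn d) i = lift ord_max i by apply/val_inj/esym/lift_max.
  by rewrite /g liftK.
have gm : g ord_max = u by rewrite /g unlift_none.
have spg k' : (\sum_l ip k' (g l) *: g l) = (\sum_l ip k' (f l) *: f l) + ip k' u *: u.
  by rewrite big_ord_recr /= gm; congr (_ + _); apply: eq_bigr => l _; rewrite gl.
exists d.+1, g; split=> [l m|k'].
  rewrite /g; case: (unliftP ord_max l) => [l'|] ->; case: (unliftP ord_max m) => [m'|] -> /=.
  - by rewrite ortho (inj_eq lift_inj).
  - by rewrite fu eq_sym (negPf (neq_lift _ _)).
  - by rewrite uf (negPf (neq_lift _ _)).
  - by rewrite uu eqxx.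
rewrite inE /spans spg => /predU1P[->|/sp hk].
  have ku : ip k u *: u = k0.
    have e : ip k u = (rnorm k0)%:C.
      rewrite ipZr conjc_real -[k in ip k _](subrK (\sum_l ip k (f l) *: f l)) -/k0.
      rewrite ipDl ip_normC ip_suml big1 => [|l _].
        by rewrite addr0 -rmorphM expr2 mulKf.
      by rewrite ipZl [ip (f l) k0]ip_conj k0f conjc0 mulr0.
    by rewrite e scalerA -rmorphM mulfV // scale1r.
  by rewrite ku addrC subrK.
have -> : ip k' u = 0; last by rewrite scale0r addr0.
by rewrite [k' in ip k' _]hk ip_suml big1 // => l _; rewrite ipZl fu mulr0.
Qed.

Definition biorthogonal d (e phi : 'I_d -> K) : Prop :=
  forall l m, ip (e l) (phi m) = (l == m)%:R.

(* Adding [x = sum a_l e_l] to the quadratic form: [e_l] becomes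
   [e_l + t conj(a_l) x], where [2 t + t^2 sum |a_l|^2 = 1]. *)
Lemma dual_system_add d (e phi : 'I_d -> K) x : biorthogonal e phi -> spans e phi x ->
  exists e' phi' : 'I_d -> K, [/\ biorthogonal e' phi',
    forall k, spans e phi k -> spans e' phi' k &
    forall (L : hilbertType R) (V : bop K L),
      \sum_l rnorm (V (e' l)) ^+ 2 = \sum_l rnorm (V (e l)) ^+ 2 + rnorm (V x) ^+ 2].
Proof.
move=> bi sx; pose a l := ip x (phi l).
pose s : R := \sum_l cmod (a l) ^+ 2.
have s0 : 0 <= s by apply: sumr_ge0 => l _; exact: sqr_ge0.
have sC : s%:C = \sum_l a l * conjc (a l).
  by rewrite rmorph_sum; apply: eq_bigr => l _; rewrite /= cmod_sqr.
pose q := Num.sqrt (1 + s).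
have q2 : q ^+ 2 = 1 + s by rewrite sqr_sqrtr // addr_ge0.
have q0 : 0 <= q := sqrtr_ge0 _.
(* [t] solves [s t^2 + 2 t = 1]. Then [1 + t s = q], and the correction [c = t / q] restores
   biorthogonality. *)
pose t : R := (q + 1)^-1.
have q1 : q + 1 != 0 by rewrite gt_eqF // ltr_wpDl.
have sE : s = q ^+ 2 - 1 by rewrite q2 addrAC subrr add0r.
have ht : 2 * t + t ^+ 2 * s = 1 by rewrite sE /t; field.
have ts1 : 1 + t * s = q by rewrite sE /t; field.
have qn : q != 0 by rewrite gt_eqF // sqrtr_gt0 ltr_wpDr.
pose c : R := t / q.
have cE : t - c - c * (t * s) = 0.
  have -> : t * s = q - 1 by rewrite -ts1 addrAC subrr add0r.
  by rewrite /c; field.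
have cq : c * q = t by rewrite /c divfK.
clearbody c t.
pose psi := \sum_m a m *: phi m.
pose e' l := e l + (t%:C * conjc (a l)) *: x.
pose phi' l := phi l - (c%:C * conjc (a l)) *: psi.
have epsi l : ip (e l) psi = conjc (a l).
  rewrite ip_sumr (bigD1 l) //= big1 => [|m ml]; rewrite ipZr bi.
    by rewrite eqxx mulr1 addr0.
  by rewrite eq_sym (negPf ml) mulr0.
have xpsi : ip x psi = s%:C.
  by rewrite sC ip_sumr; apply: eq_bigr => l _; rewrite ipZr mulrC.
have rc (u v : R) : u = v -> u%:C = v%:C :> R[i] by move->.
exists e', phi'; split=> [l m|k hk|L V].
- rewrite /e' /phi' ipDl !ipBr !ipZl !ipZr bi epsi xpsi -/(a m).
  rewrite !conjcM !conjcK !conjc_real.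
  have := rc _ _ cE; rewrite !rmorphB !rmorphM rmorph0 /= => h.
  transitivity ((l == m)%:R + conjc (a l) * a m * (t%:C - c%:C - c%:C * (t%:C * s%:C))).
    by ring.
  by rewrite h mulr0 addr0.
- rewrite /spans; have kpsi : ip k psi = \sum_l conjc (a l) * ip k (phi l).
    by rewrite ip_sumr; apply: eq_bigr => l _; rewrite ipZr.
  have aE : \sum_l a l *: e' l = q%:C *: x.
    rewrite /e'; under eq_bigr do rewrite scalerDr scalerA.
    rewrite big_split /= -sx -scaler_suml -[x in x + _]scale1r -scalerDl; congr (_ *: _).
    have -> : q%:C = 1 + t%:C * s%:C by rewrite -ts1 rmorphD rmorphM.
    rewrite sC mulr_sumr; congr (_ + _).
    by apply: eq_bigr => l _; ring.
  have -> : \sum_l ip k (phi' l) *: e' l =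
     \sum_l ip k (phi l) *: e' l - (c%:C * ip k psi) *: \sum_l a l *: e' l.
    rewrite scaler_sumr -sumrB; apply: eq_bigr => l _.
    rewrite /phi' ipBr ipZr conjcM conjcK conjc_real scalerBl scalerA; congr (_ - _ *: _).
    by ring.
  rewrite aE scalerA /e'; under eq_bigr do rewrite scalerDr scalerA.
  rewrite big_split /= -hk -scaler_suml -addrA -scalerBl.
  rewrite [X in X *: x](_ : _ = 0) ?scale0r ?addr0 //.
  have -> : \sum_l ip k (phi l) * (t%:C * conjc (a l)) = t%:C * ip k psi.
    by rewrite kpsi mulr_sumr; apply: eq_bigr => l _; ring.
  by rewrite mulrAC -rmorphM cq subrr.
- under eq_bigr do rewrite /e' bopD bopZ rnormD_sqr rnormZ.
  rewrite !big_split /= -addrA; congr (_ + _).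
  have -> : \sum_l 2 * rip (V (e l)) ((t%:C * conjc (a l)) *: V x) =
      2 * t * rnorm (V x) ^+ 2.
    rewrite -mulr_sumr -mulrA; congr (2 * _).
    rewrite -rip_norm {2}sx bop_sum rip_suml mulr_sumr; apply: eq_bigr => l _.
    by rewrite bopZ /rip ipZr ipZl conjcM conjcK conjc_real -mulrA ReM.
  have -> : \sum_l (cmod (t%:C * conjc (a l)) * rnorm (V x)) ^+ 2 =
      t ^+ 2 * s * rnorm (V x) ^+ 2.
    rewrite /s mulr_sumr mulr_suml; apply: eq_bigr => l _.
    by rewrite cmodM cmodJ cmodR !exprMn real_normK ?num_real.
  by rewrite -mulrDl ht mul1r.
Qed.

(** The quadratic form given by [es] may be degenerate. An orthonormal basis scaled by [dl] makes it
    definite, after which the vectors of [es] are added one at a time. *)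
Lemma dual_system (es ks : seq K) : exists d (f : 'I_d -> K), forall dl : R, 0 < dl ->
  exists e phi : 'I_d -> K, [/\ biorthogonal e phi,
    forall k, k \in es ++ ks -> spans e phi k &
    forall (L : hilbertType R) (V : bop K L), \sum_l rnorm (V (e l)) ^+ 2 =
      \sum_(x <- es) rnorm (V x) ^+ 2 + dl ^+ 2 * \sum_l rnorm (V (f l)) ^+ 2].
Proof.
have [d [f [ortho sp]]] := onb_span (es ++ ks).
exists d, f => dl dl0; have dn : dl != 0 by rewrite gt_eqF.
suff [e [phi [bi hs hV]]] : exists e phi : 'I_d -> K, [/\ biorthogonal e phi,
    forall k, spans f f k -> spans e phi k &
    forall (L : hilbertType R) (V : bop K L), \sum_l rnorm (V (e l)) ^+ 2 =
      \sum_(x <- es) rnorm (V x) ^+ 2 + dl ^+ 2 * \sum_l rnorm (V (f l)) ^+ 2].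
  by exists e, phi; split=> // k /sp/hs.
have spe x : x \in es -> spans f f x by move=> xe; apply: sp; rewrite mem_cat xe.
elim: es {sp} spe => [|x es IH] spe.
  exists (fun l => dl%:C *: f l), (fun l => (dl^-1)%:C *: f l); split=> [l m|k hk|L V].
  - by rewrite ipZl ipZr conjc_real ortho mulrA -rmorphM mulfV // mul1r.
  - rewrite /spans {1}hk; apply: eq_bigr => l _.
    by rewrite ipZr conjc_real scalerA mulrAC -rmorphM mulVf // mul1r.
  - rewrite big_nil add0r mulr_sumr; apply: eq_bigr => l _.
    by rewrite bopZ rnormZ cmodR exprMn real_normK ?num_real.
have [|e [phi [bi hs hV]]] := IH; first by move=> y ye; apply: spe; rewrite inE ye orbT.
have sx : spans e phi x by apply/hs/spe; rewrite inE eqxx.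
have [e' [phi' [bi' hs' hV']]] := dual_system_add bi sx.
exists e', phi'; split=> // [k /hs/hs'//|L V].
by rewrite hV' hV big_cons; ring.
Qed.

End DualSystems.

(** * Tests: inequalities between Gram forms *)

Section Tests.
Variables (R : realType) (Y : zmodType) (act : R[i] -> Y -> Y) (K : hilbertType R).
Implicit Types U W L : hilbertType R.

(** The scalar action is a parameter so that adjoints, which are conjugate linear, fall under the
    same statements. *)
Definition actlin U W (s : Y -> bop U W) : Prop :=
  (forall y z, s (y + z) = s y + s z) /\ (forall c y, s (act c y) = c *: s y).

Lemma actlin0 U W (s : Y -> bop U W) : actlin s -> s 0 = 0.
Proof. by move=> [h _]; apply: (@addrI _ (s 0)); rewrite -h !addr0. Qed.
Lemma actlin_sum U W (s : Y -> bop U W) I (r : seq I) (F : I -> Y) : actlin s ->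
  s (\sum_(i <- r) F i) = \sum_(i <- r) s (F i).
Proof.
by move=> ls; apply: (big_morph s) => [y z|]; [exact: ls.1 | exact: actlin0].
Qed.

(** In other words, the assignment [s y |-> t y] is completely contractive, for rectangular matrices
    included. *)
Definition mat_dom U W U' W' (s : Y -> bop U W) (t : Y -> bop U' W') : Prop :=
  forall m n (c : R) (A : 'I_m -> 'I_n -> Y), 0 <= c ->
    mat_le c (fun i j => s (A i j) : U -> W) -> mat_le c (fun i j => t (A i j) : U' -> W').

Definition rowv U W (s : Y -> bop U W) (V : K -> U) (r : seq (Y * K)) : W :=
  \sum_(p <- r) s p.1 (V p.2).

(* Weights enter squared, so that no sign condition is needed. *)
Definition test U W (s : Y -> bop U W) (rs : seq (R * seq (Y * K))) (es : seq (R * K)) : Prop :=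
  forall V : bop K U, \sum_(r <- rs) r.1 ^+ 2 * rnorm (rowv s V r.2) ^+ 2 <=
    \sum_(e <- es) e.1 ^+ 2 * rnorm (V e.2) ^+ 2.

Fact rank1_lin U (phi : K) (xi : U) : linear (fun x => ip x phi *: xi).
Proof. by move=> a x y; rewrite ipDl ipZl scalerDl scalerA. Qed.
Fact rank1_bound U (phi : K) (xi : U) x : rnorm (ip x phi *: xi) <= rnorm phi * rnorm xi * rnorm x.
Proof.
rewrite rnormZ mulrAC [rnorm phi * _]mulrC; apply: ler_wpM2r; first exact: rnorm_ge0.
exact: ip_CS.
Qed.
Definition rank1 U (phi : K) (xi : U) : bop K U := mkbop (rank1_lin phi xi) (rank1_bound phi xi).

(** By [dual_system] the right side is, up to [e], the sum of the [rnorm (V (ee l)) ^+ 2] over a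
    biorthogonal system. The vectors [V (ee l)] are then arbitrary, and the test becomes one
    inequality for the matrix [A]. *)
Lemma test_transfer U W U' W' (s : Y -> bop U W) (t : Y -> bop U' W') rs es :
  actlin s -> actlin t -> mat_dom s t -> test s rs es -> test t rs es.
Proof.
move=> ls lt st hs V'.
pose es' := [seq e.1%:C *: e.2 | e <- es].
have esE L (V : bop K L) :
    \sum_(e <- es) e.1 ^+ 2 * rnorm (V e.2) ^+ 2 = \sum_(x <- es') rnorm (V x) ^+ 2.
  rewrite big_map; apply: eq_bigr => e _.
  by rewrite bopZ rnormZ cmodR exprMn real_normK ?num_real.
pose ks := flatten [seq [seq p.2 | p <- r.2] | r <- rs].
pose r0 : R * seq (Y * K) := (0, [::]).
have rsE L L' (u : Y -> bop L L') (V : K -> L) :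
  \sum_(r <- rs) r.1 ^+ 2 * rnorm (rowv u V r.2) ^+ 2 =
  \sum_(i < size rs) rnorm ((nth r0 rs i).1%:C *: rowv u V (nth r0 rs i).2) ^+ 2.
  rewrite (big_nth r0) big_mkord; apply: eq_bigr => i _.
  by rewrite rnormZ cmodR exprMn real_normK ?num_real.
have [d [f hf]] := dual_system es' ks.
rewrite esE; apply: (@le_eps _ _ _ (\sum_l rnorm (V' (f l)) ^+ 2)) => [|e e0].
  by apply: sumr_ge0 => l _; exact: sqr_ge0.
have se0 : 0 < Num.sqrt e by rewrite sqrtr_gt0.
have [ee [phi [bi sp hV]]] := hf _ se0.
rewrite sqr_sqrtr ?ltW // in hV; rewrite -hV.
pose A (i : 'I_(size rs)) (l : 'I_d) : Y :=
  \sum_(p <- (nth r0 rs i).2) act ((nth r0 rs i).1%:C * ip p.2 (phi l)) p.1.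
have AE L L' (u : Y -> bop L L') (V : bop K L) i : actlin u ->
    \sum_l u (A i l) (V (ee l)) = (nth r0 rs i).1%:C *: rowv u V (nth r0 rs i).2.
  move=> lu; under eq_bigr do rewrite (actlin_sum _ _ lu) bop_sumE.
  rewrite exchange_big /= scaler_sumr; apply: eq_big_seq => p pin.
  have pk : p.2 \in es' ++ ks.
    rewrite mem_cat; apply/orP; right; apply/flatten_mapP; exists (nth r0 rs i).
      exact: mem_nth.
    by apply/mapP; exists p.
  rewrite {2}(sp _ pk) !bop_sum scaler_sumr; apply: eq_bigr => l _.
  by rewrite lu.2 bop_scaleE !bopZ scalerA.
rewrite rsE; under eq_bigr do rewrite -AE //.
rewrite -[X in _ <= X]mul1r; apply: (st _ _ 1 A ler01) => xi.
pose V : bop K U := \sum_l rank1 (phi l) (xi l).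
have Ve l : V (ee l) = xi l.
  rewrite bop_sumE (bigD1 l) //= big1 => [|m ml]; rewrite bi.
    by rewrite eqxx scale1r addr0.
  by rewrite eq_sym (negPf ml) scale0r.
under eq_bigr do under eq_bigr do rewrite -Ve.
under [X in _ <= _ * X]eq_bigr do rewrite -Ve.
under eq_bigr do rewrite AE //.
rewrite mul1r -rsE hV -esE; apply: le_trans (hs V) _; rewrite lerDl.
by rewrite mulr_ge0 ?(ltW e0) // sumr_ge0 // => l _; rewrite sqr_ge0.
Qed.

Definition hrow (h : Y * K -> Y * K -> R) (r r' : seq (Y * K)) : R :=
  \sum_(p <- r) \sum_(q <- r') h p q.

(** [h] behaves like the Gram form of a completely contractive map defined on [K] itself, the
    operator [V] having been replaced by the identity. *)
Definition contractive_form (T : seq (R * seq (Y * K)) -> seq (R * K) -> Prop)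
    (h : Y * K -> Y * K -> R) : Prop :=
  forall rs es, T rs es ->
    \sum_(r <- rs) r.1 ^+ 2 * hrow h r.2 r.2 <= \sum_(e <- es) e.1 ^+ 2 * rnorm e.2 ^+ 2.

Definition gram U W (s : Y -> bop U W) (V : K -> U) (p q : Y * K) : R :=
  rip (s p.1 (V p.2)) (s q.1 (V q.2)).

(* Every linear inequality that holds between the Gram forms of [s] holds for [h]. *)
Definition inherits U W (s : Y -> bop U W) (h : Y * K -> Y * K -> R) : Prop :=
  forall l : seq (R * ((Y * K) * (Y * K))),
    (forall V : bop K U, 0 <= \sum_(c <- l) c.1 * gram s V c.2.1 c.2.2) ->
    0 <= \sum_(c <- l) c.1 * h c.2.1 c.2.2.

Lemma hrow_gram U W (s : Y -> bop U W) V r r' :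
  hrow (gram s V) r r' = rip (rowv s V r) (rowv s V r').
Proof. by rewrite rip_suml; apply: eq_bigr => p _; rewrite rip_sumr. Qed.

(* Arveson's extension theorem in disguise: Hahn-Banach on functions of [V]. *)
Lemma dominating_form U W (s : Y -> bop U W) h : contractive_form (test s) h ->
  exists h', [/\ inherits s h', contractive_form (test s) h' &
    forall r, hrow h r r <= hrow h' r r].
Proof.
move=> hcc; pose V := bop K U -> R^o.
pose wsum (es : seq (R * K)) (v : bop K U) : R := \sum_(e <- es) e.1 ^+ 2 * rnorm (v e.2) ^+ 2.
pose rsum (rs : seq (R * seq (Y * K))) (v : bop K U) : R :=
  \sum_(r <- rs) r.1 ^+ 2 * rnorm (rowv s v r.2) ^+ 2.
pose wval (es : seq (R * K)) : R := \sum_(e <- es) e.1 ^+ 2 * rnorm e.2 ^+ 2.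
pose rval (rs : seq (R * seq (Y * K))) : R := \sum_(r <- rs) r.1 ^+ 2 * hrow h r.2 r.2.
have wsum_ge0 es v : 0 <= wsum es v by apply: sumr_ge0 => e _; rewrite mulr_ge0 ?sqr_ge0.
pose D : set V := [set f | exists es, forall v, `|f v| <= wsum es v].
(* A bound [f <= wsum es - rsum rs] should force [F f <= wval es - rval rs] for the functional
   sought; [p] is the best such bound. Contractivity of [h] is what keeps it finite. *)
pose E (f : V) : set R := [set x | exists rs es, x = wval es - rval rs /\
   forall v, f v + rsum rs v <= wsum es v].
pose p (f : V) : R := inf (E f).
have lbE f es0 : (forall v, `|f v| <= wsum es0 v) -> lbound (E f) (- wval es0).
  move=> hf _ [rs [es [-> hrs]]].
  have := hcc rs (es ++ es0); rewrite -/(rval rs) big_cat /= -/(wval es) -/(wval es0).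
  suff T0 : test s rs (es ++ es0) by move=> /(_ T0); lra.
  move=> v; rewrite big_cat /= -/(wsum es v) -/(wsum es0 v) -/(rsum rs v).
  by have := hrs v; have := hf v; rewrite ler_norml => /andP[]; lra.
have p_le f rs es : D f -> (forall v, f v + rsum rs v <= wsum es v) ->
    p f <= wval es - rval rs.
  move=> [es0 hf] hh; apply: ge_inf; last by exists rs, es.
  by exists (- wval es0); exact: lbE.
have Ene f : D f -> E f !=set0.
  move=> [es0 hf]; exists (wval es0 - rval [::]), [::], es0; split=> // v.
  by rewrite /rsum big_nil addr0; exact: le_trans (ler_norm _) (hf v).
have wscale (t : R) es v : wsum [seq (t * e.1, e.2) | e <- es] v = t ^+ 2 * wsum es v.
  by rewrite /wsum big_map mulr_sumr; apply: eq_bigr => e _; rewrite /= exprMn mulrA.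
have D0 : D 0 by exists [::] => v; rewrite normr0.
have Dl (a : R) f g : D f -> D g -> D (a *: f + g).
  move=> [es hf] [es' hg].
  exists ([seq (Num.sqrt `|a| * e.1, e.2) | e <- es] ++ es') => v.
  rewrite {1}/wsum big_cat /= -/(wsum _ v) -/(wsum es' v) wscale sqr_sqrtr //.
  apply: le_trans (ler_normD _ _) _; apply: lerD (hg v).
  by rewrite -[(a *: f) v]/(a * f v) normrM ler_wpM2l.
have sub : sublinear_on D p.
  split=> [f g Df Dg|t f t0 Df].
    have DD : D (f + g) by rewrite -[f]scale1r; exact: Dl.
    suff k u v : E f u -> E g v -> p (f + g) <= u + v.
      rewrite -lerBlDr; apply: lb_le_inf; first exact: Ene.
      move=> u Eu; rewrite lerBlDr -lerBlDl; apply: lb_le_inf; first exact: Ene.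
      by move=> v Ev; rewrite lerBlDl; exact: k.
    move=> [rs [es [-> h1]]] [rs' [es' [-> h2]]].
    have -> : wval es - rval rs + (wval es' - rval rs') = wval (es ++ es') - rval (rs ++ rs').
      by rewrite /wval /rval !big_cat /=; ring.
    apply: p_le => // w; rewrite /rsum /wsum !big_cat /= -[(f + g) w]/(f w + g w).
    have := h1 w; have := h2 w; rewrite /rsum /wsum; lra.
  have half (u : R) g : 0 < u -> D g -> p (u *: g) <= u * p g.
    move=> u0 Dg; rewrite mulrC -ler_pdivrMr //; apply: lb_le_inf; first exact: Ene.
    move=> _ [rs [es [-> h1]]]; rewrite ler_pdivrMr //.
    have us : Num.sqrt u ^+ 2 = u by rewrite sqr_sqrtr // ltW.
    pose rs' := [seq (Num.sqrt u * r.1, r.2) | r <- rs].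
    pose es' := [seq (Num.sqrt u * e.1, e.2) | e <- es].
    have -> : (wval es - rval rs) * u = wval es' - rval rs'.
      rewrite /wval /rval !big_map mulrBl !mulr_suml.
      by congr (_ - _); apply: eq_bigr => e _; rewrite /= exprMn us; ring.
    apply: p_le => [|v]; first by rewrite -[_ *: _]addr0; exact: Dl.
    have -> : rsum rs' v = u * rsum rs v.
      rewrite /rsum big_map mulr_sumr; apply: eq_bigr => r _; rewrite /= exprMn us; ring.
    by rewrite wscale us -[(u *: g) v]/(u * g v) -mulrDr ler_wpM2l ?(ltW u0) ?h1.
  apply/le_anti; rewrite half //=.
  have Dsg : D (t *: f) by rewrite -[_ *: _]addr0; exact: Dl.
  have := half t^-1 (t *: f) ltac:(by rewrite invr_gt0) Dsg.
  by rewrite scalerA mulVf ?gt_eqF // scale1r mulrC ler_pdivlMr // mulrC.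
have [F [Fl Fp _]] := hahn_banach D0 Dl sub D0.
have F0 : F 0 = 0 by have := Fl (-1) 0 0 D0 D0; rewrite scaler0 addr0; lra.
have DZ (a : R) f : D f -> D (a *: f) by move=> Df; rewrite -[_ *: _]addr0; exact: Dl.
have DD f g : D f -> D g -> D (f + g) by move=> Df Dg; rewrite -[f]scale1r; exact: Dl.
have FZ (a : R) f : D f -> F (a *: f) = a * F f.
  by move=> Df; have := Fl a f 0 Df D0; rewrite !addr0 F0 addr0.
have FD f g : D f -> D g -> F (f + g) = F f + F g.
  by move=> Df Dg; have := Fl 1 f g Df Dg; rewrite scale1r mul1r.
have Dsum (I : Type) (r : seq I) (f : I -> V) :
    (forall i, D (f i)) -> D (\sum_(i <- r) f i).
  by move=> hf; elim/big_ind: _ => //; exact: DD.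
have Fsum (I : Type) (r : seq I) (f : I -> V) : (forall i, D (f i)) ->
    F (\sum_(i <- r) f i) = \sum_(i <- r) F (f i).
  move=> hf; elim: r => [|i r IH]; first by rewrite !big_nil.
  by rewrite !big_cons FD ?IH //; exact: Dsum.
have sumE (I : Type) (r : seq I) (f : I -> V) v : (\sum_(i <- r) f i) v = \sum_(i <- r) f i v.
  by apply: (big_morph (fun g : V => g v)).
pose phi (a b : Y * K) : V := fun v => gram s v a b.
have Dphi a b : D (phi a b).
  have [c c0 hc] := bop_bound (s a.1); have [c' c0' hc'] := bop_bound (s b.1).
  exists [:: (c, a.2); (c', b.2)] => v; rewrite /wsum big_cons big_seq1 /= /phi /gram.
  have h1 := hc (v a.2); have h2 := hc' (v b.2).
  have n1 := rnorm_ge0 (s a.1 (v a.2)); have n2 := rnorm_ge0 (s b.1 (v b.2)).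
  rewrite -!exprMn; have k1 := rip_CS (s a.1 (v a.2)) (s b.1 (v b.2)).
  have k2 := rip_CS (- s a.1 (v a.2)) (s b.1 (v b.2)); rewrite ripNl rnormN in k2.
  have h3 := ler_pM n1 n1 h1 h1; have h4 := ler_pM n2 n2 h2 h2.
  rewrite -!expr2 in h3 h4.
  have h5 := sqr_ge0 (rnorm (s a.1 (v a.2)) - rnorm (s b.1 (v b.2))).
  have h6 := sqr_ge0 (rnorm (s a.1 (v a.2)) + rnorm (s b.1 (v b.2))).
  by rewrite ler_norml; lra.
pose h' a b := F (phi a b).
have neg f : D f -> (forall v, f v <= 0) -> F f <= 0.
  move=> Df hf; apply: le_trans (Fp _ Df) _.
  have := p_le f [::] [::] Df; rewrite /wval /rval !big_nil subr0; apply=> v.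
  by rewrite /rsum /wsum !big_nil addr0.
have hrE r : F (fun v => rnorm (rowv s v r) ^+ 2) = hrow h' r r /\
    D (fun v => rnorm (rowv s v r) ^+ 2).
  have -> : (fun v => rnorm (rowv s v r) ^+ 2) = \sum_(a <- r) \sum_(b <- r) phi a b :> V.
    apply/funext => v; rewrite sumE -rip_norm -hrow_gram; apply: eq_bigr => a _.
    by rewrite sumE.
  split; last by apply: (Dsum _) => a; exact: Dsum.
  rewrite Fsum; last by move=> a; exact: Dsum.
  by apply: eq_bigr => a _; rewrite Fsum.
exists h'; split.
- move=> l hl.
  have -> : \sum_(c <- l) c.1 * h' c.2.1 c.2.2 = F (\sum_(c <- l) c.1 *: phi c.2.1 c.2.2).
    by rewrite Fsum; [apply: eq_bigr => c _; rewrite FZ | move=> c; exact: DZ].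
  have Dl' : D (\sum_(c <- l) c.1 *: phi c.2.1 c.2.2) by apply: Dsum => c; exact: DZ.
  rewrite -oppr_le0 -mulN1r -FZ //; apply: neg; first exact: DZ.
  move=> v; rewrite -[(-1 *: _) v]/(-1 * (\sum_(c <- l) c.1 *: phi c.2.1 c.2.2) v) mulN1r oppr_le0.
  by rewrite sumE; exact: hl.
- move=> rs es hT.
  have Dw (e : R * K) : D (fun v => rnorm (v e.2) ^+ 2).
    exists [:: (1, e.2)] => v.
    by rewrite /wsum big_seq1 /= expr1n mul1r ger0_norm ?sqr_ge0.
  have Fw (e : R * K) : F (fun v => rnorm (v e.2) ^+ 2) <= rnorm e.2 ^+ 2.
    apply: le_trans (Fp _ (Dw e)) _.
    have := p_le _ [::] [:: (1, e.2)] (Dw e).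
    rewrite /wval /rval big_nil subr0 big_seq1 /= expr1n mul1r; apply => v.
    by rewrite /rsum /wsum big_nil addr0 big_seq1 /= expr1n mul1r.
  pose g1 (r : R * seq (Y * K)) : V := fun v => rnorm (rowv s v r.2) ^+ 2.
  pose g2 (e : R * K) : V := fun v => rnorm (v e.2) ^+ 2.
  have Dg1 r : D (g1 r) := (hrE r.2).2.
  have Dg2 e : D (g2 e) := Dw e.
  pose f1 : V := \sum_(r <- rs) r.1 ^+ 2 *: g1 r.
  pose f2 : V := \sum_(e <- es) e.1 ^+ 2 *: g2 e.
  have Df1 : D f1 by apply: (Dsum _ rs (fun r => r.1 ^+ 2 *: g1 r)) => r; exact: DZ.
  have Df2 : D f2 by apply: (Dsum _ es (fun e => e.1 ^+ 2 *: g2 e)) => e; exact: DZ.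
  have e1 : F f1 = \sum_(r <- rs) r.1 ^+ 2 * hrow h' r.2 r.2.
    rewrite /f1 Fsum => [|r]; last exact: DZ.
    by apply: eq_bigr => r _; rewrite FZ // (hrE r.2).1.
  have e2 : F f2 <= \sum_(e <- es) e.1 ^+ 2 * rnorm e.2 ^+ 2.
    rewrite /f2 Fsum => [|e]; last exact: DZ.
    by apply: ler_sum => e _; rewrite FZ // ler_wpM2l ?sqr_ge0 //; exact: Fw.
  rewrite -e1; apply: le_trans e2; rewrite -subr_le0 -[- F f2]mulN1r -FZ // -FD //; last exact: DZ.
  apply: neg; first by apply: DD => //; exact: DZ.
  move=> v; rewrite -[(f1 + -1 *: f2) v]/(f1 v + -1 * f2 v) mulN1r subr_le0 /f1 /f2 !sumE.
  exact: hT v.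
(* Applied to minus the square of the row [r], the bound [F <= p] says that [h'] dominates [h] on
   that row. *)
- move=> r; have [e1 Dr] := hrE r; rewrite -e1.
  have Dnr := DZ (-1) _ Dr.
  have := Fp _ Dnr; rewrite FZ // mulN1r => h1.
  have := p_le _ [:: (1, r)] [::] Dnr.
  rewrite /wval /rval big_nil big_seq1 /= expr1n mul1r sub0r => h2.
  have h3 : p (-1 *: (fun v : bop K U => rnorm (rowv s v r) ^+ 2 : R^o)) <= - hrow h r r.
    apply: h2 => v; rewrite /rsum /wsum big_nil big_seq1 /= expr1n mul1r.
    by rewrite -[(-1 *: _) v]/(-1 * rnorm (rowv s v r) ^+ 2) mulN1r addNr.
  by have := le_trans h1 h3; rewrite lerN2.
Qed.

End Tests.

(** * A form compatible with two representations *)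

Section StableForm.
Variables (R : realType) (Y : zmodType) (act : R[i] -> Y -> Y) (K : hilbertType R).

Lemma cvg_ge0_often (u : nat -> R) l : u @ \oo --> l ->
  (forall N, exists2 n, (N <= n)%N & 0 <= u n) -> 0 <= l.
Proof.
move=> ul h; rewrite leNgt; apply/negP => l0.
have /cvgrPdist_lt/(_ (- l)) := ul; rewrite oppr_gt0 => /(_ l0)[N _ hN].
have [n Nn] := h N; have := hN n Nn; rewrite ltr_norml => /andP[]; lra.
Qed.

Lemma cvg_lin I (l : seq (R * I)) (u : nat -> I -> R) v :
  (forall i, u n i @[n --> \oo] --> v i) ->
  \sum_(c <- l) c.1 * u n c.2 @[n --> \oo] --> \sum_(c <- l) c.1 * v c.2.
Proof.
move=> h; elim: l => [|c l IH].
  under eq_fun do rewrite big_nil.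
  by rewrite big_nil; exact: cvg_cst.
under eq_fun do rewrite big_cons.
rewrite big_cons; apply: cvgD IH.
by apply: cvgM (h c.2); exact: cvg_cst.
Qed.

Lemma inherits_eq U W (s : Y -> bop U W) (h : Y * K -> Y * K -> R) l : inherits s h ->
  (forall V : bop K U, \sum_(c <- l) c.1 * gram s V c.2.1 c.2.2 = 0) ->
  \sum_(c <- l) c.1 * h c.2.1 c.2.2 = 0.
Proof.
move=> ih hl; apply/le_anti/andP; split; last by apply: ih => V; rewrite hl.
rewrite -oppr_ge0; have := ih [seq (- c.1, c.2) | c <- l]; rewrite big_map.
under eq_bigr do rewrite mulNr.
rewrite sumrN; apply => V; rewrite big_map.
by under eq_bigr do rewrite mulNr; rewrite sumrN hl oppr0.
Qed.

Lemma inherits_sym U W (s : Y -> bop U W) (h : Y * K -> Y * K -> R) a b :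
  inherits s h -> h a b = h b a.
Proof.
move=> ih; have := @inherits_eq _ _ s h [:: (1, (a, b)); (-1, (b, a))] ih.
rewrite !big_cons big_nil /= => e; apply/eqP; rewrite -subr_eq0; apply/eqP.
rewrite -[RHS]e; first by ring.
by move=> V; rewrite !big_cons big_nil /= /gram rip_sym; ring.
Qed.

Lemma hrow1 (h : Y * K -> Y * K -> R) a : hrow h [:: a] [:: a] = h a a.
Proof. by rewrite /hrow !big_seq1. Qed.
Lemma hrow2 (h : Y * K -> Y * K -> R) a b : hrow h [:: a; b] [:: a; b] =
  h a a + h a b + (h b a + h b b).
Proof. by rewrite /hrow !big_cons !big_nil !addr0. Qed.

Lemma row_test U W (s : Y -> bop U W) (r : seq (Y * K)) : exists es, test s [:: (1, r)] es.
Proof.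
pose c y : R := sval (cid2 (bop_bound (s y))).
have cP y : forall x, rnorm (s y x) <= c y * rnorm x.
  by rewrite /c; case: (cid2 _).
exists [seq (Num.sqrt (size r)%:R * c p.1, p.2) | p <- r] => V.
rewrite big_seq1 expr1n mul1r big_map /rowv.
case: r => [|p0 r]; first by rewrite !big_nil rnorm0 expr0n.
rewrite !(big_nth p0) !big_mkord; apply: le_trans (rnorm_sum_sq _) _.
rewrite mulr_sumr; apply: ler_sum => i _; rewrite /= !exprMn sqr_sqrtr // -mulrA.
apply: ler_wpM2l => //; rewrite -exprMn; apply: lerXn2r; rewrite ?nnegrE ?rnorm_ge0 //.
exact: le_trans (rnorm_ge0 _) (cP _ _).
Qed.

(* Alternating between [s] and [t], the dominating forms increase to a limit that inherits from both. *)
Lemma stable_form U W U' W' (s : Y -> bop U W) (t : Y -> bop U' W') (h0 : Y * K -> Y * K -> R) :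
  contractive_form (test s) h0 -> (forall rs es, test (K := K) s rs es <-> test t rs es) ->
  exists h, [/\ inherits s h, inherits t h, contractive_form (test s) h &
    forall r, hrow h0 r r <= hrow h r r].
Proof.
move=> cc0 st; pose F := {h : Y * K -> Y * K -> R | contractive_form (test s) h}.
have step (b : bool) (x : F) : {x' : F | (if b then inherits s (sval x') else inherits t (sval x')) /\
    forall r, hrow (sval x) r r <= hrow (sval x') r r}.
  apply: cid; case: b; case: x => h hc /=.
    by have [h' [h1 h2 h3]] := dominating_form hc; exists (exist _ h' h2).
  have hc' : contractive_form (test t) h by move=> rs es /st; exact: hc.
  have [h' [h1 h2 h3]] := dominating_form hc'.
  have h2' : contractive_form (test s) h' by move=> rs es /st; exact: h2.
  by exists (exist _ h' h2').
pose H := fix H n : F := if n is m.+1 then sval (step (odd m) (H m)) else exist _ h0 cc0.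
pose g n := sval (H n).
have gS n : (if odd n then inherits s (g n.+1) else inherits t (g n.+1)) /\
    forall r, hrow (g n) r r <= hrow (g n.+1) r r.
  by rewrite /g /=; exact: (svalP (step (odd n) (H n))).
have gc n : contractive_form (test s) (g n) by rewrite /g; exact: (svalP (H n)).
pose q r n := hrow (g n) r r.
have qm r : nondecreasing_seq (q r) by apply/nondecreasing_seqP => n; exact: (gS n).2.
have qc r : cvgn (q r).
  apply: nondecreasing_is_cvgn => //; have [es hes] := row_test s r.
  exists (\sum_(e <- es) e.1 ^+ 2 * rnorm e.2 ^+ 2) => _ [n _ <-].
  by have := gc n _ _ hes; rewrite big_seq1 expr1n mul1r.
(* The initial form [h0] is not known to inherit from either side, so symmetry is available from
   index 1 on; hence the shift in all the limits. *)
have gsym n a b : g n.+1 a b = g n.+1 b a.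
  by have [] := gS n; case: odd => ih _; exact: inherits_sym ih.
pose Q r := limn (q r).
(* The values on rows increase and are bounded; polarisation carries convergence over to every
   entry. *)
pose h a b := (Q [:: a; b] - Q [:: a] - Q [:: b]) / 2.
have hcv a b : g n.+1 a b @[n --> \oo] --> h a b.
  have -> : (fun n => g n.+1 a b) = (fun n => (q [:: a; b] n.+1 - q [:: a] n.+1 - q [:: b] n.+1) / 2).
    by apply/funext => n; rewrite /q hrow2 !hrow1 (gsym n b a); field.
  apply: cvgM; last exact: cvg_cst.
  have qS r : q r n.+1 @[n --> \oo] --> Q r by move: (qc r); rewrite -[X in X -> _]/(q r n @[n --> \oo] --> Q r) -(cvg_shiftS (q r)).
  by apply: cvgB (qS _); apply: cvgB (qS _); exact: qS.
have lincv (l : seq (R * ((Y * K) * (Y * K)))) :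
    \sum_(c <- l) c.1 * g n.+1 c.2.1 c.2.2 @[n --> \oo] --> \sum_(c <- l) c.1 * h c.2.1 c.2.2.
  by apply: (@cvg_lin _ l (fun n c => g n.+1 c.1 c.2) (fun c => h c.1 c.2)) => c; exact: hcv.
have rowcv r : hrow (g n.+1) r r @[n --> \oo] --> hrow h r r.
  have E f : hrow f r r = \sum_(c <- [seq (1, c) | c <- [seq (a, b) | a <- r, b <- r]]) (c.1 : R) * f c.2.1 c.2.2.
    by rewrite big_map big_allpairs; apply: eq_bigr => a _; apply: eq_bigr => b _; rewrite mul1r.
  by rewrite E; under eq_fun do rewrite E; exact: lincv.
exists h; split.
(* The terms [g n.+1] with [n] odd inherit from [s], those with [n] even from [t]; infinitely many
   terms suffice for the limit. *)
- move=> l hl; apply: cvg_ge0_often (lincv l) _ => N; exists N.*2.+1; first by rewrite -addnn ltnW // ltnS leq_addr.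
  by have [] := gS N.*2.+1; rewrite /= odd_double /= => ih _; exact: ih.
- move=> l hl; apply: cvg_ge0_often (lincv l) _ => N; exists N.*2; first by rewrite -addnn leq_addr.
  by have [] := gS N.*2; rewrite /= odd_double /= => ih _; exact: ih.
- move=> rs es hT; set E := \sum_(e <- es) _.
  have cv : \sum_(r <- rs) r.1 ^+ 2 * hrow (g n.+1) r.2 r.2 @[n --> \oo] -->
      \sum_(r <- rs) r.1 ^+ 2 * hrow h r.2 r.2.
    have := @cvg_lin _ [seq (r.1 ^+ 2, r.2) | r <- rs] (fun n r => hrow (g n.+1) r r)
      (fun r => hrow h r r) rowcv; rewrite big_map /=.
    by under eq_fun do rewrite big_map /=.
  have cvE : E - \sum_(r <- rs) r.1 ^+ 2 * hrow (g n.+1) r.2 r.2 @[n --> \oo] -->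
      E - \sum_(r <- rs) r.1 ^+ 2 * hrow h r.2 r.2 by apply: cvgB cv; exact: cvg_cst.
  rewrite -subr_ge0; apply: cvg_ge0_often cvE _ => N; exists N => //.
  by rewrite subr_ge0; exact: gc.
- move=> r; rewrite -subr_ge0; 
  have cvE : hrow (g n.+1) r r - hrow h0 r r @[n --> \oo] --> hrow h r r - hrow h0 r r.
    by apply: cvgB (rowcv r) _; exact: cvg_cst.
  apply: cvg_ge0_often cvE _ => N; exists N => //.
  by rewrite subr_ge0; exact: (qm r 0%N N.+1).
Qed.

End StableForm.

(** * The GNS construction and the transport of multipliers *)

Section Gns.
Variables (R : realType) (Y : zmodType) (act : R[i] -> Y -> Y) (K : hilbertType R).

Lemma rip_i (H : hilbertType R) (x y : H) : rip x ('i *: y) = - rip y ('i *: x).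
Proof. by rewrite /rip !ipZr (ip_conj x y); case: (ip x y) => a b /=; ring. Qed.

Section OneForm.
Variables (U W : hilbertType R) (s : Y -> bop U W) (ls : actlin act s).
Variables (h : Y * K -> Y * K -> R) (ih : inherits s h).

Definition mulp (c : R[i]) (p : Y * K) : Y * K := (p.1, c *: p.2).

(** [h] is a real form. Its complex extension is sesquilinear because this identity holds for all
    Gram forms of [s] and is therefore inherited. *)
Lemma form_kernel c d a b :
  complex.Re (c * conjc d * (h a b +i* h a (mulp 'i b))) = h (mulp c a) (mulp d b).
Proof.
set z := c * conjc d.
have := @inherits_eq _ _ _ _ _ s h [:: (complex.Re z, (a, b));
   (- complex.Im z, (a, mulp 'i b)); (-1, (mulp c a, mulp d b))] ih.
rewrite !big_cons big_nil /= => e; apply/eqP; rewrite -subr_eq0; apply/eqP.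
rewrite -[RHS]e; first by clear e; case: z => x y /=; ring.
move=> V; rewrite !big_cons big_nil /= /gram /= !bopZ.
set x := s _ _; set y := s _ _.
have -> : rip (c *: x) (d *: y) = complex.Re (z * ip x y).
  by rewrite /rip ipZl ipZr /z; congr complex.Re; ring.
by clear e; rewrite ip_rip; case: z => u v /=; ring.
Qed.

Lemma form_psd r : 0 <= hrow h r r.
Proof.
have E f : hrow f r r = \sum_(c <- [seq (1, c) | c <- [seq (a, b) | a <- r, b <- r]]) (c.1 : R) * f c.2.1 c.2.2.
  by rewrite big_map big_allpairs; apply: eq_bigr => a _; apply: eq_bigr => b _; rewrite mul1r.
by rewrite E; apply: ih => V; rewrite -E hrow_gram rip_norm sqr_ge0.
Qed.

Lemma gns_kernel : exists (G : hilbertType R) (e : Y * K -> G),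
  (forall c d a b, rip (c *: e a) (d *: e b) = h (mulp c a) (mulp d b)) /\ total e.
Proof.
have [|G [e [he te]]] := @kolmogorov R (Y * K)%type (fun a b => h a b +i* h a (mulp 'i b)).
  split=> [a b|l].
    rewrite (inherits_sym b a ih); congr (_ +i* _).
    have := @inherits_eq _ _ _ _ _ s h [:: (1, (b, mulp 'i a)); (1, (a, mulp 'i b))] ih.
    rewrite !big_cons big_nil /= addr0 !mul1r => e.
    apply/eqP; rewrite -addr_eq0; apply/eqP; apply: e => V.
    by rewrite !big_cons big_nil /gram /= !bopZ (rip_i (s b.1 (V b.2))); ring.
  rewrite /lc_form Re_sum; under eq_bigr do rewrite Re_sum.
  under eq_bigr do under eq_bigr do rewrite form_kernel.
  have := form_psd [seq mulp p.1 p.2 | p <- l]; rewrite /hrow big_map.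
  by under eq_bigr do rewrite big_map.
exists G, e; split=> // c d a b.
by rewrite -form_kernel /rip ipZl ipZr he; congr complex.Re; ring.
Qed.
End OneForm.

Definition rowt G (th : Y -> bop K G) (r : seq (Y * K)) : G := \sum_(p <- r) th p.1 p.2.

Lemma rowt_norm G (th : Y -> bop K G) (h : Y * K -> Y * K -> R) r :
  (forall a b, rip (th a.1 a.2) (th b.1 b.2) = h a b) -> rnorm (rowt th r) ^+ 2 = hrow h r r.
Proof.
move=> hh; rewrite -rip_norm rip_suml; apply: eq_bigr => a _.
by rewrite rip_sumr; apply: eq_bigr => b _.
Qed.

(** Linearity of [th] is inherited: a combination of rows that vanishes for every [V] has norm zero
    in the GNS space. Boundedness of [th y] is contractivity of [h] on a single entry. *)
Lemma gns (U W : hilbertType R) (s : Y -> bop U W) (h : Y * K -> Y * K -> R) :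
  actlin act s -> inherits s h -> contractive_form (test s) h ->
  exists (G : hilbertType R) (th : Y -> bop K G), [/\ actlin act th,
    forall a b, rip (th a.1 a.2) (th b.1 b.2) = h a b & total (fun p => th p.1 p.2)].
Proof.
move=> ls ih hc; have [G [e [he te]]] := gns_kernel ih.
have m1 a : mulp 1 a = a by case: a => y k; rewrite /mulp scale1r.
have e1 a b : rip (e a) (e b) = h a b.
  by rewrite -[e a]scale1r -[e b]scale1r he !m1.
have eM c a : e (mulp c a) = c *: e a.
  apply/eqP; rewrite -subr_eq0; apply/eqP; apply: rnorm0_eq0; apply/eqP; rewrite -sqrf_eq0 -rip_norm.
  have z d b : rip (e (mulp c a) - c *: e a) (d *: e b) = 0.
    by rewrite ripBl -[e (mulp c a)]scale1r !he m1 subrr.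
  by have z1 := z 1 (mulp c a); rewrite scale1r in z1; rewrite ripBr z z1 subrr.
have zero r : (forall V : bop K U, rowv s V r = 0) -> \sum_(p <- r) e p = 0.
  move=> hr; apply: rnorm0_eq0; apply/eqP; rewrite -sqrf_eq0 -rip_norm.
  have -> : rip (\sum_(p <- r) e p) (\sum_(p <- r) e p) = hrow h r r.
    by rewrite rip_suml; apply: eq_bigr => a _; rewrite rip_sumr; apply: eq_bigr.
  have E f : hrow f r r = \sum_(c <- [seq (1, c) | c <- [seq (a, b) | a <- r, b <- r]]) (c.1 : R) * f c.2.1 c.2.2.
    by rewrite big_map big_allpairs; apply: eq_bigr => a _; apply: eq_bigr => b _; rewrite mul1r.
  apply/eqP; rewrite E; apply: (inherits_eq ih) => V.
  by rewrite -E hrow_gram hr rip0l.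
have lin y : linear (fun k => e (y, k)).
  move=> a k k'; have := zero [:: (y, a *: k + k'); mulp (-1) (mulp a (y, k)); mulp (-1) (y, k')].
  rewrite !big_cons big_nil !eM addr0 !scaleN1r -opprD => hz.
  apply/eqP; rewrite -subr_eq0; apply/eqP; apply: hz => V.
  rewrite /rowv !big_cons big_nil /= !(bopD, bopZ) addr0 !scaleN1r.
  by rewrite -opprD subrr.
have bnd y : exists c : R, forall k, rnorm (e (y, k)) <= c * rnorm k.
  have [c c0 sc] := bop_bound (s y); exists c => k.
  rewrite -(@ler_pXn2r _ 2) ?nnegrE ?mulr_ge0 ?rnorm_ge0 // exprMn -rip_norm e1 -hrow1.
  have := hc [:: (1, [:: (y, k)])] [:: (c, k)]; rewrite !big_seq1 /= expr1n mul1r; apply.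
  move=> V; rewrite !big_seq1 /= expr1n mul1r /rowv big_seq1 /= -exprMn.
  by apply: lerXn2r; rewrite ?nnegrE ?mulr_ge0 ?rnorm_ge0.
pose th y : bop K G := mkbop (lin y) (svalP (cid (bnd y))).
exists G, th; split; last by move=> g hg; apply: te => -[y k]; exact: hg (y, k).
  split=> [y z|c y]; apply: bop_eq => k; rewrite ?bop_addE ?bop_scaleE /=.
    have := zero [:: (y + z, k); mulp (-1) (y, k); mulp (-1) (z, k)].
    rewrite !big_cons big_nil !eM addr0 !scaleN1r -opprD => hz.
    apply/eqP; rewrite -subr_eq0; apply/eqP; apply: hz => V.
    by rewrite /rowv !big_cons big_nil /= ls.1 bop_addE addr0 !bopZ !scaleN1r -opprD subrr.
  have := zero [:: (act c y, k); mulp (-1) (mulp c (y, k))].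
  rewrite !big_cons big_nil !eM addr0 !scaleN1r => hz.
  apply/eqP; rewrite -subr_eq0; apply/eqP; apply: hz => V.
  by rewrite /rowv !big_cons big_nil /= ls.2 bop_scaleE addr0 !bopZ scaleN1r subrr.
by move=> [y k] [z l]; exact: e1.
Qed.

(** [a] is left multiplication by an operator and [a'] by its adjoint. Right multiplications appear
    as the left pairs of the map of adjoints. *)
Definition left_pair U W (s : Y -> bop U W) (c : R) (a a' : Y -> Y) : Prop :=
  exists al : bop W W, [/\ forall x, rnorm (al x) <= c * rnorm x,
    forall y x, s (a y) x = al (s y x) & forall y x, s (a' y) x = adj al (s y x)].

Section Hats.
Variables (U W G : hilbertType R) (s : Y -> bop U W) (th : Y -> bop K G).
Variable (h : Y * K -> Y * K -> R).
Hypotheses (ih : inherits s h) (hh : forall a b, rip (th a.1 a.2) (th b.1 b.2) = h a b).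

Lemma rowt_dom r r' (c : R) : 0 <= c ->
  (forall V : bop K U, rnorm (rowv s V r) <= c * rnorm (rowv s V r')) ->
  rnorm (rowt th r) <= c * rnorm (rowt th r').
Proof.
move=> c0 hr; rewrite -(@ler_pXn2r _ 2) ?nnegrE ?mulr_ge0 ?rnorm_ge0 // exprMn.
rewrite !(rowt_norm _ hh) -subr_ge0.
have E f : c ^+ 2 * hrow f r' r' - hrow f r r =
    \sum_(x <- [seq (c ^+ 2, x) | x <- [seq (a, b) | a <- r', b <- r']] ++
               [seq (-1, x) | x <- [seq (a, b) | a <- r, b <- r]]) x.1 * f x.2.1 x.2.2.
  rewrite big_cat !big_map !big_allpairs /=; congr (_ + _).
    by rewrite /hrow mulr_sumr; apply: eq_bigr => a _; rewrite mulr_sumr.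
  by rewrite -[- hrow _ _ _]mulN1r /hrow mulr_sumr; apply: eq_bigr => a _; rewrite mulr_sumr.
rewrite E; apply: ih => V; rewrite -E !hrow_gram !rip_norm subr_ge0 -exprMn.
by apply: lerXn2r; rewrite ?nnegrE ?mulr_ge0 ?rnorm_ge0.
Qed.

(** The estimate of [al] on rows holds for every [V], hence is inherited and gives the operator on
    [G]. The adjoint relation is an identity between Gram forms and is inherited too. *)
Lemma hat_pair (c : R) a a' : total (fun p => th p.1 p.2) -> 0 <= c ->
  left_pair s c a a' -> left_pair th c a a'.
Proof.
move=> te c0 [al [alc ha ha']].
have lcE (g : Y -> Y) l : lc_val (fun p => th (g p.1) p.2) l =
    rowt th [seq (g p.2.1, p.1 *: p.2.2) | p <- l].
  by rewrite /rowt big_map; apply: eq_bigr => p _; rewrite /= bopZ.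
have [|ah [h1 h2]] := total_ext (F := fun p => th (a p.1) p.2) te c0.
  move=> l; rewrite (lcE a) (lcE id); apply: rowt_dom => // V.
  have -> : rowv s V [seq (a p.2.1, p.1 *: p.2.2) | p <- l] =
      al (rowv s V [seq (p.2.1, p.1 *: p.2.2) | p <- l]); last exact: alc.
    by rewrite /rowv !big_map bop_sum; apply: eq_bigr => p _; rewrite /= ha.
exists ah; split=> // [y x|y x]; first by rewrite (h1 (y, x)).
have rE p q : rip (th (a p.1) p.2) (th q.1 q.2) = rip (th p.1 p.2) (th (a' q.1) q.2).
  rewrite (hh (a p.1, p.2) q) (hh p (a' q.1, q.2)).
  have := @inherits_eq _ _ _ _ _ s h [:: (1, ((a p.1, p.2), q)); (-1, (p, (a' q.1, q.2)))] ih.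
  rewrite !big_cons big_nil /= addr0 mul1r mulN1r => e; apply/eqP; rewrite -subr_eq0; apply/eqP.
  apply: e => V; rewrite !big_cons big_nil /gram /= addr0 mul1r mulN1r ha ha' /rip adjP; exact: subrr.
have iE p q : ip (th (a p.1) p.2) (th q.1 q.2) = ip (th p.1 p.2) (th (a' q.1) q.2).
  rewrite !ip_rip rE; congr (_ +i* _).
  by rewrite -!bopZ; exact: (rE p (q.1, 'i *: q.2)).
apply/eqP; rewrite -subr_eq0; apply/eqP; apply: te => p; rewrite ipBl adjPr h1.
by rewrite [X in X - _]ip_conj -(iE p (y, x)) -ip_conj subrr.
Qed.

Lemma gns_mat_dom : contractive_form (test s) h -> mat_dom s th.
Proof.
move=> hc m n c A c0 hA xi.
have := hc [seq (1, [seq (A i j, xi j) | j <- index_enum 'I_n]) | i <- index_enum 'I_m]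
   [seq (Num.sqrt c, xi j) | j <- index_enum 'I_n].
rewrite !big_map /=.
have -> : \sum_(i < m) 1 ^+ 2 * hrow h [seq (A i j, xi j) | j <- index_enum 'I_n]
     [seq (A i j, xi j) | j <- index_enum 'I_n] = \sum_i rnorm (\sum_j th (A i j) (xi j)) ^+ 2.
  apply: eq_bigr => i _; rewrite expr1n mul1r -(rowt_norm _ hh) /rowt big_map /=.
  by [].
move=> h1; rewrite mulr_sumr.
under [X in _ <= X]eq_bigr do rewrite -[c in c * _](sqr_sqrtr c0).
apply: h1 => V; rewrite !big_map /=.
have := hA (fun j => V (xi j)); rewrite mulr_sumr.
under [X in _ <= X]eq_bigr do rewrite -[c in c * _](sqr_sqrtr c0).
apply: le_trans; rewrite le_eqVlt; apply/orP; left; apply/eqP.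
apply: eq_bigr => i _.
by rewrite expr1n mul1r /rowv big_map.
Qed.

End Hats.
End Gns.

(** Models the closed span of [f] as a Hilbert space of its own; [J] is the isometric inclusion. *)
Lemma compress_total (R : realType) (T : Type) (H : hilbertType R) (f : T -> H) :
  exists (G : hilbertType R) (e : T -> G) (J : bop G H),
    [/\ total e, forall x, J (e x) = f x, forall x, rnorm (J x) <= rnorm x &
        forall x, adj J (J x) = x].
Proof.
have formE s : lc_form (fun x y => ip (f x) (f y)) s s = ip (lc_val f s) (lc_val f s).
  rewrite ip_suml; apply: eq_bigr => p _; rewrite ip_sumr; apply: eq_bigr => q _.
  by rewrite ipZl ipZr; ring.
have [|G [e [he te]]] := @kolmogorov R T (fun x y => ip (f x) (f y)).
  split=> [x y|s]; first by rewrite -ip_conj.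
  by rewrite formE -/(rip _ _) rip_norm sqr_ge0.
have [|J [Je Jn]] := total_ext (F := f) te ler01.
  move=> s; rewrite mul1r -(@ler_pXn2r _ 2) ?nnegrE ?rnorm_ge0 // -!rip_norm /rip -formE.
  rewrite [ip (lc_val e s) _]ip_suml /lc_form !Re_sum; apply: ler_sum => p _.
  rewrite ip_sumr !Re_sum; apply: ler_sum => q _.
  by rewrite ipZl ipZr he; have -> : p.1 * conjc q.1 * ip (f p.2) (f q.2) =
    p.1 * (conjc q.1 * ip (f p.2) (f q.2)) by ring.
exists G, e, J; split=> // x; first by rewrite -[X in _ <= X]mul1r.
suff /(congr1 (fun T : bop G G => T x)) : bop_comp (adj J) J = bop_id G by [].
apply: (bop_eq_total te) => a; rewrite bop_compE bop_idE Je.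
apply/eqP; rewrite -subr_eq0; apply/eqP; apply: te => b.
by rewrite ipBl adjPr Je he subrr.
Qed.

(** * One pass of the construction, with the cut to good vectors *)

Section Cut.
Variables (R : realType) (Y : zmodType) (act : R[i] -> Y -> Y) (K : hilbertType R).

Lemma left_pair_sym U W (s : Y -> bop U W) (c : R) a a' : 0 <= c ->
  left_pair s c a a' -> left_pair s c a' a.
Proof.
move=> c0 [al [h1 h2 h3]]; exists (adj al); split=> //; first exact: adj_bound.
by move=> y x; rewrite adjK h2.
Qed.

Lemma mat_dom_comp U W G G' (s : Y -> bop U W) (th : Y -> bop K G) (T : bop G G') :
  (forall x, rnorm (T x) <= rnorm x) -> mat_dom s th -> mat_dom s (fun y => bop_comp T (th y)).
Proof.
move=> hT hs m n c A c0 hA xi; apply: le_trans (hs m n c A c0 hA xi).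
apply: ler_sum => i _; apply: lerXn2r; rewrite ?nnegrE ?rnorm_ge0 //.
by under eq_bigr do rewrite bop_compE; rewrite -bop_sum.
Qed.

Variables (U W U' W' B : hilbertType R).
Variables (s : Y -> bop U W) (t : Y -> bop U' W') (b : Y -> bop K B).
Hypotheses (ls : actlin act s) (lt : actlin act t) (lb : actlin act b).
Hypotheses (st : mat_dom s t) (ts : mat_dom t s) (sb : mat_dom s b).

(** The pass starts from the Gram form of [b]. The stable form dominates it on rows, and this is
    what makes the contraction [C] back to [b] exist. *)
Lemma gns_stage : exists (G : hilbertType R) (th : Y -> bop K G) (C : bop G B),
  [/\ actlin act th, mat_dom s th, total (fun p => th p.1 p.2),
   forall (c : R) a a', 0 <= c -> left_pair s c a a' \/ left_pair t c a a' -> left_pair th c a a' &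
   (forall x, rnorm (C x) <= rnorm x) /\ forall y k, C (th y k) = b y k].
Proof.
pose h0 (p q : Y * K) := rip (b p.1 p.2) (b q.1 q.2).
have cc0 : contractive_form (test s) h0.
  move=> rs es /(test_transfer ls lb sb)/(_ (bop_id K)).
  by under eq_bigr do rewrite -rip_norm -hrow_gram.
have [|h [is_ it hc hh]] := stable_form cc0 (t := t).
  by move=> rs es; split; [exact: test_transfer ls lt st | exact: test_transfer lt ls ts].
have [G [th [lth thh te]]] := gns ls is_ hc.
have [|C [Ce Cn]] := total_ext (F := fun p : Y * K => b p.1 p.2) te ler01.
  move=> l; rewrite mul1r -(@ler_pXn2r _ 2) ?nnegrE ?rnorm_ge0 //.
  pose r := [seq (p.2.1, p.1 *: p.2.2) | p <- l].
  have := hh r; rewrite -(rowt_norm r thh).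
  have -> : hrow h0 r r = rnorm (rowt b r) ^+ 2 by rewrite (rowt_norm (h := h0)).
  rewrite /rowt !big_map /lc_val.
  by under eq_bigr do rewrite bopZ; under [X in _ <= rnorm X ^+ 2]eq_bigr do rewrite bopZ.
exists G, th, C; split=> //; first exact: gns_mat_dom thh hc.
  by move=> c a a' c0 [hs|ht]; [have := hat_pair is_ thh te c0 => hp | have := hat_pair it thh te c0 => hp]; exact: hp.
split=> [x|y k]; last exact: (Ce (y, k)).
by rewrite -[X in _ <= X]mul1r.
Qed.

Variables (N : Y -> R) (Pf : (Y -> K -> R[i]) -> Prop).
Hypotheses (N0 : forall y, 0 <= N y) (sN : forall y x, rnorm (s y x) <= N y * rnorm x).
Hypothesis PfL : forall c f g, Pf f -> Pf g -> Pf (fun y k => c * f y k + g y k).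
Hypothesis Pflim : forall f, (forall e : R, 0 < e -> exists2 g, Pf g &
  forall y k, cmod (f y k - g y k) <= e * (N y * rnorm k)) -> Pf f.
Hypothesis Pfa : forall (c : R) a a' f, 0 <= c -> left_pair s c a a' \/ left_pair t c a a' ->
  Pf f -> Pf (fun y k => f (a y) k).
Hypothesis Pfb : forall h, Pf (fun y k => ip (b y k) h).

(** [Pf] collects the properties wanted of the functionals of the new map. The vectors with such
    functionals form a closed subspace [S], invariant under the multipliers and their adjoints, so
    its projection commutes with them. By [Pfb] it contains the range of [adj C]; hence [C] still
    recovers [b]. *)
Lemma gns_stage_cut : exists (G : hilbertType R) (th : Y -> bop K G) (C : bop G B),
  [/\ actlin act th, mat_dom s th, total (fun p => th p.1 p.2),
   forall (c : R) a a', 0 <= c -> left_pair s c a a' \/ left_pair t c a a' -> left_pair th c a a' &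
   [/\ forall x, Pf (fun y k => ip (th y k) x),
    forall x, rnorm (C x) <= rnorm x & forall y k, C (th y k) = b y k]].
Proof.
have [G [th [C [lth sth te hats [Cn Cb]]]]] := gns_stage.
have thN y k : rnorm (th y k) <= N y * rnorm k.
  have := sth 1%N 1%N (N y ^+ 2) (fun _ _ => y); rewrite sqr_ge0 => /(_ isT).
  have h1 : mat_le (N y ^+ 2) (fun _ _ : 'I_1 => s y : U -> W).
    move=> xi; rewrite !big_ord1 -exprMn.
    by apply: lerXn2r; rewrite ?nnegrE ?mulr_ge0 ?rnorm_ge0.
  move=> /(_ h1 (fun _ => k)); rewrite !big_ord1 -exprMn.
  by rewrite ler_pXn2r ?nnegrE ?mulr_ge0 ?rnorm_ge0.
pose S := [set x | Pf (fun y k => ip (th y k) x)].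
have cS : closed_subspace S.
  split=> [|a x y Sx Sy|x hx]; rewrite /S /=.
  - have := Pfb 0; congr Pf; apply/funext => y; apply/funext => k; by rewrite !ip0r.
  - have := PfL (conjc a) Sx Sy; congr Pf; apply/funext => z; apply/funext => k.
    by rewrite ipDr ipZr.
  - apply: Pflim => e /hx[y Sy xy]; exists (fun z k => ip (th z k) y) => // z k.
    rewrite -ipBr; apply: le_trans (ip_CS _ _) _; rewrite mulrC.
    by apply: ler_pM; rewrite ?rnorm_ge0 // ltW.
have [P [PS Pid Psa Pn]] := projection_exists cS.
have pairS c a a' (c0 : 0 <= c) (h : left_pair s c a a' \/ left_pair t c a a') (al : bop G G) :
    (forall y x, th (a y) x = adj al (th y x)) -> forall x, S x -> S (al x).
  move=> ha x Sx; have := Pfa c0 h Sx; rewrite /S /=; congr Pf.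
  by apply/funext => y; apply/funext => k; rewrite ha adjPr.
have [G' [e [J [te' Je Jn JJ]]]] := compress_total (fun p : Y * K => P (th p.1 p.2)).
have Jn' x : rnorm (adj J x) <= rnorm x.
  by rewrite -[X in _ <= X]mul1r; apply: adj_bound => // z; rewrite mul1r.
pose T := bop_comp (adj J) P.
pose th' y := bop_comp T (th y).
have thE y k : th' y k = e (y, k) by rewrite /th' /T !bop_compE -(Je (y, k)) JJ.
have CP x : C (P x) = C x.
  apply: ip_inj => z; rewrite !adjP -[in RHS](Pid (adj C z)).
    by rewrite Psa.
  by have := Pfb z; rewrite /S /=; congr Pf; apply/funext => y; apply/funext => k; rewrite -adjP Cb.
exists G', th', (bop_comp C J); split.
- split=> [y z|c y]; apply: bop_eq => k; rewrite ?bop_addE ?bop_scaleE /th' !bop_compE.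
    by rewrite lth.1 bop_addE !bopD.
  by rewrite lth.2 bop_scaleE !bopZ.
- apply: mat_dom_comp sth => x; rewrite bop_compE.
  exact: le_trans (Jn' _) (Pn _).
- by move=> g hg; apply: te' => -[y k]; rewrite -thE; exact: hg (y, k).
- move=> c a a' c0 h; have [al [alc ha ha']] := hats c a a' c0 h.
  have h' : left_pair s c a' a \/ left_pair t c a' a.
    by case: h => h; [left | right]; exact: left_pair_sym.
  have S1 := pairS _ _ _ c0 h' _ ha'.
  have S2 x : S x -> S (adj al x).
    by apply: (pairS _ _ _ c0 h) => y z; rewrite adjK.
  have com (be : bop G G) : (forall x, S x -> S (be x)) -> (forall x, S x -> S (adj be x)) ->
      forall x, P (be x) = be (P x).
    move=> s1 s2 x; rewrite -[RHS]Pid; last exact: s1.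
    by apply: ip_inj => z; rewrite !adjP !Psa [in RHS]Pid //; exact: s2.
  exists (bop_comp (adj J) (bop_comp al J)); split=> [x|y k|y k].
  + by rewrite !bop_compE; apply: le_trans (Jn' _) _; apply: le_trans (alc _) _; rewrite ler_wpM2l.
  + by rewrite [th' y k]thE [RHS]bop_compE [bop_comp al J _]bop_compE Je /= -com // -ha.
  + rewrite !adj_comp adjK [th' y k]thE [RHS]bop_compE [bop_comp (adj J) (adj al) _]bop_compE.
    by rewrite Je /= -com ?adjK // -ha'.
- split=> [x|x|y k].
  + have := PS (J x); rewrite /S /=; congr Pf; apply/funext => y; apply/funext => k.
    by rewrite [RHS]adjPr [RHS]adjP Psa.
  + by rewrite bop_compE; exact: le_trans (Cn _) (Jn _).
  + by rewrite bop_compE thE Je CP Cb.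
Qed.

End Cut.

Lemma cmod_i (R : realType) : cmod ('i : R[i]) = 1.
Proof.
apply/eqP; rewrite -(@eqrXn2 _ 2) ?cmod_ge0 // -Re_mulJ /= expr1n; apply/eqP; ring.
Qed.

(** * Cayley transforms of self-adjoint multipliers *)

Section NormBy.
Variables (R : realType) (Y : zmodType) (act : R[i] -> Y -> Y) (N : Y -> R).

Definition norm_by U W (s : Y -> bop U W) : Prop :=
  [/\ forall y, 0 <= N y, forall y x, rnorm (s y x) <= N y * rnorm x &
    forall y c, 0 <= c -> (forall x, rnorm (s y x) <= c * rnorm x) -> N y <= c].

Definition complete_by : Prop := forall u : nat -> Y,
  (forall e, 0 < e -> exists n0, forall m n, (n0 <= m)%N -> (n0 <= n)%N -> N (u m - u n) < e) ->
  exists x, forall e, 0 < e -> exists n0, forall n, (n0 <= n)%N -> N (u n - x) < e.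

Variables (U W : hilbertType R) (s : Y -> bop U W).
Hypotheses (ls : actlin act s) (ns : norm_by s) (injs : injective s).

Lemma actlinN y : s (- y) = - s y.
Proof. by apply/eqP; rewrite -addr_eq0 -ls.1 addNr (actlin0 ls). Qed.
Lemma actlinB y z : s (y - z) = s y - s z.
Proof. by rewrite ls.1 actlinN. Qed.
Lemma normbyD y z : N (y + z) <= N y + N z.
Proof.
have [n0 nl nm] := ns; apply: nm; rewrite ?addr_ge0 // => x.
by rewrite ls.1 bop_addE; apply: le_trans (rnormD _ _) _; rewrite mulrDl lerD.
Qed.
Lemma normbyN y : N (- y) = N y.
Proof.
have [n0 nl nm] := ns; apply/le_anti/andP; split; apply: nm => // x.
  by rewrite actlinN bop_oppE rnormN.
by rewrite -[s y]opprK -actlinN bop_oppE rnormN.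
Qed.
Lemma normby0 y : N y <= 0 -> y = 0.
Proof.
move=> h; have [n0 nl nm] := ns; apply: injs; rewrite (actlin0 ls); apply: bop_eq => x.
apply: rnorm0_eq0; apply/le_anti; rewrite rnorm_ge0 andbT; apply: le_trans (nl y x) _.
by rewrite mulr_le0_ge0 // rnorm_ge0.
Qed.

Section Pair.
Variables (c : R) (a : Y -> Y) (al : bop W W).
Hypotheses (c0 : 0 <= c) (alc : forall x, rnorm (al x) <= c * rnorm x)
  (ha : forall y x, s (a y) x = al (s y x)).

Lemma left_additive y z : a (y + z) = a y + a z.
Proof. by apply: injs; apply: bop_eq => x; rewrite ls.1 bop_addE !ha ls.1 bop_addE bopD. Qed.
Lemma left_sub y z : a (y - z) = a y - a z.
Proof. by apply: injs; apply: bop_eq => x; rewrite actlinB bop_subE !ha actlinB bop_subE bopB. Qed.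
Lemma left_act d y : a (act d y) = act d (a y).
Proof. by apply: injs; apply: bop_eq => x; rewrite ls.2 bop_scaleE !ha ls.2 bop_scaleE bopZ. Qed.

Hypothesis cN : complete_by.

(** The inverse of [1 + d a] is needed on [Y] itself, not only on [W]. It is the limit of
    [u (n + 1) = y - d a (u n)], a contraction with factor [1 / 2] for the complete norm [N]. *)
Lemma neumann (d : R[i]) : cmod d * c <= 1 / 2 -> exists J : Y -> Y,
  (forall y, J y + act d (a (J y)) = y) /\ (forall y, J (y + act d (a y)) = y).
Proof.
move=> dc; pose B y := act d (a y).
have BB y z : B (y - z) = B y - B z.
  by apply: injs; rewrite actlinB /B !ls.2 left_sub actlinB scalerBr.
have [n0 nl nm] := ns.
have NB y : N (B y) <= N y / 2.
  apply: nm => [|x]; first by rewrite divr_ge0.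
  rewrite /B ls.2 bop_scaleE rnormZ ha.
  apply: le_trans (ler_wpM2l (cmod_ge0 _) (alc _)) _.
  rewrite mulrA; apply: le_trans (ler_wpM2r (rnorm_ge0 _) dc) _.
  by have := nl y x; nra.
have uniq y z : y + B y = z + B z -> y = z.
  move=> e; apply/eqP; rewrite -subr_eq0; apply/eqP; apply: normby0.
  have h : y - z = - B (y - z).
    apply: (@addIr _ (z + B y)); rewrite BB opprB addrA subrK e.
    by rewrite [z + B y]addrC addrA subrK addrC.
  have := NB (y - z); rewrite -normbyN -h; lra.
have ex y : {z | z + B z = y}.
  apply: cid; pose u := fix u n := if n is m.+1 then y - B (u m) else 0.
  have ub n : N (u n) <= 2 * N y.
    elim: n => [|n IH] /=.
      apply: (@le_trans _ _ 0); last by rewrite mulr_ge0.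
      by apply: nm => // x; rewrite (actlin0 ls) bop_zeroE rnorm0 mul0r.
    have := normbyD y (- B (u n)); rewrite normbyN; have := NB (u n); lra.
  have ud n k : N (u (n + k)%N - u n) <= (1 / 2) ^+ n * (2 * N y).
    elim: n => [|n IH]; first by rewrite expr0 mul1r add0n subr0.
    rewrite addSn /= [y - _]addrC addrKA -opprD.
    have -> : - (B (u (n + k)%N) - B (u n)) = - B (u (n + k)%N - u n) by rewrite BB.
    rewrite normbyN; apply: le_trans (NB _) _; rewrite exprS; lra.
  have small e : 0 < e -> exists n1, (1 / 2) ^+ n1 * (2 * N y) < e.
    move=> e0; have y0 : 0 < 2 * N y + 1 by have := n0 y; lra.
    have := @cvg_expr R (1 / 2) ltac:(by rewrite ger0_norm //; lra).
    move=> /cvgrPdist_lt/(_ (e / (2 * N y + 1))); rewrite divr_gt0 // => /(_ isT)[n1 _ hn].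
    exists n1; have := hn n1 (leqnn n1); rewrite sub0r normrN ger0_norm ?exprn_ge0 //.
    rewrite ltr_pdivlMr // => h; apply: le_lt_trans h.
    by rewrite ler_wpM2l ?exprn_ge0 //; lra.
  have [|z hz] := cN (u := u).
    move=> e e0; have [n1 hn] := small (e / 2) ltac:(by rewrite divr_gt0); exists n1 => m n nm' nn.
    have h1 := ud n1 (m - n1)%N; have h2 := ud n1 (n - n1)%N; rewrite !subnKC // in h1 h2.
    have -> : u m - u n = (u m - u n1) - (u n - u n1) by rewrite opprB addrA subrK.
    apply: le_lt_trans (normbyD _ _) _; rewrite normbyN; lra.
  exists z; apply/eqP; rewrite -subr_eq0; apply/eqP; apply: normby0.
  rewrite leNgt; apply/negP => e0.
  have [n1 h1] := hz (N (z + B z - y) / 4) ltac:(by rewrite divr_gt0).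
  have h2 := h1 n1 (leqnn _); have h3 := h1 n1.+1 (leqnSn _).
  have E : z + B z - y = - (u n1.+1 - z) - B (u n1 - z).
    apply: (@addIr _ y); rewrite subrK /= BB !opprB -!addrA; congr (_ + _).
    by rewrite [- B _ + y]addrC [B z + _]addrCA addKr addrCA addrN addr0.
  have := normbyD (- (u n1.+1 - z)) (- B (u n1 - z)); rewrite -E !normbyN.
  have := NB (u n1 - z); lra.
exists (fun y => sval (ex y)); split=> y; first exact: (svalP (ex y)).
by apply: uniq; exact: (svalP (ex _)).
Qed.

(* [u = 2 (1 + i t a)^-1 - 1] is the Cayley transform of [t a]. *)
Lemma cayley (t : R) : adj al = al -> `|t| * c <= 1 / 2 -> exists (J u u' : Y -> Y),
  [/\ forall y, u y = J y + J y - y, forall y, J (y + act ('i * t%:C) (a y)) = y /\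
        J y + act ('i * t%:C) (a (J y)) = y,
    cancel u u' /\ cancel u' u, {morph u : y z / y + z} &
    (forall n (y : 'I_n -> Y) x, rnorm (\sum_j s (u (y j)) (x j)) = rnorm (\sum_j s (y j) (x j))) /\
    (forall n (y : 'I_n -> Y) x, rnorm (\sum_j s (u' (y j)) (x j)) = rnorm (\sum_j s (y j) (x j)))].
Proof.
move=> sa tc.
have ci (r : R) : cmod ('i * r%:C) = `|r| by rewrite cmodM cmodR cmod_i mul1r.
have [J [J1 J2]] := neumann (d := 'i * t%:C) ltac:(by rewrite ci).
have [K [K1 K2]] := neumann (d := 'i * (- t)%:C) ltac:(by rewrite ci normrN).
have actN y : act ('i * (- t)%:C) y = - act ('i * t%:C) y.
  by apply: injs; rewrite actlinN !ls.2 -scaleNr rmorphN mulrN.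
pose B y := act ('i * t%:C) (a y).
pose u y := J y + J y - y; pose u' y := K y + K y - y.
have uE z : u (z + B z) = z - B z.
  by rewrite /u J2 opprD addrA [z + z - z]addrK.
have u'E z : u' (z - B z) = z + B z.
  have K2' : K (z - B z) = z by rewrite -[RHS]K2 actN.
  by rewrite /u' K2' opprB addrC addrA subrK addrC.
have JB y : J y + B (J y) = y := J1 y.
have KB y : K y - B (K y) = y by rewrite /B -actN.
have BD y z : B (y + z) = B y + B z.
  by apply: injs; rewrite /B !(ls.1, ls.2, left_additive) scalerDr.
have JD y z : J (y + z) = J y + J z.
  by rewrite -[in LHS](JB y) -[in LHS](JB z) addrACA -BD J2.
(* For self-adjoint [al] the operator [i t al] is skew, so [1 + i t al] and [1 - i t al] stretch
   each vector equally; therefore [u] preserves the norms of rows. *)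
have skew x : rnorm (x + ('i * t%:C) *: al x) = rnorm (x - ('i * t%:C) *: al x).
  apply/eqP; rewrite -(@eqrXn2 _ 2) ?rnorm_ge0 //; apply/eqP.
  rewrite rnormD_sqr rnormB_sqr.
  suff -> : rip x (('i * t%:C) *: al x) = 0 by ring.
  have h : ip x (al x) = conjc (ip x (al x)) by rewrite -[RHS]ip_conj adjP sa.
  rewrite /rip ipZr; move: h; case: (ip x (al x)) => p q [] hq /=.
  have -> : q = 0 by lra.
  by ring.
have sB n (z : 'I_n -> Y) x : \sum_j s (B (z j)) (x j) = ('i * t%:C) *: al (\sum_j s (z j) (x j)).
  by rewrite bop_sum scaler_sumr; apply: eq_bigr => j _; rewrite ls.2 bop_scaleE ha.
exists J, u, u'; split=> //.
- split=> y; first by rewrite -{1}(JB y) uE u'E JB.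
  by rewrite -{1}(KB y) u'E uE KB.
- move=> y z; rewrite /u JD opprD [RHS]addrACA; congr (_ + _); exact: addrACA.
- split=> n y x.
    under eq_bigr do rewrite -(JB (y _)) uE actlinB bop_subE.
    under [in RHS]eq_bigr do rewrite -(JB (y _)) ls.1 bop_addE.
    by rewrite sumrB big_split /= sB skew.
  under eq_bigr do rewrite -(KB (y _)) u'E ls.1 bop_addE.
  under [in RHS]eq_bigr do rewrite -(KB (y _)) actlinB bop_subE.
  by rewrite sumrB big_split /= sB skew.
Qed.

End Pair.
End NormBy.

(** * Commutation of left and right multiplications *)

Section Commute.
Variables (R : realType) (Y : lmodType R[i]) (L1 L2 K1 K2 : hilbertType R) (N : Y -> R).
Variables (sg : Y -> bop L1 L2) (rh : Y -> bop K1 K2).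

Definition sact (c : R[i]) (y : Y) : Y := c *: y.
Definition cact (c : R[i]) (y : Y) : Y := conjc c *: y.
Definition cadj (U W : hilbertType R) (s : Y -> bop U W) (y : Y) : bop W U := adj (s y).

Lemma actlin_cadj U W (s : Y -> bop U W) : actlin sact s -> actlin cact (cadj s).
Proof. by move=> [h1 h2]; split=> [y z|c y]; rewrite /cadj ?h1 ?adjD // h2 adjZ conjcK. Qed.
Lemma norm_by_cadj U W (s : Y -> bop U W) : norm_by N s -> norm_by N (cadj s).
Proof.
move=> [h0 h1 h2]; split=> // [y x|y c c0 h]; first exact: adj_bound.
by apply: h2 => // x; rewrite -[s y]adjK; exact: adj_bound.
Qed.

Hypotheses (ls : actlin sact sg) (lr : actlin sact rh) (ns : norm_by N sg) (nr : norm_by N rh).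
Hypotheses (injs : injective sg) (injr : injective rh) (cN : complete_by N).
Hypotheses (sr : mat_dom sg rh) (rs : mat_dom rh sg).

Let P (c : R) (A : 'I_2 -> 'I_2 -> Y) := mat_le c (fun i j => sg (A i j) : L1 -> L2).
Let mx2 (a b d e : Y) (i j : 'I_2) : Y :=
  if i == ord0 then (if j == ord0 then a else b) else (if j == ord0 then d else e).

Definition rowiso (U W : hilbertType R) (s : Y -> bop U W) (u : Y -> Y) : Prop := forall n (y : 'I_n -> Y) x,
  rnorm (\sum_j s (u (y j)) (x j)) = rnorm (\sum_j s (y j) (x j)).

Lemma rowiso_mat U W (s : Y -> bop U W) u c A : rowiso s u ->
  mat_le c (fun i j : 'I_2 => s (A i j) : U -> W) ->
  mat_le c (fun i j : 'I_2 => s (if i == ord0 then u (A i j) else A i j) : U -> W).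
Proof.
move=> hu h xi; apply: le_trans (h xi); apply: ler_sum => i _.
by case: eqP => // _; rewrite hu.
Qed.

Let row_step u c a b d e : rowiso sg u -> P c (mx2 a b d e) -> P c (mx2 (u a) (u b) d e).
Proof.
move=> hu /(rowiso_mat hu) h xi; apply: le_trans (h xi); apply: ler_sum => i _.
rewrite le_eqVlt; apply/orP; left; apply/eqP; congr (rnorm _ ^+ 2); apply: eq_bigr => j _.
by rewrite /mx2; case: (i == _); case: (j == _).
Qed.

(** A column is a row of the adjoint matrix; mutual domination allows the passage from [sg] to [rh]
    and back. *)
Let col_step v c a b d e : 0 <= c -> rowiso (cadj rh) v ->
  P c (mx2 a b d e) -> P c (mx2 (v a) b (v d) e).
Proof.
move=> c0 hv /(sr c0)/(mat_le_adj c0) h.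
have h1 := @rowiso_mat _ _ (cadj rh) v c (fun j i => mx2 a b d e i j) hv h.
have h2 := @mat_le_adj _ _ _ _ _ c _ c0 h1.
have h3 : mat_le c (fun i j => rh (mx2 (v a) b (v d) e i j) : K1 -> K2).
  move=> xi; apply: le_trans (h2 xi); apply: ler_sum => i _.
  under [in X in _ <= X]eq_bigr do rewrite /cadj adjK.
  rewrite le_eqVlt; apply/orP; left; apply/eqP; congr (rnorm _ ^+ 2); apply: eq_bigr => j _.
  by rewrite /mx2; case: (i == _); case: (j == _).
exact: rs c0 h3.
Qed.

Let P2 c a b d e x y : P c (mx2 a b d e) ->
  rnorm (sg a x + sg b y) ^+ 2 + rnorm (sg d x + sg e y) ^+ 2 <= c * (rnorm x ^+ 2 + rnorm y ^+ 2).
Proof.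
by move=> /(_ (fun j => if j == ord0 then x else y)); rewrite !big_ord_recl !big_ord0 /= !addr0.
Qed.

(** The four factors of the commutator [w] are applied in turn to the first column and the first
    row: the entries beside the corner return to their values, and only the corner is changed, by
    [w]. So [w] can be iterated in the corner of the matrix with rows [(d, d)] and [(d, - d)], where
    [d = w y - y], under one fixed bound. This pins [w^n d] near [d]; hence [w^M y - y] grows like
    [M d], against the bound [2 N y]. *)
Lemma comm_unitary (u u' v v' : Y -> Y) : rowiso sg u -> rowiso sg u' ->
  rowiso (cadj rh) v -> rowiso (cadj rh) v' -> cancel u' u -> cancel v' v ->
  {morph u : y z / y + z} -> {morph u' : y z / y + z} ->
  {morph v : y z / y + z} -> {morph v' : y z / y + z} ->
  forall y, u (v (u' (v' y))) = y.
Proof.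
move=> hu hu' hv hv' uK vK uD u'D vD v'D y.
pose w y := u (v (u' (v' y))).
have [N0 Nl Nm] := ns.
have wD a b : w (a + b) = w a + w b by rewrite /w v'D u'D vD uD.
have iso1 U W (s : Y -> bop U W) f z : norm_by N s -> rowiso s f -> N (f z) <= N z.
  move=> [h0 h1 h2] hf; apply: h2 => // x.
  by have := hf 1%N (fun _ => z) (fun _ => x); rewrite !big_ord1 => ->.
have nt := norm_by_cadj nr.
have wN z : N (w z) <= N z.
  apply: le_trans (iso1 _ _ _ _ _ ns hu) _; apply: le_trans (iso1 _ _ _ _ _ nt hv) _.
  by apply: le_trans (iso1 _ _ _ _ _ ns hu') _; exact: iso1 nt hv'.
have iN n z : N (iter n w z) <= N z.
  by elim: n => //= n IH; exact: le_trans (wN _) IH.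
have iD n a b : iter n w (a + b) = iter n w a + iter n w b.
  by elim: n => //= n ->; exact: wD.
have step c a b d e : 0 <= c -> P c (mx2 a b d e) -> P c (mx2 (w a) b d e).
  move=> c0 /(col_step c0 hv')/(row_step hu')/(col_step c0 hv)/(row_step hu).
  by rewrite uK vK.
have iterP n d : P (2 * N d ^+ 2) (mx2 (iter n w d) d d (- d)).
  elim: n => [|n IH] /=; last by apply: step => //; rewrite mulr_ge0 ?sqr_ge0.
  move=> xi; rewrite !big_ord_recl !big_ord0 /mx2 /= !addr0 (actlinN ls) bop_oppE.
  set x := xi _; set z := xi _.
  rewrite rnormD_sqr rnormB_sqr.
  have e1 : rnorm (sg d x) ^+ 2 <= N d ^+ 2 * rnorm x ^+ 2.
    by rewrite -exprMn; apply: lerXn2r; rewrite ?nnegrE ?mulr_ge0 ?rnorm_ge0.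
  have e2 : rnorm (sg d z) ^+ 2 <= N d ^+ 2 * rnorm z ^+ 2.
    by rewrite -exprMn; apply: lerXn2r; rewrite ?nnegrE ?mulr_ge0 ?rnorm_ge0.
  lra.
pose d := w y - y; apply/eqP; rewrite -subr_eq0; apply/eqP; rewrite -/(w y) -/d.
apply: (normby0 ls ns injs); rewrite leNgt; apply/negP => d0.
(* On the vector [(l, - l)] the matrix bound leaves the corner a squared error of at most
   [4 (1 - (127/128)^2) <= 1/16], that is [N d / 4] per step; and [127/128 - 1/4] exceeds [1/2]. *)
pose q := 127 / 128 * N d.
have [l hl] : exists l, q * rnorm l < rnorm (sg d l).
  apply: contrapT => /forallNP h; have : N d <= q.
    by apply: Nm => [|x]; [rewrite /q; lra | rewrite leNgt; apply/negP; exact: h].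
  rewrite /q; lra.
have l0 : 0 < rnorm l.
  rewrite lt_neqAle rnorm_ge0 andbT eq_sym; apply/eqP => e.
  by move: hl; rewrite (rnorm0_eq0 e) bop0 !rnorm0 mulr0 ltxx.
have hn n : rnorm (sg (iter n w d) l - sg d l) <= N d / 4 * rnorm l.
  have := P2 l (- l) (iterP n d); rewrite (actlinN ls) bop_oppE !bopN opprK.
  rewrite rnormN [rnorm (sg d l + _) ^+ 2]rnormD_sqr rip_norm => h.
  rewrite -(@ler_pXn2r _ 2) ?nnegrE ?mulr_ge0 ?rnorm_ge0 ?(ltW d0) // exprMn.
  have : q ^+ 2 * rnorm l ^+ 2 <= rnorm (sg d l) ^+ 2.
    have q0 : 0 <= q by rewrite /q; lra.
    rewrite -exprMn; apply: lerXn2r; rewrite ?nnegrE ?rnorm_ge0 //; last exact: ltW.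
    by rewrite mulr_ge0 ?rnorm_ge0.
  rewrite /q => h'; have := mulr_ge0 (sqr_ge0 (N d)) (sqr_ge0 (rnorm l)).
  move: h h'; move: (rnorm _ ^+ 2) (rnorm (sg d l) ^+ 2) => A B.
  by rewrite !exprMn !expr2; move: (N d * N d) (rnorm l * rnorm l) => C E; lra.
have hM M : rnorm (sg (iter M w y - y) l - M%:R%:C *: sg d l) <= M%:R * (N d / 4 * rnorm l).
  elim: M => [|M IH]; first by rewrite /= subrr (actlin0 ls) bop_zeroE scale0r subrr rnorm0 mul0r.
  have -> : iter M.+1 w y - y = (iter M w y - y) + iter M w d.
    rewrite iterSr addrAC -iD /d; congr (iter M w _ - y).
    by rewrite addrC subrK.
  rewrite ls.1 bop_addE -natr1 rmorphD scalerDl scale1r opprD addrACA mulrDl mul1r.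
  by apply: le_trans (rnormD _ _) _; apply: lerD.
have fin M : M%:R * (N d / 2) <= 2 * N y.
  have h1 : rnorm (sg (iter M w y - y) l) <= 2 * N y * rnorm l.
    apply: le_trans (Nl _ _) _; apply: ler_wpM2r; first exact: rnorm_ge0.
    have := normbyD ls ns (iter M w y) (- y); rewrite (normbyN ls ns); have := iN M y; lra.
  have h2 : M%:R * rnorm (sg d l) <= 2 * N y * rnorm l + M%:R * (N d / 4 * rnorm l).
    rewrite -[M%:R](@ger0_norm R) // -cmodR -rnormZ cmodR [`|_|]ger0_norm //.
    set z := (_ *: _); rewrite -[z](subrK (sg (iter M w y - y) l)).
    by apply: le_trans (rnormD _ _) _; rewrite rnormBC addrC; apply: lerD => //; exact: hM.
  have h3 : M%:R * (q * rnorm l) <= M%:R * rnorm (sg d l) by rewrite ler_wpM2l // ltW.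
  have h4 := le_trans h3 h2; rewrite -(ler_pM2r l0).
  have := mulr_ge0 (mulr_ge0 (ler0n R M) (ltW d0)) (ltW l0).
  by move: h4; rewrite /q; lra.
have d2 : 0 < N d / 2 by rewrite divr_gt0.
have := fin (Num.bound (2 * N y / (N d / 2))); rewrite leNgt => /negP; apply.
by rewrite -ltr_pdivrMr //; apply: archi_boundP; rewrite divr_ge0 ?(ltW d2) // mulr_ge0.
Qed.

Lemma dbl_inj (y z : Y) : y + y = z + z -> y = z.
Proof.
move=> e; have : (2%:R : R[i]) *: y = 2%:R *: z by rewrite !scaler_nat !mulr2n.
by apply: scalerI; rewrite pnatr_eq0.
Qed.

(** A Cayley transform determines its generator: [B y + u (B y) = y - u y], and [z |-> z + u z] is
    injective, being twice the resolvent [J]. So commuting transforms have commuting generators. *)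
Lemma comm_selfadj (c c' : R) (a b : Y -> Y) (al : bop L2 L2) (be : bop K1 K1) :
  0 <= c -> 0 <= c' -> (forall x, rnorm (al x) <= c * rnorm x) ->
  (forall x, rnorm (be x) <= c' * rnorm x) -> adj al = al -> adj be = be ->
  (forall y x, sg (a y) x = al (sg y x)) -> (forall y x, cadj rh (b y) x = be (cadj rh y x)) ->
  forall y, a (b y) = b (a y).
Proof.
move=> c0 c'0 alc bec sal sbe ha hb.
have lt := actlin_cadj lr; have nt := norm_by_cadj nr.
have injt : injective (cadj rh).
  by move=> y z h; apply: injr; rewrite -[rh y]adjK -[rh z]adjK; congr adj; exact: h.
(* Small enough for both Cayley transforms at once. *)
pose r := 1 / (2 * (c + c' + 1)); have r0 : 0 < r by rewrite divr_gt0 // mulr_gt0 //; lra.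
have rc e : 0 <= e <= c + c' -> `|r| * e <= 1 / 2.
  move=> /andP[e0 ee]; rewrite gtr0_norm // /r -mulrA ler_pM2l // mulrC ler_pdivrMr; lra.
have [J [u [u' [uE Ju [uK uK'] uD [hu hu']]]]] :=
  cayley ls ns injs alc ha cN sal (t := r) ltac:(by apply: rc; rewrite c0 lerDl).
have [Q [v [v' [vE Qv [vK vK'] vD [hv hv']]]]] :=
  cayley lt nt injt bec hb cN sbe (t := r) ltac:(by apply: rc; rewrite c'0 lerDr).
have morphK (f g : Y -> Y) : cancel f g -> cancel g f -> {morph f : y z / y + z} -> {morph g : y z / y + z}.
  by move=> fK gK fD y z; apply: (can_inj fK); rewrite fD !gK.
have u'D := morphK _ _ uK uK' uD; have v'D := morphK _ _ vK vK' vD.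
have uv z : u (v z) = v (u z).
  by rewrite -[RHS](comm_unitary hu hu' hv hv' uK' vK' uD u'D vD v'D) vK uK.
pose B y := sact ('i * r%:C) (a y); pose B' y := cact ('i * r%:C) (b y).
have subE (f : Y -> Y) y z : {morph f : y z / y + z} -> f (y - z) = f y - f z.
  by move=> fD; apply: (@addIr _ (f z)); rewrite -fD !subrK.
have gen (f J' D : Y -> Y) : (forall y, f y = J' y + J' y - y) -> (forall y, J' (y + D y) = y) ->
    {morph f : y z / y + z} -> (forall y, J' (y + D y) = y /\ D y + f (D y) = y - f y).
  move=> fE JD fD y; split=> //; apply: (@addIr _ (f y)); rewrite subrK -addrA -fD.
  by rewrite [D y + y]addrC fE JD addrC opprD addrA subrK addrK.
have injp (f J' : Y -> Y) (D : Y -> Y) : (forall y, f y = J' y + J' y - y) ->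
    (forall y, J' y + D (J' y) = y) -> injective (fun z => z + f z).
  move=> fE JD y z; rewrite /= !fE ![_ + (_ - _)]addrC !subrK => /dbl_inj e.
  by rewrite -(JD y) e JD.
have Ju2 y : J y + B (J y) = y.
  by have [_] := Ju y.
have Qv2 y : Q y + B' (Q y) = y.
  by have [_] := Qv y.
have Ju1 y : J (y + B y) = y by have [] := Ju y.
have Qv1 y : Q (y + B' y) = y by have [] := Qv y.
have BD : {morph B : y z / y + z}.
  by move=> y z; rewrite /B (left_additive ls injs ha) /sact scalerDr.
have vB z : v (B z) = B (v z).
  apply: (injp u J B uE Ju2); rewrite /= uv -vD (gen u J B uE Ju1 uD z).2.
  by rewrite (gen u J B uE Ju1 uD (v z)).2 subE // uv.
have BB z : B (B' z) = B' (B z).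
  apply: (injp v Q B' vE Qv2); rewrite /= vB -BD (gen v Q B' vE Qv1 vD z).2.
  by rewrite (gen v Q B' vE Qv1 vD (B z)).2 subE // vB.
move=> y; have := BB y; rewrite /B /B' /cact.
have aZ k z : a (k *: z) = k *: a z := left_act ls injs ha k z.
have bZ k z : b (k *: z) = k *: b z.
  by have := left_act lt injt hb (conjc k) z; rewrite /cact conjcK.
rewrite /sact aZ bZ !scalerA mulrC => /scalerI; apply.
have z0 : 'i * r%:C != 0 by apply/eqP => /(congr1 (@complex.Im R)) /=; lra.
by rewrite mulf_neq0 ?conjc_eq0.
Qed.

Theorem left_right_commute (c c' : R) (a a' b b' : Y -> Y) : 0 <= c -> 0 <= c' ->
  left_pair sg c a a' -> left_pair (cadj rh) c' b b' -> forall y, a (b y) = b (a y).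
Proof.
move=> c0 c'0 [al [alc ha ha']] [be [bec hb hb']].
have lt := actlin_cadj lr; have nt := norm_by_cadj nr.
have injt : injective (cadj rh).
  by move=> y z h; apply: injr; rewrite -[rh y]adjK -[rh z]adjK; congr adj; exact: h.
(* [i2 = 1 / (2 i)], so that [i2 (T - adj T)] is the self-adjoint imaginary part of [T]. *)
pose i2 : R[i] := - (1 / 2)%:C * 'i.
have split_pair U W (act : R[i] -> Y -> Y) (s : Y -> bop U W) (f f' : Y -> Y) (T : bop W W) (d : R) :
    actlin act s -> injective s -> 0 <= d -> (forall x, rnorm (T x) <= d * rnorm x) ->
    (forall y x, s (f y) x = T (s y x)) -> (forall y x, s (f' y) x = adj T (s y x)) ->
    exists (T1 T2 : bop W W) (f1 f2 : Y -> Y),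
      [/\ adj T1 = T1 /\ adj T2 = T2,
       (forall x, rnorm (T1 x) <= d * rnorm x) /\ (forall x, rnorm (T2 x) <= d * rnorm x),
       (forall y x, s (f1 y) x = T1 (s y x)) /\ (forall y x, s (f2 y) x = T2 (s y x)) &
       forall y, f y = f1 y + act 'i (f2 y)].
  move=> lS iS d0 hT hf hf'; have hT' := adj_bound d0 hT.
  have ci2 : conjc i2 = - i2.
    by rewrite /i2 conjcM conjcN conjc_real /=; congr (_ +i* _); ring.
  have cm : cmod i2 = 1 / 2.
    by rewrite /i2 cmodM cmodN cmodR cmod_i mulr1 ger0_norm ?divr_ge0.
  pose T1 : bop W W := (1 / 2)%:C *: (T + adj T); pose T2 : bop W W := i2 *: (T - adj T).
  pose f1 y := act (1 / 2)%:C (f y + f' y); pose f2 y := act i2 (f y - f' y).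
  exists T1, T2, f1, f2; rewrite /T1 /T2 /f1 /f2; split.
  - split; first by rewrite adjZ adjD adjK conjc_real addrC.
    have adjN : adj (- adj T) = - T by rewrite -scaleN1r adjZ adjK conjcN conjc1 scaleN1r.
    by rewrite adjZ ci2 adjD adjN scaleNr -scalerN opprD opprK addrC.
  - split=> x; rewrite bop_scaleE rnormZ ?cm ?cmodR; last first.
      have := rnormD (T x) (- adj T x); rewrite rnormN => h; have h1 := hT x; have h2 := hT' x.
      by rewrite bop_subE; lra.
    rewrite ger0_norm ?divr_ge0 //; have h := rnormD (T x) (adj T x); have h1 := hT x; have h2 := hT' x.
    by rewrite bop_addE; lra.
  - split=> y x; rewrite lS.2 !bop_scaleE; first by rewrite lS.1 !bop_addE hf hf'.
    by rewrite (actlinB lS) !bop_subE hf hf'.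
  - move=> y; apply: iS; rewrite lS.1 !lS.2 lS.1 (actlinB lS) scalerA.
    have -> : 'i * i2 = (1 / 2)%:C :> R[i] by rewrite /i2 /=; congr (_ +i* _); ring.
    rewrite -scalerDr addrACA subrr addr0 -mulr2n -(scaler_nat 2 (s (f y))) scalerA.
    have -> : (1 / 2)%:C * 2%:R = 1 :> R[i] by rewrite -(rmorph_nat (real_complex R)) -rmorphM /=; congr (_ %:C); field.
    by rewrite scale1r.
have [A1 [A2 [a1 [a2 [[sA1 sA2] [cA1 cA2] [hA1 hA2] aE]]]]] := split_pair _ _ _ _ _ _ _ _ ls injs c0 alc ha ha'.
have [B1 [B2 [b1 [b2 [[sB1 sB2] [cB1 cB2] [hB1 hB2] bE]]]]] := split_pair _ _ _ _ _ _ _ _ lt injt c'0 bec hb hb'.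
have k11 := comm_selfadj c0 c'0 cA1 cB1 sA1 sB1 hA1 hB1.
have k12 := comm_selfadj c0 c'0 cA1 cB2 sA1 sB2 hA1 hB2.
have k21 := comm_selfadj c0 c'0 cA2 cB1 sA2 sB1 hA2 hB1.
have k22 := comm_selfadj c0 c'0 cA2 cB2 sA2 sB2 hA2 hB2.
have aZ (f : Y -> Y) (T : bop L2 L2) (h : forall y x, sg (f y) x = T (sg y x)) k z : f (k *: z) = k *: f z := left_act ls injs h k z.
have bZ (f : Y -> Y) (T : bop K1 K1) (h : forall y x, cadj rh (f y) x = T (cadj rh y x)) k z : f (k *: z) = k *: f z.
  by have := left_act lt injt h (conjc k) z; rewrite /cact conjcK.
move=> y; rewrite !aE !bE /sact /cact.
rewrite !(left_additive ls injs hA1) !(left_additive ls injs hA2).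
rewrite !(left_additive lt injt hB1) !(left_additive lt injt hB2).
rewrite !(aZ _ _ hA1) !(aZ _ _ hA2) !(bZ _ _ hB1) !(bZ _ _ hB2) k11 k12 k21 k22.
rewrite !scalerDr !scalerA [conjc _ * _]mulrC -!addrA; congr (_ + _).
by rewrite addrCA.
Qed.

End Commute.

(** * Complete isometries and w*-continuity of multipliers *)

Section CompleteIsometries.
Variable R : realType.
Implicit Types Y : wMxNormedType R.

Lemma linear_actlin (Y : lmodType R[i]) U W (s : Y -> bop U W) : linear s -> actlin (@sact R Y) s.
Proof.
move=> ls; have D y z : s (y + z) = s y + s z by have := ls 1 y z; rewrite !scale1r.
split=> // c y; have := ls c y 0; rewrite /sact !addr0 => ->.
by rewrite -[RHS]addr0; congr (_ + _); apply: (@addIr _ (s 0)); rewrite -D !add0r.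
Qed.

(** Complete isometry speaks of square matrices; padding with zeros brings in the rectangular
    ones. *)
Lemma block_mat_le (Y : lmodType R[i]) U W (s : Y -> bop U W) m n (c : R) (A : 'I_m -> 'I_n -> Y) :
  s 0 = 0 -> 0 <= c ->
  mat_le c (fun i j => s (A i j) : U -> W) <->
  mat_le c (fun i j => s (block_mx (0 : 'M[Y]_(m, m)) (\matrix_(i, j) A i j) (0 : 'M[Y]_(n, m)) (0 : 'M[Y]_(n, n)) i j) : U -> W).
Proof.
move=> s0 c0; set B := block_mx _ _ _ _.
have E (xi : 'I_(m + n) -> U) : \sum_i rnorm (\sum_j s (B i j) (xi j)) ^+ 2 =
    \sum_i rnorm (\sum_j s (A i j) (xi (rshift m j))) ^+ 2.
  rewrite big_split_ord /= [X in _ + X]big1 ?addr0 => [|i _]; last first.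
    rewrite big1 ?rnorm0 ?expr0n // => j _.
    rewrite -[j]splitK; case: (fintype.split j) => k /=.
      by rewrite block_mxEdl mxE s0 bop_zeroE.
    by rewrite block_mxEdr mxE s0 bop_zeroE.
  apply: eq_bigr => i _; rewrite big_split_ord /= big1 ?add0r => [|j _]; last first.
    by rewrite block_mxEul mxE s0 bop_zeroE.
  by congr (rnorm _ ^+ 2); apply: eq_bigr => j _; rewrite block_mxEur mxE.
split=> h xi.
  rewrite E; apply: le_trans (h _) _; apply: ler_wpM2l => //.
  by rewrite [X in _ <= X]big_split_ord /= lerDr sumr_ge0 // => i _; exact: sqr_ge0.
have := h (fun k => if fintype.split k is inr j then xi j else 0); rewrite E big_split_ord /=.
have Er j : fintype.split (rshift m j) = inr j :> 'I_m + 'I_n := unsplitK (inr j).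
have El j : fintype.split (lshift n j) = inl j :> 'I_m + 'I_n := unsplitK (inl j).
under eq_bigr do under eq_bigr do rewrite Er.
rewrite [X in c * (X + _)]big1 ?add0r => [|j _]; last by rewrite El rnorm0 expr0n.
by under [X in c * X]eq_bigr do rewrite Er.
Qed.

Lemma complete_isometry_mat_dom (Y : mxNormedType R) U W U' W' (s : Y -> bop U W)
  (t : Y -> bop U' W') : complete_isometry s -> complete_isometry t -> mat_dom s t.
Proof.
move=> [ls ns] [lt nt] m n c A c0.
have s0 := actlin0 (linear_actlin ls); have t0 := actlin0 (linear_actlin lt).
move=> /(block_mat_le _ s0 c0) h; apply/(block_mat_le _ t0 c0); move: h.
set B := block_mx _ _ _ _ => h.
have cE : c = Num.sqrt c ^+ 2 by rewrite sqr_sqrtr.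
have hB : mxnorm (map_mx s B) <= Num.sqrt c.
  apply: mxnorm_bop_le; rewrite ?sqrtr_ge0 // -cE => xi.
  by under eq_bigr do under eq_bigr do rewrite mxE; exact: h.
have := mxnorm_bop_ub (map_mx t B); rewrite nt -ns => h2 xi; have := h2 xi.
under eq_bigr do under eq_bigr do rewrite mxE.
move=> /le_trans; apply; apply: ler_wpM2r; first by apply: sumr_ge0 => j _; exact: sqr_ge0.
by rewrite cE; apply: lerXn2r; rewrite ?nnegrE ?sqrtr_ge0 ?mxnorm_bop_ge0.
Qed.

Lemma complete_isometry_norm_by (Y : mxNormedType R) U W (s : Y -> bop U W) : complete_isometry s ->
  norm_by (@mxnorm1 R Y) s.
Proof.
move=> cs; have E y := isometry_mxnorm1 y cs.
split=> [y|y x|y c c0 h]; rewrite -E; [exact: mxnorm1_bop_ge0 | exact: mxnorm1_bop_ub |].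
exact: mxnorm1_bop_le.
Qed.

Lemma complete_isometry_inj (Y : mxNormedType R) U W (s : Y -> bop U W) : complete_isometry s ->
  (forall y : Y, mxnorm1 y = 0 -> y = 0) -> injective s.
Proof.
move=> cs h y z e; apply/eqP; rewrite -subr_eq0; apply/eqP; apply: h.
rewrite -(isometry_mxnorm1 _ cs) (actlinB (linear_actlin cs.1)) e subrr.
by apply/le_anti; rewrite mxnorm1_bop_ge0 andbT; apply: mxnorm1_bop_le => // x; rewrite bop_zeroE rnorm0 mul0r.
Qed.

(** Write [f] as a normal functional of [s]. Composition with [a] moves [adj al] onto the second
    sequence, which stays square summable. *)
Lemma wfun_left Y U W (s : Y -> bop U W) (c : R) a a' f : dualized Y ->
  complete_isometry s -> continuous s -> left_pair s c a a' -> wfun f -> wfun (fun y => f (a y)).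
Proof.
move=> dY cs ws [al [_ ha _]] wf; have [D0 _ _] := dY; have [t t0 ft] := D0 f wf.
have sN y := isometry_mxnorm1 y cs.
have ft1 : fbounded f (t + 1).
  move=> y; apply: le_trans (ft y) _; rewrite ler_wpM2r ?lerDl //.
  by rewrite -sN mxnorm1_bop_ge0.
have [|xi [eta [hx he fE]]] := normal_rep dY cs.1 sN ws wf _ ft1; first lra.
have [M hM] := sq_bounded_bop (adj al) he.
have := nlim_wfun cs.1 ws hx hM; congr wfun; apply/funext => y.
by rewrite fE -(nlim_comp al (bop_id U)); congr nlim; apply: bop_eq => x; rewrite ha.
Qed.

Lemma wfun_right Y U W (s : Y -> bop U W) (c : R) a a' f : dualized Y ->
  complete_isometry s -> continuous s -> left_pair (cadj s) c a a' -> wfun f -> wfun (fun y => f (a y)).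
Proof.
move=> dY cs ws [al [_ ha _]] wf; have [D0 _ _] := dY; have [t t0 ft] := D0 f wf.
have sN y := isometry_mxnorm1 y cs.
have ft1 : fbounded f (t + 1).
  move=> y; apply: le_trans (ft y) _; rewrite ler_wpM2r ?lerDl //.
  by rewrite -sN mxnorm1_bop_ge0.
have [|xi [eta [hx he fE]]] := normal_rep dY cs.1 sN ws wf _ ft1; first lra.
have [M hM] := sq_bounded_bop (adj al) hx.
have := nlim_wfun cs.1 ws hM he; congr wfun; apply/funext => y.
rewrite fE; have -> : s (a y) = bop_comp (bop_id W) (bop_comp (s y) (adj al)).
  have -> : s (a y) = adj (cadj s (a y)) by rewrite /cadj adjK.
  have -> : cadj s (a y) = bop_comp al (adj (s y)) by apply: bop_eq => x; rewrite ha.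
  by rewrite adj_comp adjK; exact: bop_eq.
by rewrite nlim_comp adj_id.
Qed.

(** The series of a normal functional converges in norm as a functional on [Y], and w*-continuous
    functionals are closed under norm limits; so vector functionals suffice. *)
Lemma normal_continuous Y U W (s : Y -> bop U W) : dualized Y -> linear s ->
  (forall y : Y, 0 <= mxnorm1 y) -> (forall y x, rnorm (s y x) <= mxnorm1 y * rnorm x) ->
  (forall x h, wfun (fun y => ip (s y x) h)) -> continuous s.
Proof.
move=> [_ D1 _] ls n0 sb sw; apply: continuous_bop => xi eta M M' hM hM'.
suff [] : wfun (fun y => nlim xi eta (s y)) by [].
apply: D1 => [a y z|e e0]; first by rewrite ls (nlimP _ _ _ hM hM').
have [N1 h1] := sq_tail hM e0; have [N2 h2] := sq_tail hM' e0; pose n := maxn N1 N2.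
exists (fun y => nsum xi eta (s y) n).
  rewrite /nsum; elim: n => [|k IH].
    by have := wfun0 Y; congr wfun; apply/funext => y; rewrite big_ord0.
  have := wfunZD 1 (sw (xi k) (eta k)) IH; congr wfun; apply/funext => y.
  by rewrite big_ord_recr /= mul1r addrC.
move=> y; apply: (@le_eps _ _ _ 1) => // d d0; rewrite mulr1.
have [N3 h3] := nlim_cvg (s y) hM hM' d0.
have := h3 (maxn n N3) (leq_maxr _ _); have := nsum_tail xi eta (n0 y) (sb y) (leq_maxl n N3).
set m := maxn n N3 => t1 t2.
have t3 : mxnorm1 y / 2 * (\sum_(n <= i < m) rnorm (xi i) ^+ 2 + \sum_(n <= i < m) rnorm (eta i) ^+ 2)
    <= e * mxnorm1 y.
  have a1 := h1 n m (leq_maxl _ _); have a2 := h2 n m (leq_maxr _ _).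
  have -> : e * mxnorm1 y = mxnorm1 y / 2 * (e + e) by field.
  by apply: ler_wpM2l; rewrite ?divr_ge0 // lerD // ltW.
have -> : nlim xi eta (s y) - nsum xi eta (s y) n =
   (nlim xi eta (s y) - nsum xi eta (s y) m) + (nsum xi eta (s y) m - nsum xi eta (s y) n) by ring.
apply: le_trans (cmodD _ _) _; move: t2; rewrite -cmodN opprB; lra.
Qed.

End CompleteIsometries.

(** * The common normal representation *)

Section Representation.
Variables (R : realType) (Y : wMxNormedType R) (L1 L2 K1 K2 : hilbertType R).
Variables (sg : Y -> bop L1 L2) (rh : Y -> bop K1 K2).
Hypotheses (dY : dualized Y) (cY : complete_by (@mxnorm1 R Y)) (n0 : forall y : Y, mxnorm1 y = 0 -> y = 0).
Hypotheses (csg : complete_isometry sg) (crh : complete_isometry rh).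
Hypotheses (wsg : continuous sg) (wrh : continuous rh).

Definition left_multiplier (c : R) (a a' : Y -> Y) := left_pair sg c a a' \/ left_pair rh c a a'.
Definition right_multiplier (c : R) (a a' : Y -> Y) :=
  left_pair (cadj sg) c a a' \/ left_pair (cadj rh) c a a'.

Lemma mat_dom_cadj (U W U' W' : hilbertType R) (s : Y -> bop U W) (t : Y -> bop U' W') :
  mat_dom s t -> mat_dom (cadj s) (cadj t).
Proof.
move=> st m n c A c0 /(mat_le_adj c0) h.
apply: (@mat_le_adj _ _ _ _ _ c (fun j i => t (A i j)) c0).
apply: st => // xi; have := h xi.
by under eq_bigr do under eq_bigr do rewrite /cadj adjK.
Qed.

Lemma cadjK (U W : hilbertType R) (s : Y -> bop U W) y : cadj (cadj s) y = s y.
Proof. exact: adjK. Qed.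

Lemma actlin_cadj_cact (U W : hilbertType R) (s : Y -> bop U W) :
  actlin (@cact R Y) s -> actlin (@sact R Y) (cadj s).
Proof.
move=> [h1 h2]; split=> [y z|c y]; rewrite /cadj ?h1 ?adjD //.
by have := h2 (conjc c) y; rewrite /cact conjcK => ->; rewrite adjZ conjcK.
Qed.

Theorem representation : exists (G1 G2 : hilbertType R) (ta : Y -> bop G1 G2),
  [/\ actlin (@sact R Y) ta, mat_dom sg ta, mat_dom ta sg, continuous ta &
  [/\ forall g, (forall y, ta y g = 0) -> g = 0,
    forall x, (forall y g, ip (ta y g) x = 0) -> x = 0,
    forall (c : R) a a', 0 <= c -> left_multiplier c a a' -> left_pair ta c a a' &
    forall (c : R) a a', 0 <= c -> right_multiplier c a a' -> left_pair (cadj ta) c a a']].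
Proof.
have ls := linear_actlin csg.1; have lr := linear_actlin crh.1.
have ns := complete_isometry_norm_by csg; have nr := complete_isometry_norm_by crh.
have is_ := complete_isometry_inj csg n0; have ir := complete_isometry_inj crh n0.
have sr := complete_isometry_mat_dom csg crh; have rs := complete_isometry_mat_dom crh csg.
have ss : mat_dom sg sg by []; have rr : mat_dom rh rh by [].
have [N0 Nl Nm] := ns; have [D0 D1 D2] := dY.
have comm (c c' : R) a a' b b' : 0 <= c -> 0 <= c' -> left_multiplier c a a' ->
    right_multiplier c' b b' -> forall y, a (b y) = b (a y).
  move=> c0 c'0 [ha|ha] [hb|hb].
  - exact: (left_right_commute ls ls ns ns is_ is_ cY ss ss c0 c'0 ha hb).
  - exact: (left_right_commute ls lr ns nr is_ ir cY sr rs c0 c'0 ha hb).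
  - exact: (left_right_commute lr ls nr ns ir is_ cY rs sr c0 c'0 ha hb).
  - exact: (left_right_commute lr lr nr nr ir ir cY rr rr c0 c'0 ha hb).
have D1' (T : Type) (N : T -> R) (f : Y -> R[i]) k : 0 <= k ->
    (forall e : R, 0 < e -> exists2 g, wfun g & forall y, cmod (f y - g y) <= e * (mxnorm1 y * k)) -> wfun f.
  move=> k0 h; apply: D1 => [a y z|e e0].
    apply/eqP; rewrite -subr_eq0; apply/eqP/cmod0_eq0/le_anti; rewrite cmod_ge0 andbT.
    pose Q := mxnorm1 (a *: y + z) * k + (cmod a * (mxnorm1 y * k) + mxnorm1 z * k).
    apply: (@le_eps _ _ _ Q) => [|e e0].
      by rewrite /Q !addr_ge0 // ?mulr_ge0 ?cmod_ge0.
    have [g [lg _] hg] := h e e0; rewrite add0r /Q.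
    have h1 := hg (a *: y + z); have h2 := hg y; have h3 := hg z.
    have -> : f (a *: y + z) - (a * f y + f z) =
      (f (a *: y + z) - g (a *: y + z)) + (- (a * (f y - g y)) + - (f z - g z)) by rewrite lg; ring.
    apply: le_trans (cmodD _ _) _; rewrite [e * _]mulrDr; apply: lerD => //.
    apply: le_trans (cmodD _ _) _; rewrite !cmodN cmodM [e * _]mulrDr; apply: lerD => //.
    by rewrite mulrCA; apply: ler_wpM2l => //; exact: cmod_ge0.
  have k1 : 0 < k + 1 by lra.
  have [g wg hg] := h (e / (k + 1)) ltac:(by rewrite divr_gt0); exists g => // y.
  apply: le_trans (hg y) _; have -> : e / (k + 1) * (mxnorm1 y * k) = e * mxnorm1 y * (k / (k + 1)) by ring.
  rewrite -[X in _ <= X]mulr1; apply: ler_wpM2l; first by rewrite mulr_ge0 // ltW.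
  by rewrite ler_pdivrMr // mul1r; lra.
(* First pass, starting from [rh]: w*-continuity is the property to be kept. *)
pose P1 (f : Y -> K1 -> R[i]) := forall k, wfun (fun y => f y k).
have P1L c f g : P1 f -> P1 g -> P1 (fun y k => c * f y k + g y k).
  by move=> hf hg k; have h := wfunZD c (hf k) (hg k); exact: h.
have P1lim (f : Y -> K1 -> R[i]) : (forall e : R, 0 < e -> exists2 g, P1 g &
    forall y k, cmod (f y k - g y k) <= e * (mxnorm1 y * rnorm k)) -> P1 f.
  move=> h k; apply: (@D1' unit (fun=> 0) _ (rnorm k) (rnorm_ge0 k)) => e /h[g wg hg].
  by exists (fun y => g y k).
have P1a (c : R) a a' f : 0 <= c -> left_multiplier c a a' -> P1 f -> P1 (fun y k => f (a y) k).
  by move=> c0 [h|h] wf k; [exact: wfun_left dY csg wsg h (wf k) | exact: wfun_left dY crh wrh h (wf k)].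
have P1b h : P1 (fun y k => ip (rh y k) h) by move=> k; have w := ip_wfun crh.1 wrh k h; exact: w.
have [G2 [t1 [C1 [lt1 st1 tt1 hat1 [w1 C1n C1E]]]]] :=
  gns_stage_cut ls lr lr sr rs sr N0 Nl P1L P1lim P1a P1b.
have lcs := actlin_cadj ls; have lcr := actlin_cadj lr; have lct := actlin_cadj lt1.
have [_ cNl _] := norm_by_cadj ns.
(* The operators by which left multipliers act on the target of the first pass. The second pass must
   remain compatible with them. *)
pose impl (c : R) a a' (al : bop G2 G2) := [/\ 0 <= c, left_multiplier c a a',
  forall y x, t1 (a y) x = al (t1 y x) & forall y x, t1 (a' y) x = adj al (t1 y x)].
(* Conjugates appear because the second pass works with adjoints. The second condition is what makes
   [al] act on the final map. *)
pose Pf (f : Y -> G2 -> R[i]) := (forall k, wfun (fun y => conjc (f y k))) /\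
  forall c a a' al, impl c a a' al -> forall y g, f (a y) g = f y (adj al g).
have PfL c f g : Pf f -> Pf g -> Pf (fun y k => c * f y k + g y k).
  move=> [f1 f2] [g1 g2]; split=> [k|d a a' al h y x]; last by rewrite (f2 _ _ _ _ h) (g2 _ _ _ _ h).
  have := wfunZD (conjc c) (f1 k) (g1 k); congr wfun; apply/funext => y.
  by rewrite conjcD conjcM.
have Pflim (f : Y -> G2 -> R[i]) : (forall e : R, 0 < e -> exists2 g, Pf g &
    forall y k, cmod (f y k - g y k) <= e * (mxnorm1 y * rnorm k)) -> Pf f.
  move=> h; split=> [k|c a a' al hi y x].
    apply: (@D1' unit (fun=> 0) _ (rnorm k) (rnorm_ge0 k)) => e /h[g [g1 _] hg].
    by exists (fun y => conjc (g y k)) => // y; rewrite -conjcN -conjcD cmodJ; exact: hg.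
  apply/eqP; rewrite -subr_eq0; apply/eqP/cmod0_eq0/le_anti; rewrite cmod_ge0 andbT.
  apply: (@le_eps _ _ _ (mxnorm1 (a y) * rnorm x + mxnorm1 y * rnorm (adj al x))) => [|e e0].
    by rewrite addr_ge0 ?mulr_ge0 ?rnorm_ge0.
  have [g [_ g2] hg] := h e e0.
  have -> : f (a y) x - f y (adj al x) = (f (a y) x - g (a y) x) + - (f y (adj al x) - g y (adj al x)).
    by rewrite (g2 _ _ _ _ hi); ring.
  by rewrite add0r [e * _]mulrDr; apply: le_trans (cmodD _ _) _; rewrite cmodN; apply: lerD.
have Pfa (c : R) a a' f : 0 <= c -> left_pair (cadj sg) c a a' \/ left_pair (cadj rh) c a a' ->
    Pf f -> Pf (fun y k => f (a y) k).
  move=> c0 h [f1 f2]; split=> [k|d b b' al hi y g].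
    by case: h => h; [exact: wfun_right dY csg wsg h (f1 k) | exact: wfun_right dY crh wrh h (f1 k)].
  (* This is the point where left and right multipliers have to commute. *)
  have [d0 lm _ _] := hi; rewrite -(comm _ _ _ _ _ _ d0 c0 lm h).
  exact: f2 hi _ _.
have Pfb h : Pf (fun y k => ip (cadj t1 y k) h).
  split=> [k|c a a' al [_ _ ha _] y g].
    by have := w1 k h; congr wfun; apply/funext => y; rewrite /cadj adjPr -ip_conj.
  by rewrite !adjPr ha.
have [G1 [t2 [C2 [lt2 st2 tt2 hat2 [w2 C2n C2E]]]]] :=
  gns_stage_cut lcs lcr lct (mat_dom_cadj sr) (mat_dom_cadj rs) (mat_dom_cadj st1)
    N0 cNl PfL Pflim Pfa Pfb.
pose ta := cadj t2.
have lta : actlin (@sact R Y) ta := actlin_cadj_cact lt2.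
have sta : mat_dom sg ta.
  move=> m n c A c0 h; apply: (mat_dom_cadj st2) => // xi; have := h xi.
  by under eq_bigr do under eq_bigr do rewrite -cadjK.
(* The contractions [C2] and [C1] lead from the final map back to [rh], which dominates [sg]. *)
have tas : mat_dom ta sg.
  move=> m n c A c0 h; apply: rs => //.
  have e1 : mat_dom t2 (cadj t1).
    have tt_ : mat_dom t2 t2 by [].
    have := mat_dom_comp C2n tt_ => hm k l d B d0 /(hm k l d B d0) h1 xi.
    by have := h1 xi; under eq_bigr do under eq_bigr do rewrite bop_compE C2E.
  have e2 : mat_dom t1 rh.
    have tt_ : mat_dom t1 t1 by [].
    have := mat_dom_comp C1n tt_ => hm k l d B d0 /(hm k l d B d0) h1 xi.
    by have := h1 xi; under eq_bigr do under eq_bigr do rewrite bop_compE C1E.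
  apply: e2 => // xi; have := mat_dom_cadj e1 c0 h xi.
  by under eq_bigr do under eq_bigr do rewrite cadjK.
exists G1, G2, ta; split=> //.
- apply: normal_continuous => //.
  + by move=> a y z; rewrite lta.1 -[a *: y]/(sact a y) lta.2.
  + move=> y x; have h : mat_le (mxnorm1 y ^+ 2) (fun _ _ : 'I_1 => sg y : L1 -> L2).
      move=> xi; rewrite !big_ord1 -exprMn.
      by apply: lerXn2r; rewrite ?nnegrE ?mulr_ge0 ?rnorm_ge0.
    have := sta _ _ _ (fun _ _ => y) (sqr_ge0 _) h (fun _ => x); rewrite !big_ord1 -exprMn.
    by rewrite ler_pXn2r ?nnegrE ?mulr_ge0 ?rnorm_ge0.
  + move=> x h; have [wf _] := w2 x; have := wf h; congr wfun; apply/funext => y.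
    by rewrite -ip_conj /ta /cadj adjPr.
- split.
  + by move=> g hg; apply: tt2 => -[y k] /=; rewrite -adjPr -/(cadj t2 y) hg ip0l.
  + move=> x hx; apply: tt1 => -[y k] /=; rewrite -adjPr -/(cadj t1 y) -C2E.
    suff -> : t2 y x = 0 by rewrite bop0 ip0l.
    by apply: ip_inj => g; rewrite ip0l ip_conj -adjPr -/(ta y) hx conjc0.
  + move=> c a a' c0 lm; have [al [alc ha ha']] := hat1 c a a' c0 lm.
    have i1 : impl c a a' al by [].
    have lm' : left_multiplier c a' a by case: lm => h; [left|right]; exact: left_pair_sym.
    have i2 : impl c a' a (adj al) by split=> // y x; rewrite adjK.
    have key d b b' be : impl d b b' be -> forall y x, ta (b y) x = be (ta y x).
      move=> hi y x; apply: ip_inj => g; rewrite [RHS]adjP /ta /cadj !adjPr.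
      have [_ h2] := w2 x; have := h2 _ _ _ _ hi y g.
      by move=> /(congr1 (@conjc R)); rewrite -!ip_conj.
    by exists al; split=> //; [exact: key i1 | exact: key i2].
  + move=> c a a' c0 h; have [al [alc ha ha']] := hat2 c a a' c0 h.
    by exists al; split=> // y x; rewrite /ta !cadjK; [exact: ha | exact: ha'].
Qed.

End Representation.

(** * Approximate units in TROs *)

Lemma telescope_step (V : zmodType) (s p r a b : V) :
  s - p - r + ((p - a) + (r - b)) = s - a - b.
Proof. by rewrite addrACA [s - p + _]addrA subrK addKr. Qed.
Lemma telescope_end (V : zmodType) (x y a b : V) :
  x - y + ((a - b) + (x + y - a - b)) = (x - b) *+ 2.
Proof.
have -> : (a - b) + (x + y - a - b) = x + y + (- b - b) by rewrite addrACA [a + _]addrC subrK.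
by rewrite addrACA [x + (x + y)]addrA addrA addrK mulr2n [RHS]addrACA.
Qed.

Lemma ler_sum_in (R : realType) (T : Type) (F E : T -> R) l :
  (forall p, List.In p l -> F p <= E p) -> \sum_(p <- l) F p <= \sum_(p <- l) E p.
Proof.
elim: l => [|p r IH] h; first by rewrite !big_nil.
by rewrite !big_cons lerD ?h //; [left | apply: IH => q iq; apply: h; right].
Qed.

Lemma in_flatten_map (S T : Type) (F : S -> seq T) (l : seq S) u :
  List.In u (flatten [seq F j | j <- l]) -> exists j, List.In j l /\ List.In u (F j).
Proof.
elim: l => //= j l IH /List.in_app_iff[h|/IH[k [kl h]]]; first by exists j; split=> //; left.
by exists k; split=> //; right.
Qed.

Lemma list_in_le (R : realType) (T : Type) (F : T -> R) l m : (forall x, 0 <= F x) ->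
  List.In m l -> F m <= \sum_(x <- l) F x.
Proof.
move=> F0; elim: l => // x l IH [->|/IH h]; rewrite big_cons; first by rewrite lerDl sumr_ge0.
by apply: le_trans h _; rewrite lerDr.
Qed.

Section ApproximateUnit.
Variables (R : realType) (H W : hilbertType R) (M : set (bop H W)).
Hypothesis tM : is_TRO M.

Lemma tro0 : M 0.
Proof. by have [[/= + _] _] := tM; rewrite inE. Qed.
Lemma tro_lin a x y : M x -> M y -> M (a *: x + y).
Proof.
move=> Mx My; have [[_ h] _] := tM.
by have := h a x y; rewrite !inE; apply.
Qed.
Lemma tro_mul a b c : M a -> M b -> M c -> M (bop_comp (bop_comp a (adj b)) c).
Proof.
move=> Ma Mb Mc; have [_ h] := tM; apply: h; exists (bop_comp a (adj b)); last by exists c.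
by exists a => //; exists (adj b) => //; exists b => // x y; exact: adjP.
Qed.
Lemma troZ a x : M x -> M (a *: x).
Proof. by move=> Mx; rewrite -[_ *: _]addr0; apply: tro_lin => //; exact: tro0. Qed.
Lemma troD x y : M x -> M y -> M (x + y).
Proof. by move=> Mx My; rewrite -[x]scale1r; exact: tro_lin. Qed.
Lemma tro_sum I (r : seq I) (F : I -> bop H W) : (forall i, List.In i r -> M (F i)) ->
  M (\sum_(i <- r) F i).
Proof.
elim: r => [|i r IH] h; first by rewrite big_nil; exact: tro0.
by rewrite big_cons; apply: troD; [apply: h; left | apply: IH => j jr; apply: h; right].
Qed.

Definition usum (us : seq (bop H W)) (x : H) : H := \sum_(u <- us) adj u (u x).

Lemma usum_rip us x y : rip (usum us x) y = \sum_(u <- us) rip (u x) (u y).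
Proof. by rewrite rip_suml; apply: eq_bigr => u _; rewrite /rip adjPr. Qed.

(* With A = sum m*m <= 1 and T = 1 - A, the identity
   2 (1 - T^(2K+1)) = A + T^K A T^K + sum_(j < K) (1 + T) T^j A T^j (1 + T)
   exhibits 1 - T^(2K+1) as a sum of u*u with u in M. *)
Lemma contractive_approx_unit (ms : seq (bop H W)) : (forall m, List.In m ms -> M m) ->
  (forall x, \sum_(m <- ms) rnorm (m x) ^+ 2 <= rnorm x ^+ 2) -> forall K : nat,
  exists us, [/\ forall u, List.In u us -> M u,
   forall x, \sum_(u <- us) rnorm (u x) ^+ 2 <= rnorm x ^+ 2 &
   forall m l, List.In m ms ->
     (2 * (2 * K + 1)%:R + 1) * rnorm (adj m l - usum us (adj m l)) ^+ 2 <= rnorm l ^+ 2].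
Proof.
move=> Mms hms K.
pose A : bop H H := \sum_(m <- ms) bop_comp (adj m) m.
have AE x : A x = usum ms x by rewrite /A bop_sumE.
pose T : bop H H := bop_id H - A.
have TE x : T x = x - A x by [].
have sA x y : rip (A x) y = rip x (A y).
  by rewrite !AE usum_rip rip_sym usum_rip; apply: eq_bigr => m _; exact: rip_sym.
have sT x y : rip (T x) y = rip x (T y) by rewrite !TE ripBl ripBr sA.
have T0 x : 0 <= rip (T x) x.
  rewrite TE ripBl AE usum_rip rip_norm subr_ge0.
  by under eq_bigr do rewrite rip_norm.
pose P n : bop H H := iter n (bop_comp T) (bop_id H).
have PS n x : P n.+1 x = T (P n x) by [].
have PSr n x : P n.+1 x = P n (T x).
  by elim: n => [//|n IH]; rewrite PS IH.
have PD m n x : P (m + n)%N x = P m (P n x).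
  by elim: m => [//|m IH]; rewrite addSn PS IH.
have sP n x y : rip (P n x) y = rip x (P n y).
  by elim: n x y => [//|n IH] x y; rewrite PS sT IH -PSr.
have AT n x : A (P n x) = P n x - P n.+1 x by rewrite PS TE opprB addrC subrK.
pose t n x := rip (P n x) x.
have t_ge0 n x : 0 <= t n x.
  rewrite /t -[n]odd_double_half addnC; case: (odd n).
    by rewrite addn1 -addnn -addSn PD sP PS rip_sym; exact: T0.
  by rewrite addn0 -addnn PD sP rip_norm sqr_ge0.
have tc n x : t n.+1 x - t n.+2 x <= t n x - t n.+1 x.
  have PA k z : P k (A z) = P k z - P k.+1 z by rewrite PSr TE bopB opprB addrC subrK.
  by have := t_ge0 n (A x); rewrite /t -sA AT !PA !ripBl; lra.
(* By [tc] the decrements of [t] do not increase, so the last of [n + 1] decrements is at most their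
   average. *)
have td n x : (n.+1)%:R * (t n x - t n.+1 x) <= rnorm x ^+ 2 - t n.+1 x.
  elim: n => [|n IH]; first by rewrite mul1r /t rip_norm.
  have := tc n x; have := ler0n R n.+1; move: IH; rewrite -[n.+2%:R]natr1; move: (n.+1%:R) => a; nra.
(* Its square is the factor [1 / 2] required by the identity above. *)
pose h : R[i] := (Num.sqrt (1 / 2))%:C.
pose q j : bop H H := P j + P j.+1.
pose us := [seq h *: m | m <- ms] ++ [seq h *: bop_comp m (P K) | m <- ms] ++
  flatten [seq [seq h *: bop_comp m (q j) | m <- ms] | j <- iota 0 K].
have MA m : M m -> M (bop_comp m A).
  move=> Mm; have -> : bop_comp m A = \sum_(m' <- ms) bop_comp (bop_comp m (adj m')) m'.
    by apply: bop_eq => x; rewrite bop_compE AE bop_sum bop_sumE.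
  by apply: tro_sum => m' hm'; apply: tro_mul => //; exact: Mms.
have MP n m : M m -> M (bop_comp m (P n)).
  elim: n m => [|n IH] m Mm; first by have -> : bop_comp m (P 0%N) = m by exact: bop_eq.
  have -> : bop_comp m (P n.+1) = bop_comp m (P n) + (-1) *: bop_comp (bop_comp m A) (P n).
    by apply: bop_eq => x; rewrite bop_addE bop_scaleE -[LHS]/(m (T (P n x))) TE bopB scaleN1r.
  by apply: troD; [exact: IH | apply: troZ; apply: IH; exact: MA].
have Mus u : List.In u us -> M u.
  move=> /List.in_app_iff[|/List.in_app_iff[|]].
  - by move=> /List.in_map_iff[m [<- /Mms Mm]]; exact: troZ.
  - by move=> /List.in_map_iff[m [<- /Mms Mm]]; apply: troZ; exact: MP.
  - move=> hu; have [j [_ /List.in_map_iff[m [<- /Mms Mm]]]] := @in_flatten_map _ _ (fun j => [seq h *: bop_comp m (q j) | m <- ms]) _ _ hu; apply: troZ.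
    have -> : bop_comp m (q j) = bop_comp m (P j) + bop_comp m (P j.+1).
      by apply: bop_eq => x; rewrite bop_addE !bop_compE bop_addE bopD.
    by apply: troD; exact: MP.
have h2 : conjc h * h = (1 / 2)%:C.
  by rewrite /h conjc_real -rmorphM /= -expr2 sqr_sqrtr // divr_ge0.
have uQ (Q : bop H H) x : usum [seq h *: bop_comp m Q | m <- ms] x = (1 / 2)%:C *: adj Q (A (Q x)).
  rewrite /usum big_map AE bop_sum scaler_sumr; apply: eq_bigr => m _.
  by rewrite adjZ adj_comp !bop_scaleE !bop_compE !bopZ scalerA h2.
have aP n : adj (P n) = P n.
  apply: esym; apply: adj_uniq => x y; rewrite !ip_rip sP; congr (_ +i* _).
  by rewrite -!bopZ; exact: sP.
have aq j : adj (q j) = q j by rewrite /q adjD !aP.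
have uE x : usum us x = x - P (2 * K + 1)%N x.
  have Qs : usum [seq h *: m | m <- ms] x = (1 / 2)%:C *: A x.
    have := uQ (bop_id H) x; rewrite adj_id => <-; congr usum; apply: eq_map => m.
    by congr (_ *: _); exact: bop_eq.
  rewrite /us /usum !big_cat /= -/(usum _ x) Qs -/(usum _ x) uQ aP.
  have -> : \sum_(u <- flatten [seq [seq h *: bop_comp m (q j) | m <- ms] | j <- iota 0 K]) adj u (u x) =
      (1 / 2)%:C *: (x + T x - P (2 * K)%N x - P (2 * K + 1)%N x).
    elim: K {us Mus} => [|k IH].
      by rewrite big_nil muln0 add0n -addrA -opprD subrr scaler0.
    rewrite -[k.+1]addn1 iotaD map_cat flatten_cat big_cat /= {}IH cats0 -/(usum _ x) uQ aq.
    rewrite -scalerDr; congr (_ *: _).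
    have Ek z : A (q k z) = P k z - P k.+2 z.
      by rewrite /q bop_addE bopD !AT addrA subrK.
    have PP m n l : (m + n)%N = l -> P m (P n x) = P l x by move=> <-; rewrite PD.
    rewrite Ek /q bop_addE (bopB (P k) (P k x)) (bopB (P k.+1) (P k x)).
    rewrite (PP k k (2 * k)%N) ?(PP k.+1 k (2 * k + 1)%N) ?(PP k k.+2 (2 * (k + 1))%N)
      ?(PP k.+1 k.+2 (2 * (k + 1) + 1)%N); try ring.
    exact: telescope_step.
  have PP m n l : (m + n)%N = l -> P m (P n x) = P l x by move=> <-; rewrite PD.
  rewrite -scalerDr -scalerDr AT (bopB (P K) (P K x)) (PP K K (2 * K)%N) ?(PP K K.+1 (2 * K + 1)%N); try ring.
  have -> : A x = x - T x by rewrite TE opprB addrC subrK.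
  rewrite telescope_end -(scaler_nat 2 (x - _)).
  rewrite scalerA; have -> : (1 / 2)%:C * 2%:R = 1 :> R[i].
    by rewrite -(rmorph_nat (real_complex R)) -rmorphM /=; congr (_ %:C); field.
  by rewrite scale1r.
exists us; split=> // [x|m l ml].
  have := usum_rip us x x; under eq_bigr do rewrite rip_norm.
  by move=> <-; rewrite uE ripBl rip_norm lerBlDr lerDl; exact: t_ge0.
rewrite uE subKr; set N := (2 * K + 1)%N.
have -> : P N (adj m l) = adj (bop_comp m (P N)) l by rewrite adj_comp aP.
(* Since [adj m m <= A], the left side is controlled by the decrement of [t] at [2 N]. *)
have mx x : (2 * N%:R + 1) * rnorm (m (P N x)) ^+ 2 <= rnorm x ^+ 2.
  have h3 : rnorm (m (P N x)) ^+ 2 <= t (N + N)%N x - t (N + N).+1 x.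
    have -> : t (N + N)%N x - t (N + N).+1 x = rip (A (P N x)) (P N x).
      by rewrite AT ripBl /t PD sP; congr (_ - _); rewrite -addSn PD sP rip_sym.
    rewrite AE usum_rip; under eq_bigr do rewrite rip_norm.
    exact: (@list_in_le _ _ (fun m : bop H W => rnorm (m (P N x)) ^+ 2)) (fun _ => sqr_ge0 _) ml.
  have h4 := td (N + N)%N x; have h5 := t_ge0 (N + N).+1 x.
  have cE : ((N + N).+1%:R = 2 * N%:R + 1 :> R) by rewrite -natr1 natrD; ring.
  rewrite cE in h4.
  have c0 : 0 <= 2 * N%:R + 1 :> R by have := ler0n R N; lra.
  have := ler_wpM2l c0 h3; lra.
have c0 : 0 < 2 * N%:R + 1 :> R by have := ler0n R N; lra.
pose k := Num.sqrt (2 * N%:R + 1 : R); have k0 : 0 < k by rewrite sqrtr_gt0.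
have k2 : k ^+ 2 = 2 * N%:R + 1 by rewrite sqr_sqrtr // ltW.
have ki : 0 <= k^-1 by rewrite invr_ge0 ltW.
have := @adj_bound _ _ _ (bop_comp m (P N)) k^-1 ki.
move=> /(_ _ l) hb; have {hb} : rnorm (adj (bop_comp m (P N)) l) <= k^-1 * rnorm l.
  apply: hb => x; rewrite ler_pdivlMl // -(@ler_pXn2r _ 2) ?nnegrE ?mulr_ge0 ?rnorm_ge0 ?(ltW k0) //.
  by rewrite exprMn k2; exact: mx.
rewrite ler_pdivlMl // => hb; rewrite -k2 -exprMn.
by apply: lerXn2r; rewrite ?nnegrE ?mulr_ge0 ?rnorm_ge0 ?(ltW k0).
Qed.

End ApproximateUnit.

(** Scaling by [s] makes the family contractive. The number of steps exceeds [(s d)^(-2)], which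
    brings the error of the scaled family below [s d]. *)
Lemma tro_approx_unit (R : realType) (H W : hilbertType R) (M : set (bop H W)) ms (d : R) :
  is_TRO M -> (forall m, List.In m ms -> M m) -> 0 < d ->
  exists us, [/\ forall u, List.In u us -> M u,
   forall x, \sum_(u <- us) rnorm (u x) ^+ 2 <= rnorm x ^+ 2 &
   forall m l, List.In m ms -> rnorm (adj m l - usum us (adj m l)) <= d * rnorm l].
Proof.
move=> tM Mms d0.
pose c (m : bop H W) : R := sval (cid2 (bop_bound m)).
have cP (m : bop H W) x : rnorm (m x) <= c m * rnorm x by rewrite /c; case: (cid2 _).
pose C := \sum_(m <- ms) c m ^+ 2; have C0 : 0 <= C by apply: sumr_ge0 => m _; exact: sqr_ge0.
pose s := (Num.sqrt (C + 1))^-1; have s0 : 0 < s by rewrite invr_gt0 sqrtr_gt0; lra.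
have s2 : s ^+ 2 * (C + 1) = 1 by rewrite exprVn sqr_sqrtr ?mulVf ?gt_eqF //; lra.
pose ms' := [seq s%:C *: m | m <- ms].
have Mms' m' : List.In m' ms' -> M m'.
  by move=> /List.in_map_iff[m [<- /Mms Mm]]; exact: troZ.
have cms' x : \sum_(m <- ms') rnorm (m x) ^+ 2 <= rnorm x ^+ 2.
  rewrite /ms' big_map.
  have h : \sum_(m <- ms) rnorm ((s%:C *: m) x) ^+ 2 <= s ^+ 2 * (C * rnorm x ^+ 2).
    rewrite /C mulr_suml mulr_sumr; apply: ler_sum => m _.
    rewrite bop_scaleE rnormZ cmodR exprMn real_normK ?num_real // ler_wpM2l ?sqr_ge0 // -exprMn.
    apply: lerXn2r; rewrite ?nnegrE ?rnorm_ge0 //; exact: le_trans (rnorm_ge0 _) (cP _ _).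
  apply: le_trans h _; rewrite mulrA -[X in _ <= X]mul1r; apply: ler_wpM2r; first exact: sqr_ge0.
  by rewrite -s2 ler_wpM2l ?sqr_ge0 //; lra.
have [us [Mus cus aus]] := contractive_approx_unit tM Mms' cms' (Num.bound ((s * d) ^- 2)).
exists us; split=> // m l ml.
have ml' : List.In (s%:C *: m) ms' by apply/List.in_map_iff; exists m.
have := aus _ l ml'; set N := Num.bound _.
have NE : (s * d) ^- 2 < N%:R.
  by apply: archi_boundP; rewrite invr_ge0 sqr_ge0.
have sd : 0 < s * d by rewrite mulr_gt0.
have -> : adj (s%:C *: m) l - usum us (adj (s%:C *: m) l) = s%:C *: (adj m l - usum us (adj m l)).
  rewrite adjZ conjc_real bop_scaleE scalerBr; congr (_ - _).
  by rewrite /usum scaler_sumr; apply: eq_bigr => u _; rewrite !bopZ.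
rewrite rnormZ cmodR gtr0_norm // => h.
rewrite -(@ler_pXn2r _ 2) ?nnegrE ?mulr_ge0 ?rnorm_ge0 ?(ltW d0) //.
set e := rnorm (_ - _) in h *; have e0 : 0 <= e := rnorm_ge0 _.
have h1 : (s * d) ^- 2 * (s * e) ^+ 2 <= rnorm l ^+ 2.
  apply: le_trans h; apply: ler_wpM2r; first exact: sqr_ge0.
  rewrite natrD natrM; have := ler0n R N; lra.
have sd2 : 0 < (s * d) ^+ 2 by rewrite exprn_gt0.
move: h1; rewrite mulrC ler_pdivrMr // !exprMn => h1.
by rewrite -(@ler_pM2l _ (s ^+ 2)) ?exprn_gt0 //; lra.
Qed.

(* Iterating |S^N v|^2 <= |S^(2N) v| |v| turns bounded orbits into contractivity. *)
Lemma bounded_orbit_contraction (R : realType) (H : hilbertType R) (S : bop H H) (v : H) (C : R) :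
  adj S = S -> (forall n, rnorm (iter n S v) <= C) -> rnorm (S v) <= rnorm v.
Proof.
move=> sS hC; rewrite leNgt; apply/negP => lt.
have v0 : 0 < rnorm v.
  rewrite lt_neqAle rnorm_ge0 andbT eq_sym; apply/eqP => e.
  by move: lt; rewrite (rnorm0_eq0 e) bop0 !rnorm0 ltxx.
pose a n := rnorm (iter n S v).
have rS n x y : rip (iter n S x) y = rip x (iter n S y).
  elim: n x y => [//|n IH] x y; rewrite iterS /rip adjP sS -/(rip _ _) IH.
  by rewrite -iterSr.
have a2 n : a n ^+ 2 <= a (n + n)%N * rnorm v.
  rewrite /a -rip_norm rS -iterD rip_sym; exact: rip_CS.
pose r := a 1%N / rnorm v.
have r1 : 1 < r by rewrite ltr_pdivlMr // mul1r.
have claim n : rnorm v * r ^+ (2 ^ n) <= a (2 ^ n)%N.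
  elim: n => [|n IH]; first by rewrite expn0 expr1 /r mulrC divfK // gt_eqF.
  rewrite expnS mul2n -addnn exprD.
  have h0 : 0 <= rnorm v * r ^+ (2 ^ n) by rewrite mulr_ge0 ?rnorm_ge0 // exprn_ge0 // ltW // (lt_trans _ r1).
  have h1 := ler_pM h0 h0 IH IH; have h2 := a2 (2 ^ n)%N.
  rewrite -(ler_pM2r v0); rewrite expr2 in h2; apply: le_trans h2.
  by apply: le_trans h1; rewrite le_eqVlt; apply/orP; left; apply/eqP; ring.
have bern (x : R) n : 0 <= x - 1 -> 1 + n%:R * (x - 1) <= x ^+ n.
  move=> x1; elim: n => [|n IH]; first by rewrite mul0r addr0 expr0.
  have x0 : 0 <= x by lra.
  have h := ler_wpM2l x0 IH; have h' := mulr_ge0 (ler0n R n) (sqr_ge0 (x - 1)).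
  rewrite exprS -natr1; apply: le_trans h; rewrite -subr_ge0; apply: le_trans h' _.
  by rewrite le_eqVlt; apply/orP; left; apply/eqP; ring.
have r10 : 0 <= r - 1 by rewrite subr_ge0 ltW.
have big n : rnorm v * (n%:R * (r - 1)) <= C.
  apply: le_trans (hC (2 ^ n)%N); apply: le_trans (claim n); apply: ler_wpM2l; first exact: ltW.
  apply: le_trans (bern r (2 ^ n)%N r10).
  have : (n%:R : R) <= (2 ^ n)%:R by rewrite ler_nat ltnW // ltn_expl.
  by move=> /(ler_wpM2r r10) h; apply: le_trans h _; rewrite lerDr.
have C0 : 0 <= C := le_trans (rnorm_ge0 _) (hC 0%N).
have w0 : 0 < rnorm v * (r - 1) by rewrite mulr_gt0 // subr_gt0.
have := big (Num.bound (C / (rnorm v * (r - 1)))); rewrite mulrCA leNgt => /negP; apply.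
by rewrite -ltr_pdivrMr //; apply: archi_boundP; rewrite divr_ge0 // ltW.
Qed.

(** * Multipliers as operators on the common representation *)

Section Hat.
Variables (R : realType) (Y : zmodType) (act : R[i] -> Y -> Y) (U W G' G : hilbertType R).
Variables (s : Y -> bop U W) (th : Y -> bop G' G).
Hypotheses (ls : actlin act s) (lth : actlin act th) (injs : injective s).
Hypothesis tth : forall x, (forall y g, ip (th y g) x = 0) -> x = 0.
Hypothesis hth : forall (c : R) a a', 0 <= c -> left_pair s c a a' -> left_pair th c a a'.

(** Invariance under the adjoint is included so that multipliers form a selfadjoint algebra. *)
Definition mult (al : bop W W) : Prop :=
  (forall y, exists y', s y' = bop_comp al (s y)) /\
  (forall y, exists y', s y' = bop_comp (adj al) (s y)).

Definition is_hat (al : bop W W) (T : bop G G) : Prop :=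
  forall y y', s y' = bop_comp al (s y) -> th y' = bop_comp T (th y).

(** Uniqueness is the source of the algebraic rules for [hat] below: the two sides of each rule
    implement the same multiplier. *)
Lemma hat_uniq al T T' : mult al -> is_hat al T -> is_hat al T' -> T = T'.
Proof.
move=> [m _] h h'; apply: (@bop_eq_total _ _ _ _ (fun p : Y * G' => th p.1 p.2)).
  by move=> x hx; apply: tth => y g; rewrite ip_conj (hx (y, g)) conjc0.
by move=> [y g] /=; have [y' e] := m y; rewrite -[LHS]/(bop_comp T (th y) g) -(h _ _ e) (h' _ _ e).
Qed.

(** The condition [mult al] stands under the existential so that [hat] can be a total function;
    nothing is claimed for other operators. *)
Lemma hat_ex al : exists T, mult al -> [/\ is_hat al T, is_hat (adj al) (adj T) &
  forall c : R, 0 <= c -> (forall x, rnorm (al x) <= c * rnorm x) -> forall x, rnorm (T x) <= c * rnorm x].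
Proof.
have [mal|no] := pselect (mult al); last by exists 0.
have [m1 m2] := mal.
pose a y := sval (cid (m1 y)); pose a' y := sval (cid (m2 y)).
have aE y : s (a y) = bop_comp al (s y) := svalP (cid (m1 y)).
have a'E y : s (a' y) = bop_comp (adj al) (s y) := svalP (cid (m2 y)).
have ex (c : R) : 0 <= c -> (forall x, rnorm (al x) <= c * rnorm x) -> exists T,
    [/\ is_hat al T, is_hat (adj al) (adj T) & forall x, rnorm (T x) <= c * rnorm x].
  move=> c0 hc; have [|T [Tc Ta Ta']] := @hth c a a' c0.
    by exists al; split=> // y x; rewrite ?aE ?a'E.
  exists T; split=> // y y' e; apply: bop_eq => x.
    by have -> : y' = a y; [apply: injs; rewrite e aE | rewrite Ta].
  by have -> : y' = a' y; [apply: injs; rewrite e a'E | rewrite Ta'].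
have [c c0 hc] := bop_bound al; have [T [h1 h2 _]] := ex c c0 hc.
exists T => _; split=> // d d0 hd; have [T' [h1' _ h3]] := ex d d0 hd.
by rewrite (hat_uniq mal h1 h1').
Qed.

Definition hat (al : bop W W) : bop G G := sval (cid (hat_ex al)).
Lemma hatP al : mult al -> is_hat al (hat al).
Proof. by move=> m; have [] := svalP (cid (hat_ex al)) m. Qed.
Lemma hat_bound al (c : R) : mult al -> 0 <= c -> (forall x, rnorm (al x) <= c * rnorm x) ->
  forall x, rnorm (hat al x) <= c * rnorm x.
Proof. by move=> m; have [_ _ h] := svalP (cid (hat_ex al)) m; exact: h. Qed.
Lemma mult_adj al : mult al -> mult (adj al).
Proof. by move=> [h1 h2]; split=> //; rewrite adjK. Qed.
Lemma hat_adj al : mult al -> hat (adj al) = adj (hat al).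
Proof.
move=> m; have [_ h _] := svalP (cid (hat_ex al)) m.
by apply: (hat_uniq (mult_adj m)) => //; apply: hatP; exact: mult_adj.
Qed.
Lemma mult_mul al be : mult al -> mult be -> mult (bop_comp al be).
Proof.
move=> [a1 a2] [b1 b2]; split=> y.
  have [z e] := b1 y; have [w f] := a1 z; exists w; rewrite f e; exact: bop_eq.
have [z e] := a2 y; have [w f] := b2 z; exists w; rewrite f e adj_comp; exact: bop_eq.
Qed.
Lemma hat_mul al be : mult al -> mult be -> hat (bop_comp al be) = bop_comp (hat al) (hat be).
Proof.
move=> ma mb; have mab := mult_mul ma mb; apply: (hat_uniq mab); first exact: hatP.
move=> y y' e; have [z ez] := mb.1 y; rewrite (hatP ma (y := z)); last first.
  by rewrite e ez; exact: bop_eq.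
by rewrite (hatP mb ez); exact: bop_eq.
Qed.
Lemma mult_lin c al be : mult al -> mult be -> mult (c *: al + be).
Proof.
move=> [a1 a2] [b1 b2]; split=> y.
  have [z e] := a1 y; have [w f] := b1 y; exists (act c z + w).
  by rewrite ls.1 ls.2 e f; exact: bop_eq.
have [z e] := a2 y; have [w f] := b2 y; exists (act (conjc c) z + w).
by rewrite ls.1 ls.2 e f adjD adjZ; exact: bop_eq.
Qed.
Lemma hat_lin c al be : mult al -> mult be -> hat (c *: al + be) = c *: hat al + hat be.
Proof.
move=> ma mb; have mab := mult_lin c ma mb; apply: (hat_uniq mab); first exact: hatP.
move=> y y' e; have [z ez] := ma.1 y; have [w ew] := mb.1 y.
have -> : y' = act c z + w by apply: injs; rewrite e ls.1 ls.2 ez ew; exact: bop_eq.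
by rewrite lth.1 lth.2 (hatP ma ez) (hatP mb ew); exact: bop_eq.
Qed.
Lemma mult0 : mult 0.
Proof. by split=> y; exists 0; rewrite (actlin0 ls) ?adj0; exact: bop_eq. Qed.
Lemma hat0 : hat 0 = 0.
Proof.
apply: (hat_uniq mult0); first exact: (hatP mult0).
move=> y y' e; have -> : y' = 0 by apply: injs; rewrite e (actlin0 ls); exact: bop_eq.
by rewrite (actlin0 lth); exact: bop_eq.
Qed.
Lemma mult_sum T (r : seq T) (F : T -> bop W W) : (forall i, List.In i r -> mult (F i)) ->
  mult (\sum_(i <- r) F i) /\ hat (\sum_(i <- r) F i) = \sum_(i <- r) hat (F i).
Proof.
elim: r => [|i r IH] h; first by rewrite !big_nil; split; [exact: mult0 | exact: hat0].
have [|m e] := IH; first by move=> j jr; apply: h; right.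
have mi : mult (F i) by apply: h; left.
rewrite !big_cons -[F i]scale1r; split; first exact: mult_lin.
by rewrite hat_lin // e !scale1r.
Qed.

(** * Hilbert spaces induced along a TRO *)

Section Induced.
Variables (H : hilbertType R) (M : set (bop H W)).
Hypotheses (tM : is_TRO M)
  (Mact : forall m m', M m -> M m' -> forall y, exists y', s y' = bop_comp (bop_comp m (adj m')) (s y)).

Definition mm (m m' : bop H W) : bop W W := bop_comp m (adj m').
Lemma mm_mult m m' : M m -> M m' -> mult (mm m m').
Proof.
move=> Mm Mm'; split; first exact: Mact.
by rewrite /mm adj_comp adjK; exact: Mact.
Qed.
Lemma adj_mm m m' : adj (mm m m') = mm m' m.
Proof. by rewrite /mm adj_comp adjK. Qed.
Lemma mm_bound m m' x : rnorm (mm m m' x) <= mxnorm1 m * mxnorm1 m' * rnorm x.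
Proof.
rewrite /mm bop_compE; apply: le_trans (mxnorm1_bop_ub _ _) _.
rewrite -mulrA ler_wpM2l ?mxnorm1_bop_ge0 //; apply: adj_bound; first exact: mxnorm1_bop_ge0.
exact: mxnorm1_bop_ub.
Qed.

(** Inserting the approximate unit between [m'] and [adj m] splits the multiplier into products, so
    the kernel becomes a sum of inner products in [G]. *)
Lemma hat_mm_approx (ms : seq (bop H W)) (d : R) us : (forall u, List.In u us -> M u) ->
  (forall m l, List.In m ms -> rnorm (adj m l - usum us (adj m l)) <= d * rnorm l) -> 0 <= d ->
  (forall m, List.In m ms -> M m) ->
  forall m m' g g', List.In m ms -> M m' ->
  cmod (ip (hat (mm m' m) g) g' - \sum_(u <- us) ip (hat (mm u m) g) (hat (mm u m') g'))
    <= mxnorm1 m' * d * (rnorm g * rnorm g').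
Proof.
move=> Mus hus d0 Mms m m' g g' im Mm'; have Mm := Mms m im.
have [sm sE] := @mult_sum _ us (fun u => bop_comp (mm m' u) (mm u m))
  (fun u iu => mult_mul (mm_mult Mm' (Mus u iu)) (mm_mult (Mus u iu) Mm)).
set D := \sum_(u <- us) bop_comp _ _ in sm sE.
have -> : \sum_(u <- us) ip (hat (mm u m) g) (hat (mm u m') g') = ip (hat D g) g'.
  rewrite sE bop_sumE ip_suml; elim: us Mus {hus D sm sE} => [|u us IH] Mus; first by rewrite !big_nil.
  rewrite !big_cons IH; last by move=> v iv; apply: Mus; right.
  have Mu : M u by apply: Mus; left.
  congr (_ + _); rewrite hat_mul; [|exact: mm_mult..].
  by rewrite bop_compE -[mm u m' in LHS]adj_mm hat_adj -?adjP //; exact: mm_mult.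
have mD : mult ((-1) *: D + mm m' m) by apply: mult_lin => //; exact: mm_mult.
rewrite -ipBl; have -> : hat (mm m' m) g - hat D g = hat ((-1) *: D + mm m' m) g.
  rewrite hat_lin //; last exact: mm_mult.
  by rewrite bop_addE bop_scaleE scaleN1r addrC.
apply: le_trans (ip_CS _ _) _; rewrite mulrA; apply: ler_wpM2r; first exact: rnorm_ge0.
apply: hat_bound => // [|x]; first by rewrite mulr_ge0 ?mxnorm1_bop_ge0.
have -> : ((-1) *: D + mm m' m) x = m' (adj m x - usum us (adj m x)).
  rewrite bop_addE bop_scaleE scaleN1r addrC bopB /D bop_sumE /usum bop_sum; congr (_ - _).
apply: le_trans (mxnorm1_bop_ub _ _) _; rewrite -mulrA ler_wpM2l ?mxnorm1_bop_ge0 //.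
exact: hus.
Qed.

(** Up to [d Q] the form is a sum of squared norms, one for each element of an approximate unit; [d]
    is arbitrary. *)
Lemma mm_psd : psd_kernel (fun p q : {m | M m} * G => ip (hat (mm (sval q.1) (sval p.1)) p.2) q.2).
Proof.
split=> [[[m Mm] g] [[m' Mm'] g']|l] /=.
  by rewrite -adj_mm hat_adj ?adjPr -?ip_conj //; exact: mm_mult.
pose ms := [seq sval p.2.1 | p <- l].
have Mms m : List.In m ms -> M m by move=> /List.in_map_iff[p [<- _]]; exact: (svalP p.2.1).
pose Q : R := \sum_(p <- l) \sum_(q <- l) cmod (p.1 * conjc q.1) *
  (mxnorm1 (sval q.2.1) * (rnorm p.2.2 * rnorm q.2.2)).
rewrite -oppr_le0; apply: (@le_eps _ _ _ Q) => [|d d0].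
  apply: sumr_ge0 => p _; apply: sumr_ge0 => q _.
  by rewrite !mulr_ge0 ?cmod_ge0 ?mxnorm1_bop_ge0 ?rnorm_ge0.
have [us [Mus _ hus]] := tro_approx_unit tM Mms d0.
pose A (p q : R[i] * ({m | M m} * G)) := \sum_(u <- us)
  ip (hat (mm u (sval p.2.1)) p.2.2) (hat (mm u (sval q.2.1)) q.2.2).
have A0 : 0 <= complex.Re (\sum_(p <- l) \sum_(q <- l) p.1 * conjc q.1 * A p q).
  have -> : \sum_(p <- l) \sum_(q <- l) p.1 * conjc q.1 * A p q =
     \sum_(u <- us) ip (\sum_(p <- l) p.1 *: hat (mm u (sval p.2.1)) p.2.2)
        (\sum_(p <- l) p.1 *: hat (mm u (sval p.2.1)) p.2.2).
    under [RHS]eq_bigr do rewrite ip_suml.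
    rewrite [RHS]exchange_big /=; apply: eq_bigr => p _.
    under [RHS]eq_bigr do rewrite ip_sumr.
    rewrite [RHS]exchange_big /=; apply: eq_bigr => q _; rewrite mulr_sumr; apply: eq_bigr => u _.
    by rewrite ipZl ipZr; ring.
  by rewrite Re_sum; apply: sumr_ge0 => u _; rewrite -/(rip _ _) rip_norm sqr_ge0.
rewrite add0r; rewrite lerNl; set k := fun p q => ip _ _.
have -> : lc_form k l l = \sum_(p <- l) \sum_(q <- l) p.1 * conjc q.1 * A p q +
    \sum_(p <- l) \sum_(q <- l) p.1 * conjc q.1 * (k p.2 q.2 - A p q).
  rewrite -big_split; apply: eq_bigr => p _; rewrite -big_split; apply: eq_bigr => q _ /=; ring.
rewrite ReD; apply: le_trans (_ : complex.Re (\sum_(p <- l) \sum_(q <- l) p.1 * conjc q.1 * (k p.2 q.2 - A p q)) <= _); last by rewrite lerDr.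
rewrite lerNl -ReN; apply: le_trans (ler_norm _) _; apply: le_trans (ler_Re _) _; rewrite cmodN.
apply: le_trans (cmod_sum _ _ _) _; rewrite /Q mulr_sumr.
apply: ler_sum_in => p ip_; apply: le_trans (cmod_sum _ _ _) _; rewrite mulr_sumr.
apply: ler_sum_in => q iq; rewrite cmodM [X in _ <= X]mulrCA; apply: ler_wpM2l; first exact: cmod_ge0.
rewrite mulrCA mulrA; apply: hat_mm_approx Mus hus (ltW d0) Mms _ _ _ _ _ _.
  by apply/List.in_map_iff; exists p.
exact: (svalP q.2.1).
Qed.

(** The vector [nu m g] plays the role of the tensor of [adj m] with [g], so it is conjugate linear
    in [m]. The approximate units serve [H] and the induced space simultaneously, because later
    estimates use the same elements on both. *)
Theorem induced : exists (H' : hilbertType R) (nu : bop H W -> bop G H'),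
  [/\ forall m m' y y' x, M m -> M m' -> s y' = bop_comp (mm m m') (s y) ->
        th y' x = adj (nu m) (nu m' (th y x)),
   forall x, (forall m g, M m -> ip x (nu m g) = 0) -> x = 0 &
   forall (ms : seq (bop H W)) (xs : seq H') (d : R), 0 < d -> (forall m, List.In m ms -> M m) ->
     exists us, [/\ forall u, List.In u us -> M u,
       forall x, \sum_(u <- us) rnorm (u x) ^+ 2 <= rnorm x ^+ 2,
       forall x, \sum_(u <- us) rnorm (adj (nu u) x) ^+ 2 <= rnorm x ^+ 2,
       forall m l, List.In m ms -> rnorm (adj m l - usum us (adj m l)) <= d * rnorm l &
       forall x, List.In x xs -> rnorm (x - \sum_(u <- us) nu u (adj (nu u) x)) <= d]].
Proof.
have [H' [e [he te]]] := kolmogorov mm_psd.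
have nuex m : exists N : bop G H', forall (Mm : M m) g, N g = e (exist _ m Mm, g).
  have [Mm|no] := pselect (M m); last by exists 0 => Mm; case: (no Mm).
  have lin : linear (fun g => e (exist _ m Mm, g)).
    move=> a g g'; apply/eqP; rewrite -subr_eq0; apply/eqP; apply: te => p.
    by rewrite ipBl ipDl ipZl !he /= bopD bopZ ipDl ipZl subrr.
  have bnd g : rnorm (e (exist _ m Mm, g)) <= mxnorm1 m * rnorm g.
    rewrite -(@ler_pXn2r _ 2) ?nnegrE ?mulr_ge0 ?rnorm_ge0 ?mxnorm1_bop_ge0 //.
    rewrite -rip_norm /rip he /= -/(rip _ _); apply: le_trans (rip_CS _ _) _.
    rewrite exprMn expr2 [rnorm g ^+ 2]expr2 mulrA; apply: ler_wpM2r; first exact: rnorm_ge0.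
    apply: hat_bound => [||x]; first exact: mm_mult.
      by rewrite mulr_ge0 ?mxnorm1_bop_ge0.
    exact: mm_bound.
  by exists (mkbop lin bnd) => Mm' g; rewrite (Prop_irrelevance Mm' Mm).
pose nu m := sval (cid (nuex m)).
have nuE m (Mm : M m) g : nu m g = e (exist _ m Mm, g) := svalP (cid (nuex m)) Mm g.
have nuip m m' g g' : M m -> M m' -> ip (nu m g) (nu m' g') = ip (hat (mm m' m) g) g'.
  by move=> Mm Mm'; rewrite (nuE _ Mm) (nuE _ Mm') he.
have nutot x : (forall m g, M m -> ip x (nu m g) = 0) -> x = 0.
  by move=> h; apply: te => -[[m Mm] g]; rewrite -nuE h.
have nu_eq x z : (forall m g, M m -> ip x (nu m g) = ip z (nu m g)) -> x = z.
  by move=> h; apply/eqP; rewrite -subr_eq0; apply/eqP; apply: nutot => m g Mm; rewrite ipBl h // subrr.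
have nuadj m m' g : M m -> M m' -> adj (nu m') (nu m g) = hat (mm m' m) g.
  by move=> Mm Mm'; apply: ip_inj => g'; rewrite adjPr nuip.
have nuL c m m' g : M m -> M m' -> nu (c *: m + m') g = conjc c *: nu m g + nu m' g.
  move=> Mm Mm'; apply: nu_eq => n g' Mn; rewrite nuip //; last exact: tro_lin.
  have -> : mm n (c *: m + m') = conjc c *: mm n m + mm n m'.
    by apply: bop_eq => x; rewrite bop_addE bop_scaleE /mm !bop_compE adjD adjZ bop_addE bop_scaleE bopD bopZ.
  by rewrite hat_lin ?bop_addE ?bop_scaleE ?ipDl ?ipZl ?nuip //; exact: mm_mult.
have M0 := tro0 tM.
have nu0 g : nu 0 g = 0.
  have := nuL (-1) 0 0 g M0 M0; rewrite scaler0 addr0 => ->.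
  by rewrite conjcN conjc1 scaleN1r addNr.
have nub a c g : M a -> 0 <= c -> (forall l, rnorm (adj a l) <= c * rnorm l) -> rnorm (nu a g) <= c * rnorm g.
  move=> Ma c0 ha; rewrite -(@ler_pXn2r _ 2) ?nnegrE ?mulr_ge0 ?rnorm_ge0 //.
  rewrite -rip_norm /rip nuip // -/(rip _ _); apply: le_trans (rip_CS _ _) _.
  rewrite exprMn expr2 [rnorm g ^+ 2]expr2 mulrA; apply: ler_wpM2r; first exact: rnorm_ge0.
  apply: hat_bound => [||x]; [exact: mm_mult | exact: mulr_ge0 |].
  have ha' := adj_bound c0 ha; rewrite adjK in ha'.
  by rewrite /mm bop_compE; apply: le_trans (ha' _) _; rewrite -mulrA ler_wpM2l.
exists H', nu; split=> // [m m' y y' x Mm Mm' eq|ms xs d d0 Mms].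
  by rewrite nuadj // (hatP (mm_mult Mm Mm') eq).
have apx x : {l | rnorm (x - lc_val e l) < d / 4} by apply: cid; apply: (total_dense te); rewrite divr_gt0.
pose lx x := sval (apx x).
pose ms' := ms ++ flatten [seq [seq sval p.2.1 | p <- lx x] | x <- xs].
pose B := \sum_(x <- xs) \sum_(p <- lx x) cmod p.1 * rnorm p.2.2.
have B0 : 0 <= B.
  by apply: sumr_ge0 => x _; apply: sumr_ge0 => p _; rewrite mulr_ge0 ?cmod_ge0 ?rnorm_ge0.
(* The second bound pays for the combinations approximating [xs], whose total weight is [B]. *)
pose dl := Num.min d (d / (2 * (B + 1))).
have dl0 : 0 < dl by rewrite lt_min d0 divr_gt0 // mulr_gt0 //; lra.
have Mms' m : List.In m ms' -> M m.
  move=> /List.in_app_iff[/Mms //|h].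
  have [x [_ /List.in_map_iff[p [<- _]]]] := @in_flatten_map _ _ (fun x => [seq sval p.2.1 | p <- lx x]) _ _ h.
  exact: (svalP p.2.1).
have [us [Mus cus hus]] := tro_approx_unit tM Mms' dl0.
(* The approximate unit as an operator on the induced space; it sends [nu m g] to [nu (Zm m) g]. *)
pose S : bop H' H' := \sum_(u <- us) bop_comp (nu u) (adj (nu u)).
have SE x : S x = \sum_(u <- us) nu u (adj (nu u) x) by rewrite /S bop_sumE.
have sS : adj S = S by rewrite /S adj_sum; apply: eq_bigr => u _; rewrite adj_comp adjK.
pose Zm m : bop H W := \sum_(u <- us) bop_comp (mm m u) u.
have MZ m : M m -> M (Zm m) by move=> Mm; apply: tro_sum => // u iu; apply: tro_mul => //; exact: Mus.
have adjZm m l : adj (Zm m) l = usum us (adj m l).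
  by rewrite /Zm adj_sum bop_sumE; apply: eq_bigr => u _; rewrite adj_comp adj_mm.
have SnuE m g : M m -> S (nu m g) = nu (Zm m) g.
  move=> Mm; rewrite SE /Zm; elim: us Mus {cus hus S SE sS Zm MZ adjZm} => [|u us IH] Mus.
    by rewrite !big_nil nu0.
  have Mu : M u by apply: Mus; left.
  have Mus' v : List.In v us -> M v by move=> iv; apply: Mus; right.
  have Mmu : M (bop_comp (mm m u) u) by exact: tro_mul.
  rewrite !big_cons -[bop_comp (mm m u) u]scale1r nuL //; last first.
    by apply: tro_sum => // v iv; apply: tro_mul => //; exact: Mus'.
  rewrite conjc1 scale1r IH //; congr (_ + _); apply: nu_eq => n g' Mn.
  rewrite nuadj // !nuip //.
  have -> : mm n (bop_comp (mm m u) u) = bop_comp (mm n u) (mm u m).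
    by apply: bop_eq => x; rewrite {1}/mm adj_comp adj_mm.
  by rewrite hat_mul //; exact: mm_mult.
have ucontr x : rnorm (usum us x) <= rnorm x.
  rewrite -(@ler_pXn2r _ 2) ?nnegrE ?rnorm_ge0 // -rip_norm usum_rip.
  have h : \sum_(u <- us) rip (u x) (u (usum us x)) <=
      \sum_(u <- us) ((rnorm (u x) ^+ 2 + rnorm (u (usum us x)) ^+ 2) / 2).
    apply: ler_sum => u _; have := rip_CS (u x) (u (usum us x)).
    have := sqr_ge0 (rnorm (u x) - rnorm (u (usum us x))); lra.
  rewrite -mulr_suml big_split /= in h.
  have := cus x; have := cus (usum us x); have := usum_rip us x (usum us x); rewrite rip_norm; lra.
have lcE l : lc_val e l = \sum_(p <- l) p.1 *: nu (sval p.2.1) p.2.2.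
  by apply: eq_bigr => -[c [[m Mm] g]] _ /=; rewrite -nuE.
(* On a finite combination, iterating [S] only iterates [Zm] on the elements of [M], and their norms
   stay bounded. The bounded orbit then forces [S] not to increase the norm. *)
have Scontr l : rnorm (S (lc_val e l)) <= rnorm (lc_val e l).
  apply: (@bounded_orbit_contraction _ _ S _ (\sum_(p <- l) cmod p.1 * (mxnorm1 (sval p.2.1) * rnorm p.2.2)) sS) => n.
  have -> : iter n S (lc_val e l) = \sum_(p <- l) p.1 *: nu (iter n Zm (sval p.2.1)) p.2.2.
    elim: n => [|n IH]; first by rewrite lcE.
    have MI k (p : R[i] * ({m | M m} * G)) : M (iter k Zm (sval p.2.1)).
      by elim: k => [|k IHk] /=; [exact: (svalP p.2.1) | exact: MZ].
    by rewrite iterS IH bop_sum; apply: eq_bigr => p _; rewrite bopZ SnuE.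
  apply: le_trans (rnorm_sum _ _ _) _; apply: ler_sum => p _; rewrite rnormZ ler_wpM2l ?cmod_ge0 //.
  have MI k : M (iter k Zm (sval p.2.1)) by elim: k => [|k IHk] /=; [exact: (svalP p.2.1) | exact: MZ].
  apply: nub => // [|l']; first exact: mxnorm1_bop_ge0.
  elim: n => [|n IH] /=; last by rewrite adjZm; exact: le_trans (ucontr _) IH.
  apply: adj_bound; [exact: mxnorm1_bop_ge0 | exact: mxnorm1_bop_ub].
have Sc x : rnorm (S x) <= rnorm x.
  have [c c0 hc] := bop_bound S; apply: (@le_eps _ _ _ (c + 1)) => [|d' d'0]; first lra.
  have [l hl] := total_dense te x d'0.
  have h1 := rnormD (S (x - lc_val e l)) (S (lc_val e l)); rewrite -bopD subrK in h1.
  have h2 := hc (x - lc_val e l); have h3 := Scontr l.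
  have h4 := rnormD (lc_val e l - x) x; rewrite subrK rnormBC in h4.
  have h5 := ler_wpM2l c0 (ltW hl); lra.
exists us; split=> // [x|m l im|x ix].
- have -> : \sum_(u <- us) rnorm (adj (nu u) x) ^+ 2 = rip (S x) x.
    by rewrite SE rip_suml; apply: eq_bigr => u _; rewrite -rip_norm /rip [in RHS]adjP.
  apply: le_trans (rip_CS _ _) _; rewrite expr2; apply: ler_wpM2r => //; exact: rnorm_ge0.
- apply: le_trans (hus m l _) _; first by apply/List.in_app_iff; left.
  by rewrite ler_wpM2r ?rnorm_ge0 // ge_min lexx.
- rewrite -SE; have hx : rnorm (x - lc_val e (lx x)) < d / 4 := svalP (apx x).
  set v := lc_val e (lx x) in hx.
  have hv : rnorm (v - S v) <= dl * B.
    have -> : v - S v = \sum_(p <- lx x) p.1 *: nu ((-1) *: Zm (sval p.2.1) + sval p.2.1) p.2.2.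
      rewrite /v lcE bop_sum -sumrB; apply: eq_bigr => p _.
      have Mp := svalP p.2.1.
      by rewrite bopZ SnuE // nuL //; [rewrite conjcN conjc1 scaleN1r -scalerBr addrC | exact: MZ].
    apply: le_trans (rnorm_sum _ _ _) _.
    apply: le_trans (_ : \sum_(p <- lx x) dl * (cmod p.1 * rnorm p.2.2) <= _).
      apply: ler_sum_in => p ip_; have Mp := svalP p.2.1.
      rewrite rnormZ mulrCA ler_wpM2l ?cmod_ge0 //; apply: nub => [||l].
      + by apply: tro_lin => //; exact: MZ.
      + exact: ltW.
      + rewrite adjD adjZ conjcN conjc1 scaleN1r bop_addE bop_oppE adjZm addrC; apply: hus.
        apply/List.in_app_iff; right.
        elim: (xs) ix => //= z zs IH [->|/IH h]; apply/List.in_app_iff; [left | by right].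
        by apply/List.in_map_iff; exists p.
    rewrite -mulr_sumr ler_wpM2l ?(ltW dl0) //.
    apply: (@list_in_le _ _ (fun x => \sum_(p <- lx x) cmod p.1 * rnorm p.2.2)) => // z.
    by apply: sumr_ge0 => p _; rewrite mulr_ge0 ?cmod_ge0 ?rnorm_ge0.
  have hb : dl * B <= d / 2.
    have h : dl <= d / (2 * (B + 1)) by rewrite ge_min lexx orbT.
    have B1 : 0 < 2 * (B + 1) by lra.
    move: h; rewrite ler_pdivlMr // => h.
    have := ler_wpM2l (ltW dl0) (ler0n R 1); lra.
  have -> : x - S x = (x - v) + ((v - S v) + S (v - x)).
    by rewrite bopB [v - S v + _]addrA subrK addrA subrK.
  have h1 := Sc (v - x); rewrite rnormBC in h1.
  apply: le_trans (rnormD _ _) _; have := rnormD (v - S v) (S (v - x)); lra.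
Qed.

End Induced.
End Hat.

(** * Operator matrices over finite index types *)

Section MatrixForms.
Variable R : realType.
Implicit Types H K W U : hilbertType R.

Definition fmat_le H K (I J : finType) (c : R) (A : I -> J -> H -> K) : Prop :=
  forall xi : J -> H,
    \sum_i rnorm (\sum_j A i j (xi j)) ^+ 2 <= c * \sum_j rnorm (xi j) ^+ 2.

Lemma mat_dom_fin (Y : zmodType) U W U' W' (s : Y -> bop U W) (t : Y -> bop U' W') (I J : finType) (c : R)
    (A : I -> J -> Y) : mat_dom s t -> 0 <= c ->
  fmat_le c (fun i j => s (A i j) : U -> W) -> fmat_le c (fun i j => t (A i j) : U' -> W').
Proof.
move=> st c0 h.
have re (T : finType) (F : T -> R) : \sum_i F i = \sum_(k < #|T|) F (enum_val k).
  by rewrite (reindex (@enum_val T T)) //; apply: onW_bij; exact: enum_val_bij.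
have rev (T : finType) (L : hilbertType R) (F : T -> L) : \sum_i F i = \sum_(k < #|T|) F (enum_val k).
  by rewrite (reindex (@enum_val T T)) //; apply: onW_bij; exact: enum_val_bij.
have hE L L' (r : Y -> bop L L') : fmat_le c (fun i j => r (A i j) : L -> L') <->
    mat_le c (fun (i : 'I_#|I|) (j : 'I_#|J|) => r (A (enum_val i) (enum_val j)) : L -> L').
  split=> k xi.
    have := k (fun j => xi (enum_rank j)); rewrite re [X in _ <= c * X]re.
    under eq_bigr do rewrite rev.
    under eq_bigr do under eq_bigr do rewrite enum_valK.
    by under [X in _ <= _ * X]eq_bigr do rewrite enum_valK.
  by rewrite re [X in _ <= c * X]re; under eq_bigr do rewrite rev; exact: k.
by apply/hE; apply: st => //; apply/hE.
Qed.

Lemma col_row_contraction H W (I : finType) (a : I -> bop H W) :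
  (forall x, \sum_i rnorm (a i x) ^+ 2 <= rnorm x ^+ 2) ->
  forall g, rnorm (\sum_i adj (a i) (g i)) ^+ 2 <= \sum_i rnorm (g i) ^+ 2.
Proof.
move=> ha g; set z := \sum_i _.
have h : rnorm z ^+ 2 <= \sum_i (rnorm (g i) ^+ 2 + rnorm (a i z) ^+ 2) / 2.
  rewrite -rip_norm {1}/z rip_suml; apply: ler_sum => i _; rewrite /rip adjPr -/(rip _ _).
  have := rip_CS (g i) (a i z); have := sqr_ge0 (rnorm (g i) - rnorm (a i z)); lra.
rewrite -mulr_suml big_split /= in h; have := ha z; lra.
Qed.

(** The new matrix is an amplification of [D], multiplied on the left by the column of the [a] and
    on the right by the row of adjoints of the [b], both contractive. *)
Lemma fmat_compress H K W1 W2 (I J I' J' : finType) (c : R) (D : I -> J -> bop H K)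
    (a : I' -> bop K W2) (b : J' -> bop H W1) : 0 <= c ->
  (forall x, \sum_i rnorm (a i x) ^+ 2 <= rnorm x ^+ 2) ->
  (forall x, \sum_j rnorm (b j x) ^+ 2 <= rnorm x ^+ 2) ->
  fmat_le c (fun i j => D i j : H -> K) ->
  fmat_le c (fun (p : I * I') (q : J * J') =>
    (fun g => a p.2 (D p.1 q.1 (adj (b q.2) g))) : W1 -> W2).
Proof.
move=> c0 ha hb hD g; pose h j := \sum_j' adj (b j') (g (j, j')).
have -> : \sum_p rnorm (\sum_q a p.2 (D p.1 q.1 (adj (b q.2) (g q)))) ^+ 2 =
    \sum_i \sum_i' rnorm (a i' (\sum_j D i j (h j))) ^+ 2.
  rewrite pair_bigA /=; apply: eq_bigr => -[i i'] _ /=; congr (rnorm _ ^+ 2).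
  rewrite bop_sum; under [RHS]eq_bigr do rewrite /h bop_sum bop_sum.
  by rewrite pair_bigA; apply: eq_bigr => -[j j'].
apply: le_trans (_ : \sum_i rnorm (\sum_j D i j (h j)) ^+ 2 <= _).
  by apply: ler_sum => i _; exact: ha.
apply: le_trans (hD h) _; apply: ler_wpM2l => //.
have -> : \sum_q rnorm (g q) ^+ 2 = \sum_j \sum_j' rnorm (g (j, j')) ^+ 2.
  by rewrite pair_bigA; apply: eq_bigr => -[j j'].
by apply: ler_sum => j _; exact: col_row_contraction.
Qed.

(* AM-GM makes the operator bound and the bound on the form equivalent without square roots. *)
Lemma fmat_form H K (I J : finType) (c : R) (D : I -> J -> H -> K) : fmat_le c D <->
  forall x y, \sum_i rip (\sum_j D i j (x j)) (y i) <=
    (c * \sum_j rnorm (x j) ^+ 2 + \sum_i rnorm (y i) ^+ 2) / 2.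
Proof.
split=> h x.
  move=> y; have h1 := h x.
  apply: le_trans (_ : \sum_i (rnorm (\sum_j D i j (x j)) ^+ 2 + rnorm (y i) ^+ 2) / 2 <= _).
    apply: ler_sum => i _; have := rip_CS (\sum_j D i j (x j)) (y i).
    have := sqr_ge0 (rnorm (\sum_j D i j (x j)) - rnorm (y i)); lra.
  by rewrite -mulr_suml big_split /=; lra.
have := h x (fun i => \sum_j D i j (x j)); under eq_bigr do rewrite rip_norm; lra.
Qed.

Lemma usum_le H W (us : seq (bop H W)) x :
  (forall x, \sum_(u <- us) rnorm (u x) ^+ 2 <= rnorm x ^+ 2) -> rnorm (usum us x) <= rnorm x.
Proof.
move=> cus; rewrite -(@ler_pXn2r _ 2) ?nnegrE ?rnorm_ge0 // -rip_norm usum_rip.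
have h : \sum_(u <- us) rip (u x) (u (usum us x)) <=
    \sum_(u <- us) ((rnorm (u x) ^+ 2 + rnorm (u (usum us x)) ^+ 2) / 2).
  apply: ler_sum => u _; have := rip_CS (u x) (u (usum us x)).
  have := sqr_ge0 (rnorm (u x) - rnorm (u (usum us x))); lra.
rewrite -mulr_suml big_split /= in h.
have := cus x; have := cus (usum us x); have := usum_rip us x (usum us x); rewrite rip_norm; lra.
Qed.

End MatrixForms.

(** * Approximate units on the support of a TRO *)

Section InducedBy.
Variables (R : realType) (Y : Type) (U W G' G H H' : hilbertType R).
Variables (s : Y -> bop U W) (th : Y -> bop G' G).

(** The conclusion of [induced] as a predicate, to be assumed separately for the left TRO and, on
    adjoints, for the right one. *)
Definition induced_by (M : set (bop H W)) (nu : bop H W -> bop G H') : Prop :=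
  [/\ forall m m' y y' x, M m -> M m' -> s y' = bop_comp (mm m m') (s y) ->
        th y' x = adj (nu m) (nu m' (th y x)),
   forall x, (forall m g, M m -> ip x (nu m g) = 0) -> x = 0 &
   forall (ms : seq (bop H W)) (xs : seq H') (d : R), 0 < d -> (forall m, List.In m ms -> M m) ->
     exists us, [/\ forall u, List.In u us -> M u,
       forall x, \sum_(u <- us) rnorm (u x) ^+ 2 <= rnorm x ^+ 2,
       forall x, \sum_(u <- us) rnorm (adj (nu u) x) ^+ 2 <= rnorm x ^+ 2,
       forall m l, List.In m ms -> rnorm (adj m l - usum us (adj m l)) <= d * rnorm l &
       forall x, List.In x xs -> rnorm (x - \sum_(u <- us) nu u (adj (nu u) x)) <= d]].

(** The support of [M] in [H]: its orthogonal complement is where all elements of [M] vanish. *)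
Definition adj_range (M : set (bop H W)) : set H :=
  closed_span (fun p : {m | M m} * W => adj (sval p.1) p.2).

(** Each given vector of the closed span is replaced by a finite combination of vectors [adj m l];
    the tolerance [dl] is fixed afterwards, according to the total weight [B]. *)
Lemma approx_on_range (M : set (bop H W)) nu : induced_by M nu ->
  forall (ms : seq (bop H W)) (xs : seq H') (zs : seq H) (d : R), 0 < d ->
  (forall m, List.In m ms -> M m) -> (forall z, List.In z zs -> adj_range M z) ->
  exists us, [/\ forall u, List.In u us -> M u,
    forall x, \sum_(u <- us) rnorm (u x) ^+ 2 <= rnorm x ^+ 2,
    forall x, \sum_(u <- us) rnorm (adj (nu u) x) ^+ 2 <= rnorm x ^+ 2,
    forall m l, List.In m ms -> rnorm (adj m l - usum us (adj m l)) <= d * rnorm l &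
    (forall x, List.In x xs -> rnorm (x - \sum_(u <- us) nu u (adj (nu u) x)) <= d) /\
    forall z, List.In z zs -> rnorm (z - usum us z) <= d].
Proof.
move=> [_ _ au] ms xs zs d d0 Mms Mzs.
pose lcv := lc_val (fun p : {m | M m} * W => adj (sval p.1) p.2).
have apx z : {l | adj_range M z -> rnorm (z - lcv l) < d / 4}.
  apply: cid; have [h|no] := pselect (adj_range M z); last by exists [::].
  by have [l hl] := h (d / 4) ltac:(by rewrite divr_gt0); exists l.
pose lz z := sval (apx z).
pose B := \sum_(z <- zs) \sum_(p <- lz z) cmod p.1 * rnorm p.2.2.
have B0 : 0 <= B.
  by apply: sumr_ge0 => x _; apply: sumr_ge0 => p _; rewrite mulr_ge0 ?cmod_ge0 ?rnorm_ge0.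
pose dl := Num.min d (d / (2 * (B + 1))).
have dl0 : 0 < dl by rewrite lt_min d0 divr_gt0 // mulr_gt0 //; lra.
have [|us [Mus cus cnu hus hxs]] := au (ms ++ flatten [seq [seq sval p.2.1 | p <- lz z] | z <- zs]) xs dl dl0.
  move=> m /List.in_app_iff[/Mms //|h].
  have [z [_ /List.in_map_iff[p [<- _]]]] := @in_flatten_map _ _ (fun z => [seq sval p.2.1 | p <- lz z]) _ _ h.
  exact: (svalP p.2.1).
have dld : dl <= d by rewrite ge_min lexx.
exists us; split=> // [m l im|].
  apply: le_trans (hus m l _) _; first by apply/List.in_app_iff; left.
  by rewrite ler_wpM2r ?rnorm_ge0.
split=> [x ix|z iz]; first exact: le_trans (hxs x ix) dld.
have hz : rnorm (z - lcv (lz z)) < d / 4 := svalP (apx z) (Mzs z iz).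
set v := lcv (lz z) in hz.
have uB x y : usum us (x - y) = usum us x - usum us y.
  by rewrite /usum -sumrB; apply: eq_bigr => u _; rewrite !bopB.
have hv : rnorm (v - usum us v) <= dl * B.
  have -> : v - usum us v = \sum_(p <- lz z) p.1 *: (adj (sval p.2.1) p.2.2 - usum us (adj (sval p.2.1) p.2.2)).
    rewrite /v /lcv /lc_val; under [RHS]eq_bigr do rewrite scalerBr.
    rewrite [RHS]sumrB; congr (_ - _); rewrite /usum.
    under [RHS]eq_bigr do rewrite scaler_sumr.
    rewrite [RHS]exchange_big /=; apply: eq_bigr => u _; rewrite !bop_sum.
    by apply: eq_bigr => p _; rewrite !bopZ.
  apply: le_trans (rnorm_sum _ _ _) _.
  apply: le_trans (_ : \sum_(p <- lz z) dl * (cmod p.1 * rnorm p.2.2) <= _).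
    apply: ler_sum_in => p ip_; rewrite rnormZ mulrCA ler_wpM2l ?cmod_ge0 //; apply: hus.
    apply/List.in_app_iff; right.
    elim: (zs) iz => //= y ys IH [->|/IH h]; apply/List.in_app_iff; [left | by right].
    by apply/List.in_map_iff; exists p.
  rewrite -mulr_sumr ler_wpM2l ?(ltW dl0) //.
  apply: (@list_in_le _ _ (fun z => \sum_(p <- lz z) cmod p.1 * rnorm p.2.2)) => // y.
  by apply: sumr_ge0 => p _; rewrite mulr_ge0 ?cmod_ge0 ?rnorm_ge0.
have hb : dl * B <= d / 2.
  have h : dl <= d / (2 * (B + 1)) by rewrite ge_min lexx orbT.
  have B1 : 0 < 2 * (B + 1) by lra.
  by move: h; rewrite ler_pdivlMr // => h; have := ltW dl0; lra.
have -> : z - usum us z = (z - v) + ((v - usum us v) + usum us (v - z)).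
  by rewrite uB [v - usum us v + _]addrA subrK addrA subrK.
have h1 := usum_le (v - z) cus; rewrite rnormBC in h1.
apply: le_trans (rnormD _ _) _; have := rnormD (v - usum us v) (usum us (v - z)); lra.
Qed.
End InducedBy.

Lemma eq_sum_in (T : Type) (Z : nmodType) (r : seq T) (F E : T -> Z) :
  (forall i, List.In i r -> F i = E i) -> \sum_(i <- r) F i = \sum_(i <- r) E i.
Proof.
elim: r => [|i r IH] h; first by rewrite !big_nil.
by rewrite !big_cons h ?IH //; [move=> j jr; apply: h; right | left].
Qed.

(** * Transfer of a representation to the induced spaces *)

Section Transfer.
Variables (R : realType) (Y V : wMxNormedType R) (L1 L2 G1 G2 H1 H2 H1' H2' : hilbertType R).
Variables (sg : Y -> bop L1 L2) (ta : Y -> bop G1 G2) (t : V -> bop H1 H2).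
Variables (M1 : set (bop H1 L1)) (M2 : set (bop H2 L2)).
Variables (nu1 : bop H1 L1 -> bop G1 H1') (nu2 : bop H2 L2 -> bop G2 H2').
Hypotheses (dY : dualized Y) (dV : dualized V) (csg : complete_isometry sg) (wsg : continuous sg).
Hypotheses (ct : complete_isometry t) (wt : continuous t) (injs : injective sg).
Hypotheses (lta : actlin (@sact R Y) ta) (wta : continuous ta).
Hypotheses (sta : mat_dom sg ta) (tas : mat_dom ta sg).
Hypotheses (I1 : induced_by (cadj sg) (cadj ta) M1 nu1) (I2 : induced_by sg ta M2 nu2).
Hypothesis act1 : forall m m', M1 m -> M1 m' -> forall y, exists y', sg y' = bop_comp (sg y) (mm m m').
Hypothesis act2 : forall m m', M2 m -> M2 m' -> forall y, exists y', sg y' = bop_comp (mm m m') (sg y).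
Hypothesis cut : forall v m1 m2, M1 m1 -> M2 m2 ->
  exists y, sg y = bop_comp m2 (bop_comp (t v) (adj m1)).
Hypothesis rng2 : forall v x, adj_range M2 (t v x).
Hypothesis rng1 : forall v x, adj_range M1 (adj (t v) x).

Let ls : actlin (@sact R Y) sg := linear_actlin csg.1.
Let lt : actlin (@sact R V) t := linear_actlin ct.1.

Lemma ta_bound y (c : R) : 0 <= c -> (forall x, rnorm (sg y x) <= c * rnorm x) ->
  forall x, rnorm (ta y x) <= c * rnorm x.
Proof.
move=> c0 h x.
have h1 : mat_le (c ^+ 2) (fun _ _ : 'I_1 => sg y : L1 -> L2).
  by move=> xi; rewrite !big_ord1 -exprMn; apply: lerXn2r; rewrite ?nnegrE ?mulr_ge0 ?rnorm_ge0.
have := sta (A := fun _ _ : 'I_1 => y) (sqr_ge0 c) h1 (fun _ => x); rewrite !big_ord1 -exprMn.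
by rewrite ler_pXn2r ?nnegrE ?mulr_ge0 ?rnorm_ge0.
Qed.

(** Both induction relations at once; the right one is applied through adjoints. *)
Lemma sandwich m2 m2' m1 m1' y y' g : M2 m2 -> M2 m2' -> M1 m1 -> M1 m1' ->
  sg y' = bop_comp (mm m2 m2') (bop_comp (sg y) (mm m1' m1)) ->
  ta y' g = adj (nu2 m2) (nu2 m2' (ta y (adj (nu1 m1') (nu1 m1 g)))).
Proof.
move=> h2 h2' h1 h1' e; have [z ez] := act2 h2 h2' y.
have [i2 _ _] := I2; have [i1 _ _] := I1.
rewrite -(i2 _ _ _ _ _ h2 h2' ez); apply: ip_inj => x.
have e1 : cadj sg y' = bop_comp (mm m1 m1') (cadj sg z).
  have -> : cadj sg y' = adj (bop_comp (sg z) (mm m1' m1)) by rewrite /cadj e ez; congr adj; exact: bop_eq.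
  by rewrite adj_comp adj_mm.
rewrite adjP; have -> : adj (ta y') x = cadj ta y' x by [].
by rewrite (i1 _ _ _ _ _ h1 h1' e1) -adjP -adjPr /cadj -adjP.
Qed.

Lemma cut_fun_ex v m1 m2 : exists y, M1 m1 -> M2 m2 -> sg y = bop_comp m2 (bop_comp (t v) (adj m1)).
Proof.
have [[h1 h2]|no] := pselect (M1 m1 /\ M2 m2); last by exists 0 => h1 h2; case: no.
by have [y e] := cut v h1 h2; exists y.
Qed.
(** Defined for all operators; its value is meaningful when they lie in the two TROs. *)
Definition cut_fun v m1 m2 : Y := sval (cid (cut_fun_ex v m1 m2)).
Lemma cut_funP v m1 m2 : M1 m1 -> M2 m2 -> sg (cut_fun v m1 m2) = bop_comp m2 (bop_comp (t v) (adj m1)).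
Proof. exact: (svalP (cid (cut_fun_ex v m1 m2))). Qed.

(** Approximate units inserted on both sides of [t v] change the cut by little, and by [sandwich]
    the result of the insertion is the double sum over the cuts by their elements. *)
Lemma cut_pair_approx v m1 m2 g g' us1 us2 (d c : R) : M1 m1 -> M2 m2 -> 0 <= d -> 0 <= c ->
  (forall x, rnorm (t v x) <= c * rnorm x) ->
  (forall u, List.In u us1 -> M1 u) -> (forall u, List.In u us2 -> M2 u) ->
  (forall x, \sum_(u <- us1) rnorm (u x) ^+ 2 <= rnorm x ^+ 2) ->
  (forall x, \sum_(u <- us2) rnorm (u x) ^+ 2 <= rnorm x ^+ 2) ->
  (forall l, rnorm (adj m1 l - usum us1 (adj m1 l)) <= d * rnorm l) ->
  (forall l, rnorm (adj m2 l - usum us2 (adj m2 l)) <= d * rnorm l) ->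
  cmod (ip (ta (cut_fun v m1 m2) g) g' - \sum_(u2 <- us2) \sum_(u1 <- us1)
      ip (ta (cut_fun v u1 u2) (adj (nu1 u1) (nu1 m1 g))) (adj (nu2 u2) (nu2 m2 g'))) <=
    d * (c * (mxnorm1 m1 + mxnorm1 m2)) * (rnorm g * rnorm g').
Proof.
move=> M1m M2m d0 c0 hc Mu1 Mu2 c1 c2 a1 a2.
have exy u1 u2 : exists y, M1 u1 -> M2 u2 ->
    sg y = bop_comp (mm m2 u2) (bop_comp (sg (cut_fun v u1 u2)) (mm u1 m1)).
  have [[h1 h2]|no] := pselect (M1 u1 /\ M2 u2); last by exists 0 => h1 h2; case: no.
  have [y e] := act2 M2m h2 (cut_fun v u1 u2); have [z ez] := act1 h1 M1m y.
  by exists z => _ _; rewrite ez e; exact: bop_eq.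
pose yy u1 u2 := sval (cid (exy u1 u2)).
have yyP u1 u2 : M1 u1 -> M2 u2 ->
    sg (yy u1 u2) = bop_comp (mm m2 u2) (bop_comp (sg (cut_fun v u1 u2)) (mm u1 m1)) := svalP (cid (exy u1 u2)).
pose D := cut_fun v m1 m2 - \sum_(u2 <- us2) \sum_(u1 <- us1) yy u1 u2.
have -> : ip (ta (cut_fun v m1 m2) g) g' - \sum_(u2 <- us2) \sum_(u1 <- us1)
      ip (ta (cut_fun v u1 u2) (adj (nu1 u1) (nu1 m1 g))) (adj (nu2 u2) (nu2 m2 g')) = ip (ta D g) g'.
  rewrite /D (actlinB lta) bop_subE ipBl; congr (_ - _).
  rewrite (actlin_sum _ _ lta) bop_sumE ip_suml; apply: eq_sum_in => u2 i2.
  rewrite (actlin_sum _ _ lta) bop_sumE ip_suml; apply: eq_sum_in => u1 i1.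
  have h1 := Mu1 _ i1; have h2 := Mu2 _ i2.
  by rewrite (sandwich _ M2m h2 M1m h1 (yyP _ _ h1 h2)) adjPr -adjP.
apply: le_trans (ip_CS _ _) _; rewrite mulrA; apply: ler_wpM2r; first exact: rnorm_ge0.
apply: ta_bound => [|l]; first by rewrite !mulr_ge0 ?addr_ge0 ?mxnorm1_bop_ge0.
have -> : sg D l = m2 (t v (adj m1 l) - usum us2 (t v (usum us1 (adj m1 l)))).
  rewrite /D (actlinB ls) bop_subE bopB cut_funP //; congr (_ - _).
  rewrite (actlin_sum _ _ ls) bop_sumE /usum bop_sum; apply: eq_sum_in => u2 i2.
  rewrite (actlin_sum _ _ ls) bop_sumE !bop_sum; apply: eq_sum_in => u1 i1.
  have h1 := Mu1 _ i1; have h2 := Mu2 _ i2.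
  by rewrite yyP // cut_funP.
set a := adj m1 l; have -> : t v a - usum us2 (t v (usum us1 a)) =
    (t v a - usum us2 (t v a)) + usum us2 (t v (a - usum us1 a)).
  have uB x y : usum us2 (x - y) = usum us2 x - usum us2 y.
    by rewrite /usum -sumrB; apply: eq_bigr => u _; rewrite !bopB.
  by rewrite bopB uB addrA subrK.
rewrite bopD; apply: le_trans (rnormD _ _) _.
have n1 l' : rnorm (adj m1 l') <= mxnorm1 m1 * rnorm l'.
  by apply: adj_bound; [exact: mxnorm1_bop_ge0 | exact: mxnorm1_bop_ub].
have k1 : rnorm (m2 (t v a - usum us2 (t v a))) <= d * (c * mxnorm1 m1 * rnorm l).
  pose Z : bop H2 H2 := \sum_(u <- us2) bop_comp (adj u) u.
  have ZE x : Z x = usum us2 x by rewrite /Z bop_sumE.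
  have sZ : adj Z = Z by rewrite /Z adj_sum; apply: eq_bigr => u _; rewrite adj_comp adjK.
  have h : forall x, rnorm (bop_comp m2 (bop_id H2 + (-1) *: Z) x) <= d * rnorm x.
    move=> x; rewrite -[bop_comp _ _]adjK; apply: adj_bound => // {}x.
    rewrite adj_comp adjD adj_id adjZ sZ conjcN conjc1 scaleN1r bop_compE bop_subE bop_idE ZE.
    exact: a2.
  have := h (t v a); rewrite bop_compE bop_addE bop_scaleE scaleN1r bop_idE ZE => /le_trans; apply.
  by apply: ler_wpM2l => //; apply: le_trans (hc _) _; rewrite -mulrA ler_wpM2l //; exact: n1.
have k2 : rnorm (m2 (usum us2 (t v (a - usum us1 a)))) <= mxnorm1 m2 * (c * (d * rnorm l)).
  apply: le_trans (mxnorm1_bop_ub _ _) _; apply: ler_wpM2l; first exact: mxnorm1_bop_ge0.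
  by apply: le_trans (usum_le _ c2) _; apply: le_trans (hc _) _; rewrite ler_wpM2l //; exact: a1.
by apply: le_trans (lerD k1 k2) _; rewrite le_eqVlt; apply/orP; left; apply/eqP; ring.
Qed.

Definition cut_matrix_bound (m n : nat) (c : R) (A : 'I_m -> 'I_n -> V) (us1 : seq (bop H1 L1)) (us2 : seq (bop H2 L2)) :=
  @fmat_le R G1 G2 ('I_m * 'I_(size us2))%type ('I_n * 'I_(size us1))%type c
    (fun p q => ta (cut_fun (A p.1 q.1) (nth 0 us1 q.2) (nth 0 us2 p.2)) : G1 -> G2).

Lemma in_nth (H K : hilbertType R) (us : seq (bop H K)) (i : 'I_(size us)) : List.In (nth 0 us i) us.
Proof.
case: i => i; elim: us i => //= u us IH [|i] h /=; [by left | right; exact: IH].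
Qed.

Lemma cut_matrix m n (c : R) (A : 'I_m -> 'I_n -> V) us1 us2 : 0 <= c ->
  (forall u, List.In u us1 -> M1 u) -> (forall u, List.In u us2 -> M2 u) ->
  (forall x, \sum_(u <- us1) rnorm (u x) ^+ 2 <= rnorm x ^+ 2) ->
  (forall x, \sum_(u <- us2) rnorm (u x) ^+ 2 <= rnorm x ^+ 2) ->
  mat_le c (fun i j => t (A i j) : H1 -> H2) -> cut_matrix_bound c A us1 us2.
Proof.
move=> c0 Mu1 Mu2 c1 c2 hA.
apply: (mat_dom_fin (A := fun (p : 'I_m * 'I_(size us2)) (q : 'I_n * 'I_(size us1)) =>
  cut_fun (A p.1 q.1) (nth 0 us1 q.2) (nth 0 us2 p.2)) sta c0).
have d1 x : \sum_(i < size us1) rnorm (nth 0 us1 i x) ^+ 2 <= rnorm x ^+ 2.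
  by have := c1 x; rewrite (big_nth 0) big_mkord.
have d2 x : \sum_(i < size us2) rnorm (nth 0 us2 i x) ^+ 2 <= rnorm x ^+ 2.
  by have := c2 x; rewrite (big_nth 0) big_mkord.
move=> xi; have := @fmat_compress R H1 H2 L1 L2 _ _ _ _ c (fun i j => t (A i j))
   (fun k : 'I_(size us2) => nth 0 us2 k) (fun k : 'I_(size us1) => nth 0 us1 k) c0 d2 d1 hA xi.
apply: le_trans; rewrite le_eqVlt; apply/orP; left; apply/eqP.
apply: eq_bigr => p _; congr (rnorm _ ^+ 2); apply: eq_bigr => q _.
by rewrite cut_funP //; [exact: Mu1 (in_nth _) | exact: Mu2 (in_nth _)].
Qed.

(** The double sum pairs the matrix of cuts, bounded by [cut_matrix], with two columns that are
    contractive because the units are contractive on the induced spaces. *)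
Lemma cut_main_bound v us1 us2 x x' :
  (forall u, List.In u us1 -> M1 u) -> (forall u, List.In u us2 -> M2 u) ->
  (forall x, \sum_(u <- us1) rnorm (u x) ^+ 2 <= rnorm x ^+ 2) ->
  (forall x, \sum_(u <- us2) rnorm (u x) ^+ 2 <= rnorm x ^+ 2) ->
  (forall x, \sum_(u <- us1) rnorm (adj (nu1 u) x) ^+ 2 <= rnorm x ^+ 2) ->
  (forall x, \sum_(u <- us2) rnorm (adj (nu2 u) x) ^+ 2 <= rnorm x ^+ 2) ->
  cmod (\sum_(u2 <- us2) \sum_(u1 <- us1)
      ip (ta (cut_fun v u1 u2) (adj (nu1 u1) x)) (adj (nu2 u2) x')) <= mxnorm1 v * (rnorm x * rnorm x').
Proof.
move=> Mu1 Mu2 c1 c2 e1 e2; set Q := \sum_(u2 <- us2) _.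
have v0 : 0 <= mxnorm1 v by rewrite -(isometry_mxnorm1 v ct) mxnorm1_bop_ge0.
have hv : mat_le (mxnorm1 v ^+ 2) (fun _ _ : 'I_1 => t v : H1 -> H2).
  move=> xi; rewrite !big_ord1 -exprMn; apply: lerXn2r; rewrite ?nnegrE ?mulr_ge0 ?rnorm_ge0 //.
  by rewrite -(isometry_mxnorm1 v ct) mxnorm1_bop_ub.
have := @cut_matrix 1 1 _ (fun _ _ => v) us1 us2 (sqr_ge0 (mxnorm1 v)) Mu1 Mu2 c1 c2 hv.
move=> /(_ (fun q => adj (nu1 (nth 0 us1 q.2)) x)).
pose z (i : 'I_(size us2)) := \sum_(j < size us1) ta (cut_fun v (nth 0 us1 j) (nth 0 us2 i)) (adj (nu1 (nth 0 us1 j)) x).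
have pr (Z : zmodType) n (F : 'I_1 * 'I_n -> Z) : \sum_p F p = \sum_j F (ord0, j).
  transitivity (\sum_p F (p.1, p.2)); first by apply: eq_bigr => -[].
  by rewrite -(pair_bigA _ (fun i j => F (i, j))) big_ord1.
rewrite !pr /=; under eq_bigr do rewrite pr /= -/(z _).
move=> hz; have [w [w1 wQ]] := phase Q.
have QE : cmod Q = \sum_(i < size us2) rip (w *: z i) (adj (nu2 (nth 0 us2 i)) x').
  have -> : cmod Q = complex.Re (w * Q) by rewrite wQ.
  rewrite /Q (big_nth 0) big_mkord mulr_sumr Re_sum; apply: eq_bigr => i _.
  by rewrite /rip ipZl /z ip_suml (big_nth 0) big_mkord.
rewrite -(@ler_pXn2r _ 2) ?nnegrE ?mulr_ge0 ?rnorm_ge0 ?cmod_ge0 // QE.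
apply: le_trans (sum_rip_CS _ _ _) _; rewrite !exprMn mulrA; apply: ler_pM.
- by apply: sumr_ge0 => i _; exact: sqr_ge0.
- by apply: sumr_ge0 => i _; exact: sqr_ge0.
- under eq_bigr do rewrite rnormZ w1 mul1r.
  apply: le_trans hz _; apply: ler_wpM2l; first exact: sqr_ge0.
  by have := e1 x; rewrite (big_nth 0) big_mkord.
- by have := e2 x'; rewrite (big_nth 0) big_mkord.
Qed.

(** The prescribed values form a bounded sesquilinear form. [cut_pair_approx] brings it arbitrarily
    close to the double sum of [cut_main_bound], which sees the combinations only through their
    values in the induced spaces. *)
Lemma transfer_ex v : exists Om : bop H1' H2',
  (forall m1 m2 g g', M1 m1 -> M2 m2 ->
     ip (Om (nu1 m1 g)) (nu2 m2 g') = ip (ta (cut_fun v m1 m2) g) g') /\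
  forall x, rnorm (Om x) <= mxnorm1 v * rnorm x.
Proof.
have [_ T1 A1] := I1; have [_ T2 A2] := I2.
pose e1 (p : {m | M1 m} * G1) := nu1 (sval p.1) p.2.
pose e2 (p : {m | M2 m} * G2) := nu2 (sval p.1) p.2.
have te1 : total e1 by move=> h hh; apply: T1 => m g Mm; exact: (hh (exist _ m Mm, g)).
have te2 : total e2 by move=> h hh; apply: T2 => m g Mm; exact: (hh (exist _ m Mm, g)).
have v0 : 0 <= mxnorm1 v by rewrite -(isometry_mxnorm1 v ct) mxnorm1_bop_ge0.
have hv x : rnorm (t v x) <= mxnorm1 v * rnorm x.
  by rewrite -(isometry_mxnorm1 v ct) mxnorm1_bop_ub.
pose B (p : {m | M1 m} * G1) (q : {m | M2 m} * G2) :=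
  ip (ta (cut_fun v (sval p.1) (sval q.1)) p.2) q.2.
have [s l|Om [hO bO]] := total_form (B := B) te1 te2 v0; last first.
  exists Om; split=> // m1 m2 g g' h1 h2.
  by have := hO (exist _ m1 h1, g) (exist _ m2 h2, g').
pose K : R := \sum_(p <- s) \sum_(q <- l) cmod (p.1 * conjc q.1) *
  (mxnorm1 v * (mxnorm1 (sval p.2.1) + mxnorm1 (sval q.2.1)) * (rnorm p.2.2 * rnorm q.2.2)).
apply: (@le_eps _ _ _ K) => [|d d0].
  apply: sumr_ge0 => p _; apply: sumr_ge0 => q _.
  by rewrite !mulr_ge0 ?cmod_ge0 ?addr_ge0 ?mxnorm1_bop_ge0 ?rnorm_ge0.
have [us1 [Mu1 c1 n1 a1 _]] := A1 [seq sval p.2.1 | p <- s] [::] d d0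
  ltac:(by move=> m /List.in_map_iff[p [<- _]]; exact: (svalP p.2.1)).
have [us2 [Mu2 c2 n2 a2 _]] := A2 [seq sval p.2.1 | p <- l] [::] d d0
  ltac:(by move=> m /List.in_map_iff[p [<- _]]; exact: (svalP p.2.1)).
have main := cut_main_bound v (lc_val e1 s) (lc_val e2 l) Mu1 Mu2 c1 c2 n1 n2.
set Q := \sum_(u2 <- us2) _ in main.
pose C p q := \sum_(u2 <- us2) \sum_(u1 <- us1)
      ip (ta (cut_fun v u1 u2) (adj (nu1 u1) (e1 p))) (adj (nu2 u2) (e2 q)).
have QE : Q = \sum_(p <- s) \sum_(q <- l) p.1 * conjc q.1 * C p.2 q.2.
  rewrite /Q; transitivity (\sum_(u2 <- us2) \sum_(u1 <- us1) \sum_(p <- s) \sum_(q <- l)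
     p.1 * conjc q.1 * ip (ta (cut_fun v u1 u2) (adj (nu1 u1) (e1 p.2))) (adj (nu2 u2) (e2 q.2))).
    apply: eq_bigr => u2 _; apply: eq_bigr => u1 _.
    rewrite /lc_val !bop_sum ip_suml; apply: eq_bigr => p _; rewrite ip_sumr; apply: eq_bigr => q _.
    by rewrite !bopZ ipZl ipZr mulrA.
  under eq_bigr do rewrite exchange_big /=.
  rewrite exchange_big /=; apply: eq_bigr => p _.
  under eq_bigr do rewrite exchange_big /=.
  rewrite exchange_big /=; apply: eq_bigr => q _.
  by rewrite /C mulr_sumr; apply: eq_bigr => u2 _; rewrite mulr_sumr.
have -> : \sum_(p <- s) p.1 * lc_ev (B p.2) l =
   Q + \sum_(p <- s) \sum_(q <- l) p.1 * conjc q.1 * (B p.2 q.2 - C p.2 q.2).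
  rewrite QE -big_split; apply: eq_bigr => p _; rewrite /lc_ev mulr_sumr -big_split.
  by apply: eq_bigr => q _ /=; ring.
apply: le_trans (cmodD _ _) _; apply: lerD; first by rewrite -mulrA.
apply: le_trans (cmod_sum _ _ _) _; rewrite /K mulr_sumr; apply: ler_sum_in => p ip_.
apply: le_trans (cmod_sum _ _ _) _; rewrite mulr_sumr; apply: ler_sum_in => q iq.
rewrite cmodM [X in _ <= X]mulrCA; apply: ler_wpM2l; first exact: cmod_ge0.
rewrite [X in _ <= X]mulrA; apply: cut_pair_approx (ltW d0) v0 hv Mu1 Mu2 c1 c2 _ _.
- exact: (svalP p.2.1).
- exact: (svalP q.2.1).
- by move=> l'; apply: a1; apply/List.in_map_iff; exists p.
- by move=> l'; apply: a2; apply/List.in_map_iff; exists q.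
Qed.

Lemma transfer_eq v : exists Om : bop H1' H2',
  (forall m1 m2 y g, M1 m1 -> M2 m2 -> sg y = bop_comp m2 (bop_comp (t v) (adj m1)) ->
     adj (nu2 m2) (Om (nu1 m1 g)) = ta y g) /\
  forall x, rnorm (Om x) <= mxnorm1 v * rnorm x.
Proof.
have [Om [h b]] := transfer_ex v; exists Om; split=> // m1 m2 y g h1 h2 e.
have -> : y = cut_fun v m1 m2 by apply: injs; rewrite cut_funP.
by apply: ip_inj => g'; rewrite adjPr h.
Qed.

Definition transfer v : bop H1' H2' := sval (cid (transfer_eq v)).
Lemma transferE v m1 m2 y g : M1 m1 -> M2 m2 ->
  sg y = bop_comp m2 (bop_comp (t v) (adj m1)) -> adj (nu2 m2) (transfer v (nu1 m1 g)) = ta y g.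
Proof. by move=> h1 h2; have [h _] := svalP (cid (transfer_eq v)); exact: h. Qed.
Lemma transfer_bound v x : rnorm (transfer v x) <= mxnorm1 v * rnorm x.
Proof. by have [_ h] := svalP (cid (transfer_eq v)). Qed.

Lemma transfer_uniq (S T : bop H1' H2') : (forall m1 m2 g, M1 m1 -> M2 m2 ->
  adj (nu2 m2) (S (nu1 m1 g)) = adj (nu2 m2) (T (nu1 m1 g))) -> S = T.
Proof.
have [_ T1 _] := I1; have [_ T2 _] := I2; move=> h.
apply: (@bop_eq_total _ _ _ _ (fun p : {m | M1 m} * G1 => nu1 (sval p.1) p.2)).
  by move=> x hx; apply: T1 => m g Mm; exact: (hx (exist _ m Mm, g)).
move=> [[m1 h1] g] /=; apply/eqP; rewrite -subr_eq0; apply/eqP; apply: T2 => m2 g' h2.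
by rewrite ipBl -!adjPr h // subrr.
Qed.

Lemma transfer_linear : linear transfer.
Proof.
move=> a v w; apply: transfer_uniq => m1 m2 g h1 h2.
have ev := cut_funP v h1 h2; have ew := cut_funP w h1 h2.
rewrite bop_addE bop_scaleE bopD bopZ (transferE _ h1 h2 ev) (transferE _ h1 h2 ew).
rewrite -bop_scaleE -bop_addE -lta.2 -lta.1; apply: transferE => //.
rewrite ls.1 ls.2 ev ew lt.1 -[a *: v]/(sact a v) lt.2.
by apply: bop_eq => x; rewrite bop_addE bop_scaleE !bop_compE bop_addE bop_scaleE bopD bopZ.
Qed.

Lemma transfer_of v y m1 m2 : M1 m1 -> M2 m2 -> t v = bop_comp (adj m2) (bop_comp (sg y) m1) ->
  transfer v = bop_comp (nu2 m2) (bop_comp (ta y) (adj (nu1 m1))).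
Proof.
move=> h1 h2 e; apply: transfer_uniq => n1 n2 g k1 k2.
have e1 := cut_funP v k1 k2; rewrite (transferE _ k1 k2 e1) !bop_compE.
by apply: sandwich => //; rewrite e1 e; exact: bop_eq.
Qed.

(** Compressed by the units, the transferred matrix is a matrix of cuts, bounded by [cut_matrix];
    and on the finitely many vectors involved the units are close to the identity. *)
Lemma transfer_le m n (c : R) (A : 'I_m -> 'I_n -> V) : 0 <= c ->
  mat_le c (fun i j => t (A i j) : H1 -> H2) ->
  mat_le c (fun i j => transfer (A i j) : H1' -> H2').
Proof.
move=> c0 hA; apply/fmat_form => x y; set X := \sum_j rnorm (x j) ^+ 2; set Yy := \sum_i rnorm (y i) ^+ 2.
have [_ _ A1] := I1; have [_ _ A2] := I2.
pose K : R := \sum_i \sum_j mxnorm1 (A i j) * (rnorm (x j) + rnorm (y i) + 1).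
have n0 (v : V) : 0 <= mxnorm1 v by rewrite -(isometry_mxnorm1 v ct) mxnorm1_bop_ge0.
apply: (@le_eps _ _ _ (2 * K)) => [|d d0].
  by rewrite mulr_ge0 // !sumr_ge0 // => i _; rewrite sumr_ge0 // => j _; rewrite mulr_ge0 ?addr_ge0 ?rnorm_ge0.
pose e := Num.min d 1; have e0 : 0 < e by rewrite lt_min d0 ltr01.
have ed : e <= d by rewrite ge_min lexx.
have e1 : e <= 1 by rewrite ge_min lexx orbT.
have [//|us1 [Mu1 c1 n1 _ a1]] := A1 [::] [seq x j | j <- index_enum 'I_n] e e0.
have [//|us2 [Mu2 c2 n2 _ a2]] := A2 [::] [seq y i | i <- index_enum 'I_m] e e0.
have inE_ (T : finType) L (f : T -> L) i : List.In (f i) [seq f j | j <- index_enum T].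
  apply/List.in_map_iff; exists i; split=> //.
  have : i \in index_enum T by rewrite mem_index_enum.
  by elim: (index_enum T) => //= z l IH; rewrite inE => /orP[/eqP->|/IH]; [left | right].
pose S1 z := \sum_(u <- us1) nu1 u (adj (nu1 u) z).
pose S2 z := \sum_(u <- us2) nu2 u (adj (nu2 u) z).
have hx j : rnorm (x j - S1 (x j)) <= e by apply: a1; exact: inE_.
have hy i : rnorm (y i - S2 (y i)) <= e by apply: a2; exact: inE_.
have cm := cut_matrix c0 Mu1 Mu2 c1 c2 hA.
move: cm => /fmat_form /(_ (fun q => adj (nu1 (nth 0 us1 q.2)) (x q.1))
  (fun p => adj (nu2 (nth 0 us2 p.2)) (y p.1))) cm.
have pr (I J : finType) (F : I * J -> R) : \sum_p F p = \sum_(i : I) \sum_(j : J) F (i, j).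
  by rewrite pair_bigA; apply: eq_bigr => -[].
have main : \sum_i \sum_j rip (transfer (A i j) (S1 (x j))) (S2 (y i)) <= (c * X + Yy) / 2.
  apply: le_trans (_ : _ <= _) (le_trans cm _); last first.
    rewrite ler_pM2r ?invr_gt0 //; apply: lerD; last first.
      rewrite pr /Yy; apply: ler_sum => i _ /=.
      by have := n2 (y i); rewrite (big_nth 0) big_mkord.
    apply: ler_wpM2l => //; rewrite pr /X; apply: ler_sum => j _ /=.
    by have := n1 (x j); rewrite (big_nth 0) big_mkord.
  rewrite le_eqVlt; apply/orP; left; apply/eqP.
  rewrite pr; apply: eq_bigr => i _.
  have -> : \sum_j rip (transfer (A i j) (S1 (x j))) (S2 (y i)) =
     \sum_(k < size us2) \sum_j \sum_(l < size us1) rip (ta (cut_fun (A i j) (nth 0 us1 l) (nth 0 us2 k))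
        (adj (nu1 (nth 0 us1 l)) (x j))) (adj (nu2 (nth 0 us2 k)) (y i)).
    rewrite exchange_big /=; apply: eq_bigr => j _.
    rewrite /S2 (big_nth 0) big_mkord rip_sumr; apply: eq_bigr => k _.
    rewrite /S1 (big_nth 0) big_mkord bop_sum rip_suml; apply: eq_bigr => l _.
    have k1 := Mu1 _ (in_nth l); have k2 := Mu2 _ (in_nth k).
    by rewrite -(transferE _ k1 k2 (cut_funP _ k1 k2)) /rip -adjPr.
  apply: eq_bigr => k _ /=; rewrite rip_suml pr; apply: eq_bigr => j _.
  by apply: eq_bigr => l _.
have diff i j : rip (transfer (A i j) (x j)) (y i) <= rip (transfer (A i j) (S1 (x j))) (S2 (y i)) +
    d * (2 * (mxnorm1 (A i j) * (rnorm (x j) + rnorm (y i) + 1))).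
  set T := transfer (A i j); set a := mxnorm1 (A i j).
  have -> : rip (T (x j)) (y i) = rip (T (S1 (x j))) (S2 (y i)) +
      (rip (T (x j - S1 (x j))) (y i) + rip (T (S1 (x j))) (y i - S2 (y i))).
    by rewrite bopB ripBl ripBr; ring.
  rewrite lerD2l; apply: le_trans (lerD (rip_CS _ _) (rip_CS _ _)) _.
  have b1 : rnorm (T (x j - S1 (x j))) <= a * e.
    by apply: le_trans (transfer_bound _ _) _; rewrite ler_wpM2l.
  have s1 : rnorm (S1 (x j)) <= rnorm (x j) + 1.
    have := rnormD (S1 (x j) - x j) (x j); rewrite subrK rnormBC; have := hx j; lra.
  have b2 : rnorm (T (S1 (x j))) <= a * (rnorm (x j) + 1).
    by apply: le_trans (transfer_bound _ _) _; rewrite ler_wpM2l.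
  have a0 : 0 <= a := n0 _.
  have k1 : rnorm (T (x j - S1 (x j))) * rnorm (y i) <= a * d * rnorm (y i).
    by apply: ler_wpM2r; rewrite ?rnorm_ge0 //; apply: le_trans b1 _; rewrite ler_wpM2l.
  have k2 : rnorm (T (S1 (x j))) * rnorm (y i - S2 (y i)) <= a * (rnorm (x j) + 1) * d.
    by apply: ler_pM; rewrite ?rnorm_ge0 //; exact: le_trans (hy i) ed.
  have k3 : 0 <= d * (a * (rnorm (x j) + rnorm (y i) + 1)).
    by rewrite !mulr_ge0 ?addr_ge0 ?rnorm_ge0 // ltW.
  move: (rnorm_ge0 (x j)) (rnorm_ge0 (y i)) k1 k2 k3; lra.
apply: le_trans (_ : \sum_i \sum_j (rip (transfer (A i j) (S1 (x j))) (S2 (y i)) +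
    d * (2 * (mxnorm1 (A i j) * (rnorm (x j) + rnorm (y i) + 1)))) <= _).
  by apply: ler_sum => i _; rewrite rip_suml; apply: ler_sum => j _; exact: diff.
under eq_bigr do rewrite big_split /=; rewrite big_split /=; apply: lerD => //.
rewrite /K !mulr_sumr; apply: ler_sum => i _; rewrite !mulr_sumr; apply: ler_sum => j _.
by rewrite lexx.
Qed.

(** The reverse passage, with [tas]. The units approximate the identity only on the supports; by
    [rng2] the operator [t v] maps into one support, and by [rng1] it vanishes off the other. *)
Lemma transfer_ge m n (c : R) (A : 'I_m -> 'I_n -> V) : 0 <= c ->
  mat_le c (fun i j => transfer (A i j) : H1' -> H2') ->
  mat_le c (fun i j => t (A i j) : H1 -> H2).
Proof.
move=> c0 hA; apply/fmat_form => x y; set X := \sum_j rnorm (x j) ^+ 2; set Yy := \sum_i rnorm (y i) ^+ 2.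
pose K : R := \sum_(i < m) \sum_(j < n) (rnorm (y i) + rnorm (x j)).
apply: (@le_eps _ _ _ K) => [|d d0].
  by rewrite !sumr_ge0 // => i _; rewrite sumr_ge0 // => j _; rewrite addr_ge0 ?rnorm_ge0.
have inE_ (T : finType) L (f : T -> L) i : List.In (f i) [seq f j | j <- index_enum T].
  apply/List.in_map_iff; exists i; split=> //.
  have : i \in index_enum T by rewrite mem_index_enum.
  by elim: (index_enum T) => //= z l IH; rewrite inE => /orP[/eqP->|/IH]; [left | right].
have [//||us2 [Mu2 c2 n2 _ [_ z2]]] := approx_on_range I2 (ms := [::]) [::]
  (zs := [seq t (A p.1 p.2) (x p.2) | p <- index_enum ('I_m * 'I_n)%type]) d0.
  by move=> z /List.in_map_iff[p [<- _]]; exact: rng2.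
(* Chosen after [us2], since the vectors to be approximated involve [us2]. *)
have [//||us1 [Mu1 c1 n1 _ [_ z1]]] := approx_on_range I1 (ms := [::]) [::]
  (zs := [seq adj (t (A p.1 p.2)) (usum us2 (y p.1)) | p <- index_enum ('I_m * 'I_n)%type]) d0.
  by move=> z /List.in_map_iff[p [<- _]]; exact: rng1.
have usym H W (us : seq (bop H W)) a b : rip (usum us a) b = rip a (usum us b).
  by rewrite usum_rip rip_sym usum_rip; apply: eq_bigr => u _; exact: rip_sym.
have d1 z : \sum_(i < size us1) rnorm (adj (nu1 (nth 0 us1 i)) z) ^+ 2 <= rnorm z ^+ 2.
  by have := n1 z; rewrite (big_nth 0) big_mkord.
have d2 z : \sum_(i < size us2) rnorm (adj (nu2 (nth 0 us2 i)) z) ^+ 2 <= rnorm z ^+ 2.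
  by have := n2 z; rewrite (big_nth 0) big_mkord.
pose CF (p : 'I_m * 'I_(size us2)) (q : 'I_n * 'I_(size us1)) :=
  cut_fun (A p.1 q.1) (nth 0 us1 q.2) (nth 0 us2 p.2).
have cta : fmat_le c (fun p q => ta (CF p q) : G1 -> G2).
  move=> xi; have := @fmat_compress R H1' H2' G1 G2 _ _ _ _ c (fun i j => transfer (A i j))
    (fun k : 'I_(size us2) => adj (nu2 (nth 0 us2 k))) (fun k : 'I_(size us1) => adj (nu1 (nth 0 us1 k))) c0 d2 d1 hA xi.
  apply: le_trans; rewrite le_eqVlt; apply/orP; left; apply/eqP.
  apply: eq_bigr => p _; congr (rnorm _ ^+ 2); apply: eq_bigr => q _.
  have k1 := Mu1 _ (in_nth q.2); have k2 := Mu2 _ (in_nth p.2).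
  by rewrite adjK (transferE _ k1 k2 (cut_funP _ k1 k2)).
have := mat_dom_fin tas c0 cta => /fmat_form /(_ (fun q => nth 0 us1 q.2 (x q.1))
  (fun p => nth 0 us2 p.2 (y p.1))) cm.
have pr (I J : finType) (F : I * J -> R) : \sum_p F p = \sum_(i : I) \sum_(j : J) F (i, j).
  by rewrite pair_bigA; apply: eq_bigr => -[].
have main : \sum_i \sum_j rip (t (A i j) (usum us1 (x j))) (usum us2 (y i)) <= (c * X + Yy) / 2.
  apply: le_trans (_ : _ <= _) (le_trans cm _); last first.
    rewrite ler_pM2r ?invr_gt0 //; apply: lerD; last first.
      rewrite pr /Yy; apply: ler_sum => i _ /=.
      by have := c2 (y i); rewrite (big_nth 0) big_mkord.
    apply: ler_wpM2l => //; rewrite pr /X; apply: ler_sum => j _ /=.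
    by have := c1 (x j); rewrite (big_nth 0) big_mkord.
  rewrite le_eqVlt; apply/orP; left; apply/eqP.
  rewrite pr; apply: eq_bigr => i _.
  have -> : \sum_j rip (t (A i j) (usum us1 (x j))) (usum us2 (y i)) =
     \sum_(k < size us2) \sum_j \sum_(l < size us1) rip (sg (CF (i, k) (j, l)) (nth 0 us1 l (x j))) (nth 0 us2 k (y i)).
    rewrite exchange_big /=; apply: eq_bigr => j _.
    rewrite -usym usum_rip (big_nth 0) big_mkord; apply: eq_bigr => k _.
    rewrite /usum (big_nth 0) big_mkord !bop_sum rip_suml; apply: eq_bigr => l _.
    have k1 := Mu1 _ (in_nth l); have k2 := Mu2 _ (in_nth k).
    by rewrite /CF cut_funP.
  apply: eq_bigr => k _ /=; rewrite rip_suml pr; apply: eq_bigr => j _.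
  by apply: eq_bigr => l _.
have diff i j : rip (t (A i j) (x j)) (y i) <= rip (t (A i j) (usum us1 (x j))) (usum us2 (y i)) +
    d * (rnorm (y i) + rnorm (x j)).
  set T := t (A i j); set a := T (x j); set b := adj T (usum us2 (y i)).
  have ha : rnorm (a - usum us2 a) <= d.
    by apply: z2; exact: (inE_ _ _ (fun p : 'I_m * 'I_n => t (A p.1 p.2) (x p.2)) (i, j)).
  have hb : rnorm (b - usum us1 b) <= d.
    by apply: z1; exact: (inE_ _ _ (fun p : 'I_m * 'I_n => adj (t (A p.1 p.2)) (usum us2 (y p.1))) (i, j)).
  have -> : rip (T (usum us1 (x j))) (usum us2 (y i)) = rip (x j) (usum us1 b).
    by rewrite /rip adjP -/(rip _ _) -/b usym.
  have E : rip a (y i) = rip (a - usum us2 a) (y i) + (rip (x j) (b - usum us1 b) + rip (x j) (usum us1 b)).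
    rewrite -ripDr subrK ripBl usym; have -> : rip a (usum us2 (y i)) = rip (x j) b by rewrite /rip /a adjP.
    by ring.
  rewrite E addrA [X in _ <= X]addrC lerD2r mulrDr; apply: lerD.
    by apply: le_trans (rip_CS _ _) _; rewrite ler_wpM2r ?rnorm_ge0.
  by apply: le_trans (rip_CS _ _) _; rewrite mulrC ler_wpM2r ?rnorm_ge0.
apply: le_trans (_ : \sum_i \sum_j (rip (t (A i j) (usum us1 (x j))) (usum us2 (y i)) +
    d * (rnorm (y i) + rnorm (x j))) <= _).
  by apply: ler_sum => i _; rewrite rip_suml; apply: ler_sum => j _; exact: diff.
under eq_bigr do rewrite big_split /=; rewrite big_split /=; apply: lerD => //.
rewrite /K !mulr_sumr; apply: ler_sum => i _; rewrite !mulr_sumr; apply: ler_sum => j _.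
by rewrite lexx.
Qed.

Lemma transfer_isometry : complete_isometry transfer.
Proof.
split; first exact: transfer_linear.
move=> n A; rewrite -ct.2; apply/le_anti/andP; split.
  apply: mxnorm_bop_le; first exact: mxnorm_bop_ge0.
  move=> xi; under eq_bigr do under eq_bigr do rewrite mxE.
  apply: (@transfer_le n n (mxnorm (map_mx t A) ^+ 2) (fun i j => A i j) (sqr_ge0 _)) => {}xi.
  by have := mxnorm_bop_ub (map_mx t A) xi; under eq_bigr do under eq_bigr do rewrite mxE.
apply: mxnorm_bop_le; first exact: mxnorm_bop_ge0.
move=> xi; under eq_bigr do under eq_bigr do rewrite mxE.
apply: (@transfer_ge n n (mxnorm (map_mx transfer A) ^+ 2) (fun i j => A i j) (sqr_ge0 _)) => {}xi.
by have := mxnorm_bop_ub (map_mx transfer A) xi; under eq_bigr do under eq_bigr do rewrite mxE.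
Qed.

(** For vectors [nu1 m1 g] and [nu2 m2 g'] the functional comes from a normal functional of [sg],
    hence of [t]. It passes to closed spans as a norm limit. *)
Lemma transfer_continuous : continuous transfer.
Proof.
have [_ T1 _] := I1; have [_ T2 _] := I2; have [_ D1 _] := dV.
have n0 (v : V) : 0 <= mxnorm1 v by rewrite -(isometry_mxnorm1 v ct) mxnorm1_bop_ge0.
apply: normal_continuous => //; [exact: transfer_linear | exact: transfer_bound |].
have lim (f : H1' -> H2' -> V -> R[i]) x x' :
    (forall e : R, 0 < e -> exists2 p : H1' * H2', wfun (fun v => ip (transfer v p.1) p.2) &
       forall v, cmod (ip (transfer v x) x' - ip (transfer v p.1) p.2) <= e * mxnorm1 v) ->
    wfun (fun v => ip (transfer v x) x').
  move=> h; apply: D1 => [a v w|e /h[p wp hp]].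
    by rewrite transfer_linear bop_addE bop_scaleE ipDl ipZl.
  by exists (fun v => ip (transfer v p.1) p.2).
have basic m1 m2 g g' : M1 m1 -> M2 m2 -> wfun (fun v => ip (transfer v (nu1 m1 g)) (nu2 m2 g')).
  move=> h1 h2; have ltl : linear ta.
    by move=> a y z; rewrite lta.1 -[a *: y]/(sact a y) lta.2.
  have wf := ip_wfun ltl wta g g'; have [D0 _ _] := dY; have [r r0 hr] := D0 _ wf.
  have hr1 : fbounded (fun y => ip (ta y g) g') (r + 1).
    move=> y; apply: le_trans (hr y) _; rewrite ler_wpM2r ?lerDl //.
    by rewrite -(isometry_mxnorm1 y csg) mxnorm1_bop_ge0.
  have [|xi [eta [hx he fE]]] := normal_rep dY csg.1 (fun y => isometry_mxnorm1 y csg) wsg wf _ hr1.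
    lra.
  have [K1 k1] := sq_bounded_bop (adj m1) hx; have [K2 k2] := sq_bounded_bop (adj m2) he.
  have := nlim_wfun ct.1 wt k1 k2; congr wfun; apply/funext => v.
  rewrite -adjPr (transferE _ h1 h2 (cut_funP v h1 h2)) fE cut_funP //.
  by rewrite nlim_comp.
have close (z : H1' * H2') x x' e : 0 < e -> rnorm (x - z.1) * rnorm x' + rnorm z.1 * rnorm (x' - z.2) <= e ->
    forall v, cmod (ip (transfer v x) x' - ip (transfer v z.1) z.2) <= e * mxnorm1 v.
  move=> e0 hz v; have -> : ip (transfer v x) x' - ip (transfer v z.1) z.2 =
      ip (transfer v (x - z.1)) x' + ip (transfer v z.1) (x' - z.2).
    by rewrite bopB ipBl ipBr; ring.
  apply: le_trans (cmodD _ _) _; apply: le_trans (lerD (ip_CS _ _) (ip_CS _ _)) _.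
  apply: le_trans (_ : mxnorm1 v * (rnorm (x - z.1) * rnorm x' + rnorm z.1 * rnorm (x' - z.2)) <= _).
    rewrite mulrDr !mulrA; apply: lerD; apply: ler_wpM2r; rewrite ?rnorm_ge0 //; exact: transfer_bound.
  by rewrite mulrC; apply: ler_wpM2r.
have S1 x m2 g' : M2 m2 -> wfun (fun v => ip (transfer v x) (nu2 m2 g')).
  move=> h2; pose S := [set x | wfun (fun v => ip (transfer v x) (nu2 m2 g'))].
  suff : closed_span (fun p : {m | M1 m} * G1 => nu1 (sval p.1) p.2) `<=` S.
    apply; apply: total_dense => h hh; apply: T1 => m g Mm; exact: (hh (exist _ m Mm, g)).
  apply: closed_span_min => [|p]; last by apply: basic => //; exact: (svalP p.1).
  split=> [|a u w Su Sw|u hu]; rewrite /S /=.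
  - by have := wfun0 V; congr wfun; apply/funext => v; rewrite bop0 ip0l.
  - by have := wfunZD a Su Sw; congr wfun; apply/funext => v; rewrite bopD bopZ ipDl ipZl.
  - apply: (lim (fun _ _ _ => 0)) => e e0; pose k := rnorm (nu2 m2 g') + 1.
    have k0 : 0 < k by rewrite /k ltr_wpDl // rnorm_ge0.
    have [w Sw uw] := hu (e / k) ltac:(by rewrite divr_gt0).
    exists (w, nu2 m2 g') => //; apply: close => //=; rewrite subrr rnorm0 mulr0 addr0.
    move: uw; rewrite ltr_pdivlMr // /k => uw; have := rnorm_ge0 (u - w); lra.
move=> x; pose S := [set x' | wfun (fun v => ip (transfer v x) x')].
suff : closed_span (fun p : {m | M2 m} * G2 => nu2 (sval p.1) p.2) `<=` S.
  move=> hS x'; apply: hS; apply: total_dense => h hh; apply: T2 => m g Mm; exact: (hh (exist _ m Mm, g)).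
apply: closed_span_min => [|p]; last by apply: S1; exact: (svalP p.1).
split=> [|a u w Su Sw|u hu]; rewrite /S /=.
- by have := wfun0 V; congr wfun; apply/funext => v; rewrite ip0r.
- by have := wfunZD (conjc a) Su Sw; congr wfun; apply/funext => v; rewrite ipDr ipZr.
- apply: (lim (fun _ _ _ => 0)) => e e0; pose k := rnorm x + 1.
  have k0 : 0 < k by rewrite /k ltr_wpDl // rnorm_ge0.
  have [w Sw uw] := hu (e / k) ltac:(by rewrite divr_gt0).
  exists (x, w) => //; apply: close => //=; rewrite subrr rnorm0 mul0r add0r mulrC.
  move: uw; rewrite ltr_pdivlMr // /k => uw; have := rnorm_ge0 (u - w); lra.
Qed.

Theorem transfer_exists : exists om : V -> bop H1' H2',
  [/\ complete_isometry om, continuous om,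
   forall v m1 m2 y g, M1 m1 -> M2 m2 -> sg y = bop_comp m2 (bop_comp (t v) (adj m1)) ->
     adj (nu2 m2) (om v (nu1 m1 g)) = ta y g &
   forall v y m1 m2, M1 m1 -> M2 m2 -> t v = bop_comp (adj m2) (bop_comp (sg y) m1) ->
     om v = bop_comp (nu2 m2) (bop_comp (ta y) (adj (nu1 m1)))].
Proof.
exists transfer; split; [exact: transfer_isometry | exact: transfer_continuous | exact: transferE |].
exact: transfer_of.
Qed.

End Transfer.

(** * Ranges of isometries as operator subspaces *)

Section OntoRange.
Variables (R : realType) (H K : hilbertType R).
Implicit Types X : wMxNormedType R.

Lemma opsub_val_linear (S : opSubspace H K) : linear (@opsub_val R H K S).
Proof. by []. Qed.

Lemma opsub_val_continuous (S : opSubspace H K) : continuous (@opsub_val R H K S).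
Proof. exact: initial_continuous. Qed.

Lemma opsub_val_isometry (S : opSubspace H K) : complete_isometry (@opsub_val R H K S).
Proof. by split; [exact: opsub_val_linear | move=> n A]. Qed.

Lemma opsub_mem (S : opSubspace H K) (T : opsub S) : opset S T.
Proof. by have := opsubP T; rewrite inE. Qed.

Lemma opsub_lift (S : opSubspace H K) T : opset S T -> exists s : opsub S, opsub_val s = T.
Proof.
move=> ST; have h : T \in opsub_pred S by rewrite inE.
by exists (Opsub h).
Qed.

Lemma wonto_val X (S : opSubspace H K) (phi : X -> opsub S) : wcomplete_isometry_onto phi ->
  [/\ complete_isometry (fun x => opsub_val (phi x)), continuous (fun x => opsub_val (phi x)) &
   forall T, opset S T <-> exists x, opsub_val (phi x) = T].
Proof.
move=> [[lphi nphi] cphi rphi]; split.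
- split=> [a x y|n A]; first by rewrite lphi.
  rewrite -nphi; have -> : map_mx (fun x => opsub_val (phi x)) A = map_mx (@opsub_val R H K S) (map_mx phi A).
    by apply/matrixP => i j; rewrite !mxE.
  by [].
- by move=> x; apply: continuous_comp; [exact: cphi | exact: opsub_val_continuous].
- move=> T; split=> [ST|[x <-]]; last exact: opsub_mem.
  have [s sT] := opsub_lift ST; have : [set: opsub S] s by [].
  by rewrite -rphi => -[x _ e]; exists x; rewrite e.
Qed.

Section RangeSub.
Variables (X : wMxNormedType R) (chi : X -> bop H K).
Hypothesis lchi : linear chi.

Fact range_submod : submod_closed [in range chi].
Proof.
have c0 : chi 0 = 0 by have := lchi (-1) 0 0; rewrite scaler0 addr0 scaleN1r addNr.
split; first by rewrite inE; exists 0.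
by move=> a _ _ /set_mem[x _ <-] /set_mem[y _ <-]; rewrite inE; exists (a *: x + y); rewrite ?lchi.
Qed.
Definition range_sub : opSubspace H K := OpSubspace range_submod.
Fact range_sub_mem x : chi x \in opsub_pred range_sub.
Proof. by rewrite inE; exists x. Qed.
Definition to_range (x : X) : opsub range_sub := Opsub (range_sub_mem x).

Lemma to_range_linear : linear to_range.
Proof. by move=> a x y; apply: val_inj => /=; rewrite lchi. Qed.
Lemma to_range_continuous : continuous chi -> continuous to_range.
Proof. by move=> cc; apply: continuous_comp_initial => x; exact: cc. Qed.
Lemma to_range_onto : range to_range = setT.
Proof.
apply/seteqP; split=> // s _; have [x _ e] := opsub_mem s.
by exists x => //; apply: val_inj.
Qed.
Lemma to_range_isometry : complete_isometry chi -> continuous chi -> wcomplete_isometry_onto to_range.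
Proof.
move=> [_ nc] cc; split; [split; first exact: to_range_linear | exact: to_range_continuous | exact: to_range_onto].
move=> n A; rewrite -nc; have -> // : map_mx chi A = map_mx (@opsub_val R H K range_sub) (map_mx to_range A).
by apply/matrixP => i j; rewrite !mxE.
Qed.
End RangeSub.
End OntoRange.

(** * The corner of a dual space is again a dual space *)

Section CompressedDual.
Variables (R : realType) (X : wMxNormedType R) (H K : hilbertType R) (S : opSubspace H K).
Variables (phi : X -> opsub S) (p : bop K K) (q : bop H H).
Hypotheses (dX : dualized X) (wphi : wcomplete_isometry_onto phi).
Hypotheses (pp : projection p) (pq : projection q).
Hypotheses (pS : [set p] `o` S `<=` opset S) (Sq : opset S `o` [set q] `<=` opset S).

Lemma projE (L : hilbertType R) (r : bop L L) : projection r ->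
  [/\ forall x, r (r x) = r x, adj r = r & forall x, rnorm (r x) <= rnorm x].
Proof.
move=> [rr ra]; have ar : adj r = r by rewrite [RHS](adj_uniq (T := r)).
have rE x : r (r x) = r x by rewrite -[in RHS]rr.
split=> // x; have : rnorm (r x) ^+ 2 <= rnorm (r x) * rnorm x.
  by rewrite -rip_norm {1}/rip adjP ar rE -/(rip _ _) rip_sym; exact: rip_CS.
have [->|n0] := eqVneq (rnorm (r x)) 0; first by rewrite rnorm_ge0.
by rewrite expr2 ler_pM2l // lt_neqAle eq_sym n0 rnorm_ge0.
Qed.

Let C := compression p S q.
Let chi (x : X) : bop H K := opsub_val (phi x).

Lemma compress_mem T : opset S T -> opset C (bop_comp p (bop_comp T q)).
Proof.
move=> ST; exists (bop_comp p T); first by exists p => //; exists T.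
by exists q => //; exact: bop_eq.
Qed.
Lemma compression_sub T : opset C T -> opset S T.
Proof.
move=> [_ [_ -> [T' ST' <-]] [_ -> <-]]; apply: Sq; exists (bop_comp p T'); last by exists q.
by apply: pS; exists p => //; exists T'.
Qed.
Lemma compressionE T : opset C T -> bop_comp p (bop_comp T q) = T.
Proof.
have [p2 _ _] := projE pp; have [q2 _ _] := projE pq.
move=> [_ [_ -> [T' ST' <-]] [_ -> <-]]; apply: bop_eq => x; rewrite !bop_compE.
by rewrite p2 q2.
Qed.

Fact compress_fun_mem x : bop_comp p (bop_comp (chi x) q) \in opsub_pred C.
Proof. by rewrite inE; apply: compress_mem; exact: opsub_mem. Qed.
Definition compress (x : X) : opsub C := Opsub (compress_fun_mem x).

Let lift_ex (w : opsub C) : exists x, chi x = opsub_val w.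
Proof.
have [_ _ h] := wonto_val wphi; apply/h; apply: compression_sub; exact: opsub_mem.
Qed.
Let lift (w : opsub C) : X := sval (cid (lift_ex w)).
Let liftE w : chi (lift w) = opsub_val w := svalP (cid (lift_ex w)).
Let compress_lift w : compress (lift w) = w.
Proof. by apply: val_inj => /=; rewrite liftE compressionE //; exact: opsub_mem. Qed.

Let cchi : complete_isometry chi. Proof. by have [] := wonto_val wphi. Qed.
Let wchi : continuous chi. Proof. by have [] := wonto_val wphi. Qed.
Let nchi x : mxnorm1 (chi x) = mxnorm1 x := isometry_mxnorm1 x cchi.
Let lift_norm w : mxnorm1 (lift w) = mxnorm1 w.
Proof. by rewrite -nchi liftE; exact: (isometry_mxnorm1 w (opsub_val_isometry C)). Qed.
Let nX0 (x : X) : 0 <= mxnorm1 x. Proof. by rewrite -(nchi x) mxnorm1_bop_ge0. Qed.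
Let compress_norm x : mxnorm1 (compress x) <= mxnorm1 x.
Proof.
rewrite -(isometry_mxnorm1 (compress x) (opsub_val_isometry C)) -nchi.
have [_ _ pn] := projE pp; have [_ _ qn] := projE pq.
apply: mxnorm1_bop_le => [|z]; first exact: mxnorm1_bop_ge0.
rewrite /= ; apply: le_trans (pn _) _; apply: le_trans (mxnorm1_bop_ub _ _) _.
by rewrite ler_wpM2l ?mxnorm1_bop_ge0.
Qed.
Lemma compress_linear : linear compress.
Proof.
move=> a x y; apply: val_inj; apply: bop_eq => z /=.
by rewrite cchi.1 bop_addE bop_scaleE bopD bopZ.
Qed.
Lemma compress_continuous : continuous compress.
Proof. by apply: continuous_comp_initial => x; apply: continuous_comp2; exact: wchi. Qed.

Let wfun_compress f : wfun f -> wfun (fun x => f (compress x)).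
Proof.
move=> [lf cf]; split=> [a x y|x]; first by rewrite compress_linear lf.
have h := @continuous_comp _ _ _ compress (f : opsub C -> R[i]^o) x (@compress_continuous x) (cf _); exact: h.
Qed.
Let wfun_lift g : wfun g -> wfun (fun w => g (lift w)).
Proof.
move=> wg; have [D0 _ _] := dX; have [t t0 gt] := D0 g wg.
have gt1 : fbounded g (t + 1).
  by move=> x; apply: le_trans (gt x) _; rewrite ler_wpM2r ?lerDl.
have [|xi [eta [hx he gE]]] := normal_rep dX cchi.1 nchi wchi wg _ gt1; first lra.
have := nlim_wfun (@opsub_val_linear R H K C) (@opsub_val_continuous R H K C) hx he.
by congr wfun; apply/funext => w; rewrite gE liftE.
Qed.

(** [compress] is a w*-continuous contraction onto the corner, and [lift] is an isometric section of
    it that respects w*-continuous functionals; the three properties move along this pair. *)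
Lemma compression_dualized : dualized (opsub C).
Proof.
have [D0 D1 D2] := dX; split.
- move=> f wf; have [t t0 ft] := D0 _ (wfun_compress wf); exists t => // w.
  by rewrite -{1}(compress_lift w) -lift_norm; exact: ft.
- move=> f lf h; suff wf : wfun (fun x => f (compress x)).
    by have := wfun_lift wf; congr wfun; apply/funext => w; rewrite compress_lift.
  apply: D1 => [a x y|e e0]; first by rewrite compress_linear lf.
  have [g wg hg] := h e e0; exists (fun x => g (compress x)); first exact: wfun_compress.
  by move=> x; apply: le_trans (hg _) _; rewrite ler_wpM2l ?(ltW e0).
- move=> F c Fl Fb.
  have [a f g wf wg|f t wf t0 ft|x hx] := D2 (fun g => F (fun w => g (lift w))) c.
  + by rewrite -Fl //; exact: wfun_lift.
  + by apply: Fb => // [|w]; [exact: wfun_lift | rewrite -lift_norm; exact: ft].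
  + exists (compress x) => f wf; rewrite -(hx _ (wfun_compress wf)); congr F.
    by apply/funext => w; rewrite compress_lift.
Qed.
End CompressedDual.

(** * Linear spans and w*-closures *)

Section Spans.
Variables (R : realType) (V : lmodType R[i]).
Implicit Types S P : set V.

Lemma lspan0 S : lspan S 0.
Proof. by exists 0%N, (fun _ => 0), (fun _ => 0); split=> [[]|] //; rewrite big_ord0. Qed.
Lemma lspan_lin S a x y : lspan S x -> lspan S y -> lspan S (a *: x + y).
Proof.
move=> [m [b [u [Su ->]]]] [n [c [w [Sw ->]]]].
exists (m + n)%N, (fun i => match fintype.split i with inl j => a * b j | inr k => c k end),
  (fun i => match fintype.split i with inl j => u j | inr k => w k end).
split=> [i|]; first by case: (fintype.split i).
rewrite big_split_ord /= scaler_sumr; congr (_ + _); apply: eq_bigr => i _.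
  by rewrite (unsplitK (inl i)) scalerA.
by rewrite (unsplitK (inr i)).
Qed.
Lemma lspan_in S x : S x -> lspan S x.
Proof.
by move=> Sx; exists 1%N, (fun _ => 1), (fun _ => x); split=> //; rewrite big_ord1 scale1r.
Qed.
Lemma lspan_ind S P : P 0 -> (forall a x y, S x -> P y -> P (a *: x + y)) -> lspan S `<=` P.
Proof.
move=> P0 Pl _ [n [a [u [Su ->]]]]; elim: n a u Su => [|n IH] a u Su; first by rewrite big_ord0.
rewrite big_ord_recl; apply: Pl => //; apply: (IH (fun i => a (lift ord0 i)) (fun i => u (lift ord0 i))).
by move=> i; exact: Su.
Qed.
Lemma lspan_submod S : submod_closed [in lspan S].
Proof.
split; first by rewrite inE; exact: lspan0.
by move=> a x y /set_mem hx /set_mem hy; rewrite inE; exact: lspan_lin.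
Qed.
End Spans.

Section Closures.
Variable R : realType.

Lemma closure_approx (X : topologicalType) (S : set X) t (fs : seq (X -> R[i]^o)) (d : R) :
  closure S t -> (forall f, List.In f fs -> continuous f) -> 0 < d ->
  exists2 x, S x & forall f, List.In f fs -> cmod (f x - f t) < d.
Proof.
move=> clS cfs d0.
suff : nbhs t [set x | forall f, List.In f fs -> cmod (f x - f t) < d] by move=> /clS[x [Sx hx]]; exists x.
elim: fs cfs => [|f fs IH] cfs; first by apply: filterS filterT => x _ f [].
have h1 := continuous_cmod (cfs f (or_introl erefl)) t d0.
have h2 := IH (fun g ig => cfs g (or_intror ig)).
by apply: filterS (filterI h1 h2) => x [hx hy] g [<-|/hy].
Qed.

Lemma closure_add (A B : hilbertType R) (S : set (bop A B)) :
  (forall x y, S x -> S y -> S (x + y)) -> forall x y, closure S x -> closure S y -> closure S (x + y).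
Proof.
move=> SD x y hx hy; apply: (closure_initial (ev := @normal_functional R A B)) => l e e0.
pose fs := [seq (fun T : bop A B => nlim (sval s).1 (sval s).2 T : R[i]^o) | s <- l].
have cfs f : List.In f fs -> continuous f.
  move=> /List.in_map_iff[s [<- _]]; have [M [M' [hM hM']]] := nidxE s; exact: nlim_continuous hM hM'.
have e2 : 0 < e / 2 by rewrite divr_gt0.
have [x' Sx ax] := closure_approx hx cfs e2; have [y' Sy ay] := closure_approx hy cfs e2.
exists (x' + y'); first exact: SD.
move=> s sl; have [M [M' [hM hM']]] := nidxE s.
have inf_ : List.In (fun T : bop A B => nlim (sval s).1 (sval s).2 T : R[i]^o) fs.
  by apply/List.in_map_iff; exists s.
have := ax _ inf_; have := ay _ inf_.
rewrite -[normal_functional (x' + y') s]/(nlim (sval s).1 (sval s).2 (x' + y')).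
rewrite -[normal_functional (x + y) s]/(nlim (sval s).1 (sval s).2 (x + y)).
have D u v : nlim (sval s).1 (sval s).2 (u + v) = nlim (sval s).1 (sval s).2 u + nlim (sval s).1 (sval s).2 v.
  by have := nlimP 1 u v hM hM'; rewrite scale1r mul1r.
rewrite !D => h1 h2.
have -> : nlim (sval s).1 (sval s).2 x' + nlim (sval s).1 (sval s).2 y' -
   (nlim (sval s).1 (sval s).2 x + nlim (sval s).1 (sval s).2 y) =
   (nlim (sval s).1 (sval s).2 x' - nlim (sval s).1 (sval s).2 x) +
   (nlim (sval s).1 (sval s).2 y' - nlim (sval s).1 (sval s).2 y) by ring.
by apply: le_lt_trans (cmodD _ _) _; have := ltrD h1 h2; lra.
Qed.

Definition unit_on (G A : hilbertType R) (N : set (bop G A)) : Prop :=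
  forall (xs : seq A) (d : R), 0 < d -> exists us, [/\ forall u, List.In u us -> N u,
    forall x, rnorm (\sum_(u <- us) u (adj u x)) <= rnorm x &
    forall x, List.In x xs -> rnorm (x - \sum_(u <- us) u (adj u x)) <= d].

(** [T] is the limit of [P2 T P1], and each such product expands into the terms of the last
    hypothesis. All of them obey the bound [c], so [wot_closure] applies. *)
Lemma sandwich_closure (G1 G2 A1 A2 : hilbertType R) (N1 : set (bop G1 A1)) (N2 : set (bop G2 A2))
    (S : set (bop A1 A2)) (T : bop A1 A2) : unit_on N1 -> unit_on N2 -> S 0 ->
  (forall x y, S x -> S y -> S (x + y)) ->
  (forall u v, N2 u -> N1 v -> S (bop_comp u (bop_comp (bop_comp (adj u) (bop_comp T v)) (adj v)))) ->
  closure S T.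
Proof.
move=> un1 un2 S0 SD hS; have [c c0 hc] := bop_bound T.
apply: (wot_closure c0 hc) => l e e0.
pose K : R := \sum_(p <- l) (rnorm p.1 + rnorm p.2) + 1.
have K1 : 0 < K by rewrite ltr_wpDl // sumr_ge0 // => p _; rewrite addr_ge0 ?rnorm_ge0.
have c1 : 0 < c + 1 by lra.
(* The two errors add up to at most [c d K], which is below [(c + 1) d K = e]. *)
pose d := e / ((c + 1) * K); have d0 : 0 < d by rewrite divr_gt0 // mulr_gt0.
have [us1 [M1 b1 a1]] := un1 [seq p.1 | p <- l] d d0.
have [us2 [M2 b2 a2]] := un2 [seq p.2 | p <- l] d d0.
pose P1 : bop A1 A1 := \sum_(u <- us1) bop_comp u (adj u).
pose P2 : bop A2 A2 := \sum_(u <- us2) bop_comp u (adj u).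
have P1E x : P1 x = \sum_(u <- us1) u (adj u x) by rewrite /P1 bop_sumE.
have P2E x : P2 x = \sum_(u <- us2) u (adj u x) by rewrite /P2 bop_sumE.
have sP2 : adj P2 = P2 by rewrite /P2 adj_sum; apply: eq_bigr => u _; rewrite adj_comp adjK.
exists (bop_comp P2 (bop_comp T P1)).
  have -> : bop_comp P2 (bop_comp T P1) = \sum_(u <- us2) \sum_(v <- us1)
      bop_comp u (bop_comp (bop_comp (adj u) (bop_comp T v)) (adj v)).
    apply: bop_eq => x; rewrite bop_compE P2E bop_sumE; apply: eq_bigr => u _.
    by rewrite bop_compE P1E bop_sumE !bop_sum; apply: eq_bigr => v _.
  have sumS (r : seq (bop G2 A2)) (F : bop G2 A2 -> bop A1 A2) :
      (forall u, List.In u r -> S (F u)) -> S (\sum_(u <- r) F u).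
    elim: r => [|u r IH] h; first by rewrite big_nil.
    by rewrite big_cons; apply: SD; [apply: h; left | apply: IH => v iv; apply: h; right].
  have sumS1 (r : seq (bop G1 A1)) (F : bop G1 A1 -> bop A1 A2) :
      (forall u, List.In u r -> S (F u)) -> S (\sum_(u <- r) F u).
    elim: r => [|u r IH] h; first by rewrite big_nil.
    by rewrite big_cons; apply: SD; [apply: h; left | apply: IH => v iv; apply: h; right].
  by apply: sumS => u iu; apply: sumS1 => v iv; apply: hS; [exact: M2 | exact: M1].
split=> [x|p pl].
  rewrite !bop_compE P2E; apply: le_trans (b2 _) _; apply: le_trans (hc _) _.
  by rewrite ler_wpM2l // P1E.
rewrite !bop_compE.
have -> : ip (P2 (T (P1 p.1))) p.2 - ip (T p.1) p.2 = - (ip (T (p.1 - P1 p.1)) (P2 p.2) + ip (T p.1) (p.2 - P2 p.2)).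
  by rewrite adjP sP2 bopB ipBl ipBr; ring.
rewrite cmodN; apply: le_lt_trans (cmodD _ _) _.
have k1 : cmod (ip (T (p.1 - P1 p.1)) (P2 p.2)) <= c * d * rnorm p.2.
  apply: le_trans (ip_CS _ _) _; apply: ler_pM; rewrite ?rnorm_ge0 //; last by rewrite P2E.
  by apply: le_trans (hc _) _; rewrite ler_wpM2l // P1E; apply: a1; apply/List.in_map_iff; exists p.
have k2 : cmod (ip (T p.1) (p.2 - P2 p.2)) <= c * rnorm p.1 * d.
  apply: le_trans (ip_CS _ _) _; apply: ler_pM; rewrite ?rnorm_ge0 //.
  by rewrite P2E; apply: a2; apply/List.in_map_iff; exists p.
have pK : rnorm p.1 + rnorm p.2 <= K.
  have := @list_in_le _ _ (fun p : A1 * A2 => rnorm p.1 + rnorm p.2) l p (fun p => addr_ge0 (rnorm_ge0 _) (rnorm_ge0 _)) pl.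
  rewrite /K; lra.
have cd : 0 <= c * d by rewrite mulr_ge0 // ltW.
have k3 := ler_wpM2l cd pK.
have dK : d * ((c + 1) * K) = e by rewrite /d divfK // gt_eqF // mulr_gt0.
have dK0 : 0 < d * K by rewrite mulr_gt0.
apply: le_lt_trans (lerD k1 k2) _; move: k3 dK dK0; clearbody d K; lra.
Qed.
End Closures.

(** * Corners over the common representation and the TROs that link them *)

Section Corners.
Variables (R : realType) (Y : wMxNormedType R) (G1 G2 : hilbertType R) (ta : Y -> bop G1 G2).
Hypotheses (lta : actlin (@sact R Y) ta) (wta : continuous ta).

(** What the new representations of [p X q] and of [Z] have in common: sandwiching by [N1] and [N2]
    leads from [ta Y] into [C] and back, and products within [N1] or [N2] are multipliers of
    [ta]. *)
Record corner (A1 A2 : hilbertType R) (C : set (bop A1 A2)) (N1 : set (bop G1 A1)) (N2 : set (bop G2 A2)) : Prop :=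
 Corner { corner_closed : closed C; corner0 : C 0;
  corner_lin : forall a x y, C x -> C y -> C (a *: x + y);
  corner_in : forall a1 a2 y, N1 a1 -> N2 a2 -> C (bop_comp a2 (bop_comp (ta y) (adj a1)));
  corner_out : forall c a1 a2, C c -> N1 a1 -> N2 a2 -> exists y, ta y = bop_comp (adj a2) (bop_comp c a1);
  corner_alg1 : forall a a', N1 a -> N1 a' -> mult (cadj ta) (bop_comp (adj a) a');
  corner_alg2 : forall a a', N2 a -> N2 a' -> mult ta (bop_comp (adj a) a');
  corner_unit1 : unit_on N1; corner_unit2 : unit_on N2 }.

(** A path from [A] to [G], through a multiplier there, and on to [A']. The multiplier in the middle
    is what makes the span stable under triple products. *)
Definition link_gen (G A A' : hilbertType R) (N : set (bop G A)) (N' : set (bop G A')) (D : set (bop G G)) : set (bop A A') :=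
  [set T | exists a d b, [/\ N' a, D d, N b & T = bop_comp a (bop_comp d (adj b))]].

Lemma link_tro (G A A' : hilbertType R) (N : set (bop G A)) (N' : set (bop G A')) (D : set (bop G G)) :
  (forall d d', D d -> D d' -> D (bop_comp d d')) -> (forall d, D d -> D (adj d)) ->
  (forall a a', N a -> N a' -> D (bop_comp (adj a) a')) ->
  (forall a a', N' a -> N' a' -> D (bop_comp (adj a) a')) -> is_TRO (lspan (link_gen N N' D)).
Proof.
move=> DM DA hN hN'; split; first exact: lspan_submod.
set S := lspan _.
move=> _ [_ [x Sx [_ [y Sy /adjoint_ofE ->] <-]] [z Sz <-]].
have SL a u v : S u -> S v -> S (a *: u + v) by exact: lspan_lin.
move: x Sx; apply: lspan_ind => [|a x x' gx Sx'].
  have -> : bop_comp (bop_comp (0 : bop A A') (adj y)) z = 0; last exact: lspan0.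
    by apply: bop_eq => g; rewrite !bop_compE bop_zeroE.
have -> : bop_comp (bop_comp (a *: x + x') (adj y)) z =
   a *: bop_comp (bop_comp x (adj y)) z + bop_comp (bop_comp x' (adj y)) z by exact: bop_eq.
apply: (SL _) => //; move: y Sy {Sx'}; apply: lspan_ind => [|b y y' gy Sy'].
  have -> : bop_comp (bop_comp x (adj (0 : bop A A'))) z = 0; last exact: lspan0.
  by apply: bop_eq => g; rewrite adj0 !bop_compE bop_zeroE bop0.
have -> : bop_comp (bop_comp x (adj (b *: y + y'))) z =
   conjc b *: bop_comp (bop_comp x (adj y)) z + bop_comp (bop_comp x (adj y')) z.
  by apply: bop_eq => g; rewrite adjD adjZ bop_addE bop_scaleE !bop_compE bop_addE bop_scaleE bopD bopZ.
apply: (SL _) => //; move: z Sz {Sy'}; apply: lspan_ind => [|c z z' gz Sz'].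
  have -> : bop_comp (bop_comp x (adj y)) (0 : bop A A') = 0; last exact: lspan0.
  by apply: bop_eq => g; rewrite !bop_compE bop_zeroE !bop0.
have -> : bop_comp (bop_comp x (adj y)) (c *: z + z') =
   c *: bop_comp (bop_comp x (adj y)) z + bop_comp (bop_comp x (adj y)) z'.
  by apply: bop_eq => g; rewrite bop_addE bop_scaleE !bop_compE bop_addE bop_scaleE !bopD !bopZ.
apply: (SL _) => //; apply: lspan_in.
move: gx gy gz => [a1 [d1 [b1 [h1 k1 l1 ->]]]] [a2 [d2 [b2 [h2 k2 l2 ->]]]] [a3 [d3 [b3 [h3 k3 l3 ->]]]].
exists a1, (bop_comp d1 (bop_comp (bop_comp (adj b1) b2) (bop_comp (adj d2) (bop_comp (bop_comp (adj a2) a3) d3)))), b3.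
split=> //; first by apply: (DM _) => //; apply: (DM _); [exact: hN | apply: (DM _); [exact: DA | apply: (DM _) => //; exact: hN']].
by apply: bop_eq => g; rewrite !adj_comp adjK.
Qed.

Lemma mult_right d y : mult (cadj ta) d -> exists y', ta y' = bop_comp (ta y) d.
Proof.
move=> [_ h]; have [y' e] := h y; exists y'; rewrite -[ta y']adjK -/(cadj ta y') e adj_comp adjK /cadj adjK.
by [].
Qed.

Section Absorb.
Variables (A1 A2 : hilbertType R) (C : set (bop A1 A2)) (N1 : set (bop G1 A1)) (N2 : set (bop G2 A2)).
Hypothesis cC : corner C N1 N2.

(** Membership in [C] can be tested after sandwiching; needed where a product of linking operators
    meets [C] on one side only. *)
Lemma corner_sandwich T : (forall u v, N2 u -> N1 v -> exists y, ta y = bop_comp (adj u) (bop_comp T v)) -> C T.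
Proof.
move=> h; apply: (corner_closed cC); apply: (sandwich_closure (corner_unit1 cC) (corner_unit2 cC) (corner0 cC)).
- by move=> x y hx hy; rewrite -[x]scale1r; exact: (corner_lin cC).
- by move=> u v hu hv; have [y <-] := h u v hu hv; exact: (corner_in cC).
Qed.
End Absorb.

Section TroSub.
Variables (A1 A2 B1 B2 : hilbertType R) (C : set (bop A1 A2)) (C' : set (bop B1 B2)).
Variables (N1 : set (bop G1 A1)) (N2 : set (bop G2 A2)) (N1' : set (bop G1 B1)) (N2' : set (bop G2 B2)).
Hypotheses (cC : corner C N1 N2) (cC' : corner C' N1' N2').
Hypothesis gen : forall y (fs : seq (Y -> R[i])) (d : R), 0 < d -> (forall f, List.In f fs -> wfun f) ->
  exists2 y', lspan [set z | exists c a1 a2, [/\ C c, N1 a1, N2 a2 & ta z = bop_comp (adj a2) (bop_comp c a1)]] y' &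
    forall f, List.In f fs -> cmod (f y' - f y) < d.

Let lct := actlin_cadj lta.
Let R1 := lspan (link_gen N1 N1' (mult (cadj ta))).
Let R2 := lspan (link_gen N2 N2' (mult ta)).
Let mM d d' := @mult_mul R Y G1 G2 ta d d'.
Let mM1 d d' := @mult_mul R Y G2 G1 (cadj ta) d d'.

Let mult1 (U W : hilbertType R) (s : Y -> bop U W) : mult s (bop_id W).
Proof. by split=> y; exists y; rewrite ?adj_id; exact: bop_eq. Qed.

(** The linking TROs pass from one corner to the other through [G1] and [G2]. Hypothesis [gen] says
    that the part of [Y] coming from [C] is w*-dense, which is why the products generate all of
    [C']. *)
Lemma corner_tro_sub : TRO_sub C' C.
Proof.
have C0 := corner0 cC; have Cl := corner_lin cC; have C'0 := corner0 cC'; have C'l := corner_lin cC'.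
have adjl (A B : hilbertType R) a (x y : bop A B) : adj (a *: x + y) = conjc a *: adj x + adj y.
  by rewrite adjD adjZ.
exists R1, R2; split.
- apply: link_tro; [exact: mM1 | exact: mult_adj | exact: (corner_alg1 cC) | exact: (corner_alg1 cC')].
- apply: link_tro; [exact: mM | exact: mult_adj | exact: (corner_alg2 cC) | exact: (corner_alg2 cC')].
- set E := lspan _; apply/seteqP; split=> [c Cc|].
    have ED x y : closure E x -> closure E y -> closure E (x + y).
      by apply: closure_add => u v hu hv; rewrite -[u]scale1r; exact: lspan_lin.
    (* Two approximations in succession: units around [c], and [gen] for the elements of [Y] between
       them. Hence the closure of a closure. *)
    apply: (@closed_closure _ E).
    apply: (sandwich_closure (corner_unit1 cC') (corner_unit2 cC') _ ED).
      by apply: subset_closure; exact: lspan0.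
    move=> u v hu hv; have [y <-] := corner_out cC' Cc hv hu.
    apply: (closure_initial (ev := @normal_functional R B1 B2)) => l e e0.
    pose G (T : bop G1 G2) : bop B1 B2 := bop_comp u (bop_comp T (adj v)).
    pose fs := [seq (fun y => nlim (sval s).1 (sval s).2 (G (ta y))) | s <- l].
    have ltl : linear ta by move=> a x z; rewrite lta.1 -[a *: x]/(sact a x) lta.2.
    have fsw f : List.In f fs -> wfun f.
      move=> /List.in_map_iff[s [<- _]]; have [M [M' [hM hM']]] := nidxE s.
      have [K1 k1] := sq_bounded_bop (adj v) hM; have [K2 k2] := sq_bounded_bop (adj u) hM'.
      by have := nlim_wfun ltl wta k1 k2; congr wfun; apply/funext => z; rewrite nlim_comp.
    have [y' sy' hy'] := gen y e0 fsw; exists (G (ta y')).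
      move: y' sy' {hy'}; apply: lspan_ind => [|a x z [c' [a1 [a2 [Cc' h1 h2 ex]]]] Ez].
        have -> : G (ta 0) = 0; last exact: lspan0.
        by rewrite (actlin0 lta); apply: bop_eq => g; rewrite /G !bop_compE bop_zeroE bop0.
      have -> : G (ta (a *: x + z)) = a *: G (ta x) + G (ta z).
        apply: bop_eq => g; rewrite ltl /G bop_addE bop_scaleE !bop_compE.
        by rewrite bop_addE bop_scaleE bopD bopZ.
      apply: lspan_lin => //; apply: lspan_in.
      exists (bop_comp (bop_comp u (bop_comp (bop_id G2) (adj a2))) c').
        exists (bop_comp u (bop_comp (bop_id G2) (adj a2))); last by exists c'.
        by apply: lspan_in; exists u, (bop_id G2), a2; split=> //; exact: mult1.
      exists (adj (bop_comp v (bop_comp (bop_id G1) (adj a1)))).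
        exists (bop_comp v (bop_comp (bop_id G1) (adj a1))); last by move=> ? ?; exact: adjP.
        by apply: lspan_in; exists v, (bop_id G1), a1; split=> //; exact: mult1.
      by apply: bop_eq => g; rewrite /G ex !adj_comp adj_id adjK.
    move=> s sl; have i_ : List.In (fun y => nlim (sval s).1 (sval s).2 (G (ta y))) fs.
      by apply/List.in_map_iff; exists s.
    exact: (hy' _ i_).
  have cl : closure C' `<=` C' := corner_closed cC'.
  apply: subset_trans cl; apply: closure_subset.
  apply: lspan_ind => // a T y [_ [x2 h2 [c Cc <-]] [_ [x1 h1 /adjoint_ofE ->] <-]] C'y; apply: (corner_lin cC') => // {y C'y a}.
  move: x2 h2; apply: lspan_ind => [|a x x' [a2 [d2 [b2 [k2 m2 l2 ->]]]] C'x].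
    have -> // : bop_comp (bop_comp (0 : bop A2 B2) c) (adj x1) = 0.
    by apply: bop_eq => g; rewrite !bop_compE bop_zeroE.
  set z := bop_comp a2 _; have -> : bop_comp (bop_comp (a *: z + x') c) (adj x1) =
    a *: bop_comp (bop_comp z c) (adj x1) + bop_comp (bop_comp x' c) (adj x1) by exact: bop_eq.
  apply: (corner_lin cC') => //; move: x1 h1 {C'x}; apply: lspan_ind => [|a' x1 x1' [a1 [d1 [b1 [k1 m1 l1 ->]]]] C'x].
    have -> // : bop_comp (bop_comp z c) (adj (0 : bop A1 B1)) = 0.
    by apply: bop_eq => g; rewrite adj0 !bop_compE bop_zeroE !bop0.
  set z1 := bop_comp a1 _.
  have -> : bop_comp (bop_comp z c) (adj (a' *: z1 + x1')) =
    conjc a' *: bop_comp (bop_comp z c) (adj z1) + bop_comp (bop_comp z c) (adj x1').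
    by apply: bop_eq => g; rewrite adjl bop_addE bop_scaleE !bop_compE bop_addE bop_scaleE !bopD !bopZ.
  apply: (corner_lin cC') => //; have [y ey] := corner_out cC Cc l1 l2.
  have [y1 e1] := m2.1 y; have [y2 e2] := mult_right y1 (mult_adj m1).
  have := corner_in cC' y2 k1 k2; congr C'; apply: bop_eq => g.
  by rewrite e2 e1 ey /z /z1 !adj_comp adjK.
split.
- move=> _ [_ [_ [x2 h2 /adjoint_ofE ->] [c Cc <-]] [x1 h1 <-]].
  move: x2 h2; apply: lspan_ind => [|a x x' [a2 [d2 [b2 [k2 m2 l2 ->]]]] Cx].
    have -> // : bop_comp (bop_comp (adj (0 : bop A2 B2)) c) x1 = 0.
    by apply: bop_eq => g; rewrite adj0.
  rewrite adjl; set z := adj (bop_comp a2 _).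
  have -> : bop_comp (bop_comp (conjc a *: z + adj x') c) x1 =
    conjc a *: bop_comp (bop_comp z c) x1 + bop_comp (bop_comp (adj x') c) x1 by exact: bop_eq.
  apply: (corner_lin cC) => //; move: x1 h1 {Cx}; apply: lspan_ind => [|a' x1 x1' [a1 [d1 [b1 [k1 m1 l1 ->]]]] Cx].
    have -> // : bop_comp (bop_comp z c) (0 : bop A1 B1) = 0.
    by apply: bop_eq => g; rewrite !bop_compE bop_zeroE !bop0.
  set z1 := bop_comp a1 _.
  have -> : bop_comp (bop_comp z c) (a' *: z1 + x1') =
    a' *: bop_comp (bop_comp z c) z1 + bop_comp (bop_comp z c) x1'.
    by apply: bop_eq => g; rewrite bop_addE bop_scaleE !bop_compE bop_addE bop_scaleE !bopD !bopZ.
  apply: (corner_lin cC) => //; have [y ey] := corner_out cC' Cc k1 k2.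
  have [y1 e1] := (mult_adj m2).1 y; have [y2 e2] := mult_right y1 m1.
  have := corner_in cC y2 l1 l2; congr C; apply: bop_eq => g.
  by rewrite e2 e1 ey /z /z1 !adj_comp adjK.
- move=> _ [_ [_ [x2 h2 /adjoint_ofE ->] [x1 h1 <-]] [c Cc <-]].
  move: x2 h2; apply: lspan_ind => [|a x x' [a2 [d2 [b2 [k2 m2 l2 ->]]]] Cx].
    have -> // : bop_comp (bop_comp (adj (0 : bop A2 B2)) x1) c = 0.
    by apply: bop_eq => g; rewrite adj0.
  rewrite adjl; set z := adj (bop_comp a2 _).
  have -> : bop_comp (bop_comp (conjc a *: z + adj x') x1) c =
    conjc a *: bop_comp (bop_comp z x1) c + bop_comp (bop_comp (adj x') x1) c by exact: bop_eq.
  apply: (corner_lin cC) => //; move: x1 h1 {Cx}; apply: lspan_ind => [|a' x1 x1' [a1 [d1 [b1 [k1 m1 l1 ->]]]] Cx].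
    have -> // : bop_comp (bop_comp z (0 : bop A2 B2)) c = 0.
    by apply: bop_eq => g; rewrite !bop_compE bop_zeroE !bop0.
  set z1 := bop_comp a1 _.
  have -> : bop_comp (bop_comp z (a' *: z1 + x1')) c =
    a' *: bop_comp (bop_comp z z1) c + bop_comp (bop_comp z x1') c.
    by apply: bop_eq => g; rewrite bop_addE bop_scaleE !bop_compE bop_addE bop_scaleE !bopD !bopZ.
  apply: (corner_lin cC) => //; apply: (corner_sandwich cC) => u v hu hv.
  have [y ey] := corner_out cC Cc hv l1.
  have mm_ : mult ta (bop_comp (bop_comp (adj u) b2) (bop_comp (adj d2) (bop_comp (bop_comp (adj a2) a1) d1))).
    by apply: (mM _); [exact: (corner_alg2 cC) | apply: (mM _); [exact: mult_adj | apply: (mM _) => //; exact: (corner_alg2 cC')]].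
  have [y1 e1] := mm_.1 y; exists y1; rewrite e1 ey; apply: bop_eq => g.
  by rewrite /z /z1 !adj_comp adjK.
- move=> _ [_ [c Cc [_ [x2 h2 /adjoint_ofE ->] <-]] [x1 h1 <-]].
  move: x2 h2; apply: lspan_ind => [|a x x' [a2 [d2 [b2 [k2 m2 l2 ->]]]] Cx].
    have -> // : bop_comp (bop_comp c (adj (0 : bop A1 B1))) x1 = 0.
    by apply: bop_eq => g; rewrite adj0 !bop_compE bop_zeroE bop0.
  rewrite adjl; set z := adj (bop_comp a2 _).
  have -> : bop_comp (bop_comp c (conjc a *: z + adj x')) x1 =
    conjc a *: bop_comp (bop_comp c z) x1 + bop_comp (bop_comp c (adj x')) x1.
    by apply: bop_eq => g; rewrite bop_addE bop_scaleE !bop_compE bop_addE bop_scaleE !bopD !bopZ.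
  apply: (corner_lin cC) => //; move: x1 h1 {Cx}; apply: lspan_ind => [|a' x1 x1' [a1 [d1 [b1 [k1 m1 l1 ->]]]] Cx].
    have -> // : bop_comp (bop_comp c z) (0 : bop A1 B1) = 0.
    by apply: bop_eq => g; rewrite !bop_compE bop_zeroE !bop0.
  set z1 := bop_comp a1 _.
  have -> : bop_comp (bop_comp c z) (a' *: z1 + x1') =
    a' *: bop_comp (bop_comp c z) z1 + bop_comp (bop_comp c z) x1'.
    by apply: bop_eq => g; rewrite bop_addE bop_scaleE !bop_compE bop_addE bop_scaleE !bopD !bopZ.
  apply: (corner_lin cC) => //; apply: (corner_sandwich cC) => u v hu hv.
  have [y ey] := corner_out cC Cc l2 hu.
  have mm_ : mult (cadj ta) (bop_comp (bop_comp (adj d2) (bop_comp (adj a2) a1)) (bop_comp d1 (bop_comp (adj b1) v))).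
    apply: (mM1 _); [apply: (mM1 _); [exact: mult_adj | exact: (corner_alg1 cC')] | apply: (mM1 _) => //; exact: (corner_alg1 cC)].
  have [y1 e1] := mult_right y mm_; exists y1; rewrite e1 ey; apply: bop_eq => g.
  by rewrite /z /z1 !adj_comp adjK.
Qed.
End TroSub.

End Corners.

(** * The range of a transferred representation is a corner *)

Section TransferCorner.
Variables (R : realType) (Y V : wMxNormedType R) (L1 L2 G1 G2 H1 H2 H1' H2' : hilbertType R).
Variables (sg : Y -> bop L1 L2) (ta : Y -> bop G1 G2) (t : V -> bop H1 H2).
Variables (M1 : set (bop H1 L1)) (M2 : set (bop H2 L2)).
Variables (nu1 : bop H1 L1 -> bop G1 H1') (nu2 : bop H2 L2 -> bop G2 H2').
Hypotheses (dY : dualized Y) (dV : dualized V) (csg : complete_isometry sg) (wsg : continuous sg).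
Hypotheses (ct : complete_isometry t) (wt : continuous t) (injs : injective sg).
Hypotheses (lta : actlin (@sact R Y) ta) (wta : continuous ta).
Hypotheses (sta : mat_dom sg ta) (tas : mat_dom ta sg).
Hypotheses (I1 : induced_by (cadj sg) (cadj ta) M1 nu1) (I2 : induced_by sg ta M2 nu2).
Hypothesis act1 : forall m m', M1 m -> M1 m' -> forall y, exists y', sg y' = bop_comp (sg y) (mm m m').
Hypothesis act2 : forall m m', M2 m -> M2 m' -> forall y, exists y', sg y' = bop_comp (mm m m') (sg y).
Hypothesis cut : forall v m1 m2, M1 m1 -> M2 m2 ->
  exists y, sg y = bop_comp m2 (bop_comp (t v) (adj m1)).
Hypothesis back : forall y m1 m2, M1 m1 -> M2 m2 ->
  exists v, t v = bop_comp (adj m2) (bop_comp (sg y) m1).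
Hypothesis rng2 : forall v x, adj_range M2 (t v x).
Hypothesis rng1 : forall v x, adj_range M1 (adj (t v) x).

Lemma induced_unit (U W G' G H H' : hilbertType R) (s : Y -> bop U W) (th : Y -> bop G' G) (M : set (bop H W)) (nu : bop H W -> bop G H') :
  induced_by s th M nu -> unit_on (nu @` M).
Proof.
move=> [_ _ au] xs d d0; have [//|us [Mus _ nus _ hus]] := au [::] xs d d0.
exists [seq nu u | u <- us]; split=> [u /List.in_map_iff[m [<- im]]|x|x ix].
- by exists m => //; exact: Mus.
- have := @usum_le R _ _ [seq adj (nu u) | u <- us] x.
  rewrite /usum !big_map; under [X in rnorm X]eq_bigr do rewrite adjK.
  by apply => z; rewrite big_map.
- by rewrite big_map; exact: hus.
Qed.

(** Closedness of the range is [isometry_range_closed]; the multiplier fields are the induction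
    relations, the units come with the induced spaces. *)
Theorem transfer_corner : exists om : V -> bop H1' H2',
  [/\ complete_isometry om, continuous om, corner ta (range om) (nu1 @` M1) (nu2 @` M2) &
   forall v m1 m2 y g, M1 m1 -> M2 m2 -> sg y = bop_comp m2 (bop_comp (t v) (adj m1)) ->
     adj (nu2 m2) (om v (nu1 m1 g)) = ta y g].
Proof.
have [om [com wom omE omB]] := transfer_exists dY dV csg wsg ct wt injs lta wta sta tas I1 I2
  act1 act2 cut rng2 rng1.
have [i1 _ _] := I1; have [i2 _ _] := I2.
have o0 : om 0 = 0 by have := com.1 (-1) 0 0; rewrite scaler0 addr0 scaleN1r addNr.
exists om; split=> //; split.
- exact: isometry_range_closed dV com.1 (fun v => isometry_mxnorm1 v com) wom.
- by exists 0.
- by move=> a _ _ [v _ <-] [w _ <-]; exists (a *: v + w); rewrite ?com.1.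
- move=> _ _ y [m1 h1 <-] [m2 h2 <-]; have [v ev] := back y h1 h2.
  by exists v => //; exact: omB.
- move=> _ _ _ [v _ <-] [m1 h1 <-] [m2 h2 <-]; have [y e] := cut v h1 h2; exists y.
  by apply: bop_eq => g; rewrite !bop_compE (omE _ _ _ _ _ h1 h2 e).
- have h m m' : M1 m -> M1 m' -> forall y, exists y', cadj ta y' = bop_comp (bop_comp (adj (nu1 m)) (nu1 m')) (cadj ta y).
    move=> hm hm' y; have [y' e] := act1 hm' hm y; exists y'.
    have e' : cadj sg y' = bop_comp (mm m m') (cadj sg y) by rewrite /cadj e adj_comp adj_mm.
    by apply: bop_eq => x; rewrite !bop_compE (i1 _ _ _ _ x hm hm' e').
  by move=> _ _ [m hm <-] [m' hm' <-]; split; rewrite ?adj_comp ?adjK; exact: h.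
- have h m m' : M2 m -> M2 m' -> forall y, exists y', ta y' = bop_comp (bop_comp (adj (nu2 m)) (nu2 m')) (ta y).
    move=> hm hm' y; have [y' e] := act2 hm hm' y; exists y'.
    by apply: bop_eq => x; rewrite !bop_compE (i2 _ _ _ _ x hm hm' e).
  by move=> _ _ [m hm <-] [m' hm' <-]; split; rewrite ?adj_comp ?adjK; exact: h.
- exact: induced_unit I1.
- exact: induced_unit I2.
Qed.
End TransferCorner.

(** * Definiteness of the norm, range projections, images of closures *)

Section DualFacts.
Variables (R : realType) (X : wMxNormedType R).
Hypothesis dX : dual_operator_space X.

Lemma dual_complete : complete_by (@mxnorm1 R X).
Proof.
move=> u hu; have [[c _] _] := dX; have [x hx] := c u hu; exists x => e e0.
move: hx => /cvgrPdist_lt/(_ e e0)[N _ hN]; exists N => n Nn.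
by have := hN n Nn; rewrite sub0r normrN; apply: le_lt_trans; exact: ler_norm.
Qed.

Lemma dual_norm0 (x : X) : mxnorm1 x = 0 -> x = 0.
Proof.
move=> x0; have [_ [V [J [J' [[_ [H [u ciu]]] ciJ JK J'K _]]]]] := dX.
have J0 : J 0 = 0 by have := ciJ.1 (-1) 0 0; rewrite scaler0 addr0 scaleN1r addNr.
rewrite -(JK x) -[RHS](JK 0); congr J'; rewrite J0.
apply/val_inj/funext => v; apply: cmod0_eq0; apply/le_anti; rewrite cmod_ge0 andbT.
apply: le_trans (dual_eval_le ciu (J x) v) _.
by rewrite (isometry_mxnorm1 x ciJ) x0 mul0r.
Qed.
End DualFacts.

Section RangeProjection.
Variables (R : realType) (H L : hilbertType R) (M : set (bop H L)).

Lemma range_projection : exists p : bop H H, [/\ projection p, forall x, adj_range M (p x),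
  forall x, adj_range M x -> p x = x & forall m x, M m -> m (p x) = m x].
Proof.
have [p [pS pid ps pn]] := projection_exists (closed_spanP (fun p : {m | M m} * L => adj (sval p.1) p.2)).
exists p; split=> //.
  split; first by apply: bop_eq => x; rewrite bop_compE pid.
  by move=> x y; rewrite adjP ps.
move=> m x Mm; apply: ip_inj => z; rewrite !adjP ps pid //.
exact: (closed_span_mem (fun p : {m | M m} * L => adj (sval p.1) p.2) (exist _ m Mm, z)).
Qed.
End RangeProjection.

Lemma closure_map (X Y : topologicalType) (f : X -> Y) (A : set X) (B : set Y) : continuous f ->
  (forall x, A x -> B (f x)) -> forall x, closure A x -> closure B (f x).
Proof.
move=> cf h x clA U /cf; rewrite nbhs_simpl => hU.
by have [z [Az Uz]] := clA _ hU; exists (f z); split=> //; exact: h.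
Qed.

Lemma closure_lspan_comp (R : realType) (A B A' B' : hilbertType R) (S : set (bop A B)) (S' : set (bop A' B'))
    (P : bop B B') (Q : bop A' A) :
  (forall T, S T -> S' (bop_comp P (bop_comp T Q))) ->
  forall T, closure (lspan S) T -> closure (lspan S') (bop_comp P (bop_comp T Q)).
Proof.
move=> h; apply: closure_map => [|T]; first by apply: continuous_comp2 => x; exact: cvg_id.
move: T; apply: lspan_ind => [|a x y Sx Sy].
  have -> : bop_comp P (bop_comp (0 : bop A B) Q) = 0; last exact: lspan0.
  by apply: bop_eq => g; rewrite !bop_compE !bop_zeroE bop0.
have -> : bop_comp P (bop_comp (a *: x + y) Q) = a *: bop_comp P (bop_comp x Q) + bop_comp P (bop_comp y Q).
  by apply: bop_eq => g; rewrite bop_addE bop_scaleE !bop_compE bop_addE bop_scaleE bopD bopZ.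
by apply: lspan_lin => //; apply: lspan_in; exact: h.
Qed.

(** The TROs of [Z < Y] start from the spaces on which [Y] is represented, while induction uses
    operators that end there. *)
Lemma tro_adj (R : realType) (H K : hilbertType R) (N : set (bop H K)) : is_TRO N -> is_TRO [set m | N (adj m)].
Proof.
move=> tN; split.
  split; first by rewrite inE /= adj0; exact: tro0.
  move=> a x y /set_mem Nx /set_mem Ny; rewrite inE /= adjD adjZ; exact: tro_lin.
move=> _ [_ [a Na [_ [b Nb /adjoint_ofE ->] <-]] [c Nc <-]] /=.
rewrite !adj_comp adjK; have := tro_mul tN Nc Nb Na; rewrite adjK; congr N.
by apply: bop_eq => g; rewrite !bop_compE.
Qed.

(** * The corner of X and the space Z over the common representation *)

Section Composition.
Variables (R : realType) (X Y Z : wMxNormedType R).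
Hypotheses (dX : dualized X) (dY : dual_operator_space Y) (dZ : dualized Z).
Variables (H1 H2 L1 L2 K1 K2 J1 J2 : hilbertType R).
Variables (X2 : opSubspace H1 H2) (Y2 : opSubspace L1 L2) (Y1 : opSubspace K1 K2) (Z1 : opSubspace J1 J2).
Variables (phiX : X -> opsub X2) (psiY : Y -> opsub Y2) (phiY : Y -> opsub Y1) (psiZ : Z -> opsub Z1).
Hypotheses (clX : closed X2) (oX : wcomplete_isometry_onto phiX) (oY2 : wcomplete_isometry_onto psiY)
  (oY1 : wcomplete_isometry_onto phiY) (oZ : wcomplete_isometry_onto psiZ).
Hypotheses (tYX : TRO_sub Y2 X2) (tZY : TRO_sub Z1 Y1).

(** On generators [ip (S x) y = ip (S (q x)) (p y)] holds with the support projections [p] and [q];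
    both sides are w*-continuous in [S], so the identity reaches the closure. *)
Lemma sub_support (A B A' B' : hilbertType R) (C : set (bop A B)) (D : set (bop A' B')) (N1 : set (bop A' A)) (N2 : set (bop B' B)) :
  C = closure (lspan (N2 `o` D `o` N1^`*)) -> forall T, C T ->
  (forall x, adj_range [set m | N2 (adj m)] (T x)) /\ (forall x, adj_range [set m | N1 (adj m)] (adj T x)).
Proof.
move=> -> T clT.
have [p [[_ pa] pin pid _]] := range_projection [set m | N2 (adj m)].
have [q [[_ qa] qin qid _]] := range_projection [set m | N1 (adj m)].
have ap : adj p = p by rewrite [RHS](adj_uniq (T := p)).
have aq : adj q = q by rewrite [RHS](adj_uniq (T := q)).
have gen (N : hilbertType R) (N' : hilbertType R) (M : set (bop N N')) m x : M m -> adj_range [set a | M (adj a)] (m x).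
  move=> Mm; have h : [set a | M (adj a)] (adj m) by rewrite /= adjK.
  have := closed_span_mem (fun p : {a | [set a | M (adj a)] a} * N => adj (sval p.1) p.2) (exist _ (adj m) h, x).
  by rewrite /= adjK.
have e : forall S, closure (lspan (N2 `o` D `o` N1^`*)) S -> forall x y, ip (S x) y = ip (S (q x)) (p y).
  move=> S clS x y; apply: (closed_eq_fun (f := fun S : bop A B => ip (S x) y : R[i]^o) (g := fun S : bop A B => ip (S (q x)) (p y) : R[i]^o) _ _ _ clS).
  - exact: ip_continuous.
  - exact: ip_continuous.
  - move=> U; apply: (@lspan_ind _ _ _ [set U : bop A B | ip (U x) y = ip (U (q x)) (p y)]) => [|a V W [_ [m2 Mm2 [d Dd <-]] [_ [m1 Mm1 /adjoint_ofE ->] <-]] hW]; first by rewrite /= !ip0l.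
    set V' := bop_comp (bop_comp m2 d) _.
    suff : ip ((a *: V' + W) x) y = ip ((a *: V' + W) (q x)) (p y) by [].
    have {}hW : ip (W x) y = ip (W (q x)) (p y) := hW.
    rewrite !bop_addE !bop_scaleE !ipDl !ipZl hW; congr (_ * _ + _); rewrite /V' !bop_compE.
    have -> : adj m1 (q x) = adj m1 x.
      by apply: ip_inj => z; rewrite !adjPr -[in LHS]aq adjPr qid //; exact: gen.
    by rewrite -[in RHS]ap -adjP pid //; exact: gen.
have TE x : T x = p (T x).
  by apply: ip_inj => y; rewrite [RHS]adjP ap (e T clT x y) (e T clT x (p y)) [p (p y)]pid.
split=> x; first by rewrite TE; exact: pin.
have -> : adj T x = q (adj T x); last exact: qin.
apply: ip_injr => y; rewrite -[LHS]adjP -[in RHS]aq -[RHS]adjP -[RHS]adjP.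
by rewrite (e T clT y x) (e T clT (q y) x) [q (q y)]qid.
Qed.

Theorem common_representation : exists (p : bop H2 H2) (q : bop H1 H1) (A1 A2 B1 B2 : hilbertType R)
    (om : opsub (compression p X2 q) -> bop A1 A2) (oz : Z -> bop B1 B2),
  [/\ projection p, projection q, [set p] `o` X2 `<=` opset X2, X2 `o` [set q] `<=` opset X2 &
   [/\ complete_isometry om /\ continuous om, closed (range om), complete_isometry oz /\ continuous oz,
     closed (range oz) & TRO_sub (range oz) (range om)]].
Proof.
have [M1 [M2 [tM1 tM2 eY2 [inYX aX2 aX1]]]] := tYX.
have [N1 [N2 [tN1 tN2 eZ1 [inZY aY2 aY1]]]] := tZY.
have [cX wX oXE] := wonto_val oX; have [csg wsg oY2E] := wonto_val oY2.
have [crh wrh oY1E] := wonto_val oY1; have [cz wz oZE] := wonto_val oZ.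
set sg := fun y => opsub_val (psiY y) in csg wsg oY2E.
set rh := fun y => opsub_val (phiY y) in crh wrh oY1E.
set ze := fun z => opsub_val (psiZ z) in cz wz oZE.
have dYd := dual_dualized dY; have cY := dual_complete dY; have n0 := @dual_norm0 R Y dY.
have [G1 [G2 [ta [lta sta tas wta [tt1 tt2 hL hR]]]]] := representation dYd cY n0 csg crh wsg wrh.
have ls := linear_actlin csg.1; have lr := linear_actlin crh.1.
have is_ := complete_isometry_inj csg n0; have ir := complete_isometry_inj crh n0.
have lcs := actlin_cadj ls; have lcr := actlin_cadj lr; have lct := actlin_cadj lta.
have injc (U W : hilbertType R) (s : Y -> bop U W) : injective s -> injective (cadj s).
  by move=> h y z e; apply: h; rewrite -[s y]adjK -[s z]adjK; congr adj; exact: e.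
have tct g : (forall y x, ip (cadj ta y x) g = 0) -> g = 0.
  by move=> h; apply: tt1 => y; apply: ip_injr => x; rewrite ip0r -adjPr; exact: h.
have actM2 m m' : M2 m -> M2 m' -> forall y, exists y', sg y' = bop_comp (mm m m') (sg y).
  move=> h h' y; apply/oY2E.
  have -> : bop_comp (mm m m') (sg y) = bop_comp (mm m m') (bop_comp (sg y) (bop_id L1)) by exact: bop_eq.
  have : opset Y2 (sg y) by apply/oY2E; exists y.
  rewrite eY2; apply: closure_lspan_comp => _ [_ [m2 k2 [x Xx <-]] [a ka <-]].
  exists (bop_comp (bop_comp (bop_comp m (adj m')) m2) x); last by exists a => //; exact: bop_eq.
  by exists (bop_comp (bop_comp m (adj m')) m2); [exact: tro_mul | exists x].
have actM1 m m' : M1 m -> M1 m' -> forall y, exists y', sg y' = bop_comp (sg y) (mm m m').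
  move=> h h' y; apply/oY2E.
  have -> : bop_comp (sg y) (mm m m') = bop_comp (bop_id L2) (bop_comp (sg y) (mm m m')) by exact: bop_eq.
  have : opset Y2 (sg y) by apply/oY2E; exists y.
  rewrite eY2; apply: closure_lspan_comp => _ [b kb [_ [m1 k1 /adjoint_ofE ->] <-]].
  exists b => //; exists (adj (bop_comp (bop_comp m' (adj m)) m1)).
    by exists (bop_comp (bop_comp m' (adj m)) m1); [exact: tro_mul | move=> ? ?; exact: adjP].
  by apply: bop_eq => g; rewrite !adj_comp adjK.
have actN2 m m' : N2 (adj m) -> N2 (adj m') -> forall y, exists y', rh y' = bop_comp (mm m m') (rh y).
  move=> h h' y; apply/oY1E; apply: aY2; exists (bop_comp m (adj m')).
    by exists m; [exists (adj m) => // u v; rewrite adjPr | exists (adj m')].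
  by exists (rh y) => //; apply/oY1E; exists y.
have actN1 m m' : N1 (adj m) -> N1 (adj m') -> forall y, exists y', rh y' = bop_comp (rh y) (mm m m').
  move=> h h' y; apply/oY1E; apply: aY1; exists (bop_comp (rh y) m).
    by exists (rh y); [apply/oY1E; exists y | exists m => //; exists (adj m) => // u v; rewrite adjPr].
  by exists (adj m') => //; exact: bop_eq.
have toC (U W H : hilbertType R) (s : Y -> bop U W) (M : set (bop H U)) :
    (forall m m', M m -> M m' -> forall y, exists y', s y' = bop_comp (s y) (mm m m')) ->
    forall m m', M m -> M m' -> forall y, exists y', cadj s y' = bop_comp (bop_comp m (adj m')) (cadj s y).
  move=> h m m' hm hm' y; have [y' e] := h m' m hm' hm y; exists y'.
  by rewrite /cadj e adj_comp adj_mm.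
have [A2 [nu2 I2]] := induced ls lta is_ tt2 (fun c a a' c0 h => hL c a a' c0 (or_introl h)) tM2 actM2.
have [A1 [nu1 I1]] := induced lcs lct (injc _ _ _ is_) tct (fun c a a' c0 h => hR c a a' c0 (or_introl h))
  tM1 (toC _ _ _ _ _ actM1).
have [B2 [mu2 I2']] := induced lr lta ir tt2 (fun c a a' c0 h => hL c a a' c0 (or_intror h)) (tro_adj tN2) actN2.
have [B1 [mu1 I1']] := induced lcr lct (injc _ _ _ ir) tct (fun c a a' c0 h => hR c a a' c0 (or_intror h))
  (tro_adj tN1) (toC _ _ _ rh [set m | N1 (adj m)] actN1).
have [p [pp pin pid pM]] := range_projection M2; have [q [pq qin qid qM]] := range_projection M1.
have [p2 ap pn] := projE pp; have [q2 aq qn] := projE pq.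
have usl (A B : hilbertType R) (M : set (bop A B)) (r : bop A A) us x : (forall m x, M m -> m (r x) = m x) ->
    (forall u, List.In u us -> M u) -> usum us (r x) = usum us x.
  by move=> rM Mus; apply: eq_sum_in => u iu; rewrite rM //; exact: Mus.
have X2sum (T : Type) (l : seq T) (F : T -> bop H1 H2) : (forall i, List.In i l -> opset X2 (F i)) -> opset X2 (\sum_(i <- l) F i).
  have [X0 Xl] := opset_submod X2; elim: l => [|i l IH] h; first by rewrite big_nil; move: X0; rewrite inE.
  rewrite big_cons -[F i]scale1r; apply: set_mem; apply: Xl; apply: mem_set; first by apply: h; left.
  by apply: IH => j jl; apply: h; right.
(* On the vectors concerned [p] is approximated by sums of [adj u u] with [u] in [M2]. These leave
   [X2] invariant, and [X2] is w*-closed. *)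
have pX x : opset X2 x -> opset X2 (bop_comp p x).
  move=> Xx; apply: clX; have [c c0 hc] := bop_bound x.
  apply: (wot_closure c0) => [g|l e e0]; first by rewrite bop_compE; exact: le_trans (pn _) (hc _).
  pose K := \sum_(z <- l) rnorm z.2 + 1.
  have K0 : 0 < K by rewrite ltr_wpDl // sumr_ge0 // => z _; exact: rnorm_ge0.
  have [//||us [Mus cus _ _ [_ zus]]] := approx_on_range I2 (ms := [::]) [::] (zs := [seq p (x z.1) | z <- l])
    (d := e / (K + K)) ltac:(by rewrite divr_gt0 // addr_gt0).
    by move=> z /List.in_map_iff[z' [<- _]]; exact: pin.
  have uE g : (\sum_(u <- us) bop_comp (bop_comp (adj u) u) x) g = usum us (x g) by rewrite bop_sumE.
  exists (\sum_(u <- us) bop_comp (bop_comp (adj u) u) x).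
    apply: X2sum => u iu; apply: aX2; exists (bop_comp (adj u) u); last by exists x.
    by exists (adj u); [exists u; [exact: Mus | move=> ? ?; exact: adjP] | exists u => //; exact: Mus].
  split=> [g|z zl]; first by rewrite uE; exact: le_trans (usum_le _ cus) (hc _).
  rewrite uE bop_compE -(usl _ _ M2 p us _ pM Mus) -ipBl; apply: le_lt_trans (ip_CS _ _) _.
  have h1 : rnorm (usum us (p (x z.1)) - p (x z.1)) <= e / (K + K).
    by rewrite rnormBC; apply: zus; apply/List.in_map_iff; exists z.
  have h2 : rnorm z.2 <= K.
    have := @list_in_le _ _ (fun z : H1 * H2 => rnorm z.2) l z (fun z => rnorm_ge0 _) zl; rewrite /K; lra.
  apply: le_lt_trans (ler_pM (rnorm_ge0 _) (rnorm_ge0 _) h1 h2) _.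
  have : e / (K + K) * (K + K) = e by rewrite divfK // gt_eqF // addr_gt0.
  by rewrite mulrDr; move: (e / (K + K) * K) => w ww; lra.
have Xq x : opset X2 x -> opset X2 (bop_comp x q).
  move=> Xx; apply: clX; have [c c0 hc] := bop_bound x.
  apply: (wot_closure c0) => [g|l e e0]; first by rewrite bop_compE; apply: le_trans (hc _) _; rewrite ler_wpM2l.
  pose K := \sum_(z <- l) rnorm (adj x z.2) + 1.
  have K0 : 0 < K by rewrite ltr_wpDl // sumr_ge0 // => z _; exact: rnorm_ge0.
  have [//||us [Mus cus _ _ [_ zus]]] := approx_on_range I1 (ms := [::]) [::] (zs := [seq q z.1 | z <- l])
    (d := e / (K + K)) ltac:(by rewrite divr_gt0 // addr_gt0).
    by move=> z /List.in_map_iff[z' [<- _]]; exact: qin.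
  have uE g : (\sum_(u <- us) bop_comp (bop_comp x (adj u)) u) g = x (usum us g).
    by rewrite bop_sumE /usum bop_sum; apply: eq_bigr.
  exists (\sum_(u <- us) bop_comp (bop_comp x (adj u)) u).
    apply: X2sum => u iu; apply: aX1; exists (bop_comp x (adj u)); last by exists u => //; exact: Mus.
    by exists x => //; exists (adj u) => //; exists u; [exact: Mus | move=> ? ?; exact: adjP].
  split=> [g|z zl]; first by rewrite uE; apply: le_trans (hc _) _; rewrite ler_wpM2l // usum_le.
  rewrite uE bop_compE -(usl _ _ M1 q us _ qM Mus) -ipBl -bopB adjP; apply: le_lt_trans (ip_CS _ _) _.
  have h1 : rnorm (usum us (q z.1) - q z.1) <= e / (K + K).
    by rewrite rnormBC; apply: zus; apply/List.in_map_iff; exists z.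
  have h2 : rnorm (adj x z.2) <= K.
    have := @list_in_le _ _ (fun z : H1 * H2 => rnorm (adj x z.2)) l z (fun z => rnorm_ge0 _) zl; rewrite /K; lra.
  apply: le_lt_trans (ler_pM (rnorm_ge0 _) (rnorm_ge0 _) h1 h2) _.
  have : e / (K + K) * (K + K) = e by rewrite divfK // gt_eqF // addr_gt0.
  by rewrite mulrDr; move: (e / (K + K) * K) => w ww; lra.
have pS : [set p] `o` X2 `<=` opset X2 by move=> _ [_ -> [x Xx <-]]; exact: pX.
have Sq : X2 `o` [set q] `<=` opset X2 by move=> _ [x Xx [_ -> <-]]; exact: Xq.
have dW := compression_dualized dX oX pp pq pS Sq.
pose W := compression p X2 q.
have WE (w : opsub W) : bop_comp p (bop_comp w q) = opsub_val w.
  by apply: (compressionE pp pq); exact: opsub_mem.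
have WX (w : opsub W) : opset X2 w by apply: (compression_sub pS Sq); exact: opsub_mem.
have M2p m : M2 m -> bop_comp m p = m by move=> h; apply: bop_eq => x; exact: pM.
have qM1 m : M1 m -> bop_comp q (adj m) = adj m.
  by move=> h; rewrite -[q]aq -adj_comp; congr adj; apply: bop_eq => x; exact: qM.
have inY x m1 m2 : opset X2 x -> M1 m1 -> M2 m2 -> exists y, sg y = bop_comp m2 (bop_comp x (adj m1)).
  move=> Xx h1 h2; apply/oY2E; rewrite eY2; apply: subset_closure; apply: lspan_in.
  exists (bop_comp m2 x); last by exists (adj m1); [exists m1 => // ? ?; exact: adjP | exact: bop_eq].
  by exists m2 => //; exists x.
(* The corner, included in [X2], is transferred along [M1] and [M2]. *)
have [om [com wom comc omE]] := transfer_corner dYd dW csg wsg (opsub_val_isometry W)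
  (@opsub_val_continuous R H1 H2 W) is_ lta wta sta tas I1 I2 actM1 actM2
  (fun w m1 m2 h1 h2 => inY _ m1 m2 (WX w) h1 h2)
  ltac:(move=> y m1 m2 h1 h2; apply: opsub_lift;
    have Xx : opset X2 (bop_comp (adj m2) (bop_comp (sg y) m1)) by
      [apply: inYX; exists (bop_comp (adj m2) (sg y)); [exists (adj m2); [exists m2 => // ? ?; exact: adjP |
         exists (sg y) => //; apply/oY2E; by exists y] | by exists m1 => //; exact: bop_eq]];
    have := compress_mem p q Xx; congr (opset W _);
    apply: bop_eq => g; rewrite !bop_compE qM //; apply: ip_inj => z;
    by rewrite adjP ap !adjPr pM)
  ltac:(move=> w x; rewrite -[opsub_val w]WE; exact: pin)
  ltac:(move=> w x; rewrite -[opsub_val w]WE !adj_comp aq; exact: qin).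
(* For [Z] the representation [rh] takes the place of [sg]; domination with [ta] is routed through
   [sg], which is completely isometric to it. *)
have [oz [coz woz cozc _]] := transfer_corner dYd dZ crh wrh cz wz ir lta wta
  (fun m n c A c0 h => sta m n c A c0 (complete_isometry_mat_dom crh csg c0 h))
  (fun m n c A c0 h => complete_isometry_mat_dom csg crh c0 (tas m n c A c0 h)) I1' I2' actN1 actN2
  ltac:(move=> z m1 m2 h1 h2; apply/oY1E; apply: inZY; exists (bop_comp m2 (ze z));
    [exists m2; [exists (adj m2) => // ? ?; by rewrite adjPr | exists (ze z) => //; apply/oZE; by exists z] |
     by exists (adj m1) => //; exact: bop_eq])
  ltac:(move=> y m1 m2 h1 h2; apply/oZE; rewrite eZ1; apply: subset_closure; apply: lspan_in;
    exists (bop_comp (adj m2) (rh y)); [exists (adj m2) => //; exists (rh y) => //; apply/oY1E; by exists y |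
      exists m1; [exists (adj m1) => // ? ?; by rewrite adjPr | exact: bop_eq]])
  ltac:(move=> z; exact: (sub_support eZ1 (T := ze z) ltac:(by apply/oZE; exists z)).1)
  ltac:(move=> z; exact: (sub_support eZ1 (T := ze z) ltac:(by apply/oZE; exists z)).2).
exists p, q, A1, A2, B1, B2, om, oz; split=> //; split=> //.
- exact: (corner_closed comc).
- exact: (corner_closed cozc).
apply: (corner_tro_sub lta wta comc cozc) => y fs d d0 wfs.
(* Functionals on [Y] are extended to normal functionals on all operators, so that the density of
   the generators of [Y2] can be used for them. *)
have ext (f : Y -> R[i]) : {F : bop L1 L2 -> R[i]^o | wfun f -> continuous F /\ forall y, f y = F (sg y)}.
  apply: cid; have [wf|no] := pselect (wfun f); last by exists (fun _ => 0).
  have [D0 _ _] := dYd; have [r r0 hr] := D0 _ wf.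
  have hr1 : fbounded f (r + 1).
    move=> z; apply: le_trans (hr z) _; rewrite ler_wpM2r ?lerDl //.
    by rewrite -(isometry_mxnorm1 z csg) mxnorm1_bop_ge0.
  have [|xi [eta [hx he fE]]] := normal_rep dYd csg.1 (fun z => isometry_mxnorm1 z csg) wsg wf _ hr1; first lra.
  by exists (fun T => nlim xi eta T) => _; split=> //; exact: nlim_continuous hx he.
have clY : closure (lspan (M2 `o` X2 `o` M1^`*)) (sg y) by rewrite -eY2; apply/oY2E; exists y.
have [|T sT hT] := closure_approx (fs := [seq sval (ext f) | f <- fs]) clY _ d0.
  by move=> F /List.in_map_iff[f [<- /wfs wf]]; exact: (svalP (ext f) wf).1.
set Y0 := [set z | exists c a1 a2, _].
have [y' Ly' ey'] : exists2 y', lspan Y0 y' & sg y' = T.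
  move: T sT {hT}; apply: lspan_ind => [|a U V [_ [m2 h2 [x Xx <-]] [_ [m1 h1 /adjoint_ofE ->] <-]] [v Lv <-]].
    by exists 0; [exact: lspan0 | exact: actlin0 ls].
  have [u eu] := inY x m1 m2 Xx h1 h2.
  exists (a *: u + v); last by rewrite csg.1 eu; congr (_ *: _ + _); exact: bop_eq.
  apply: lspan_lin => //; apply: lspan_in.
  have [w ew] := opsub_lift (compress_mem p q Xx).
  exists (om w), (nu1 m1), (nu2 m2); split; [by exists w | by exists m1 | by exists m2 |].
  have e : sg u = bop_comp m2 (bop_comp (opsub_val w) (adj m1)).
    rewrite eu ew; apply: bop_eq => g; rewrite !bop_compE pM //.
    by rewrite -[in LHS](qM1 _ h1).
  by apply: bop_eq => g; rewrite -(omE _ _ _ _ g h1 h2 e).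
exists y' => // f ifs; have wf := wfs f ifs; have [_ fE] := svalP (ext f) wf.
rewrite !fE ey'; apply: hT; by apply/List.in_map_iff; exists f.
Qed.

End Composition.

(** * Direct sums and the cb isomorphism *)

Lemma direct_sum (R : realType) (A B : hilbertType R) :
  exists (S : hilbertType R) (i : bop A S) (j : bop B S),
  [/\ forall x, adj i (i x) = x, forall x, adj j (j x) = x, forall x, adj j (i x) = 0,
      forall x, adj i (j x) = 0 &
   (forall s, i (adj i s) + j (adj j s) = s) /\
   forall s, rnorm s ^+ 2 = rnorm (adj i s) ^+ 2 + rnorm (adj j s) ^+ 2].
Proof.
pose pa (p : A + B) : A := if p is inl a then a else 0.
pose pb (p : A + B) : B := if p is inr b then b else 0.
have [|S [e [he te]]] := @kolmogorov R (A + B)%type (fun p q => ip (pa p) (pa q) + ip (pb p) (pb q)).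
  split=> [p q|s]; first by rewrite conjcD -!ip_conj.
  have -> : lc_form (fun p q => ip (pa p) (pa q) + ip (pb p) (pb q)) s s =
      ip (lc_val pa s) (lc_val pa s) + ip (lc_val pb s) (lc_val pb s).
    rewrite !ip_suml -big_split; apply: eq_bigr => p _ /=; rewrite !ip_sumr -big_split.
    by apply: eq_bigr => q _ /=; rewrite !ipZl !ipZr; ring.
  by rewrite ReD addr_ge0 // -/(rip _ _) rip_norm sqr_ge0.
have li : linear (fun a => e (inl a)).
  move=> c x y; apply/eqP; rewrite -subr_eq0; apply/eqP; apply: te => q.
  by rewrite ipBl ipDl ipZl !he /= !ip0l !addr0 ipDl ipZl subrr.
have lj : linear (fun b => e (inr b)).
  move=> c x y; apply/eqP; rewrite -subr_eq0; apply/eqP; apply: te => q.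
  by rewrite ipBl ipDl ipZl !he /= !ip0l !add0r ipDl ipZl subrr.
have ni a : rnorm (e (inl a)) <= 1 * rnorm a.
  rewrite mul1r -(@ler_pXn2r _ 2) ?nnegrE ?rnorm_ge0 // -rip_norm /rip he /= ip0l addr0 -/(rip _ _).
  by rewrite rip_norm.
have nj b : rnorm (e (inr b)) <= 1 * rnorm b.
  rewrite mul1r -(@ler_pXn2r _ 2) ?nnegrE ?rnorm_ge0 // -rip_norm /rip he /= ip0l add0r -/(rip _ _).
  by rewrite rip_norm.
pose i : bop A S := mkbop li ni; pose j : bop B S := mkbop lj nj.
have ii x : adj i (i x) = x by apply: ip_inj => a; rewrite adjPr he /= ip0l addr0.
have jj x : adj j (j x) = x by apply: ip_inj => a; rewrite adjPr he /= ip0l add0r.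
have ji x : adj j (i x) = 0 by apply: ip_inj => a; rewrite adjPr he /= ip0r !ip0l addr0.
have ij x : adj i (j x) = 0 by apply: ip_inj => a; rewrite adjPr he /= ip0r !ip0l addr0.
have dec s : i (adj i s) + j (adj j s) = s.
  apply/eqP; rewrite -subr_eq0; apply/eqP; apply: te => -[a|b]; rewrite ipBl ipDl.
    by rewrite -[e (inl a)]/(i a) -!adjPr ii ij ip0l addr0 subrr.
  by rewrite -[e (inr b)]/(j b) -!adjPr ji jj ip0l add0r subrr.
exists S, i, j; split=> //; split=> // s.
have -> : rnorm s ^+ 2 = rip (i (adj i s)) s + rip (j (adj j s)) s by rewrite -ripDl dec rip_norm.
have hr (H : hilbertType R) (k : bop H S) : rip (k (adj k s)) s = rnorm (adj k s) ^+ 2.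
  by rewrite /rip adjP -/(rip _ _) rip_norm.
by rewrite !hr.
Qed.

(** The TROs are extended by zero off the ranges of [j1] and [j2]. The decoupling of blocks in the
    third hypothesis ensures that products with elements of [E] meet only their block in [C]. *)
Lemma tro_sub_lift (R : realType) (K1 K2 A1 A2 S1 S2 : hilbertType R) (C' : set (bop K1 K2)) (C : set (bop A1 A2))
    (E : set (bop S1 S2)) (j1 : bop A1 S1) (j2 : bop A2 S2) :
  (forall x, adj j1 (j1 x) = x) -> (forall x, adj j2 (j2 x) = x) ->
  (forall e, E e -> exists c, [/\ C c, bop_comp (adj j2) e = bop_comp c (adj j1) & bop_comp e j1 = bop_comp j2 c]) ->
  (forall c, C c -> E (bop_comp j2 (bop_comp c (adj j1)))) -> TRO_sub C' C -> TRO_sub C' E.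
Proof.
move=> jj1 jj2 EC CE [M1 [M2 [t1 t2 eC [h1 h2 h3]]]].
have lift (A S K : hilbertType R) (j : bop A S) (M : set (bop A K)) : (forall x, adj j (j x) = x) ->
    is_TRO M -> is_TRO [set bop_comp m (adj j) | m in M].
  move=> jj tM; split.
    split; first by rewrite inE; exists 0; [exact: tro0 | exact: bop_eq].
    move=> a _ _ /set_mem[x Mx <-] /set_mem[y My <-]; rewrite inE; exists (a *: x + y); first exact: tro_lin.
    exact: bop_eq.
  move=> _ [_ [_ [a Ma <-] [_ [_ [b Mb <-] /adjoint_ofE ->] <-]] [_ [c Mc <-] <-]].
  exists (bop_comp (bop_comp a (adj b)) c); first exact: tro_mul.
  by apply: bop_eq => x; rewrite adj_comp adjK !bop_compE jj.
have aM (A S K : hilbertType R) (j : bop A S) (M : set (bop A K)) m : M m ->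
    ([set bop_comp m (adj j) | m in M])^`* (bop_comp j (adj m)).
  by move=> Mm; exists (bop_comp m (adj j)); [exists m | apply/adjoint_ofE; rewrite adj_comp adjK].
exists [set bop_comp m (adj j1) | m in M1], [set bop_comp m (adj j2) | m in M2]; split.
- exact: lift.
- exact: lift.
- rewrite eC; congr (closure (lspan _)); apply/seteqP; split.
    move=> _ [_ [m2 k2 [c Cc <-]] [_ [m1 k1 /adjoint_ofE ->] <-]].
    exists (bop_comp (bop_comp m2 (adj j2)) (bop_comp j2 (bop_comp c (adj j1)))).
      exists (bop_comp m2 (adj j2)); first by exists m2.
      by exists (bop_comp j2 (bop_comp c (adj j1))) => //; exact: CE.
    exists (bop_comp j1 (adj m1)); first exact: aM.
    by apply: bop_eq => x; rewrite !bop_compE jj2 jj1.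
  move=> _ [_ [_ [m2 k2 <-] [e Ee <-]] [_ [_ [m1 k1 <-] /adjoint_ofE ->] <-]].
  have [c [Cc e1 _]] := EC e Ee.
  exists (bop_comp m2 c); first by exists m2 => //; exists c.
  exists (adj m1); first by exists m1 => // ? ?; exact: adjP.
  apply: bop_eq => x; rewrite adj_comp adjK !bop_compE.
  by rewrite -[adj j2 _]/(bop_comp (adj j2) e (j1 (adj m1 x))) e1 bop_compE jj1.
split.
- move=> _ [_ [_ [_ [m2 k2 <-] /adjoint_ofE ->] [y Cy <-]] [_ [m1 k1 <-] <-]].
  have := CE _ (h1 (bop_comp (bop_comp (adj m2) y) m1) _); set T := bop_comp j2 _.
  have -> : bop_comp (bop_comp (adj (bop_comp m2 (adj j2))) y) (bop_comp m1 (adj j1)) = T.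
    by apply: bop_eq => x; rewrite /T adj_comp adjK.
  apply; exists (bop_comp (adj m2) y); last by exists m1.
  by exists (adj m2); [exists m2 => // ? ?; exact: adjP | exists y].
- move=> _ [_ [_ [_ [m2 k2 <-] /adjoint_ofE ->] [_ [m1 k1 <-] <-]] [e Ee <-]].
  have [c [Cc e1 _]] := EC e Ee.
  have := CE _ (h2 (bop_comp (bop_comp (adj m2) m1) c) _); set T := bop_comp j2 _.
  have -> : bop_comp (bop_comp (adj (bop_comp m2 (adj j2))) (bop_comp m1 (adj j2))) e = T.
    by apply: bop_eq => x; rewrite /T adj_comp adjK !bop_compE -[adj j2 (e x)]/(bop_comp (adj j2) e x) e1.
  apply; exists (bop_comp (adj m2) m1); last by exists c.
  by exists (adj m2); [exists m2 => // ? ?; exact: adjP | exists m1].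
- move=> _ [_ [e Ee [_ [_ [m2 k2 <-] /adjoint_ofE ->] <-]] [_ [m1 k1 <-] <-]].
  have [c [Cc _ e1]] := EC e Ee.
  have := CE _ (h3 (bop_comp (bop_comp c (adj m2)) m1) _); set T := bop_comp j2 _.
  have -> : bop_comp (bop_comp e (adj (bop_comp m2 (adj j1)))) (bop_comp m1 (adj j1)) = T.
    apply: bop_eq => x; rewrite /T adj_comp adjK !bop_compE.
    by rewrite -[e (j1 _)]/(bop_comp e j1 (adj m2 (m1 (adj j1 x)))) e1.
  apply; exists (bop_comp c (adj m2)); last by exists m1.
  by exists c => //; exists (adj m2) => //; exists m2 => // ? ?; exact: adjP.
Qed.

Section SplitOff.
Variables (R : realType) (X Z : wMxNormedType R).
Hypotheses (dX : dual_operator_space X).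
Variables (H1 H2 A1 A2 : hilbertType R) (S : opSubspace H1 H2) (phi : X -> opsub S).
Variables (p : bop H2 H2) (q : bop H1 H1) (om : opsub (compression p S q) -> bop A1 A2).
Hypotheses (clS : closed S) (oX : wcomplete_isometry_onto phi) (pp : projection p) (pq : projection q).
Hypotheses (pS : [set p] `o` S `<=` opset S) (Sq : opset S `o` [set q] `<=` opset S).
Hypotheses (com : complete_isometry om) (wom : continuous om) (clom : closed (range om)).

(* The isomorphism is [x |-> (x - pxq) (+) om (pxq)]; the TROs see the second summand only. *)
Theorem split_off (B1 B2 : hilbertType R) (C' : set (bop B1 B2)) : TRO_sub C' (range om) ->
  exists (T1 T2 : hilbertType R) (X' : opSubspace T1 T2) (psi : X -> opsub X'),
    [/\ closed X', wcb_isomorphism psi & TRO_sub C' X'].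
Proof.
move=> tro.
have [T1 [i1 [j1 [ii1 jj1 ji1 ij1 [dec1 nrm1]]]]] := direct_sum H1 A1.
have [T2 [i2 [j2 [ii2 jj2 ji2 ij2 [dec2 nrm2]]]]] := direct_sum H2 A2.
have [cchi wchi oXE] := wonto_val oX; set chi := fun x => opsub_val (phi x) in cchi wchi oXE.
have [p2 ap pn] := projE pp; have [q2 aq qn] := projE pq.
pose cp (x : X) := compress phi p q x.
have lcp : linear cp := compress_linear p q oX.
have wcp : continuous cp := @compress_continuous _ _ _ _ _ phi p q oX.
have cpE x : opsub_val (cp x) = bop_comp p (bop_comp (chi x) q) by [].
(* This is [x - p x q], with the scalar in front to match [continuous_bopD]. *)
pose D (x : X) : bop H1 H2 := (-1) *: bop_comp p (bop_comp (chi x) q) + chi x.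
have DE x a : D x a = chi x a - p (chi x (q a)) by rewrite /D bop_addE bop_scaleE scaleN1r addrC.
have chiDE x a : chi x a = D x a + cp x a by rewrite DE cpE subrK.
have lD : linear D.
  move=> c x y; apply: bop_eq => a; rewrite DE [RHS]bop_addE [X in _ = X + _]bop_scaleE !DE cchi.1 !bop_addE !bop_scaleE bopD bopZ.
  by rewrite scalerBr opprD addrACA.
have wD : continuous D by apply: continuous_bopD => //; apply: continuous_comp2; exact: wchi.
have Dlin x : D x = (-1) *: opsub_val (cp x) + chi x by [].
clearbody D.
pose psi x : bop T1 T2 := bop_comp i2 (bop_comp (D x) (adj i1)) + bop_comp j2 (bop_comp (om (cp x)) (adj j1)).
have psiE x s : psi x s = i2 (D x (adj i1 s)) + j2 (om (cp x) (adj j1 s)) by [].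
have lpsi : linear psi.
  move=> c x y; apply: bop_eq => s; rewrite psiE [RHS]bop_addE [X in _ = X + _]bop_scaleE !psiE lD lcp com.1 !bop_addE !bop_scaleE !bopD !bopZ.
  by rewrite scalerDr addrACA.
have wpsi : continuous psi.
  have h := @continuous_bopD R X T1 T2 (fun x => bop_comp i2 (bop_comp (D x) (adj i1)))
    (fun x => bop_comp j2 (bop_comp (om (cp x)) (adj j1))) 1.
  have E : psi = fun x => 1 *: bop_comp i2 (bop_comp (D x) (adj i1)) + bop_comp j2 (bop_comp (om (cp x)) (adj j1)).
    by apply/funext => x; rewrite scale1r.
  rewrite E; apply: h; apply: continuous_comp2 => // x.
  by apply: continuous_comp; [exact: wcp | exact: wom].
have adj_i x s : adj i2 (psi x s) = D x (adj i1 s) by rewrite psiE bopD ii2 ij2 addr0.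
have adj_j x s : adj j2 (psi x s) = om (cp x) (adj j1 s) by rewrite psiE bopD jj2 ji2 add0r.
have cp_le n (A : 'M[X]_n) : mxnorm (map_mx cp A) <= mxnorm A.
  rewrite -(cchi.2 n A); apply: mxnorm_bop_le; first exact: mxnorm_bop_ge0.
  move=> xi; apply: le_trans (_ : \sum_i rnorm (\sum_j chi (A i j) (q (xi j))) ^+ 2 <= _).
    apply: ler_sum => i _; apply: lerXn2r; rewrite ?nnegrE ?rnorm_ge0 //.
    by under eq_bigr do rewrite !mxE; rewrite -bop_sum; exact: pn.
  have := mxnorm_bop_ub (map_mx chi A) (fun j => q (xi j)).
  under eq_bigr do under eq_bigr do rewrite mxE.
  move=> /le_trans; apply; apply: ler_wpM2l; first exact: sqr_ge0.
  by apply: ler_sum => j _; apply: lerXn2r; rewrite ?nnegrE ?rnorm_ge0.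
have sq2 (H : hilbertType R) (a b : H) : rnorm (a + b) ^+ 2 <= 2 * rnorm a ^+ 2 + 2 * rnorm b ^+ 2.
  by have := parallelogram a b; have := sqr_ge0 (rnorm (a - b)); lra.
(* The two summands of [psi] are orthogonal. [D] is a difference of two terms bounded by [mxnorm A],
   so its square costs a factor 4; the other block costs 1. *)
have psi_le n (A : 'M[X]_n) : mxnorm (map_mx psi A) <= 2 * mxnorm A.
  have A0 : 0 <= mxnorm A by rewrite -(cchi.2 n A) mxnorm_bop_ge0.
  apply: mxnorm_bop_le => [|xi]; first by rewrite mulr_ge0.
  pose c := mxnorm A ^+ 2.
  have h1 : \sum_i rnorm (\sum_j D (A i j) (adj i1 (xi j))) ^+ 2 <= 4 * c * \sum_j rnorm (adj i1 (xi j)) ^+ 2.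
    have k1 := mxnorm_bop_ub (map_mx chi A) (fun j => adj i1 (xi j)).
    have k2 := mxnorm_bop_ub (map_mx (@opsub_val R _ _ _) (map_mx cp A)) (fun j => adj i1 (xi j)).
    rewrite (cchi.2 n A) -/c in k1; rewrite -[mxnorm _]/(mxnorm (map_mx cp A)) in k2.
    have k3 : mxnorm (map_mx cp A) ^+ 2 <= c.
      by apply: lerXn2r; rewrite ?nnegrE //; exact: (mxnorm_bop_ge0 (map_mx (@opsub_val R _ _ _) (map_mx cp A))).
    have s0 : 0 <= \sum_j rnorm (adj i1 (xi j)) ^+ 2 by apply: sumr_ge0 => j _; exact: sqr_ge0.
    have k4 := ler_wpM2r s0 k3.
    apply: le_trans (_ : \sum_i (2 * rnorm (\sum_j map_mx chi A i j (adj i1 (xi j))) ^+ 2 +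
       2 * rnorm (\sum_j map_mx (@opsub_val R _ _ _) (map_mx cp A) i j (adj i1 (xi j))) ^+ 2) <= _).
      apply: ler_sum => i _; rewrite -(rnormN (\sum_j map_mx (@opsub_val R _ _ _) _ i j _)).
      apply: le_trans (sq2 _ _ _); rewrite -sumrB le_eqVlt; apply/orP; left; apply/eqP.
      by congr (rnorm _ ^+ 2); apply: eq_bigr => j _; rewrite !mxE DE.
    rewrite big_split /= -!mulr_sumr; lra.
  have h2 : \sum_i rnorm (\sum_j om (cp (A i j)) (adj j1 (xi j))) ^+ 2 <= c * \sum_j rnorm (adj j1 (xi j)) ^+ 2.
    have := mxnorm_bop_ub (map_mx om (map_mx cp A)) (fun j => adj j1 (xi j)).
    under eq_bigr do under eq_bigr do rewrite !mxE.
    move=> /le_trans; apply; apply: ler_wpM2r; first by apply: sumr_ge0 => j _; exact: sqr_ge0.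
    rewrite com.2; apply: lerXn2r; rewrite ?nnegrE //.
    exact: (mxnorm_bop_ge0 (map_mx (@opsub_val R _ _ _) (map_mx cp A))).
  under eq_bigr do rewrite nrm2 !bop_sum.
  under eq_bigr do under [X in rnorm X ^+ 2 + _]eq_bigr do rewrite mxE adj_i.
  under eq_bigr do under [X in _ + rnorm X ^+ 2]eq_bigr do rewrite mxE adj_j.
  under [X in _ <= _ * X]eq_bigr do rewrite nrm1.
  rewrite !big_split /= mulrDr; apply: lerD.
    by apply: le_trans h1 _; rewrite le_eqVlt; apply/orP; left; apply/eqP; rewrite /c; ring.
  apply: le_trans h2 _; apply: ler_wpM2r; first by apply: sumr_ge0 => j _; exact: sqr_ge0.
  rewrite exprMn -/c; have : 0 <= c by exact: sqr_ge0.
  lra.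
(* [x] is the sum of [D x] and its compression, each controlled by one block of [psi x]; hence the
   factor 2. *)
have psi_ge n (A : 'M[X]_n) : mxnorm A <= 2 * mxnorm (map_mx psi A).
  set c := mxnorm (map_mx psi A); have c0 : 0 <= c by exact: mxnorm_bop_ge0.
  have hub := mxnorm_bop_ub (map_mx psi A); rewrite -/c in hub.
  have h1 xi : \sum_i rnorm (\sum_j D (A i j) (xi j)) ^+ 2 <= c ^+ 2 * \sum_j rnorm (xi j) ^+ 2.
    have := hub (fun j => i1 (xi j)); under [X in _ <= _ * X]eq_bigr do rewrite nrm1 ii1 ji1 rnorm0 expr0n addr0.
    apply: le_trans; apply: ler_sum => i _; rewrite nrm2; apply: ler_wpDr; first exact: sqr_ge0.
    by rewrite bop_sum; under eq_bigr do rewrite -[xi _](ii1) -adj_i; under [X in _ <= rnorm X ^+ 2]eq_bigr do rewrite mxE.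
  have h2 : mxnorm (map_mx cp A) <= c.
    rewrite -com.2; apply: mxnorm_bop_le => // xi.
    have := hub (fun j => j1 (xi j)); under [X in _ <= _ * X]eq_bigr do rewrite nrm1 ij1 jj1 rnorm0 expr0n add0r.
    apply: le_trans; apply: ler_sum => i _; rewrite [X in _ <= X]nrm2; apply: ler_wpDl; first exact: sqr_ge0.
    rewrite bop_sum; under [X in _ <= rnorm X ^+ 2]eq_bigr do rewrite mxE adj_j jj1.
    rewrite le_eqVlt; apply/orP; left; apply/eqP; congr (rnorm _ ^+ 2).
    by apply: eq_bigr => j _; rewrite !mxE.
  rewrite -(cchi.2 n A); apply: mxnorm_bop_le => [|xi]; first by rewrite mulr_ge0.
  have k2 := mxnorm_bop_ub (map_mx (@opsub_val R _ _ _) (map_mx cp A)) xi.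
  rewrite -[mxnorm _]/(mxnorm (map_mx cp A)) in k2.
  have k3 : mxnorm (map_mx cp A) ^+ 2 <= c ^+ 2.
    by apply: lerXn2r; rewrite ?nnegrE //; exact: (mxnorm_bop_ge0 (map_mx (@opsub_val R _ _ _) (map_mx cp A))).
  have s0 : 0 <= \sum_j rnorm (xi j) ^+ 2 by apply: sumr_ge0 => j _; exact: sqr_ge0.
  have k4 := ler_wpM2r s0 k3; have k1 := h1 xi.
  apply: le_trans (_ : \sum_i (2 * rnorm (\sum_j D (A i j) (xi j)) ^+ 2 +
     2 * rnorm (\sum_j map_mx (@opsub_val R _ _ _) (map_mx cp A) i j (xi j)) ^+ 2) <= _).
    apply: ler_sum => i _; apply: le_trans (sq2 _ _ _); rewrite -big_split le_eqVlt; apply/orP; left; apply/eqP.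
    by congr (rnorm _ ^+ 2); apply: eq_bigr => j _; rewrite !mxE chiDE.
  rewrite big_split /= -!mulr_sumr exprMn; lra.
(* An element of the corner has no [D] part, so each [om w] occurs alone in the second block. *)
have split_val w : exists x, [/\ D x = 0, cp x = w & chi x = opsub_val w].
  have Sw : opset S w by apply: (compression_sub pS Sq); exact: opsub_mem.
  have ew := compressionE pp pq (opsub_mem w).
  have [x ex] := (oXE _).1 Sw; exists x; split=> //.
    by apply: bop_eq => a; rewrite DE -/(chi x) /chi ex -[in X in _ - X]ew !bop_compE -[in LHS]ew !bop_compE p2 q2 p2 q2 subrr.
  by apply: val_inj; rewrite /= ex.
(* A limit is block diagonal, its blocks lie in [S] and in [range om] because these are closed, and
   the first block has zero compression. The blocks are then lifted separately, to [x1] and [x2]. *)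
have cl : closed (range psi).
  move=> T clT.
  have t11 : opset S (bop_comp (adj i2) (bop_comp T i1)).
    apply: clS; apply: (closure_map (f := fun T => bop_comp (adj i2) (bop_comp T i1)) _ _ clT).
      by apply: continuous_comp2 => x; exact: cvg_id.
    move=> _ [x _ <-]; have -> : bop_comp (adj i2) (bop_comp (psi x) i1) = D x.
      by apply: bop_eq => a; rewrite !bop_compE adj_i ii1.
    have [_ Sl] := opset_submod S; apply: set_mem; rewrite Dlin; apply: Sl; apply: mem_set; last by apply/oXE; exists x.
    by apply: (compression_sub pS Sq); apply: compress_mem; apply/oXE; exists x.
  have [w _ ew] : range om (bop_comp (adj j2) (bop_comp T j1)).
    apply: clom; apply: (closure_map (f := fun T => bop_comp (adj j2) (bop_comp T j1)) _ _ clT).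
      by apply: continuous_comp2 => x; exact: cvg_id.
    move=> _ [x _ <-]; exists (cp x) => //; apply: bop_eq => a; by rewrite !bop_compE adj_j jj1.
  have zero a b : (forall x, ip (psi x a) b = 0) -> ip (T a) b = 0.
    move=> h; apply: (closed_eq_fun (f := fun T : bop T1 T2 => ip (T a) b : R[i]^o) (g := fun=> 0) _ _ _ clT).
    - exact: ip_continuous.
    - exact: cst_continuous.
    - by move=> _ [x _ <-].
  have [x1 ex1] := (oXE _).1 t11; have [x2 [D2 c2 _]] := split_val w.
  have ex1' a : chi x1 a = adj i2 (T (i1 a)) by rewrite /chi ex1.
  have ipp u v : ip u (p v) = ip (p u) v by rewrite adjP ap.
  have c1 : cp x1 = 0.
    apply: val_inj; apply: bop_eq => a; rewrite /= -/(chi x1) ex1'.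
    apply: ip_inj => b; rewrite ip0l adjP ap adjPr; apply: zero => x.
    by rewrite -adjPr adj_i ii1 DE ipp bopB p2 q2 subrr ip0l.
  exists (x1 + x2) => //; apply: bop_eq => s.
  have lD' : D (x1 + x2) = chi x1.
    have := lD 1 x1 x2; rewrite !scale1r => ->; rewrite D2 addr0.
    by apply: bop_eq => a; rewrite chiDE c1 addr0.
  have lc' : cp (x1 + x2) = w by have := lcp 1 x1 x2; rewrite !scale1r => ->; rewrite c1 add0r.
  have z1 : adj i2 (T (j1 (adj j1 s))) = 0.
    apply: ip_inj => b; rewrite ip0l adjPr; apply: zero => x.
    by rewrite -adjPr adj_i ij1 bop0 ip0l.
  have z2 : adj j2 (T (i1 (adj i1 s))) = 0.
    apply: ip_inj => b; rewrite ip0l adjPr; apply: zero => x.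
    by rewrite -adjPr adj_j ji1 bop0 ip0l.
  have Ts : T s = T (i1 (adj i1 s)) + T (j1 (adj j1 s)) by rewrite -bopD dec1.
  rewrite psiE lD' lc' ex1' ew !bop_compE Ts -[RHS]dec2.
  by rewrite [adj i2 (_ + _)]bopD [adj j2 (_ + _)]bopD z1 z2 addr0 add0r.
have injp : injective psi.
  move=> x y e; apply/eqP; rewrite -subr_eq0; apply/eqP; apply: (dual_norm0 dX).
  have h := psi_ge 1%N (const_mx (x - y)).
  have z : mxnorm (map_mx psi (const_mx (x - y) : 'M[X]_1)) <= 0.
    apply: mxnorm_bop_le => // xi; rewrite !big_ord1 !mxE (actlinB (linear_actlin lpsi)) e subrr bop_zeroE rnorm0.
    by rewrite expr0n /= mul0r.
  apply/le_anti/andP; split; first by rewrite /mxnorm1; lra.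
  by rewrite -(isometry_mxnorm1 (x - y) cchi) mxnorm1_bop_ge0.
exists T1, T2, (range_sub lpsi), (to_range lpsi); split=> //.
- split; [exact: to_range_linear | exact: to_range_continuous | |].
    exists 2 => n A; apply: le_trans (psi_le n A).
    have -> : map_mx psi A = map_mx (@opsub_val R _ _ (range_sub lpsi)) (map_mx (to_range lpsi) A).
      by apply/matrixP => i j; rewrite !mxE.
    exact: lexx.
  have ex s : exists x, to_range lpsi x = s.
    by have [x _ e] := opsub_mem s; exists x; apply: val_inj.
  pose g s := sval (cid (ex s)); have gE s : to_range lpsi (g s) = s := svalP (cid (ex s)).
  exists g; split=> // [x|].
    by apply: injp; exact: (congr1 (@opsub_val R _ _ _) (gE (to_range lpsi x))).
  exists 2 => n A; apply: le_trans (psi_ge n (map_mx g A)) _.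
  rewrite le_eqVlt; apply/orP; left; apply/eqP; congr (2 * _).
  have -> // : map_mx psi (map_mx g A) = map_mx (@opsub_val R _ _ (range_sub lpsi)) A.
  by apply/matrixP => i j; rewrite !mxE -[in RHS](gE (A i j)).
- apply: (tro_sub_lift jj1 jj2 _ _ tro).
    move=> _ [x _ <-]; exists (om (cp x)); split; first by exists (cp x).
      by apply: bop_eq => s; rewrite !bop_compE adj_j.
    by apply: bop_eq => s; rewrite !bop_compE psiE ij1 jj1 ?bop0 ?add0r.
  move=> _ [w _ <-]; have [x [Dx cx _]] := split_val w; exists x => //.
  by apply: bop_eq => s; rewrite psiE Dx cx bop_zeroE bop0 add0r.
Qed.
End SplitOff.

Lemma wonto_wcb (R : realType) (X Y : wMxNormedType R) (phi : X -> Y) :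
  injective phi -> wcomplete_isometry_onto phi -> wcb_isomorphism phi.
Proof.
move=> injp [[lphi iso] wphi onto]; split=> //; first by exists 1 => n A; rewrite mul1r iso.
have ex s : exists x, phi x = s by have : range phi s by [rewrite onto]; case=> x _ <-; exists x.
pose g s := sval (cid (ex s)); have gE s : phi (g s) = s := svalP (cid (ex s)).
exists g; split=> // [x|]; first exact: injp.
exists 1 => n A; rewrite mul1r -iso.
have -> : map_mx phi (map_mx g A) = A by apply/matrixP => i j; rewrite !mxE gE.
exact: lexx.
Qed.

Theorem theorem3p14 (R : realType) (X Y Z : wMxNormedType R)
    (dualX : dual_operator_space X) (dualY : dual_operator_space Y)
    (dualZ : dual_operator_space Z)
    (ZY : delta_sub Z Y) (YX : delta_sub Y X) :
  (exists (H1 H2 : hilbertType R) (chiX : opSubspace H1 H2)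
      (chi : X -> opsub chiX) (p : bop H2 H2) (q : bop H1 H1),
    [/\ closed chiX, wcomplete_isometry_onto chi, projection p, projection q &
    [/\ [set p] `o` chiX `<=` chiX, chiX `o` [set q] `<=` chiX &
        delta_sub Z (opsub (compression p chiX q))]]) /\
  cb_delta_sub Z X.
Proof.
have [J1 [J2 [K1 [K2 [Z1 [Y1 [psiZ [phiY [clZ clY1 oZ oY1 tZY]]]]]]]]] := ZY.
have [L1 [L2 [H1 [H2 [Y2 [X2 [psiY [phiX [clY2 clX oY2 oX tYX]]]]]]]]] := YX.
have [p [q [A1 [A2 [B1 [B2 [om [oz [pp pq pX Xq [[com wom] clom [coz woz] cloz tro]]]]]]]]]] :=
  common_representation (dual_dualized dualX) dualY (dual_dualized dualZ) clX oX oY2 oY1 oZ tYX tZY.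
have iz := to_range_isometry coz.1 coz woz; have io := to_range_isometry com.1 com wom.
split.
  exists H1, H2, X2, phiX, p, q; split=> //; split=> //.
  by exists B1, B2, A1, A2, (range_sub coz.1), (range_sub com.1), (to_range coz.1), (to_range com.1).
have [T1 [T2 [X' [psi [clX' wpsi tX']]]]] := split_off dualX clX oX pp pq pX Xq com wom clom tro.
exists B1, B2, T1, T2, (range_sub coz.1), X', (to_range coz.1), psi; split=> //.
(* The inverse needs injectivity, which holds because [mxnorm1] is definite on a dual operator
   space. *)
apply: wonto_wcb iz => x y e; apply: (complete_isometry_inj coz (dual_norm0 dualZ)).
exact: (congr1 (@opsub_val R _ _ _) e).
Qed.
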